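(* Let $c>0$ be given. There exist constants $\alpha_0, C_0, L_0>0$ and a constant $C>0$ (all depending only on $c$) such that for all $0<\alpha<\alpha_0$ and all $L>L_0$ the following holds. Assume that $u_0\in H^1(\mathbb{R}^-)$ satisfies $u_0(0)=0$ and $$\|u_0-Q_c(\cdot+L)\|_{H^1(\mathbb{R}^-)}<\alpha .$$ Let $u=u(x,t)$ be the global (negative-time) solution of the initial boundary value problem $$\partial_t u+\partial_x(\partial_x^2u+u^2)=0 \ \ (x<0,\ t<0),\qquad u(x,0)=u_0(x)\ \ (x<0),\qquad u(0,t)=0\ \ (t<0).$$ Then there is a $C^1$ function $\rho:(-\infty,0]\to\mathbb{R}$ such that $$\sup_{t\le 0}\|u(t)-Q_c(\cdot-\rho(t)+L)\|_{H^1(\mathbb{R}^-)}<C_0\big(\alpha+e^{-\sqrt{c}\,L}\big)$$ and $$\sup_{t\le 0}|\rho'(t)-c|<C\,C_0\,\alpha .$$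
   Context: $\mathbb{R}^-=(-\infty,0)$, $\mathbb{R}^+=(0,+\infty)$. For $c>0$ the KdV soliton profile on the line is $\widetilde Q_c(s)=\frac{3c}{2}\,\mathrm{sech}^2\!\big(\frac{\sqrt c\, s}{2}\big)$, $s\in\mathbb{R}$. For $y\in\mathbb{R}$, $Q_c(\cdot-y)$ here denotes the restriction to $\mathbb{R}^-$ of the function $x\mapsto\widetilde Q_c(x-y)$. $H^s(\mathbb{R}^\pm)$ is the space of restrictions to $\mathbb{R}^\pm$ of functions in $H^s(\mathbb{R})$, with the infimum-over-extensions norm. Notion of solution: $u$ is the solution of the negative-time left half-line problem obtained as $u(x,t)=w(-x,-t)$ for $x<0$, $t\le 0$, where $w$ is the solution of the right half-line problem $\partial_t w+\partial_x(\partial_x^2w+w^2)=0$ for $x>0,t>0$, with $w(x,0)=u_0(-x)$ and $w(0,t)=0$. By the known well-posedness theory, for every $T>0$ this $w$ exists in the space $Z^1_T(\mathbb{R}^+)$, that is, $w\in C([0,T];H^1(\mathbb{R}^+))$ and $\partial_x^l w\in C(\mathbb{R}^+;H^{(2-l)/3}(0,T))$ for $l=0,1,2$; it is unique (in $C([0,T];H^1(\mathbb{R}^+))$, as a mild solution) and depends Lipschitz-continuously on the initial datum on balls, so it is also a limit in $Z^1_T$ of smoother solutions with zero boundary datum. *)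

(* Defs.v *)
From mathcomp Require Import all_boot all_order all_algebra.
From mathcomp Require Import all_classical all_reals all_analysis.

Set Implicit Arguments.
Unset Strict Implicit.
Unset Printing Implicit Defensive.

Import Order.TTheory GRing.Theory Num.Theory.
Import numFieldNormedType.Exports.

Local Open Scope classical_set_scope.
Local Open Scope ring_scope.

Section Sobolev.
Context {R : realType}.
Implicit Types (f g phi : R -> R) (s : R) (I J : set R).

Local Notation mu := (@lebesgue_measure R).

Definition smooth phi : Prop := forall k x, derivable (derive1n k phi) x 1.

Definition test_function (U : set R) phi : Prop :=
  smooth phi /\
  exists K, [/\ compact K, K `<=` U & forall x, ~ K x -> phi x = 0].

Definition weak_derivative (k : nat) f g : Prop :=
  forall phi, test_function setT phi ->
    \int[mu]_x (f x * derive1n k phi x) = (-1) ^+ k * \int[mu]_x (g x * phi x).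

Definition L2_sqnorm f : \bar R := (\int[mu]_x (f x ^+ 2)%:E)%E.

(* The squared Gagliardo-Slobodeckij seminorm of H^a(R), for 0 < a < 1. *)
Definition gagliardo_sqnorm (a : R) f : \bar R :=
  (\int[mu]_x \int[mu]_y ((f x - f y) ^+ 2 / `|x - y| `^ (1 + 2 * a))%:E)%E.

(* The norm of H^s(R), for s >= 0.  With m the integer part of s, d k is the
   k-th weak derivative of f for k <= m, and the fractional part of s is measured
   on d m.  The weak derivatives are unique up to null sets, so the infimum only
   serves to give the value +oo when f is not in H^s(R); in particular
   f belongs to H^s(R) iff its norm is < +oo. *)
Definition sobolev_norm_line s f : \bar R :=
  let m := Num.truncn s in
  ereal_inf
    [set sqrte (\sum_(k < m.+1) L2_sqnorm (d k)
                + (if (s == m%:R)%R then 0 else gagliardo_sqnorm (s - m%:R)%R (d m)))%E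
    | d in [set d : nat -> R -> R | d 0%N = f /\
        forall k, (k <= m)%N ->
          measurable_fun setT (d k) /\ weak_derivative k f (d k)]].

(* Elements of H^s(I) are represented by functions R -> R whose values outside I
   are irrelevant, and which only matter up to a null set. *)
Definition sobolev_norm s I f : \bar R :=
  ereal_inf [set sobolev_norm_line s g
            | g in [set g | {ae mu, forall x, I x -> f x = g x}]].

Definition in_sobolev s I f : Prop := (sobolev_norm s I f < +oo)%E.

(* F belongs to C(J; H^s(I)). *)
Definition sobolev_continuous J s I (F : R -> R -> R) : Prop :=
  forall a, J a -> in_sobolev s I (F a) /\
    (fun b => sobolev_norm s I (F b \- F a)) @ within J (nbhs a) --> (0 : \bar R)%E.

(* The trace at the endpoint a of the interval I of a function in H^1(I), that
   is, the value at a of its continuous representative. *)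
Definition has_trace I f (a y : R) : Prop :=
  exists g, [/\ continuous g, {ae mu, forall x, I x -> f x = g x} & g a = y].

(* r is C^1 on J with derivative dr, one-sided at the endpoints lying in J. *)
Definition C1_on J (r dr : R -> R) : Prop :=
  {within J, continuous dr} /\
  forall t, J t ->
    (fun s => (r s - r t) / (s - t)) @ within J (t^') --> dr t.

End Sobolev.

Section KdV.
Context {R : realType}.
Implicit Types (T : R) (w phi : R -> R -> R) (v : nat -> R -> R -> R).

Local Notation mu := (@lebesgue_measure R).

Definition neg_half_line : set R := `]-oo, 0[.
Definition pos_half_line : set R := `]0, +oo[.

Definition sech (y : R) : R := 2 / (expR y + expR (- y)).

Definition soliton (c s : R) : R :=
  3 * c / 2 * sech (Num.sqrt c * s / 2) ^+ 2.

(* Functions of space and time take the time t first: w t x. *)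
Definition dt phi : R -> R -> R := fun t x => derive1 (phi^~ x) t.
Definition dx phi : R -> R -> R := fun t x => derive1 (phi t) x.

Definition smooth2 phi : Prop :=
  forall i j : nat, let psi := iter i dx (iter j dt phi) in
    [/\ continuous (fun p : R * R => psi p.1 p.2),
        (forall t x, derivable (psi^~ x) t 1)
      & (forall t x, derivable (psi t) x 1)].

Definition test_function2 (U : set (R * R)) phi : Prop :=
  smooth2 phi /\
  exists K, [/\ compact K, K `<=` U & forall t x, ~ K (t, x) -> phi t x = 0].

Definition strip T : set (R * R) := `]0, T[ `*` pos_half_line.

(* z = d^l w / dx^l in the sense of distributions on the strip, where w is a
   function of time with values in functions of space, while z is a function of
   space with values in functions of time: z x t.  The iterated integrals are
   taken in the order in which they do not depend on the representatives. *)
Definition weak_dx T (l : nat) w (z : R -> R -> R) : Prop :=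
  forall phi, test_function2 (strip T) phi ->
    \int[mu]_(x in pos_half_line) \int[mu]_(t in `]0, T[) (z x t * phi t x)
    = (-1) ^+ l *
      \int[mu]_(t in `]0, T[) \int[mu]_(x in pos_half_line)
        (w t x * iter l dx phi t x).

(* w belongs to Z^1_T, and v l = d^l w / dx^l for l = 0, 1, 2. *)
Definition in_Z1 T w v : Prop :=
  sobolev_continuous `[0, T] 1 pos_half_line w /\
  forall l : nat, (l <= 2)%N ->
    weak_dx T l w (v l) /\
    sobolev_continuous pos_half_line ((2 - l%:R) / 3) `]0, T[ (v l).

Definition Z1_norm T w v : \bar R :=
  (ereal_sup [set sobolev_norm 1 pos_half_line (w t) | t in `[0%R, T]]
   + \sum_(l < 3) ereal_sup
       [set sobolev_norm ((2 - l%:R) / 3)%R `]0%R, T[ (v l x)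
       | x in pos_half_line])%E.

(* w_t + (w_xx + w^2)_x = 0 in the sense of distributions on the strip, with
   w = 0 at x = 0. *)
Definition kdv_zero_boundary T w : Prop :=
  (forall phi, test_function2 (strip T) phi ->
     \int[mu]_(t in `]0, T[) \int[mu]_(x in pos_half_line)
       (w t x * dt phi t x + w t x * iter 3 dx phi t x + w t x ^+ 2 * dx phi t x)
     = 0) /\
  (forall t, 0 < t < T -> has_trace pos_half_line (w t) 0 0).

(* The solution w of the right half-line problem with initial datum w0 and zero
   boundary datum.  That w is a limit in Z^1_T of smoother (here C([0,T]; H^4))
   solutions with zero boundary datum is part of the well-posedness theory. *)
Definition right_half_line_solution (w0 : R -> R) w : Prop :=
  {ae mu, forall x, pos_half_line x -> w 0 x = w0 x} /\
  forall T, 0 < T -> exists v,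
    [/\ in_Z1 T w v, kdv_zero_boundary T w
      & exists (wn : nat -> R -> R -> R) (vn : nat -> nat -> R -> R -> R),
        (forall n,
          [/\ in_Z1 T (wn n) (vn n), kdv_zero_boundary T (wn n)
            & sobolev_continuous `[0, T] 4 pos_half_line (wn n)]) /\
        (fun n => Z1_norm T (fun t => w t \- wn n t)
                            (fun l x => v l x \- vn n l x))
          @ \oo --> (0 : \bar R)%E].

(* The solution, for t <= 0, of the left half-line problem with final datum u0
   and zero boundary datum. *)
Definition left_half_line_backward_solution (u0 : R -> R) (u : R -> R -> R) : Prop :=
  exists w, right_half_line_solution (fun x => u0 (- x)) w /\
    forall t x, t <= 0 -> x < 0 -> u t x = w (- t) (- x).

End KdV.

(* Main.v *)
(* Reflecting space and time turns u into the solution w of the right half-line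
   problem.  The zero boundary datum makes the mass and the energy of w
   nonincreasing: formally their rates are - w_x(0,t)^2 and - w_xx(0,t)^2 / 2,
   and the computation is made on the smoother approximations of w.  Extended by zero,
   w(t) is a function in H^1(R), so the variational stability of the soliton on the
   line applies: the linearised operator L is coercive modulo the translations and
   the scaling of Q, so a function whose mass and energy do not exceed those of a
   small perturbation of Q, and which is close to some translate of Q, is much
   closer to a translate; continuity in time propagates this to all t >= 0.  The
   distance at time 0 is O(alpha), since the trace condition gives Q(L) = O(alpha)
   and the part of Q(. - L) cut off at 0 is controlled by Q(L).

   The centre y(t) is then fixed by the orthogonality (w(t), phi(. - y(t))) = 0
   for an odd compactly supported smooth phi, away from the boundary; testing the
   equation with phi(. - y) makes y differentiable, with y' = c + O(alpha). *)

(* With [c = 4 k^2], the functional [energy + 2 k^2 mass] is critical at [Q], so its excess is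
   quadratic in the initial error. Since mass and energy may both drop, the component [int Q f] of
   the error is caught between the mass bound (from above) and the energy bound (from below).
   Coercivity uses no spectral theory: the error is recentred so that it has equal values at the two
   points [node] and [- node], a multiple of the speed derivative [Lam] of [Q] makes both values
   zero, and on the three intervals so cut off explicit Riccati functions bound the form. This
   recentring needs no regularity in time; the window [phi] then produces the [C^1] centre. The
   obstacle to differentiating mass and energy is that even the smoother approximations satisfy the
   equation only as distributions. An increment [h] over a time [tau] is compared with [tau] times
   the flux in [L^2], by duality with test functions; the term [int h_x^2] is then [- int h h_xx],
   the product of an [O(tau)] and a small factor. *)
Require Import Defs.
From mathcomp Require Import all_boot all_order all_algebra.
From mathcomp Require Import all_classical all_reals all_analysis.
From mathcomp Require Import measurable_realfun ring lra.

Import Order.TTheory GRing.Theory Num.Theory.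
Import numFieldNormedType.Exports.

Local Open Scope classical_set_scope.
Local Open Scope ring_scope.

(** * Real-valued integrals, square-integrable functions, Cauchy-Schwarz, dominated convergence *)

Section IntegralToolkit.
Context {R : realType}.
Local Notation mu := (@lebesgue_measure R).
Implicit Types (D E : set R) (f g h : R -> R).

Definition intg D f : Prop := mu.-integrable D (EFin \o f).

(** [L^2(D)] as a predicate on actual functions, so that no quotient by null sets has to be
    formed. *)
Definition sqi D f := measurable_fun D f /\ intg D (fun x => f x ^+ 2).

Lemma intg_meas {D f} : intg D f -> measurable_fun D f.
Proof. by move=> /measurable_int /measurable_EFinP. Qed.

Lemma intg_dom {D f} g : measurable D -> measurable_fun D f -> intg D g ->
  (forall x, D x -> `|f x| <= g x) -> intg D f.
Proof.
move=> mD mf ig fg; rewrite /intg; apply: (@le_integrable _ _ R mu D mD _ (EFin \o g) _ _ ig).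
  exact/measurable_EFinP.
move=> x Dx /=; rewrite lee_fin (le_trans (fg x Dx))//.
exact: ler_norm.
Qed.

Lemma eq_intg {D f} g : measurable D -> (forall x, D x -> g x = f x) ->
  intg D f -> intg D g.
Proof.
move=> mD fg; move=> intf; apply: (@eq_integrable _ _ R mu D mD _ _ _ intf) => x /set_mem Dx /=.
by rewrite fg.
Qed.

Lemma intgD {D f g} : measurable D -> intg D f -> intg D g ->
  intg D (fun x => f x + g x).
Proof. by move=> mD intf intg'; apply: (@integrableD _ _ R mu D mD _ _ intf intg'). Qed.

Lemma intgB {D f g} : measurable D -> intg D f -> intg D g ->
  intg D (fun x => f x - g x).
Proof. by move=> mD intf intg'; apply: (@integrableB _ _ R mu D mD _ _ intf intg'). Qed.

Lemma intgZ {D f} r : measurable D -> intg D f -> intg D (fun x => r * f x).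
Proof. by move=> mD intf; apply: (@integrableZl _ _ R mu D mD r _ intf). Qed.

Lemma intgN {D f} : measurable D -> intg D f -> intg D (fun x => - f x).
Proof.
move=> mD intf; apply: (@eq_intg _ _ _ mD _ (intgZ (-1) mD intf)) => x _.
by rewrite mulN1r.
Qed.

Lemma intg0 {D} : measurable D -> intg D (fun=> 0).
Proof. by move=> mD; have := @integrable0 _ _ R mu D. Qed.

Lemma intgS {D} E f : measurable E -> measurable D -> D `<=` E -> intg E f ->
  intg D f.
Proof. by move=> mE mD DE; exact: (@integrableS _ _ R mu E D). Qed.

Lemma intg_norm {D f} : measurable D -> intg D f -> intg D (fun x => `|f x|).
Proof. by move=> mD; exact: (@integrable_norm _ _ R mu D). Qed.

Lemma intg_bM {D f g} K : measurable D -> measurable_fun D g ->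
  (forall x, D x -> `|g x| <= K) -> intg D f -> intg D (fun x => g x * f x).
Proof.
move=> mD mg gK intf; apply: (intg_dom (fun x => K * `|f x|)) => //.
- by apply: measurable_funM => //; exact: intg_meas.
- by apply: intgZ => //; exact: intg_norm.
- by move=> x Dx; rewrite normrM ler_wpM2r// gK.
Qed.

Lemma RintD {D f g} : measurable D -> intg D f -> intg D g ->
  \int[mu]_(x in D) (f x + g x) =
  \int[mu]_(x in D) f x + \int[mu]_(x in D) g x.
Proof. by move=> mD F G; exact: (@RintegralD _ _ R mu D f g mD F G). Qed.

Lemma RintB {D f g} : measurable D -> intg D f -> intg D g ->
  \int[mu]_(x in D) (f x - g x) =
  \int[mu]_(x in D) f x - \int[mu]_(x in D) g x.
Proof. by move=> mD F G; exact: (@RintegralB _ _ R mu D f g mD F G). Qed.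

Lemma RintZ {D f} r : measurable D -> intg D f ->
  \int[mu]_(x in D) (r * f x) = r * \int[mu]_(x in D) f x.
Proof. by move=> mD F; exact: (@RintegralZl _ _ R mu D f r mD F). Qed.

Lemma eq_Rint {D} f g : (forall x, D x -> f x = g x) ->
  \int[mu]_(x in D) f x = \int[mu]_(x in D) g x.
Proof. by move=> fg; apply: eq_Rintegral => x /set_mem; exact: fg. Qed.

Lemma le_Rint {D f g} : measurable D -> intg D f -> intg D g ->
  (forall x, D x -> f x <= g x) ->
  \int[mu]_(x in D) f x <= \int[mu]_(x in D) g x.
Proof. by move=> mD F G; exact: (@le_Rintegral _ _ R mu D f g mD F G). Qed.

Lemma Rint_ge0 {D f} : (forall x, D x -> 0 <= f x) ->
  0 <= \int[mu]_(x in D) f x.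
Proof. by move=> H; have := @Rintegral_ge0 _ _ R mu D f H. Qed.

Lemma RintN {D f} : measurable D -> intg D f ->
  \int[mu]_(x in D) (- f x) = - \int[mu]_(x in D) f x.
Proof.
move=> mD intf; rewrite -[RHS]mulN1r -RintegralZl//.
by apply: eq_Rintegral => x _; rewrite mulN1r.
Qed.

Lemma normr_Rint_le {D f} g : measurable D -> measurable_fun D f -> intg D g ->
  (forall x, D x -> `|f x| <= g x) ->
  `|\int[mu]_(x in D) f x| <= \int[mu]_(x in D) g x.
Proof.
move=> mD mf ig fg; have intf := intg_dom g mD mf ig fg.
apply: (@le_trans _ _ (\int[mu]_(x in D) `|f x|)).
  exact: le_normr_Rintegral.
by apply: le_Rintegral => //; exact: intg_norm.
Qed.

Lemma Rint_indic {D} f : measurable D ->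
  \int[mu]_x (\1_D x * f x) = \int[mu]_(x in D) f x.
Proof.
move=> mD; rewrite [RHS]Rintegral_mkcond; apply: eq_Rintegral => x _.
by rewrite patchE indicE; case: (x \in D); rewrite ?mul1r ?mul0r.
Qed.

Lemma intg_indic {D} f : measurable D ->
  intg setT (fun x => \1_D x * f x) <-> intg D f.
Proof.
move=> mD; rewrite /intg; have -> := @integrable_mkcond _ _ R mu D (EFin \o f) mD.
suff -> : (EFin \o f) \_ D = EFin \o (fun x => \1_D x * f x) by [].
apply/funext => x; rewrite patchE /= indicE.
by case: (x \in D); rewrite ?mul1r ?mul0r.
Qed.

Lemma meas_indicM D f : measurable D -> measurable_fun D f ->
  measurable_fun setT (fun x => \1_D x * f x).
Proof.
move=> mD mf.
have -> : (fun x => \1_D x * f x) = f \_ D.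
  apply/funext => x; rewrite patchE indicE.
  by case: (x \in D); rewrite ?mul1r ?mul0r.
exact/(measurable_restrictT f mD).
Qed.

Lemma sqiM {D f g} : measurable D -> sqi D f -> sqi D g ->
  intg D (fun x => f x * g x).
Proof.
move=> mD [mf f2] [mg g2].
apply: (intg_dom (fun x => f x ^+ 2 + g x ^+ 2)) => //.
- exact: measurable_funM.
- exact: intgD.
- move=> x _; rewrite ler_norml; have := sqr_ge0 (f x + g x).
  have := sqr_ge0 (f x - g x); have := sqr_ge0 (f x); have := sqr_ge0 (g x).
  by move=> *; apply/andP; split; nra.
Qed.

Lemma sqi_dom {D f} g : measurable D -> measurable_fun D f -> sqi D g ->
  (forall x, D x -> `|f x| <= `|g x|) -> sqi D f.
Proof.
move=> mD mf [mg g2] fg; split => //.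
apply: (intg_dom _ mD _ g2); first exact: measurable_funX.
by move=> x Dx; rewrite normrX -(real_normK (num_real (g x))) lerXn2r ?nnegrE// fg.
Qed.

Lemma sqiZ {D f} r : measurable D -> sqi D f -> sqi D (fun x => r * f x).
Proof.
move=> mD [mf f2]; split; first exact: measurable_funM.
by apply: (eq_intg _ mD _ (intgZ (r ^+ 2) mD f2)) => x _; rewrite exprMn.
Qed.

Lemma sqiD {D f g} : measurable D -> sqi D f -> sqi D g ->
  sqi D (fun x => f x + g x).
Proof.
move=> mD [mf f2] [mg g2]; split; first exact: measurable_funD.
apply: (intg_dom (fun x => 2 * f x ^+ 2 + 2 * g x ^+ 2)) => //.
- by apply: measurable_funX; exact: measurable_funD.
- by apply: intgD => //; exact: intgZ.
- move=> x _; rewrite ger0_norm ?sqr_ge0//.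
  by have := sqr_ge0 (f x - g x); nra.
Qed.

Lemma sqiN {D f} : measurable D -> sqi D f -> sqi D (fun x => - f x).
Proof.
move=> mD sf; have [m i] := sqiZ (-1) mD sf.
have e : (fun x => - f x) = (fun x => -1 * f x).
  by apply/funext => x; rewrite mulN1r.
by rewrite e.
Qed.

Lemma sqiB {D f g} : measurable D -> sqi D f -> sqi D g ->
  sqi D (fun x => f x - g x).
Proof. by move=> mD sf sg; exact: (sqiD mD sf (sqiN mD sg)). Qed.

Lemma sqi_bM {D f g} K : measurable D -> measurable_fun D g ->
  (forall x, D x -> `|g x| <= K) -> sqi D f -> sqi D (fun x => g x * f x).
Proof.
move=> mD mg gK [mf f2]; apply: (sqi_dom (fun x => K * f x)) => //.
- exact: measurable_funM.
- exact: sqiZ.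
- move=> x Dx; rewrite !normrM ler_wpM2r// (le_trans (gK x Dx))//.
  exact: ler_norm.
Qed.

Lemma sqiS {D} E f : measurable E -> measurable D -> D `<=` E -> sqi E f ->
  sqi D f.
Proof.
by move=> mE mD DE [mf f2]; split; [exact: measurable_funS mf|exact: intgS f2].
Qed.

Lemma sqi_indic {D f} : measurable D -> sqi D f ->
  sqi setT (fun x => \1_D x * f x).
Proof.
move=> mD [mf f2]; split; first exact: meas_indicM.
apply: (@eq_intg _ (fun x => \1_D x * f x ^+ 2)) => //.
  by move=> x _; rewrite exprMn indicE; case: (x \in D); rewrite ?expr1n ?expr0n/= ?mul0r.
exact/intg_indic.
Qed.

(** For [a > 0] the polynomial is evaluated at its minimiser [- b / a]. For [a = 0] it is affine,
    and the chosen point would give it the value [-1] if [b] were nonzero. *)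
Lemma sqr_poly_disc (a b c : R) : 0 <= a ->
  (forall x, 0 <= a * x ^+ 2 + 2 * b * x + c) -> b ^+ 2 <= a * c.
Proof.
rewrite le_eqVlt => /orP[/eqP<- H|a0 H].
  rewrite mul0r; have [->|b0] := eqVneq b 0; first by rewrite expr0n.
  have := H (- (c + 1) / (2 * b)); rewrite mul0r add0r.
  have -> : 2 * b * (- (c + 1) / (2 * b)) = - (c + 1) by field.
  lra.
have := H (- b / a); rewrite -(ler_pM2l a0).
have -> : a * (a * (- b / a) ^+ 2 + 2 * b * (- b / a) + c) = a * c - b ^+ 2.
  by field; rewrite gt_eqF.
by rewrite mulr0; lra.
Qed.

(** Discriminant of the nonnegative quadratic polynomial [t |-> int (t f + g)^2]. *)
Lemma Rint_CS {D f g} : measurable D -> sqi D f -> sqi D g ->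
  (\int[mu]_(x in D) (f x * g x)) ^+ 2 <=
  \int[mu]_(x in D) (f x ^+ 2) * \int[mu]_(x in D) (g x ^+ 2).
Proof.
move=> mD sf sg; have ifg := sqiM mD sf sg.
case: (sf) (sg) => mf f2 [mg g2]; apply: sqr_poly_disc.
  by apply: Rintegral_ge0 => x _; exact: sqr_ge0.
move=> t; have -> : \int[mu]_(x in D) (f x ^+ 2) * t ^+ 2 +
    2 * \int[mu]_(x in D) (f x * g x) * t + \int[mu]_(x in D) (g x ^+ 2) =
    \int[mu]_(x in D) ((t ^+ 2 * f x ^+ 2 + (2 * t) * (f x * g x)) + g x ^+ 2).
  rewrite RintegralD//; last by apply: intgD => //; exact: intgZ.
  rewrite RintegralD//; [|exact: intgZ|exact: intgZ].
  by rewrite !RintegralZl//; ring.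
apply: Rintegral_ge0 => x _; have := sqr_ge0 (t * f x + g x).
by rewrite [X in 0 <= X -> _](_ : _ = t ^+ 2 * f x ^+ 2 + (2 * t) * (f x * g x) + g x ^+ 2)//; ring.
Qed.

Lemma dct {D} (fn : nat -> R -> R) f g : measurable D ->
  (forall n, measurable_fun D (fn n)) -> measurable_fun D f ->
  (forall x, D x -> fn ^~ x @ \oo --> f x) -> intg D g ->
  (forall n x, D x -> `|fn n x| <= g x) ->
  (fun n => \int[mu]_(x in D) fn n x) @ \oo --> \int[mu]_(x in D) f x.
Proof.
move=> mD mfn mf fnf ig fng.
have [||||i _ H] := @dominated_convergence _ _ _ mu D mD
  (fun n => EFin \o fn n) (EFin \o f) (EFin \o g) _ _ _ ig.
- by move=> n; apply/measurable_EFinP; exact: mfn.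
- exact/measurable_EFinP.
- by apply: aeW => x Dx; apply: cvg_EFin; [exact: nearW|exact: fnf].
- by apply: aeW => x n Dx /=; rewrite lee_fin fng.
by apply: fine_cvg; rewrite fineK//; exact: integrable_fin_num.
Qed.

End IntegralToolkit.

(** * Absolutely continuous functions: product rule, behaviour at infinity, the Sobolev bound *)

Section AbsolutelyContinuous.
Context {R : realType}.
Local Notation mu := (@lebesgue_measure R).
Implicit Types (D E : set R) (f g h d e : R -> R) (a b c x y eps : R).

Lemma dcst (c x : R) : is_derive x (1 : R) (fun=> c) (0 : R).
Proof. exact: is_derive_cst. Qed.

Lemma did (x : R) : is_derive x (1 : R) (fun y : R => y) (1 : R).
Proof. exact: is_derive_id. Qed.

Lemma dD {f g} {x u v : R} : is_derive x (1 : R) f u -> is_derive x (1 : R) g v ->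
  is_derive x (1 : R) (fun y => f y + g y) (u + v).
Proof. by move=> F G; exact: (is_deriveD F G). Qed.

Lemma dN {f} {x u : R} : is_derive x (1 : R) f u ->
  is_derive x (1 : R) (fun y => - f y) (- u).
Proof. by move=> F; exact: (is_deriveN F). Qed.

Lemma dB {f g} {x u v : R} : is_derive x (1 : R) f u -> is_derive x (1 : R) g v ->
  is_derive x (1 : R) (fun y => f y - g y) (u - v).
Proof. by move=> F G; exact: (is_deriveB F G). Qed.

Lemma dM {f g} {x u v : R} : is_derive x (1 : R) f u -> is_derive x (1 : R) g v ->
  is_derive x (1 : R) (fun y => f y * g y) (u * g x + f x * v).
Proof.
move=> F G; have H := is_deriveM F G; apply: (is_derive_eq H).
by rewrite addrC /GRing.scale /= (mulrC (g x)).
Qed.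

Lemma dZ (c : R) {f} {x u : R} : is_derive x (1 : R) f u ->
  is_derive x (1 : R) (fun y => c * f y) (c * u).
Proof. by move=> F; exact: (is_deriveZ c F). Qed.

Lemma dcomp g f {x u v : R} : is_derive x (1 : R) f u ->
  is_derive (f x) (1 : R) g v ->
  is_derive x (1 : R) (fun y => g (f y)) (v * u).
Proof. by move=> F G; exact: (is_derive1_comp G F). Qed.

Lemma d_eq {f} {x u v : R} : is_derive x (1 : R) f u -> u = v ->
  is_derive x (1 : R) f v.
Proof. by move=> F <-. Qed.

Lemma d_cont {f} : (forall x : R, exists u, is_derive x (1 : R) f u) -> continuous f.
Proof.
move=> fd x; apply/differentiable_continuous/derivable1_diffP.
by have [u []] := fd x.
Qed.

Lemma cont_meas {f} : continuous f -> measurable_fun setT f.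
Proof. by move=> cf; apply: continuous_measurable_fun. Qed.

(** The point [y] may lie outside [[a, b]]. Each covering ball has half the radius given by
    continuity at its centre, and compactness in near-covering form makes one [de] serve for all
    [x]. *)
Lemma heine {f} : continuous f -> forall a b eps, 0 < eps ->
  exists2 de : R, 0 < de & forall x y, a <= x <= b -> `|x - y| < de ->
  `|f x - f y| < eps.
Proof.
move=> cf a b eps e0.
have /compact_near_coveringP H := @segment_compact R a b.
have := H R (0^'+) (fun (de x : R) => forall y, `|x - y| < de -> `|f x - f y| < eps) _.
case.
- move=> x _.
  have /cvgrPdist_lt /(_ (eps / 2)) := cf x.
  rewrite divr_gt0// => /(_ isT) [r /= r0 Hr].
  exists (ball x (r / 2), [set de | 0 < de < r / 2]) => /=.
    split; first by apply: nbhsx_ballx; rewrite divr_gt0.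
    exists (r / 2) => /=; first by rewrite divr_gt0.
    by move=> z /=; rewrite sub0r normrN => zr z0; rewrite z0 (le_lt_trans _ zr)// ler_norm.
  move=> [x' de] /= [xx' /andP[d0 dr]] y x'y.
  have H1 : `|f x - f x'| < eps / 2 by apply: Hr => /=; rewrite (lt_trans xx')//; lra.
  have H2 : `|f x - f y| < eps / 2.
    apply: Hr => /=; have := ler_normD (x - x') (x' - y); rewrite addrA subrK.
    by move: xx'; rewrite /ball /=; lra.
  have := ler_normD (f x' - f x) (f x - f y); rewrite addrA subrK (distrC (f x') (f x)); lra.
- move=> r /= r0 Hr; exists (r / 2); first by rewrite divr_gt0.
  move=> x y xab xy; apply: (Hr (r / 2) _ _ x) => //=.
  + by rewrite sub0r normrN gtr0_norm ?divr_gt0//; lra.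
  + by rewrite divr_gt0.
Qed.

(** Along a uniform subdivision finer than [de] both sides telescope, which gives
    [|J b - J a| <= eps (V b - V a)] for every [eps]. In the product rule this stands in for an
    argument with almost-everywhere derivatives. *)
Lemma slow_const (J V : R -> R) a b : a <= b ->
  (forall eps, 0 < eps -> exists2 de : R, 0 < de & forall x y : R, a <= x -> x <= y ->
    y <= b -> y - x < de -> `|J y - J x| <= eps * (V y - V x)) -> J a = J b.
Proof.
move=> ab H.
have key eps : 0 < eps -> `|J b - J a| <= eps * (V b - V a).
  move=> e0; have [de d0 Hd] := H _ e0.
  have [n Hn] : exists n : nat, (b - a) / de < n.+1%:R.
    exists (Num.truncn ((b - a) / de)).
    by rewrite truncnS_gt// divr_ge0 ?subr_ge0// ltW.
  pose p i := a + (b - a) * i%:R / n.+1%:R.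
  have ps i : p i.+1 = p i + (b - a) / n.+1%:R.
    rewrite /p -[i.+1%:R]natr1; field.
    by rewrite addrC natr1 pnatr_eq0.
  have st : 0 <= (b - a) / n.+1%:R by rewrite divr_ge0// subr_ge0.
  have pl i : (i <= n.+1)%N -> p i <= b.
    move=> i1; rewrite /p -mulrA -lerBrDl ler_piMr ?subr_ge0//.
    by rewrite ler_pdivrMr// mul1r ler_nat.
  have pg i : a <= p i by rewrite /p lerDl divr_ge0// mulr_ge0// subr_ge0.
  have ind i : (i <= n.+1)%N -> `|J (p i) - J a| <= eps * (V (p i) - V a).
    elim: i => [_|i IH i1].
      by rewrite /p mulr0 mul0r addr0 !subrr mulr0 normr0.
    have := IH (ltnW i1); have := Hd (p i) (p i.+1) (pg i) _ (pl _ i1) _.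
    have -> : p i <= p i.+1 by rewrite ps lerDl.
    have -> : p i.+1 - p i < de.
      by rewrite ps addrAC subrr add0r ltr_pdivrMr// mulrC -ltr_pdivrMr.
    move=> /(_ isT isT) h1 h2.
    have := ler_normD (J (p i.+1) - J (p i)) (J (p i) - J a).
    rewrite addrA subrK; lra.
  have := ind n.+1 (leqnn _); have -> // : p n.+1 = b.
  by rewrite /p; field; rewrite addrC natr1 pnatr_eq0.
apply/eqP; rewrite eq_sym -subr_eq0 -normr_le0 leNgt; apply/negP => J0.
have := key (`|J b - J a| / (2 * (`|V b - V a| + 1))) _.
set v := V b - V a; set z := 2 * _; have z0 : 0 < z by rewrite mulr_gt0// ltr_wpDl.
rewrite divr_gt0// => /(_ isT); rewrite mulrAC ler_pdivlMr// ler_pM2l//.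
rewrite /z; have := ler_norm v; have := normr_ge0 v; lra.
Qed.

Lemma Rint_split {d} a b c : a <= b -> b <= c -> intg `[a, c] d ->
  \int[mu]_(x in `[a, c]) d x =
  \int[mu]_(x in `[a, b]) d x + \int[mu]_(x in `[b, c]) d x.
Proof.
move=> ab bc id; have := @Rintegral_itvB R d (BLeft a) (BRight c) b id.
rewrite !bnd_simp => /(_ ab bc); rewrite Rintegral_itv_obnd_cbnd.
  by move=> <-; rewrite addrC subrK.
by apply: (@intgS _ _ `[a, c]) => //; apply: subset_itvr; rewrite bnd_simp.
Qed.

(** Local absolute continuity with the density carried along: the pair [(f, d)] plays the role of a
    continuous function and its weak derivative, where [d] is determined only up to a null set. *)
Definition ac f d :=
  [/\ continuous f, measurable_fun setT d, (forall a b, intg `[a, b] d) &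
      forall a b, a <= b -> f b - f a = \int[mu]_(x in `[a, b]) d x].

Lemma ac_cst (c : R) : ac (fun=> c) (fun=> 0).
Proof.
split=> //.
- by move=> x; exact: cvg_cst.
- by move=> a b; exact: intg0.
- by move=> a b ab; rewrite subrr Rintegral_cst// mul0r.
Qed.

Lemma acD {f d g e} : ac f d -> ac g e ->
  ac (fun x => f x + g x) (fun x => d x + e x).
Proof.
move=> [cf md id fd] [cg me ie ge]; split.
- by move=> x; apply: cvgD; [exact: cf|exact: cg].
- exact: measurable_funD.
- by move=> a b; exact: intgD.
- by move=> a b ab; rewrite RintD// -fd// -ge//; ring.
Qed.

Lemma acZ k {f d} : ac f d -> ac (fun x => k * f x) (fun x => k * d x).
Proof.
move=> [cf md id fd]; split.
- by move=> x; apply: cvgMr; exact: cf.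
- exact: measurable_funM.
- by move=> a b; exact: intgZ.
- by move=> a b ab; rewrite RintZ// -fd// mulrBr.
Qed.

Lemma eq_ac f d {g e} : f =1 g -> d =1 e -> ac f d -> ac g e.
Proof. by move=> /funext-> /funext->. Qed.

Lemma acB {f d g e} : ac f d -> ac g e ->
  ac (fun x => f x - g x) (fun x => d x - e x).
Proof.
move=> F G; apply: (eq_ac _ _ _ _ (acD F (acZ (-1) G))) => x /=;
by rewrite mulN1r.
Qed.

Lemma cont_bnd_itv {f} a b : continuous f ->
  exists2 M : R, 0 < M & forall x, a <= x <= b -> `|f x| <= M.
Proof.
move=> cf; have [ab|ba] := leP a b; last first.
  by exists 1 => // x /andP[ax xb]; move: ba; rewrite ltNge (le_trans ax).
have cn : {within `[a, b], continuous (fun x => `|f x|)}.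
  by apply: continuous_subspaceT => x; apply: cvg_norm; exact: cf.
have [c _ H] := EVT_max ab cn.
exists (`|f c| + 1); first by rewrite ltr_wpDl.
move=> x xab; apply: le_trans (H x _) _; first by rewrite in_itv.
by rewrite lerDl.
Qed.

Lemma cont_intg_itv {f} a b : continuous f -> intg `[a, b] f.
Proof.
move=> cf; apply: continuous_compact_integrable; first exact: segment_compact.
exact: continuous_subspaceT.
Qed.

Lemma ac_C1 {f d} : (forall x : R, is_derive x (1 : R) f (d x)) ->
  continuous d -> ac f d.
Proof.
move=> fd cd; have cf : continuous f.
  by move=> x; apply/differentiable_continuous/derivable1_diffP; case: (fd x).
split=> //; [exact: cont_meas|by move=> a b; exact: cont_intg_itv|].
move=> a b; rewrite le_eqVlt => /orP[/eqP<-|ab].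
  by rewrite set_itv1 Rintegral_set1 subrr.
rewrite /Rintegral (@continuous_FTC2 _ d f)//.
- exact: continuous_subspaceT.
- split.
  + by move=> x _; case: (fd x).
  + by apply: cvg_at_right_filter; exact: cf.
  + by apply: cvg_at_left_filter; exact: cf.
- by move=> x _; rewrite derive1E; exact: derive_val.
Qed.

(** The function [J t = f t g t - int_a^t (d g + f e)] has increment [int_x^y (d(s) (g y - g s) + (f
    x - f s) e(s)) ds]. By uniform continuity of [f] and [g] this is at most [eps] times the
    increment of [int (|d| + |e|)], so [slow_const] shows that [J] has equal values at the ends. *)
Lemma acM {f d g e} : ac f d -> ac g e ->
  ac (fun x => f x * g x) (fun x => d x * g x + f x * e x).
Proof.
move=> [cf md id fd] [cg me ie ge].
have mf := cont_meas cf; have mg := cont_meas cg.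
have i1 a b : intg `[a, b] (fun x => d x * g x).
  have [M M0 H] := cont_bnd_itv a b cg.
  apply: (@eq_intg _ _ (fun x => g x * d x)) => //; first by move=> x _; rewrite mulrC.
  apply: (intg_bM M) => //; first exact: measurable_funS mg.
have i2 a b : intg `[a, b] (fun x => f x * e x).
  have [M M0 H] := cont_bnd_itv a b cf.
  apply: (intg_bM M) => //; first exact: measurable_funS mf.
have i3 a b : intg `[a, b] (fun x => d x * g x + f x * e x) by exact: intgD.
split=> //.
- by move=> x; apply: cvgM; [exact: cf|exact: cg].
- by apply: measurable_funD; exact: measurable_funM.
- move=> a b ab.
  pose h x := d x * g x + f x * e x.
  pose J t := f t * g t - \int[mu]_(x in `[a, t]) h x.
  pose n x := `|d x| + `|e x|.
  have iN x y : intg `[x, y] n by apply: intgD => //; exact: intg_norm.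
  pose V t := \int[mu]_(x in `[a, t]) n x.
  suff JJ : J a = J b.
    by move: JJ; rewrite /J set_itv1 Rintegral_set1 subr0 -/h => ->; ring.
  apply: (slow_const _ V) => // eps e0.
  have [d1 d10 H1] := heine cf a b _ e0.
  have [d2 d20 H2] := heine cg a b _ e0.
  exists (Num.min d1 d2); first by rewrite lt_min d10.
  move=> x y ax xy yb; rewrite lt_min => /andP[yx1 yx2].
  have -> : V y - V x = \int[mu]_(s in `[x, y]) n s.
    by rewrite /V (Rint_split a x y)//; ring.
  have -> : J y - J x = \int[mu]_(s in `[x, y])
      ((d s * (g y - g s)) + (f x - f s) * e s).
    have ex : forall s, d s * (g y - g s) + (f x - f s) * e s =
      (g y * d s + f x * e s) - h s by move=> s; rewrite /h; ring.
    under eq_Rintegral do rewrite ex.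
    rewrite RintB//; last by apply: intgD => //; exact: intgZ.
    rewrite RintD//; [|exact: intgZ|exact: intgZ].
    rewrite !RintZ// -fd// -ge// /J (Rint_split a x y)//; ring.
  rewrite -RintZ//; apply: normr_Rint_le => //.
  + apply: measurable_funS (measurableT) _ _ => //.
    apply: measurable_funD; apply: measurable_funM => //; exact: measurable_funB.
  + exact: intgZ.
  + move=> s /=; rewrite in_itv/= => /andP[xs sy].
    have h1 : `|f x - f s| <= eps.
      apply/ltW/H1; first by rewrite ax (le_trans xy).
      by rewrite ler0_norm ?subr_le0// opprB; lra.
    have h2 : `|g y - g s| <= eps.
      apply/ltW/H2; first by rewrite yb (le_trans ax).
      by rewrite ger0_norm ?subr_ge0//; lra.
    rewrite (le_trans (ler_normD _ _))// !normrM mulrDr lerD//.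
      by rewrite mulrC ler_wpM2r.
    by rewrite ler_wpM2r.
Qed.

Lemma Rint_ge_sub {D E f} : measurable D -> measurable E -> D `<=` E ->
  intg E f -> (forall x, E x -> 0 <= f x) ->
  \int[mu]_(x in D) f x <= \int[mu]_(x in E) f x.
Proof.
move=> mD mE DE intf f0; have iD := intgS E f mE mD DE intf.
rewrite -(Rint_indic f mD) -(Rint_indic f mE); apply: le_Rint => //.
- exact/intg_indic.
- exact/intg_indic.
- move=> x _; rewrite !indicE; have [xD|xD] := boolP (x \in D).
    by rewrite (mem_set (DE _ (set_mem xD))).
  rewrite mul0r; have [xE|xE] := boolP (x \in E); last by rewrite mul0r.
  by rewrite mul1r f0//; exact: set_mem.
Qed.

Lemma Rint_set_lim {f} (D : nat -> set R) E : intg setT f ->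
  (forall n, measurable (D n)) -> measurable E ->
  (forall x, \forall n \near \oo, D n x <-> E x) ->
  (fun n : nat => \int[mu]_(x in D n) f x) @ \oo --> \int[mu]_(x in E) f x.
Proof.
move=> intf mD mE DE.
have -> : (fun n : nat => \int[mu]_(x in D n) f x) =
    (fun n : nat => \int[mu]_x (\1_(D n) x * f x)).
  by apply/funext => n; rewrite Rint_indic.
rewrite -(Rint_indic f mE).
apply: (dct _ _ (fun x => `|f x|)) => //.
- move=> n; apply: meas_indicM => //.
  by apply: measurable_funS (intg_meas intf).
- apply: meas_indicM => //.
  by apply: measurable_funS (intg_meas intf).
- move=> x _; apply: cvg_near_cst; near=> n.
  have H : D n x <-> E x by near: n; exact: DE.
  rewrite !indicE; congr (_%:R * _); congr nat_of_bool.
  by apply/idP/idP => /set_mem h; apply: mem_set; apply/H.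
- exact: intg_norm.
- move=> n x _; rewrite normrM indicE; case: (_ \in _); rewrite ?normr1 ?normr0 ?mul1r//.
  by rewrite mul0r.
Unshelve. all: by end_near. Qed.

Lemma le_Rint_cst_itv {f} c a b : a <= b -> intg `[a, b] f ->
  (forall x, a <= x <= b -> c <= f x) -> c * (b - a) <= \int[mu]_(x in `[a, b]) f x.
Proof.
move=> ab intf cf.
have [_ _ _ H] : ac (fun x => c * x) (fun=> c).
  apply: ac_C1 => x; last exact: cvg_cst.
  by apply: d_eq (dZ c (did x)) _; rewrite mulr1.
rewrite mulrBr H//; apply: le_Rint => //.
by apply: cont_intg_itv => x; exact: cvg_cst.
Qed.

(** Endpoints [p n] in [[n, n + 1]] and [q n] in [[- n - 1, - n]] are taken where [|F|] is minimal,
    hence at most its integral over that unit interval. These integrals tend to 0 because [F] is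
    integrable, and so does [F (p n) - F (q n)], the integral of [D] between the two points. *)
Lemma ac_int0 {F D : R -> R} : ac F D -> intg setT F -> intg setT D ->
  \int[mu]_x D x = 0.
Proof.
move=> [cF mD iD FD] iF iDT.
have iFS E : measurable E -> intg E (fun x => `|F x|).
  by move=> mE; apply: intgS (intg_norm _ iF).
have ex a : exists x : R, a <= x <= a + 1 /\
    `|F x| <= \int[mu]_(t in `[a, a + 1]) `|F t|.
  have a1 : a <= a + 1 by rewrite lerDl.
  have cn : {within `[a, a + 1], continuous (fun x => `|F x|)}.
    by apply: continuous_subspaceT => x; apply: cvg_norm; exact: cF.
  have [c cab H] := EVT_min a1 cn; exists c; split; first by move: cab; rewrite in_itv.
  have := @le_Rint_cst_itv (fun x => `|F x|) `|F c| a (a + 1) a1 (iFS _ _).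
  by rewrite addrAC subrr add0r mulr1; apply => // x xab; apply: H.
have /choice [p Hp] := fun n : nat => ex n%:R.
have /choice [q Hq] := fun n : nat => ex (- n.+1%:R).
have lim0 (a : nat -> R) : (forall n, n%:R <= `|a n|) -> (forall n, n%:R <= `|a n + 1|) ->
  (forall n, 0 <= a n \/ a n + 1 <= 0) ->
  (fun n => \int[mu]_(t in `[a n, a n + 1]) `|F t|) @ \oo --> 0.
  move=> an an1 a0; rewrite -[X in _ --> X](Rintegral_set0 mu (fun t => `|F t|)).
  apply: Rint_set_lim => //; first exact: iFS.
  move=> x; near=> n; split => //=; rewrite in_itv/= => /andP[h1 h2].
  have xn : `|x| < n%:R by near: n; exact: nbhs_infty_gtr.
  have := an n; have := an1 n; have := a0 n; move: xn; rewrite ltr_norml => /andP[x1 x2].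
  case=> h.
    by rewrite (ger0_norm h); lra.
  by rewrite (ler0_norm h); lra.
have JF : (fun n => \int[mu]_(t in `[q n, p n]) D t) @ \oo --> \int[mu]_t D t.
  apply: Rint_set_lim => // x; near=> n; split => // _ /=; rewrite in_itv/=.
  have := Hp n; have := Hq n; rewrite -natr1.
  have : `|x| < n%:R by near: n; exact: nbhs_infty_gtr.
  by rewrite ltr_norml => /andP[x1 x2] [/andP[h1 h2] _] [/andP[h3 h4] _]; lra.
have J0 : (fun n => \int[mu]_(t in `[q n, p n]) D t) @ \oo --> (0 + 0 : R).
  have L1 := lim0 (fun n => n%:R); have L2 := lim0 (fun n => - n.+1%:R).
  apply: (@squeeze_cvgr _ _ _ _ (fun n =>  - (\int[mu]_(t in `[n%:R, n%:R + 1]) `|F t| + \int[mu]_(t in `[- n.+1%:R, - n.+1%:R + 1]) `|F t|))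
    (fun n => \int[mu]_(t in `[n%:R, n%:R + 1]) `|F t| + \int[mu]_(t in `[- n.+1%:R, - n.+1%:R + 1]) `|F t|)).
  - near=> n; have [/andP[h1 h2] h3] := Hp n; have [/andP[h4 h5] h6] := Hq n.
    rewrite -FD.
      by rewrite -ler_norml (le_trans (ler_normB _ _))// lerD.
    by move: h5; rewrite -natr1; have : 0 <= n%:R :> R by []; lra.
  - rewrite -[0 + 0]opprK; apply: cvgN; rewrite opprD oppr0; apply: cvgD.
      apply: L1 => n; first by rewrite ger0_norm.
        by rewrite ger0_norm ?addr_ge0// lerDl.
      by left.
    apply: L2 => n; first by rewrite normrN ger0_norm// ler_nat.
      rewrite -natr1 ler0_norm; have : 0 <= n%:R :> R by []; lra.
    by right; rewrite -natr1; have : 0 <= n%:R :> R by []; lra.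
  - apply: cvgD.
      apply: L1 => n; first by rewrite ger0_norm.
        by rewrite ger0_norm ?addr_ge0// lerDl.
      by left.
    apply: L2 => n; first by rewrite normrN ger0_norm// ler_nat.
      rewrite -natr1 ler0_norm; have : 0 <= n%:R :> R by []; lra.
    by right; rewrite -natr1; have : 0 <= n%:R :> R by []; lra.
by rewrite (cvg_unique _ JF J0) // addr0.
Unshelve. all: by end_near. Qed.

(** Since [|2 f f'| <= f^2 + f'^2], one has [f(y)^2 >= f(x)^2 - S] for [y] in [[x, x + 1]], with [S]
    the squared [H^1] norm. Integrating over this unit interval gives [f(x)^2 - S <= S]. *)
Lemma ac_sup {f d} : ac f d -> sqi setT f -> sqi setT d -> forall x : R,
  f x ^+ 2 <= 2 * (\int[mu]_x (f x ^+ 2) + \int[mu]_x (d x ^+ 2)).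
Proof.
move=> Hac [mf f2] [md d2] x.
have [cf _ _ _] := Hac.
have i0 : intg setT (fun y => f y ^+ 2 + d y ^+ 2) by exact: intgD.
have i1 a b : intg `[a, b] (fun y => f y ^+ 2 + d y ^+ 2) by apply: intgS i0.
set S := \int[mu]_x (f x ^+ 2) + \int[mu]_x (d x ^+ 2).
have S0 a b : \int[mu]_(y in `[a, b]) (f y ^+ 2 + d y ^+ 2) <= S.
  rewrite /S -RintD//; apply: Rint_ge_sub => //.
  by move=> y _; rewrite addr_ge0 ?sqr_ge0.
have [_ _ iff ff] := acM Hac Hac.
have key y : x <= y -> f x ^+ 2 - S <= f y ^+ 2.
  move=> xy; have : `|f y * f y - f x * f x| <= S.
    rewrite ff//; apply: le_trans (S0 x y); apply: normr_Rint_le => //.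
    - by apply: measurable_funS measurableT _ _ => //; apply: measurable_funD; exact: measurable_funM.
    - move=> t _; rewrite ler_norml; have := sqr_ge0 (f t - d t).
      have := sqr_ge0 (f t + d t).
      by move=> *; apply/andP; split; nra.
  by rewrite ler_norml !expr2 => /andP[h1 h2]; lra.
have x1 : x <= x + 1 by rewrite lerDl.
have f2i : intg `[x, x + 1] (fun y => f y ^+ 2) by apply: intgS f2.
have := @le_Rint_cst_itv (fun y => f y ^+ 2) (f x ^+ 2 - S) x (x + 1) x1 f2i.
rewrite addrAC subrr add0r mulr1 => /(_ _).
have : \int[mu]_(y in `[x, x + 1]) (f y ^+ 2) <= S.
  apply: le_trans (S0 x (x + 1)); apply: le_Rint => // y _.
  by rewrite lerDl sqr_ge0.
move=> h1 h2; suff : f x ^+ 2 - S <= S by lra.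
by apply: le_trans h1; apply: h2 => y /andP[xy _]; exact: key.
Qed.

End AbsolutelyContinuous.

(** * Truncation at a point; invariance under translation and reflection *)

Section Invariance.
Context {R : realType}.
Local Notation mu := (@lebesgue_measure R).
Implicit Types (D E : set R) (f g h d e : R -> R) (a b c x y eps : R).

Lemma Rint_obnd_cbnd {f} a b : intg `[a, b] f ->
  \int[mu]_(x in `]a, b]) f x = \int[mu]_(x in `[a, b]) f x.
Proof.
move=> intf; have := @Rintegral_itv_obnd_cbnd R a (BRight b) f; apply.
by apply: (@intgS _ _ `[a, b]) => //; apply: subset_itvr; rewrite bnd_simp.
Qed.

(** Common source of [ac_cut] and [ac_C1_clip]: freezing [f] at the value [f a] to the left of [a]
    makes the density vanish there, so only information to the right of [a] enters. *)
Lemma ac_clip_gen a {f d} : continuous (fun x => f (Num.max x a)) ->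
  measurable_fun setT (fun x => \1_`]a, +oo[ x * d x) ->
  (forall p q, a <= p -> p <= q -> intg `[p, q] d /\
     f q - f p = \int[mu]_(x in `[p, q]) d x) ->
  ac (fun x => f (Num.max x a)) (fun x => \1_`]a, +oo[ x * d x).
Proof.
move=> cf md H; pose F x := \1_`]a, +oo[ x * d x.
have eF p q x : \1_`[p, q] x * F x = \1_`[Num.max p a, Num.max q a] x * F x.
  rewrite /F; have [xa|ax] := leP x a.
    by rewrite !indicE [_ \in `]a, +oo[%classic]memNset ?mul0r ?mulr0//= in_itv/= ltNge xa.
  rewrite !indicE !mem_setE !in_itv /= ge_max le_max (ltW ax) andbT.
  by rewrite andbT [x <= a]leNgt ax orbF.
have i2 p q : a <= p -> p <= q -> intg `[p, q] F.
  move=> ap pq; have [id _] := H _ _ ap pq.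
  apply: (intg_bM 1) => //.
  by move=> x _; rewrite indicE; case: (_ \in _); rewrite ?normr1 ?normr0.
have maxle p q : p <= q -> Num.max p a <= Num.max q a.
  by move=> pq; rewrite ge_max !le_max pq lexx orbT.
have i1 p q : intg `[p, q] F.
  have [pq|qp] := leP p q; last first.
    by rewrite set_itv_ge ?bnd_simp -?ltNge//; exact: integrable_set0.
  apply/intg_indic => //; apply: (eq_intg (fun x => _)) (_ : forall x, _ -> _ = \1_`[Num.max p a, Num.max q a] x * F x) _ => //.
  apply/intg_indic => //; apply: i2; last exact: maxle.
  by rewrite le_max lexx orbT.
split => // p q pq; rewrite -/F -Rint_indic//.
under eq_Rint do rewrite eF; rewrite Rint_indic//.
have /(H _ _)/(_ (maxle _ _ pq)) [id ->] : a <= Num.max p a by rewrite le_max lexx orbT.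
rewrite -!Rint_obnd_cbnd//; apply: eq_Rint => x /=; rewrite in_itv/= => /andP[px _].
rewrite /F indicE mem_set ?mul1r//= in_itv/= andbT (le_lt_trans _ px)//.
by rewrite le_max lexx orbT.
Qed.

Lemma max_cont a : continuous (fun x : R => Num.max x a).
Proof. by move=> x; apply: continuous_max; [exact: cvg_id|exact: cvg_cst]. Qed.

(** Because [f a = 0], extending by zero to the left of [a] creates no jump and coincides with
    freezing the value at [a]. *)
Lemma ac_cut a {f d} : ac f d -> f a = 0 ->
  ac (fun x => \1_`]a, +oo[ x * f x) (fun x => \1_`]a, +oo[ x * d x).
Proof.
move=> [cf md id fd] fa.
have -> : (fun x => \1_`]a, +oo[ x * f x) = (fun x => f (Num.max x a)).
  apply/funext => x; rewrite indicE mem_setE in_itv/= andbT.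
  by case: ltP => h; rewrite ?mul1r ?mul0r.
apply: ac_clip_gen.
- move=> x; apply: (@continuous_comp _ _ _ (fun x => Num.max x a) f).
    exact: max_cont.
  exact: cf.
- by apply: meas_indicM => //; exact: measurable_funS md.
- by move=> p q ap pq; split; [exact: id|exact: fd].
Qed.

(** Meant for Riccati functions that are known to be regular only on a half-line. *)
Lemma ac_C1_clip a {f d} : (forall x, a <= x -> is_derive x (1 : R) f (d x)) ->
  (forall x, a <= x -> {for x, continuous d}) ->
  ac (fun x => f (Num.max x a)) (fun x => \1_`]a, +oo[ x * d x).
Proof.
move=> fd cd.
have ma x : a <= Num.max x a by rewrite le_max lexx orbT.
have cf x : a <= x -> {for x, continuous f}.
  move=> ax; apply/differentiable_continuous/derivable1_diffP.
  by case: (fd x ax).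
apply: ac_clip_gen.
- move=> x; apply: (@continuous_comp _ _ _ (fun x => Num.max x a) f).
    exact: max_cont.
  exact: cf.
- have -> : (fun x => \1_`]a, +oo[ x * d x) = (fun x => \1_`]a, +oo[ x * d (Num.max x a)).
    apply/funext => x; rewrite indicE mem_setE in_itv/= andbT.
    by case: ltP => h; rewrite ?mul1r ?mul0r.
  apply: meas_indicM => //; apply: measurable_funS measurableT _ _ => //.
  apply: cont_meas => x; apply: (@continuous_comp _ _ _ (fun x => Num.max x a) d).
    exact: max_cont.
  exact: cd.
- move=> p q ap pq.
  have cdpq : {within `[p, q], continuous d}.
    apply: continuous_in_subspaceT => x /set_mem/=; rewrite in_itv/= => /andP[px _].
    by apply: cd; exact: le_trans px.
  split.
    by apply: continuous_compact_integrable => //; exact: segment_compact.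
  move: pq; rewrite le_eqVlt => /orP[/eqP<-|pq].
    by rewrite set_itv1 Rintegral_set1 subrr.
  rewrite /Rintegral (@continuous_FTC2 _ d f)//.
  + split.
    * move=> x; rewrite in_itv/= => /andP[px _].
      by case: (fd x (le_trans ap (ltW px))).
    * by apply: cvg_at_right_filter; exact: cf.
    * by apply: cvg_at_left_filter; apply: cf; exact: le_trans (ltW pq).
  + move=> x; rewrite in_itv/= => /andP[px _]; rewrite derive1E.
    by have [] := fd x (le_trans ap (ltW px)).
Qed.

(** The pushforward of [mu] under [h] agrees with [mu] on measurable sets, so change of variables is
    integration against the pushforward. Translations and the reflection are the instances in
    use. *)
Lemma Rint_isom (h : R -> R) D f : continuous h ->
  (forall A : set R, measurable A -> mu (h @^-1` A) = mu A) ->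
  measurable D -> measurable_fun setT f -> intg D f ->
  intg (h @^-1` D) (fun x => f (h x)) /\
  \int[mu]_(x in h @^-1` D) f (h x) = \int[mu]_(x in D) f x.
Proof.
move=> /cont_meas mh hmu mD mf intf.
have mDh : measurable (h @^-1` D) by rewrite -[X in measurable X]setTI; exact: mh.
have mfh : measurable_fun setT (f \o h) by exact: measurableT_comp.
pose hmix := isMeasurableFun.Build _ _ (measurableTypeR R) (measurableTypeR R) h mh.
pose hp : {mfun measurableTypeR R >-> measurableTypeR R} := MeasurableFun.Pack (MeasurableFun.Class hmix).
have e1 (g : R -> \bar R) : (\int[pushforward mu hp]_(y in D) g y = \int[mu]_(y in D) g y)%E.
  by apply: eq_measure_integral => A mA _; exact: hmu.
have ih : intg (h @^-1` D) (fun x => f (h x)).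
  apply/integrableP; split.
    by apply/measurable_EFinP; exact: measurable_funS mfh.
  move/integrableP : intf => [_]; apply: le_lt_trans; rewrite -e1.
  rewrite (@ge0_integral_pushforward _ _ (measurableTypeR R) (measurableTypeR R) R hp mh mu D)//.
  by apply: measurableT_comp => //; apply/measurable_EFinP; exact: measurable_funS mf.
split=> //; rewrite /Rintegral -e1.
rewrite (@integral_pushforward _ _ (measurableTypeR R) (measurableTypeR R) R hp mh mu D)//.
exact/measurable_EFinP.
Qed.

Lemma mu_opp (A : set R) : measurable A -> mu (-%R @^-1` A) = mu A.
Proof. exact: lebesgue_measureN. Qed.

Lemma mu_shift a (A : set R) : measurable A -> mu ((fun x => x + a) @^-1` A) = mu A.
Proof.
move=> mA; pose h : R -> R := fun x => x + a.
have mh : measurable_fun setT h by apply: cont_meas => x; apply: cvgD; [exact: cvg_id|exact: cvg_cst].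
pose hmix := isMeasurableFun.Build _ _ (measurableTypeR R) (measurableTypeR R) h mh.
pose hp : {mfun measurableTypeR R >-> measurableTypeR R} := MeasurableFun.Pack (MeasurableFun.Class hmix).
(* Uniqueness of Lebesgue measure is applied to an abstract measure [m] with the values of the
   pushforward; it remains to compare lengths of the intervals []p, q]]. *)
have key : forall m : {measure set (measurableTypeR R) -> \bar R}, (forall X, m X = mu (h @^-1` X)) -> mu (h @^-1` A) = mu A; last exact: (key (pushforward mu hp)).
move=> m em; rewrite -em.
apply/esym; apply: (@lebesgue_measure_unique R m _ A mA) => _ [[p q]] _ <-.
rewrite em.
have -> : h @^-1` `]p, q] = `]p - a, q - a]%classic.
  by apply/seteqP; split => x /=; rewrite !in_itv/= /h lerBrDr ltrBlDr.
rewrite !lebesgue_measure_itv/= !lte_fin ltrD2r; case: ifP => // _.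
by rewrite -!EFinD; congr EFin; ring.
Qed.

Lemma shift_cont (s : R) : continuous (fun x : R => x + s).
Proof. by move=> x; apply: cvgD; [exact: cvg_id|exact: cvg_cst]. Qed.

Lemma Rint_shift s {f} : intg setT f ->
  intg setT (fun x => f (x + s)) /\ \int[mu]_x f (x + s) = \int[mu]_x f x.
Proof.
move=> intf.
by have := @Rint_isom _ setT f (shift_cont s) (mu_shift s) measurableT (intg_meas intf) intf.
Qed.

Lemma Rint_opp {D f} : measurable D -> measurable_fun setT f -> intg D f ->
  intg (-%R @^-1` D) (fun x => f (- x)) /\
  \int[mu]_(x in -%R @^-1` D) f (- x) = \int[mu]_(x in D) f x.
Proof.
move=> mD mf intf; have c : continuous (fun x : R => - x).
  by move=> x; apply: cvgN; exact: cvg_id.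
exact: (@Rint_isom (fun x => - x) D f c mu_opp mD mf intf).
Qed.

Lemma sqi_shift s {f} : sqi setT f -> sqi setT (fun x => f (x + s)) /\
  \int[mu]_x (f (x + s) ^+ 2) = \int[mu]_x (f x ^+ 2).
Proof.
move=> [mf f2]; have [i e] := Rint_shift s f2; split => //; split => //.
by apply: measurableT_comp => //; apply: cont_meas; exact: shift_cont.
Qed.

Lemma ac_shift s {f d} : ac f d -> ac (fun x => f (x + s)) (fun x => d (x + s)).
Proof.
move=> [cf md id fd].
have ms := cont_meas (shift_cont s).
have H a b : intg `[a, b] (fun x => d (x + s)) /\
    \int[mu]_(x in `[a, b]) d (x + s) = \int[mu]_(x in `[a + s, b + s]) d x.
  have := @Rint_isom _ `[a + s, b + s] d (shift_cont s) (mu_shift s) (measurable_itv _) md (id _ _).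
  suff -> : (fun x => x + s) @^-1` `[a + s, b + s] = `[a, b]%classic by [].
  by apply/seteqP; split => x /=; rewrite !in_itv/= !lerD2r.
split.
- move=> x; apply: (@continuous_comp _ _ _ (fun x => x + s) f).
    exact: shift_cont.
  exact: cf.
- exact: measurableT_comp.
- by move=> a b; have [] := H a b.
- by move=> a b ab; have [_ ->] := H a b; rewrite fd// lerD2r.
Qed.

Lemma ac_opp {f d} : ac f d -> ac (fun x => f (- x)) (fun x => - d (- x)).
Proof.
move=> [cf md id fd].
have H a b : intg `[a, b] (fun x => d (- x)) /\
    \int[mu]_(x in `[a, b]) d (- x) = \int[mu]_(x in `[- b, - a]) d x.
  have := @Rint_opp `[- b, - a] d (measurable_itv _) md (id _ _).
  suff -> : -%R @^-1` `[- b, - a] = `[a, b]%classic by [].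
  by apply/seteqP; split => x /=; rewrite !in_itv/= !lerN2 andbC.
split.
- move=> x; apply: (@continuous_comp _ _ _ -%R f); first exact: opp_continuous.
  exact: cf.
- have c : continuous (fun x : R => - x) by move=> x; apply: cvgN; exact: cvg_id.
  apply: measurableT_comp (measurableT_comp md (cont_meas c)) => /=.
  exact: cont_meas c.
- by move=> a b; have [h _] := H a b; exact: intgN.
- move=> a b ab; have [h e] := H a b; rewrite RintN// e -fd ?lerN2//; ring.
Qed.
End Invariance.

(** * A smooth bump of unit mass and a smooth step *)

Section SmoothBump.
Context {R : realType}.
Local Notation mu := (@lebesgue_measure R).
Implicit Types (f g : R -> R) (a b c x y eps : R) (p q : {poly R}).

Lemma d_derive1 {f g} : (forall x, is_derive x (1 : R) f (g x)) -> derive1 f = g.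
Proof. by move=> fg; apply/funext => x; rewrite derive1E; exact: derive_val. Qed.

Lemma derivable_d {f} x : derivable f x 1 -> is_derive x (1 : R) f (derive1 f x).
Proof. by move=> /derivableP; rewrite derive1E. Qed.

(** Finite-order smoothness, so that closure under products goes by induction on the order: the
    Leibniz rule turns order [n + 1] of one product into order [n] of two products. *)
Definition smooth_upto n f := forall k, (k < n)%N -> forall x, derivable (derive1n k f) x 1.

Lemma smooth_uptoP f : smooth f <-> forall n, smooth_upto n f.
Proof. by split=> [sf n k _ x|H k x]; [exact: sf|exact: (H k.+1)]. Qed.

Lemma smooth_uptoS n f : smooth_upto n.+1 f <->
  (forall x, derivable f x 1) /\ smooth_upto n (derive1 f).
Proof.
split=> [H|[H1 H2] [|k] kn x]; first split.
- by move=> x; exact: (H 0).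
- by move=> k kn x; rewrite -derive1Sn; exact: H.
- exact: H1.
- by rewrite derive1Sn; exact: H2.
Qed.

Lemma smooth_uptoW n f : smooth_upto n.+1 f -> smooth_upto n f.
Proof. by move=> H k kn; apply: H; exact: ltnW. Qed.

Lemma smooth_uptoD n f g : smooth_upto n f -> smooth_upto n g ->
  smooth_upto n (fun x => f x + g x).
Proof.
elim: n f g => [|n IH] f g; first by move=> _ _ k; rewrite ltn0.
move=> /smooth_uptoS[df sf] /smooth_uptoS[dg sg].
have H x : is_derive x (1 : R) (fun y => f y + g y) (derive1 f x + derive1 g x).
  by apply: dD; exact: derivable_d.
apply/smooth_uptoS; split; first by move=> x; case: (H x).
by rewrite (d_derive1 H); exact: IH.
Qed.

Lemma smooth_uptoM n f g : smooth_upto n f -> smooth_upto n g ->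
  smooth_upto n (fun x => f x * g x).
Proof.
elim: n f g => [|n IH] f g; first by move=> _ _ k; rewrite ltn0.
move=> sf0 sg0.
have /smooth_uptoS[df sf] := sf0; have /smooth_uptoS[dg sg] := sg0.
have H x : is_derive x (1 : R) (fun y => f y * g y)
    (derive1 f x * g x + f x * derive1 g x).
  by apply: dM; exact: derivable_d.
apply/smooth_uptoS; split; first by move=> x; case: (H x).
rewrite (d_derive1 H); apply: smooth_uptoD.
  by apply: IH; [exact: sf|exact: smooth_uptoW].
by apply: IH; [exact: smooth_uptoW|exact: sg].
Qed.

Lemma smoothD {f g} : smooth f -> smooth g -> smooth (fun x => f x + g x).
Proof.
move=> /smooth_uptoP sf /smooth_uptoP sg; apply/smooth_uptoP => n.
exact: smooth_uptoD.
Qed.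

Lemma smoothM {f g} : smooth f -> smooth g -> smooth (fun x => f x * g x).
Proof.
move=> /smooth_uptoP sf /smooth_uptoP sg; apply/smooth_uptoP => n.
exact: smooth_uptoM.
Qed.

Lemma smooth_step {f} g : (forall x, is_derive x (1 : R) f (g x)) -> smooth g -> smooth f.
Proof.
move=> H sg [|k] x; first by case: (H x).
by rewrite derive1Sn (d_derive1 H).
Qed.

Lemma smooth_derive1 {f} : smooth f -> smooth (derive1 f).
Proof. by move=> sf k x; rewrite -derive1Sn; exact: sf. Qed.

Lemma smooth_d {f} : smooth f -> forall x, is_derive x (1 : R) f (derive1 f x).
Proof. by move=> sf x; apply: derivable_d; exact: (sf 0). Qed.

Lemma smooth_cont {f} : smooth f -> continuous f.
Proof. by move=> sf; apply: d_cont => x; exists (derive1 f x); exact: smooth_d. Qed.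

Lemma smooth_cst c : smooth (fun=> c).
Proof.
have H c' x : is_derive x (1 : R) (fun=> c') (0 : R) by exact: dcst.
have H0 k : derive1n k (fun=> 0 : R) = (fun=> 0) :> (R -> R).
  by elim: k => [//|k IH]; rewrite derive1Sn (d_derive1 (H 0)).
case=> [|k] x; first by case: (H c x).
by rewrite derive1Sn (d_derive1 (H c)) H0; case: (H 0 x).
Qed.

Lemma smooth_affine {f} a b : smooth f -> smooth (fun x => f (a * x + b)).
Proof.
have aff x : is_derive x (1 : R) (fun y => a * y + b) a.
  by apply: d_eq (dD (dZ a (did x)) (dcst b x)) _; rewrite mulr1 addr0.
suff H n : forall f, smooth_upto n f -> smooth_upto n (fun x => f (a * x + b)).
  by move=> /smooth_uptoP sf; apply/smooth_uptoP => n; exact: H.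
elim: n => [|n IH] {}f; first by move=> _ k; rewrite ltn0.
move=> /smooth_uptoS[df sf].
have H x : is_derive x (1 : R) (fun x => f (a * x + b)) (derive1 f (a * x + b) * a).
  by apply: dcomp (aff x) _; exact: derivable_d.
apply/smooth_uptoS; split; first by move=> x; case: (H x).
rewrite (d_derive1 H); apply: smooth_uptoM; first exact: IH.
exact: ((smooth_uptoP _).1 (smooth_cst a) n).
Qed.

(** The polynomial parameter makes the family stable under differentiation: the derivative of
    [p(1/x) exp(-1/x)] is the same expression with [X^2 (p - p')]. Smoothness then follows by
    induction for all [p] at once. *)
Definition expinv p x := if 0 < x then p.[x^-1] * expR (- x^-1) else 0.

(** From [y^n <= n! exp y], coefficient by coefficient. *)
Lemma poly_expR_bnd p : exists2 C : R, 0 <= C & forall y, 0 <= y -> `|p.[y]| * expR (- y) <= C.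
Proof.
exists (\sum_(i < size p) `|p`_i| * (i`!)%:R).
  by apply: sumr_ge0 => i _; rewrite mulr_ge0.
move=> y y0; rewrite horner_coef.
apply: (@le_trans _ _ (\sum_(i < size p) `|p`_i * y ^+ i| * expR (- y))).
  by rewrite -mulr_suml ler_wpM2r ?expR_ge0// ler_norm_sum.
apply: ler_sum => i _; rewrite normrM -mulrA ler_wpM2l//.
rewrite ger0_norm ?exprn_ge0// expRN ler_pdivrMr ?expR_gt0//.
case: (nat_of_ord i) => [|n].
  by rewrite expr0 fact0 mul1r; have := expR_ge1Dx y; lra.
have := expR_ge1Dxn n y0; rewrite -ler_pdivrMl ?ltr0n ?fact_gt0//.
by rewrite mulrC; lra.
Qed.

Lemma expinv_d p x : is_derive x (1 : R) (expinv p) (expinv ('X^2 * (p - p^`())) x).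
Proof.
have [x0|x0|->] := ltgtP x 0.
- rewrite /expinv ltNge ltW//=.
  have H : is_derive x (1 : R) (fun=> 0 : R) 0 := dcst 0 x.
  apply: (@near_eq_is_derive R R^o R^o (fun=> 0) _ _ _ _ _ H).
  near=> y; rewrite /=; case: ifPn => // y0.
  exfalso; have : y < 0 by near: y; exact: lt_nbhsl.
  by move=> /(lt_trans y0); rewrite ltxx.
- have dinv : is_derive x (1 : R) (fun y => y^-1) (- x ^- 2).
    have := @is_deriveV R id x 1 1 (negbT (gt_eqF x0)) (did x).
    by move/d_eq; apply; rewrite /GRing.scale/= mulr1.
  have H := dM (dcomp (horner p) _ dinv (is_derive_poly p _))
    (dcomp expR _ (dN dinv) (is_derive_expR _)).
  apply: (@near_eq_is_derive R R^o R^o (fun y => p.[y^-1] * expR (- y^-1))).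
    near=> y; rewrite /expinv ifT//; near: y; exact: lt_nbhsr.
  apply: d_eq H _; rewrite /expinv x0 !hornerE /=.
  set u := expR _; set v := _.[_]; set w := _.[_].
  by field; rewrite gt_eqF.
- have -> : expinv ('X^2 * (p - p^`())) 0 = 0 by rewrite /expinv ltxx.
  (* Applied to [X^2 p], the bound yields [|expinv p h| <= C h^2], so the difference quotient at 0
     tends to 0. *)
  have [C C0 HC] := poly_expR_bnd ('X^2 * p).
  have bnd (h : R) : `|expinv p h| <= C * h ^+ 2.
    rewrite /expinv; case: ifPn => h0; last by rewrite normr0 mulr_ge0// sqr_ge0.
    have -> : C * h ^+ 2 = h * (h * C) by ring.
    have := HC h^-1 (ltW (_ : 0 < h^-1)); rewrite invr_gt0 => /(_ h0).
    rewrite !hornerE !normrM (ger0_norm (expR_ge0 _)) -mulrA ger0_norm ?exprn_ge0 ?invr_ge0 ?(ltW h0)//.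
    rewrite -!mulrA !ler_pdivrMl// => H1; apply: le_trans H1 _.
    by rewrite mulrA; exact: lexx.
  have L : (fun h : R => h^-1 *: (expinv p (h *: 1 + 0) - expinv p 0)) @ 0^' --> (0 : R).
    apply/cvgrPdist_le => eps e0; near=> h.
    rewrite sub0r normrN addr0 /GRing.scale/= mulr1 {2}/expinv ltxx subr0 normrM.
    have h0 : h != 0 by near: h; exact: nbhs_dnbhs_neq.
    rewrite normfV ler_pdivrMl ?normr_gt0// (le_trans (bnd h))//.
    rewrite -(real_normK (num_real h)) expr2 mulrA mulrC ler_wpM2l//.
    have : `|h| < eps / (C + 1) by near: h; apply: dnbhs0_lt; rewrite divr_gt0// ltr_wpDl.
    rewrite ltr_pdivlMr ?ltr_wpDl// mulrDr mulr1 mulrC => /ltW.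
    by apply: le_trans; rewrite lerDl.
  apply: DeriveDef; first by apply/cvg_ex; exists 0.
  by apply: cvg_lim.
Unshelve. all: by end_near. Qed.

Lemma expinv_smooth p : smooth (expinv p).
Proof.
apply/smooth_uptoP => n; elim: n p => [|n IH] p; first by move=> k; rewrite ltn0.
apply/smooth_uptoS; split.
  by move=> x; case: (expinv_d p x).
by rewrite (d_derive1 (expinv_d p)).
Qed.

Lemma expinv1_le0 x : x <= 0 -> expinv 1 x = 0.
Proof. by rewrite /expinv ltNge => ->. Qed.

Lemma expinv1_gt0 x : 0 < x -> 0 < expinv 1 x.
Proof. by move=> x0; rewrite /expinv x0 hornerC mul1r expR_gt0. Qed.

Lemma expinv1_ge0 x : 0 <= expinv 1 x.
Proof.
by have [x0|x0] := leP x 0; [rewrite expinv1_le0|rewrite ltW// expinv1_gt0].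
Qed.

Definition prebump x := expinv 1 x * expinv 1 (-1 * x + 1).

Lemma prebump_smooth : smooth prebump.
Proof.
apply: smoothM; first exact: expinv_smooth.
by apply: (smooth_affine (-1) 1); exact: expinv_smooth.
Qed.

Lemma prebump_ge0 x : 0 <= prebump x.
Proof. by rewrite mulr_ge0// expinv1_ge0. Qed.

Lemma prebump_out x : ~~ (0 < x < 1) -> prebump x = 0.
Proof.
rewrite /prebump negb_and -!leNgt => /orP[x0|x1].
  by rewrite expinv1_le0// mul0r.
by rewrite [X in _ * X]expinv1_le0 ?mulr0//; lra.
Qed.

Definition bump_mass := \int[mu]_(x in `[0, 1]) prebump x.

Lemma bump_mass_gt0 : 0 < bump_mass.
Proof.
have c0 := smooth_cont prebump_smooth.
have ab : 1 / 4 <= 3 / 4 :> R by lra.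
have [m mI H] := EVT_min ab (continuous_subspaceT c0).
have m0 : 0 < prebump m.
  by move: mI; rewrite in_itv/= => /andP[m1 m2]; rewrite mulr_gt0// expinv1_gt0; lra.
apply: (@lt_le_trans _ _ (\int[mu]_(x in `[1 / 4, 3 / 4]) prebump x)); last first.
  apply: Rint_ge_sub => //; last by move=> x _; exact: prebump_ge0.
    by apply: subset_itv; rewrite bnd_simp; lra.
  exact: cont_intg_itv.
apply: (@lt_le_trans _ _ (prebump m * (3 / 4 - 1 / 4))).
  by rewrite mulr_gt0//; lra.
apply: le_Rint_cst_itv => //; first exact: cont_intg_itv.
Qed.

Definition bump x := bump_mass^-1 * prebump x.

Lemma bump_smooth : smooth bump.
Proof. by apply: smoothM; [exact: smooth_cst|exact: prebump_smooth]. Qed.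

Lemma bump_ge0 x : 0 <= bump x.
Proof. by rewrite mulr_ge0 ?invr_ge0 ?prebump_ge0// ltW// bump_mass_gt0. Qed.

Lemma bump_out x : ~~ (0 < x < 1) -> bump x = 0.
Proof. by move=> /prebump_out; rewrite /bump => ->; rewrite mulr0. Qed.

Lemma bump_gt0 x : 0 < x < 1 -> 0 < bump x.
Proof.
move=> /andP[x0 x1]; rewrite mulr_gt0 ?invr_gt0 ?bump_mass_gt0//.
by rewrite mulr_gt0// expinv1_gt0; lra.
Qed.

Lemma bump_cont : continuous bump. Proof. exact: smooth_cont bump_smooth. Qed.

(** The lower limit is [-1] and not [0], so that every [x >= 0] is interior to the domain of
    integration and the fundamental theorem applies at it. *)
Definition step x := \int[mu]_(t in `[-1, x]) bump t.

Lemma Rint_eq0 {D f} : (forall x, D x -> f x = 0) -> \int[mu]_(x in D) f x = 0.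
Proof.
move=> H; rewrite (eq_Rint _ _ H) /Rintegral; under eq_integral do rewrite /=.
by rewrite integral0.
Qed.

Lemma step_le0 x : x <= 0 -> step x = 0.
Proof.
move=> x0; apply: Rint_eq0 => t /=; rewrite in_itv/= => /andP[_ tx].
by apply: bump_out; rewrite negb_and -leNgt (le_trans tx x0).
Qed.

Lemma step_ge1 x : 1 <= x -> step x = 1.
Proof.
move=> x1; have ii a b : intg `[a, b] bump by apply: cont_intg_itv; exact: bump_cont.
rewrite /step (Rint_split (-1) 0 x)//; last by lra.
rewrite (Rint_split 0 1 x)//.
rewrite (@Rint_eq0 [set` `[-1, 0]]); last first.
  move=> t /=; rewrite in_itv/= => /andP[_ t0].
  by apply: bump_out; rewrite negb_and -leNgt t0.
rewrite (@Rint_eq0 [set` `[1, x]]); last first.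
  move=> t /=; rewrite in_itv/= => /andP[t1 _].
  by apply: bump_out; rewrite negb_and -!leNgt t1 orbT.
rewrite RintZ//; last by apply: cont_intg_itv; exact: smooth_cont prebump_smooth.
by rewrite -/bump_mass mulVf ?add0r ?addr0// gt_eqF// bump_mass_gt0.
Qed.

Lemma step_d x : is_derive x (1 : R) step (bump x).
Proof.
have [x0|x0] := ltP x 0.
  have -> : bump x = 0 by apply: bump_out; rewrite negb_and -leNgt ltW.
  have H : is_derive x (1 : R) (fun=> 0 : R) 0 := dcst 0 x.
  apply: (@near_eq_is_derive R R^o R^o (fun=> 0) _ _ _ _ _ H).
  near=> y; rewrite step_le0// ltW//; near: y; exact: lt_nbhsl.
have x1 : x < x + 1 by rewrite ltrDl.
have [||h1 h2] := @continuous_FTC1_closed R bump (-1) x (x + 1) x1 _ _ (bump_cont x).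
- by apply: cont_intg_itv; exact: bump_cont.
- by lra.
apply: DeriveDef; first exact: h1.
by rewrite -derive1E.
Unshelve. all: by end_near. Qed.

Lemma step_smooth : smooth step.
Proof. exact: smooth_step bump step_d bump_smooth. Qed.

Lemma step_homo x y : x <= y -> step x <= step y.
Proof.
move=> xy; have [x1|x1] := leP x (-1).
  rewrite step_le0; last by lra.
  by apply: Rint_ge0 => t _; exact: bump_ge0.
apply: Rint_ge_sub => //; last by move=> t _; exact: bump_ge0.
- by apply: subset_itvl; rewrite bnd_simp.
- by apply: cont_intg_itv; exact: bump_cont.
Qed.

Lemma step_ge0 x : 0 <= step x.
Proof. by apply: Rint_ge0 => t _; exact: bump_ge0. Qed.

Lemma step_le1 x : step x <= 1.
Proof.
have [x1|x1] := leP x 1; last by rewrite step_ge1// ltW.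
by rewrite -(step_ge1 1)//; exact: step_homo.
Qed.
End SmoothBump.

(** * The lemma of du Bois-Reymond at Lebesgue points *)

Section DuBoisReymond.
Context {R : realType}.
Local Notation mu := (@lebesgue_measure R).
Implicit Types (D : set R) (f g : R -> R) (a b c x y eps s : R).

Lemma bump_bnd : exists2 M : R, 0 < M & forall x, `|@bump R x| <= M.
Proof.
have [M M0 H] := cont_bnd_itv 0 1 (@bump_cont R); exists M => // x.
have [x01|x01] := boolP (0 < x < 1).
  by apply: H; move: x01 => /andP[/ltW-> /ltW->].
by rewrite bump_out// normr0 ltW.
Qed.

(** A kernel of unit mass supported in [[a, a + 1/s]], entirely to the right of [a]; its primitive
    [ramp s a] climbs from 0 to 1 there. *)
Definition kern s a x : R := s * bump (s * x + - (s * a)).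
Definition ramp s a x : R := step (s * x + - (s * a)).

Lemma kern_out s a x : 0 < s -> ~~ (a < x < a + s^-1) -> kern s a x = 0.
Proof.
move=> s0 H; rewrite /kern bump_out ?mulr0//; apply: contra H.
rewrite subr_gt0 ltr_pM2l// => /andP[-> /=].
by rewrite -mulrBr mulrC -ltr_pdivlMr// div1r ltrBlDl.
Qed.

Lemma ramp_d s a x : is_derive x (1 : R) (ramp s a) (kern s a x).
Proof.
have aff : is_derive x (1 : R) (fun y => s * y + - (s * a)) s.
  by apply: d_eq (dD (dZ s (did x)) (dcst _ x)) _; rewrite mulr1 addr0.
by apply: d_eq (dcomp step _ aff (step_d _)) _; rewrite mulrC.
Qed.

Lemma ramp_smooth s a : smooth (ramp s a).
Proof. exact: smooth_affine s _ step_smooth. Qed.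

Lemma kern_smooth s a : smooth (kern s a).
Proof.
apply: (smoothM (smooth_cst s)).
exact: smooth_affine s _ bump_smooth.
Qed.

Lemma ramp_le s a x : 0 < s -> x <= a -> ramp s a x = 0.
Proof. by move=> s0 xa; rewrite /ramp step_le0// subr_le0 ler_pM2l. Qed.

Lemma ramp_ge s a x : 0 < s -> a + s^-1 <= x -> ramp s a x = 1.
Proof.
move=> s0 xa; rewrite /ramp step_ge1// -mulrBr mulrC -ler_pdivrMr// div1r.
by rewrite lerBrDl.
Qed.

Lemma kern_mass s a : 0 < s -> \int[mu]_(x in `[a, a + s^-1]) kern s a x = 1.
Proof.
move=> s0; have [_ _ _ H] := ac_C1 (ramp_d s a) (smooth_cont (kern_smooth s a)).
rewrite -H ?lerDl ?invr_ge0 ?(ltW s0)// ramp_ge// ramp_le// subr0//.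
Qed.

Lemma Rint_supp {D f} : measurable D -> (forall x, ~ D x -> f x = 0) ->
  \int[mu]_x f x = \int[mu]_(x in D) f x.
Proof.
move=> mD H; rewrite -[RHS]Rint_indic//; apply: eq_Rint => x _; rewrite indicE.
have [xD|xD] := boolP (x \in D); first by rewrite mul1r.
by rewrite mul0r H// => /mem_set; exact/negP.
Qed.

(** One-sided form of the Lebesgue point property: the interval lies in the ball of radius [2 r],
    whose measure [4 r] is compensated by the tolerance [eps / 4]. *)
Lemma lebesgue_pt_itv {f} a : lebesgue_pt f a -> (forall b c, intg `[b, c] f) ->
  forall eps, 0 < eps -> exists2 r0 : R, 0 < r0 & forall r, 0 < r < r0 ->
  \int[mu]_(x in `[a, a + r]) `|f x - f a| <= eps * r.
Proof.
move=> La fi eps e0.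
have e40 : 0 < eps / 4 by rewrite divr_gt0.
have H : \forall r \near 0^'+, (davg f a r < (eps / 4)%:E)%E.
  have N : nbhs (0%E : \bar R) [set y | (y < (eps / 4)%:E)%E].
    exact: (@nbhs_open_ereal_lt R 0 (fun=> eps / 4)).
  exact: La N.
have [r0 /= r00 H0] := H; exists (r0 / 2); first by rewrite divr_gt0.
move=> r /andP[rp rr].
have := H0 (2 * r); rewrite /= sub0r normrN gtr0_norm ?mulr_gt0//.
have -> : 2 * r < r0 by move: rr; rewrite ltr_pdivlMr// mulrC.
move=> /(_ isT isT).
have mB : measurable (ball a (2 * r)) by exact: measurable_ball.
have sB : ball a (2 * r) `<=` `[a - 2 * r, a + 2 * r].
  move=> x; rewrite /ball/= in_itv/= -ler_distlC distrC => /ltW.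
  by rewrite distrC.
have i1 b c : intg `[b, c] (fun x => `|f x - f a|).
  apply: intg_norm => //; apply: intgB => //.
  by apply: cont_intg_itv => x; exact: cvg_cst.
have iB : intg (ball a (2 * r)) (fun x => `|f x - f a|).
  by apply: intgS sB (i1 _ _).
rewrite /davg /iavg lebesgue_measure_ball ?mulr_ge0 ?(ltW rp)//.
have -> : (\int[mu]_(y in ball a (2 * r)) `|((center (f a) \o f) y)%:E| =
   (\int[mu]_(y in ball a (2 * r)) `|f y - f a|)%:E)%E.
  rewrite /Rintegral fineK//.
  by apply: integrable_fin_num.
rewrite inver gt_eqF ?mulrn_wgt0 ?mulr_gt0// -EFinM lte_fin ltr_pdivrMl ?mulrn_wgt0 ?mulr_gt0// => /ltW h.
apply: le_trans (_ : _ <= \int[mu]_(y in ball a (2 * r)) `|f y - f a|) _.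
  apply: Rint_ge_sub => // x /=; rewrite in_itv/= => /andP[ax xr].
  by rewrite /ball/= ltr_distlC; lra.
by apply: le_trans h _; rewrite -mulr_natr; lra.
Qed.

(** The kernel is at most [s M] on an interval of length [1 / s], so the error is at most [M] times
    the mean oscillation of [f] on that interval, which is small at a Lebesgue point. *)
Lemma kern_cvg {f} (a e : R) : 0 < e -> measurable_fun setT f -> lebesgue_pt f a ->
  (forall b c, intg `[b, c] f) ->
  (fun n => \int[mu]_x (f x * kern (n.+1%:R / e) a x)) @ \oo --> f a.
Proof.
move=> e0 mf La fi; have [M M0 HM] := bump_bnd.
apply/cvgrPdist_le => eps eps0.
have [r0 r00 Hr] := lebesgue_pt_itv a La fi (eps / M) (divr_gt0 eps0 M0).
near=> n; set s := _ / e; have s0 : 0 < s by rewrite divr_gt0.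
have sr : s^-1 < r0.
  rewrite /s invf_div ltr_pdivrMr// mulrC -ltr_pdivrMr//.
  by apply: lt_trans (_ : n%:R < _); [near: n; exact: nbhs_infty_gtr|rewrite ltr_nat].
have kM x : `|kern s a x| <= s * M.
  by rewrite /kern normrM gtr0_norm// ler_pM2l.
have ik b c : intg `[b, c] (kern s a).
  by apply: cont_intg_itv; exact: smooth_cont (kern_smooth s a).
have ifk b c : intg `[b, c] (fun x => f x * kern s a x).
  apply: (@eq_intg _ _ (fun x => kern s a x * f x)) => //; first by move=> x _; rewrite mulrC.
  apply: (intg_bM (s * M)) => //.
  by apply: measurable_funS measurableT _ _ => //; apply: cont_meas; exact: smooth_cont (kern_smooth s a).
rewrite (@Rint_supp [set` `[a, a + s^-1]])//; last first.
  move=> x /=; rewrite in_itv/= => /negP H; rewrite kern_out ?mulr0//.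
  by apply: contra H => /andP[/ltW-> /ltW->].
have -> : f a - \int[mu]_(x in `[a, a + s^-1]) (f x * kern s a x) =
    - \int[mu]_(x in `[a, a + s^-1]) (f x * kern s a x - f a * kern s a x).
  by rewrite RintB//; [rewrite RintZ// kern_mass//; ring|exact: intgZ].
rewrite normrN.
have s1 : 0 < s^-1 by rewrite invr_gt0.
have /Hr H : 0 < s^-1 < r0 by rewrite s1.
apply: (@le_trans _ _ (\int[mu]_(x in `[a, a + s^-1]) (s * M * `|f x - f a|))).
  have if' : intg `[a, a + s^-1] (fun x => `|f x - f a|).
    apply: intg_norm => //; apply: intgB => //.
    by apply: cont_intg_itv => x; exact: cvg_cst.
  apply: normr_Rint_le => //.
  - by apply: intg_meas; apply: intgB => //; exact: intgZ.
  - exact: intgZ.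
  - by move=> x _; rewrite -mulrBl normrM mulrC ler_wpM2r.
rewrite RintZ//; last first.
  apply: intg_norm => //; apply: intgB => //.
  by apply: cont_intg_itv => x; exact: cvg_cst.
apply: (@le_trans _ _ (s * M * (eps / M * s^-1))).
  by rewrite ler_wpM2l// mulr_ge0 ?ltW.
have -> // : s * M * (eps / M * s^-1) = eps by field; rewrite !gt_eqF.
Unshelve. all: by end_near. Qed.

(** The test function [ramp s a - ramp s b] approximates the indicator of []a, b]], while its
    derivative is a difference of two kernels, so the left-hand side tends to [f a - f b]. The
    kernels sit to the right of [a] and [b]; all supports lie in [[a, b + e]], hence the room [e]
    demanded in [U]. *)
Lemma du_bois_reymond {f d} (U : set R) (a b e : R) :
  measurable_fun setT f -> measurable_fun setT d ->
  (forall p q, intg `[p, q] f) -> (forall p q, intg `[p, q] d) ->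
  (forall phi, test_function U phi ->
    \int[mu]_x (f x * derive1 phi x) = - \int[mu]_x (d x * phi x)) ->
  a <= b -> 0 < e -> `[a, b + e] `<=` U -> lebesgue_pt f a -> lebesgue_pt f b ->
  f b - f a = \int[mu]_(x in `[a, b]) d x.
Proof.
move=> mf md fi di H ab e0 abU La Lb.
pose s n := n.+1%:R / e : R.
have s0 n : 0 < s n by rewrite divr_gt0.
have sinv n : (s n)^-1 <= e.
  by rewrite /s invf_div ler_pdivrMr// ler_peMr ?(ltW e0)// ler1n.
pose th n x := ramp (s n) a x - ramp (s n) b x.
have th_d n x : is_derive x (1 : R) (th n) (kern (s n) a x - kern (s n) b x).
  by apply: dB; exact: ramp_d.
have th_s n : smooth (th n).
  apply: (@smoothD _ _ (fun x => - ramp (s n) b x)); first exact: ramp_smooth.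
  rewrite (_ : (fun x => - ramp (s n) b x) = (fun x => -1 * ramp (s n) b x)).
    exact: smoothM (smooth_cst _) (ramp_smooth _ _).
  by apply/funext => x; rewrite mulN1r.
have th_out n x : ~ `[a, b + e]%classic x -> th n x = 0.
  move=> /= /negP; rewrite in_itv/= negb_and -!ltNge => /orP[xa|xb].
    by rewrite /th !ramp_le ?subr0// ltW// (lt_le_trans xa).
  by rewrite /th !ramp_ge ?subrr//; apply: le_trans (ltW xb); rewrite lerD.
have th_test n : test_function U (th n).
  split=> //; exists `[a, b + e]%classic; split => //; first exact: segment_compact.
  exact: th_out.
have th01 n x : 0 <= th n x <= 1.
  rewrite /th subr_ge0 /ramp; apply/andP; split.
    by apply: step_homo; rewrite lerD2l lerN2 ler_pM2l.
  have := @step_le1 R (s n * x - s n * a); have := @step_ge0 R (s n * x - s n * b).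
  lra.
have ikf n c : intg setT (fun x => f x * kern (s n) c x).
  have kc := smooth_cont (kern_smooth (s n) c).
  have [M M0 HM] := bump_bnd.
  have i1 : intg `[c, c + (s n)^-1] (fun x => f x * kern (s n) c x).
    apply: (@eq_intg _ _ (fun x => kern (s n) c x * f x)) => //; first by move=> x _; rewrite mulrC.
    apply: (intg_bM (s n * M)) => //.
      by apply: measurable_funS measurableT _ _ => //; exact: cont_meas.
    by move=> x _; rewrite /kern normrM gtr0_norm// ler_pM2l.
  move/(intg_indic _ (measurable_itv _)) : i1; apply: eq_intg => // x _.
  rewrite indicE; have [|xD] := boolP (x \in _); first by rewrite mul1r.
  rewrite mul0r kern_out ?mulr0//; apply: contra xD => /andP[h1 h2].
  by rewrite inE/= in_itv/= !ltW.
have L1 : (fun n => \int[mu]_x (f x * kern (s n) a x) -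
                   \int[mu]_x (f x * kern (s n) b x)) @ \oo --> f a - f b.
  by apply: cvgB; apply: kern_cvg.
have L2 : (fun n => - \int[mu]_x (d x * th n x)) @ \oo -->
    - \int[mu]_x (\1_`]a, b] x * d x).
  apply: cvgN; apply: (dct _ _ (fun x => \1_`[a, b + e] x * `|d x|)) => //.
  - move=> n; apply: measurable_funM => //; apply: cont_meas.
    exact: smooth_cont (th_s n).
  - by apply: meas_indicM => //; exact: measurable_funS md.
  - move=> x _; apply: cvg_near_cst; near=> n; rewrite mulrC; congr (_ * _).
    rewrite indicE mem_setE in_itv/=; have [xa|ax] := leP x a.
      by rewrite /th !ramp_le ?subr0// (le_trans xa).
    rewrite /th; have -> : ramp (s n) a x = 1.
      apply: ramp_ge => //; rewrite -lerBrDl /s invf_div ler_pdivrMr// mulrC -ler_pdivrMr ?subr_gt0//.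
      apply: le_trans (_ : n%:R <= _); last by rewrite ler_nat.
      by near: n; exact: nbhs_infty_ger.
    have [xb|bx] := leP x b; first by rewrite ramp_le// subr0.
    rewrite ramp_ge ?subrr//.
    rewrite -lerBrDl /s invf_div ler_pdivrMr// mulrC -ler_pdivrMr ?subr_gt0//.
    apply: le_trans (_ : n%:R <= _); last by rewrite ler_nat.
    by near: n; exact: nbhs_infty_ger.
  - by apply/intg_indic => //; exact: intg_norm.
  - move=> n x _; rewrite normrM indicE.
    have [xD|xD] := boolP (x \in _).
      rewrite mul1r ler_piMr// ger0_norm; by have /andP[] := th01 n x.
    rewrite mul0r th_out ?normr0 ?mulr0//.
    by move=> /mem_set; exact/negP.
have E : (fun n => \int[mu]_x (f x * kern (s n) a x) -
                   \int[mu]_x (f x * kern (s n) b x)) =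
    (fun n => - \int[mu]_x (d x * th n x)).
  apply/funext => n; rewrite -H// -RintB//; apply: eq_Rint => x _.
  by rewrite (d_derive1 (th_d n)) mulrBr.
rewrite E in L1; have := cvg_unique _ L1 L2.
rewrite Rint_indic// Rint_obnd_cbnd// => e1; rewrite -opprB (e1 _) ?opprK//.
Unshelve. all: by end_near. Qed.

Lemma cont_lebesgue_pt {f} a : continuous f -> lebesgue_pt f a.
Proof.
move=> cf; apply: (@continuous_lebesgue_pt _ _ _ setT) => //.
- by split => //; exact: openT.
- exact: cont_meas.
- exact: cf.
Qed.
End DuBoisReymond.

(** * Weak derivatives and absolute continuity *)

Section WeakDerivative.
Context {R : realType}.
Local Notation mu := (@lebesgue_measure R).
Implicit Types (I D : set R) (f g d : R -> R) (a b c x y eps s : R).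

Lemma aeS {P Q : set R} : (forall x, P x -> Q x) -> {ae mu, forall x, P x} ->
  {ae mu, forall x, Q x}.
Proof.
move=> PQ [N [mN N0 H]]; exists N; split=> // x /= nQ.
by apply: H => /= Px; apply: nQ; exact: PQ.
Qed.

Lemma aeI {P Q : set R} : {ae mu, forall x, P x} -> {ae mu, forall x, Q x} ->
  {ae mu, forall x, P x /\ Q x}.
Proof.
move=> nP nQ; apply: (@negligibleS _ _ _ mu _ _ _ (negligibleU nP nQ)).
move=> x /= nPQ; have [Px|] := pselect (P x); last by left.
by right => Qx; apply: nPQ.
Qed.

Lemma primitive {d} : measurable_fun setT d -> (forall a b, intg `[a, b] d) ->
  exists F, ac F d.
Proof.
move=> md id.
(* A segment with reversed endpoints is empty, so for each sign of [x] only one of the two integrals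
   contributes. *)
pose F x := \int[mu]_(t in `[0, x]) d t - \int[mu]_(t in `[x, 0]) d t.
have e0 x : \int[mu]_(t in `[x, x]) d t = 0 by rewrite set_itv1 Rintegral_set1.
have em a b : b <= a -> \int[mu]_(t in `[a, b]) d t = 0.
  rewrite le_eqVlt => /orP[/eqP->//|ba].
  by rewrite set_itv_ge ?Rintegral_set0// -leNgt bnd_simp.
have FE a b : a <= b -> F b - F a = \int[mu]_(t in `[a, b]) d t.
  move=> ab; rewrite /F; have [a0|a0] := leP 0 a.
    have b0 := le_trans a0 ab.
    by rewrite (em a 0)// (em b 0)// (Rint_split 0 a b)//; ring.
  have [b0|b0] := leP 0 b.
    by rewrite (em 0 a) ?(ltW a0)// (em b 0)// (Rint_split a 0 b) ?(ltW a0)//; ring.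
  rewrite (em 0 a) ?(ltW a0)// (em 0 b) ?(ltW b0)// (Rint_split a b 0) ?(ltW b0)//; ring.
exists F; split=> // x.
have x1 : x - 1 <= x + 1 by lra.
have := @parameterized_integral_continuous R (x - 1) (x + 1) d x1 (id _ _).
rewrite continuous_within_itvP; last by lra.
move=> [+ _ _] => /(_ x); rewrite in_itv/= ltrBlDr ltrDl ltr01 => /(_ isT) C.
have C2 : {for x, continuous (fun y => F (x - 1) + parameterized_integral mu (x - 1) y d)}.
  by apply: continuousD => //; exact: cst_continuous.
rewrite /continuous_at.
have -> : F x = F (x - 1) + parameterized_integral mu (x - 1) x d.
  by rewrite /parameterized_integral -FE; [ring|lra].
apply: cvg_trans C2; apply: near_eq_cvg; near=> y.
rewrite /parameterized_integral -FE; first by ring.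
by apply: ltW; near: y; apply: lt_nbhsr; lra.
Unshelve. all: by end_near. Qed.

Lemma sqi_intg {f} a b : sqi setT f -> intg `[a, b] f.
Proof.
move=> [mf f2]; apply: (intg_dom (fun x => f x ^+ 2 + 1)) => //.
- exact: measurable_funS mf.
- apply: intgD => //; first by apply: intgS f2.
  by apply: cont_intg_itv => x; exact: cvg_cst.
- move=> x _; rewrite -(real_normK (num_real (f x))).
  by have := sqr_ge0 (`|f x| - 1); nra.
Qed.

Lemma sqi_locally {f} : measurable_fun setT f -> (forall a b, intg `[a, b] f) -> locally_integrable setT f.
Proof.
move=> mf intf; split => //; first exact: openT.
move=> K _ cK.
have [M [_ HM]] : bounded_set K by exact: compact_bounded.
have /integrableP[_] := intf (- (M + 1)) (M + 1).
apply: le_lt_trans; apply: ge0_subset_integral => //.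
- by apply: closed_measurable; apply: compact_closed => //; exact: Rhausdorff.
- have mnf : measurable_fun setT (fun x => `|f x|) by exact: measurableT_comp.
  by apply/measurable_EFinP; exact: measurable_funS mnf.
- move=> x Kx /=; rewrite in_itv/= -ler_norml.
  by apply: (HM (M + 1)) => //; rewrite ltrDl.
Qed.

Lemma mu_setT_neq0 : mu [set: R] <> 0%E.
Proof.
move=> H; have : (mu `[0%R, 1%R]%classic <= mu [set: R])%E by apply: le_measure; rewrite ?inE.
by rewrite H; have -> := @lebesgue_measure_itv R `[0%R, 1%R]; rewrite /= lte_fin ltr01 /= -EFinD subr0 lee_fin ler10.
Qed.

Lemma ae_exists {P : set R} : {ae mu, forall x, P x} -> exists x, P x.
Proof.
move=> [N [mN N0 PN]]; apply: contrapT => /forallNP H.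
apply: mu_setT_neq0; rewrite -N0; congr (mu _); apply/seteqP; split => // x _.
by apply: PN; exact: H.
Qed.

(** By [du_bois_reymond], [g] minus a primitive of [d] takes the same value at all Lebesgue points
    of [g], which are almost all points. *)
Lemma weak_ac {g d} : sqi setT g -> sqi setT d -> weak_derivative 1 g d ->
  exists2 f, ac f d & {ae mu, forall x, f x = g x}.
Proof.
move=> sg sd W; have [mg _] := sg; have [md _] := sd.
have ig a b : intg `[a, b] g by exact: sqi_intg.
have id a b : intg `[a, b] d by exact: sqi_intg.
have [F acF] := primitive md id.
have := lebesgue_differentiation (sqi_locally mg ig) => aeL.
have [x0 Lx0] := ae_exists aeL.
have key a b : a <= b -> lebesgue_pt g a -> lebesgue_pt g b -> g b - g a = F b - F a.
  move=> ab La Lb; have [_ _ _ ->//] := acF.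
  apply: (@du_bois_reymond _ g d setT a b 1) => // phi tphi.
  by have := W phi tphi; rewrite expr1 mulN1r => <-.
exists (fun x => F x + (g x0 - F x0)).
  apply: (eq_ac _ _ _ _ (acD acF (ac_cst (g x0 - F x0)))) => x //=.
  by rewrite addr0.
apply: aeS aeL => x Lx.
have [xx|xx] := leP x x0; first by have := key _ _ xx Lx Lx0; lra.
by have := key _ _ (ltW xx) Lx0 Lx; lra.
Qed.

Lemma test_bnd {U : set R} {phi} : test_function U phi -> exists2 A : R, 0 < A &
  forall x, ~ `[- A, A]%classic x -> phi x = 0.
Proof.
move=> [sphi [K [cK KU H]]].
have [M [Mr HM]] : bounded_set K by exact: compact_bounded.
exists (`|M| + 1); first by rewrite ltr_wpDl.
move=> x xA; apply: H => Kx; apply: xA; rewrite /= in_itv/= -ler_norml.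
by apply: (HM (`|M| + 1)) => //; rewrite (le_lt_trans (ler_norm M))// ltrDl.
Qed.

Lemma cont_supp_intg {f} A : continuous f -> (forall x, ~ `[- A, A]%classic x -> f x = 0) ->
  intg setT f.
Proof.
move=> cf H; have /(intg_indic _ (measurable_itv _)) := cont_intg_itv (- A) A cf.
apply: eq_intg => // x _; rewrite indicE; have [|xD] := boolP (x \in _); rewrite ?mul1r//.
by rewrite mul0r H// => /mem_set; exact/negP.
Qed.

Lemma loc_supp_intg {f phi} A : (forall a b, intg `[a, b] f) -> continuous phi ->
  (forall x, ~ `[- A, A]%classic x -> phi x = 0) ->
  intg setT (fun x => f x * phi x).
Proof.
move=> intf cphi H; have [M M0 HM] := cont_bnd_itv (- A) A cphi.
have : intg `[- A, A] (fun x => phi x * f x).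
  apply: (intg_bM M) => //.
  by apply: measurable_funS (cont_meas cphi).
move/(intg_indic _ (measurable_itv _)); apply: eq_intg => // x _.
rewrite indicE; have [|xD] := boolP (x \in _); rewrite ?mul1r ?mul0r//; first by rewrite mulrC.
by rewrite H ?mulr0// => /mem_set; exact/negP.
Qed.

Lemma d_supp {phi} A : smooth phi -> (forall x, ~ `[- A, A]%classic x -> phi x = 0) ->
  forall x, ~ `[- (A + 1), A + 1]%classic x -> derive1 phi x = 0.
Proof.
move=> sphi H x xA.
have : is_derive x (1 : R) phi 0.
  have H0 : is_derive x (1 : R) (fun=> 0 : R) 0 := dcst 0 x.
  apply: (@near_eq_is_derive R R^o R^o (fun=> 0) _ _ _ _ _ H0).
  near=> y; rewrite H// => /=; rewrite in_itv/= => /andP[y1 y2]; apply: xA.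
  have h1 : y < x + 1 by near: y; apply: lt_nbhsl; rewrite ltrDl.
  have h2 : x - 1 < y by near: y; apply: lt_nbhsr; rewrite gtrBl.
  by rewrite /= in_itv/=; lra.
by move=> ?; rewrite derive1E; exact: derive_val.
Unshelve. all: by end_near. Qed.

Lemma ac_weak {f d} : ac f d -> weak_derivative 1 f d.
Proof.
move=> acf phi tphi; have [A A0 HA] := test_bnd tphi; have [sphi _] := tphi.
have cphi := smooth_cont sphi; have sd := smooth_derive1 sphi.
have HA1 x : ~ `[- (A + 1), A + 1]%classic x -> phi x = 0.
  by move=> xA; apply: HA => /=; rewrite in_itv/= => /andP[h1 h2]; apply: xA; rewrite /= in_itv/=; lra.
have acphi := ac_C1 (smooth_d sphi) (smooth_cont sd).
have acP := acM acf acphi.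
have [cf md id _] := acf; have [cfp _ _ _] := acP.
have fi a b : intg `[a, b] f by exact: cont_intg_itv.
have i1 := loc_supp_intg (A + 1) id cphi HA1.
have i2 := loc_supp_intg (A + 1) fi (smooth_cont sd) (d_supp A sphi HA).
have i0 := loc_supp_intg (A + 1) fi cphi HA1.
have := ac_int0 acP i0 (intgD measurableT i1 i2).
rewrite RintD// expr1 mulN1r => e; rewrite derive1n1; lra.
Qed.

(** At a Lebesgue point [x > 0] of [d - e], the integral of [d - e] over [[x, x + r]] vanishes
    because the primitives agree, while it is close to [r (d x - e x)]. *)
Lemma ac_unique_pos {f d g e} : ac f d -> ac g e -> (forall x, 0 < x -> f x = g x) ->
  {ae mu, forall x, 0 < x -> d x = e x}.
Proof.
move=> acf acg fg; have [_ mh ih H] := acB acf acg.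
have := lebesgue_differentiation (sqi_locally mh ih); apply: aeS => x Lx x0.
apply/eqP; rewrite -subr_eq0 -normr_le0; apply/ler_addgt0Pr => eps e0; rewrite add0r.
have [r0 r00 Hr] := lebesgue_pt_itv x Lx ih eps e0.
pose r := r0 / 2; have r1 : 0 < r by rewrite divr_gt0.
have rr : 0 < r < r0 by rewrite r1 /r; lra.
have xr : x <= x + r by rewrite lerDl ltW.
have z : \int[mu]_(t in `[x, x + r]) (d t - e t) = 0.
  by rewrite -H// !fg ?subrr// addr_gt0.
have icst : intg `[x, x + r] (fun=> d x - e x) by apply: cont_intg_itv => y; exact: cvg_cst.
rewrite -(ler_pM2r r1); apply: le_trans (Hr _ rr).
have [_ _ _ Hc] := ac_C1 (fun y : R => d_eq (dZ (d x - e x) (did y)) (mulr1 _)) (fun y => cvg_cst (d x - e x)).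
have Ec : \int[mu]_(t in `[x, x + r]) ((d t - e t) - (d x - e x)) = - ((d x - e x) * r).
  by rewrite RintB// z sub0r -Hc//; congr (- _); ring.
rewrite -[X in _ * X]gtr0_norm// -normrM -normrN -Ec.
apply: le_normr_Rintegral => //; exact: intgB.
Qed.

End WeakDerivative.

(** * From the Sobolev norms of the statement to concrete representatives *)

Section SobolevInterface.
Context {R : realType}.
Local Notation mu := (@lebesgue_measure R).
Implicit Types (I D : set R) (f g d : R -> R) (a b c x y eps s : R).

Lemma L2_fin {f} : measurable_fun setT f -> (L2_sqnorm f < +oo)%E ->
  sqi setT f /\ L2_sqnorm f = (\int[mu]_x (f x ^+ 2))%:E.
Proof.
move=> mf fin; have i : intg setT (fun x => f x ^+ 2).
  apply/integrableP; split.
    by apply/measurable_EFinP; exact: measurable_funX.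
  apply: le_lt_trans fin; apply: ge0_le_integral => //.
  - apply: measurableT_comp => //; apply/measurable_EFinP; exact: measurable_funX.
  - by apply/measurable_EFinP; exact: measurable_funX.
  - by move=> x _ /=; rewrite ger0_norm ?sqr_ge0.
split=> //; rewrite /L2_sqnorm /Rintegral fineK//.
exact: integrable_fin_num.
Qed.

Lemma L2_ge0 f : (0 <= L2_sqnorm f)%E.
Proof. by apply: integral_ge0 => x _; rewrite lee_fin sqr_ge0. Qed.

Lemma sqrte_lt (X : \bar R) a : (0 <= X)%E -> (sqrte X < a%:E)%E -> (X < (a ^+ 2)%:E)%E.
Proof.
move=> X0 h; have a0 : 0 < a by rewrite -lte_fin (le_lt_trans (sqrte_ge0 X) h).
move: h; rewrite -[a in a%:E]gtr0_norm// -[`|a|]sqrtr_sqr.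
rewrite -[(Num.sqrt _)%:E]/(sqrte (a ^+ 2)%:E) !ltNge lee_sqrt//.
Qed.

(** The strict bound on the infima lets one pick an extension together with weak derivatives whose
    squared norms sum to less than [a ^+ 2]; for an integer exponent the Gagliardo term is zero. *)
Lemma sobn_lt {n : nat} {I f a} : (sobolev_norm n%:R I f < a%:E)%E ->
  exists d : nat -> R -> R,
  [/\ forall k, (k <= n)%N -> sqi setT (d k) /\ weak_derivative k (d 0) (d k),
      {ae mu, forall x, I x -> f x = d 0 x} &
      \sum_(k < n.+1) \int[mu]_x (d k x ^+ 2) < a ^+ 2].
Proof.
move=> /ereal_inf_lt [_ [g fg <-]] /ereal_inf_lt [_ [d [d0 Hd] <-]].
rewrite natrK in Hd; rewrite !natrK eqxx adde0.
move=> /(sqrte_lt _ _ (_ : (0 <= _)%E)) lt.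
have {}lt : (\sum_(k < n.+1) L2_sqnorm (d k) < (a ^+ 2)%:E)%E.
  by apply: lt; apply: sume_ge0 => k _; exact: L2_ge0.
have fin k : (k <= n)%N -> (L2_sqnorm (d k) < +oo)%E.
  move=> kn; apply: le_lt_trans (lt_trans lt (ltry _)).
  rewrite -ltnS in kn; rewrite (bigD1 (Ordinal kn))//= leeDl//.
  by apply: sume_ge0 => i _; exact: L2_ge0.
exists d; split.
- move=> k kn; have [mk wk] := Hd k kn; rewrite d0; split => //.
  by have [] := L2_fin mk (fin k kn).
- by rewrite d0.
- rewrite -lte_fin; apply: le_lt_trans lt; rewrite -sumEFin; apply: lee_sum => k _.
  have kn : (k <= n)%N by rewrite -ltnS.
  by have [mk _] := Hd k kn; have [_ ->] := L2_fin mk (fin k kn).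
Qed.

Lemma Rint_ae {D f g} : measurable D -> measurable_fun D f -> measurable_fun D g ->
  {ae mu, forall x, D x -> f x = g x} ->
  \int[mu]_(x in D) f x = \int[mu]_(x in D) g x.
Proof.
move=> mD mf mg fg; congr fine; apply: ae_eq_integral => //.
- exact/measurable_EFinP.
- exact/measurable_EFinP.
- by apply: aeS fg => x H Dx /=; rewrite H.
Qed.

Lemma intg_ae {D f} g : measurable D -> measurable_fun D f -> intg D g ->
  {ae mu, forall x, D x -> f x = g x} -> intg D f.
Proof.
move=> mD mf ig fg; have mg := intg_meas ig.
move/integrableP : (ig) => [_ h]; apply/integrableP; split.
  exact/measurable_EFinP.
apply: le_lt_trans h; rewrite le_eqVlt; apply/orP; left; apply/eqP.
apply: ae_eq_integral => //.
- by apply: measurableT_comp => //; exact/measurable_EFinP.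
- by apply: measurableT_comp => //; exact/measurable_EFinP.
- by apply: aeS fg => x H Dx /=; rewrite H.
Qed.

Lemma ac_ae {f d} e : ac f d -> measurable_fun setT e ->
  {ae mu, forall x, d x = e x} -> ac f e.
Proof.
move=> [cf md id fd] me de.
have H a b : {ae mu, forall x, `[a, b]%classic x -> d x = e x}.
  by apply: aeS de.
split => //.
- move=> a b; apply: (intg_ae d) => //; first exact: measurable_funS me.
  by apply: aeS (H a b) => x h /h.
- move=> a b ab; rewrite fd//; apply: Rint_ae => //.
    exact: measurable_funS md.
  exact: measurable_funS me.
Qed.

Lemma ac_d {f d} : ac f d -> continuous d -> forall x, is_derive x (1 : R) f (d x).
Proof.
move=> [cf md id fd] cd x.
have x1 : x < x + 1 by rewrite ltrDl.
have x2 : x - 1 < x by rewrite gtrBl.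
have [] := @continuous_FTC1_closed R d (x - 1) x (x + 1) x1 (id _ _) x2 (cd x).
set F := (fun y => _) => h1 h2.
have H : is_derive x (1 : R) (fun y => F y + f (x - 1)) (d x).
  have HF : is_derive x (1 : R) F (d x).
    by apply: DeriveDef; [exact: h1|rewrite -derive1E].
  by apply: d_eq (dD HF (dcst _ x)) _; rewrite addr0.
apply: (@near_eq_is_derive R R^o R^o _ _ _ _ _ _ H).
near=> y; rewrite /F -fd; first by ring.
by apply: ltW; near: y; exact: lt_nbhsr.
Unshelve. all: by end_near. Qed.

Lemma sqi_ae {f} g : sqi setT g -> measurable_fun setT f ->
  {ae mu, forall x, f x = g x} ->
  sqi setT f /\ \int[mu]_x (f x ^+ 2) = \int[mu]_x (g x ^+ 2).
Proof.
move=> [mg g2] mf fg.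
have m2 : measurable_fun setT (fun x => f x ^+ 2) by exact: measurable_funX.
have e : {ae mu, forall x, setT x -> f x ^+ 2 = g x ^+ 2}.
  by apply: aeS fg => x ->.
split; last by apply: Rint_ae => //; exact: measurable_funX.
by split => //; exact: intg_ae e.
Qed.

Lemma sob1_lt {I f a} : (sobolev_norm 1 I f < a%:E)%E ->
  exists g d, [/\ ac g d, sqi setT g, sqi setT d,
    {ae mu, forall x, I x -> f x = g x} &
    \int[mu]_x (g x ^+ 2) + \int[mu]_x (d x ^+ 2) < a ^+ 2].
Proof.
move=> /(@sobn_lt 1) [d [Hd fd]]; rewrite big_ord_recr big_ord1/= => lt.
have [s0 _] := Hd 0 isT; have [s1 w1] := Hd 1 isT.
have [g acg gd] := weak_ac s0 s1 w1.
have [cg _ _ _] := acg.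
have [sg eg] := sqi_ae _ s0 (cont_meas cg) gd.
exists g, (d 1); split => //; last by rewrite eg.
by apply: aeS (aeI fd gd) => x [h1 h2] /h1 ->.
Qed.

(** The derivative of a test function is a test function, so the identity for [d] may be used on
    [phi'] and compared with the identity for [e] on [phi]. *)
Lemma weak_step {k f d e} : weak_derivative k f d -> weak_derivative k.+1 f e ->
  weak_derivative 1 d e.
Proof.
move=> W1 W2 phi tphi; rewrite expr1 mulN1r.
have tphi' : test_function setT (derive1 phi).
  have [sphi [K [cK KU H]]] := tphi; split; first exact: smooth_derive1.
  have [A A0 HA] := test_bnd tphi.
  exists `[- (A + 1), A + 1]%classic; split => //; first exact: segment_compact.
  exact: d_supp.
have := W1 _ tphi'; have := W2 _ tphi.
under eq_Rintegral do rewrite derive1Sn.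
move=> -> /eqP; rewrite exprS mulN1r mulNr -mulrN.
have u : (-1) ^+ k != 0 :> R by rewrite signr_eq0.
by move=> /eqP /(mulfI u) <-.
Qed.

(** A weak derivative of order [k <= 3] has a continuous representative because the next one is
    square integrable; the fourth is spent on the continuity of the third. The relations between
    consecutive orders then hold classically. *)
Lemma sob4_lt {I f a} : (sobolev_norm 4 I f < a%:E)%E ->
  exists g : nat -> R -> R, [/\ forall k, (k <= 3)%N -> continuous (g k) /\ sqi setT (g k),
    forall k, (k < 3)%N -> forall x, is_derive x (1 : R) (g k) (g k.+1 x),
    {ae mu, forall x, I x -> f x = g 0 x} &
    \sum_(k < 4) \int[mu]_x (g k x ^+ 2) < a ^+ 2].
Proof.
move=> /(@sobn_lt 4) [d [Hd fd lt]].
have H k : exists g, (k <= 3)%N -> ac g (d k.+1) /\ {ae mu, forall x, g x = d k x}.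
  have [k3|k3] := leqP k 3; last by exists (d 0).
  have [s0 w0] := Hd k (leqW k3); have [s1 w1] := Hd k.+1 k3.
  by have [g h1 h2] := weak_ac s0 s1 (weak_step w0 w1); exists g.
have [g Hg] := choice H.
have cg k : (k <= 3)%N -> continuous (g k) by move=> /Hg [[]].
have sg k : (k <= 3)%N -> sqi setT (g k) /\ \int[mu]_x (g k x ^+ 2) = \int[mu]_x (d k x ^+ 2).
  move=> k3; have [_ h] := Hg k k3; apply: (sqi_ae (d k)) => //.
    by have [] := Hd k (leqW k3).
  by apply: cont_meas; exact: cg.
exists g; split.
- by move=> k k3; split; [exact: cg|have [] := sg k k3].
- move=> k k3; apply: ac_d; last exact: cg.
  have [h1 _] := Hg k (ltnW k3); have [_ h2] := Hg k.+1 k3.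
  apply: (ac_ae _ h1); first by apply: cont_meas; exact: cg.
  by apply: aeS h2 => x ->.
- have [_ h] := Hg 0 isT; by apply: aeS (aeI fd h) => x [h1 h2] /h1 ->.
- apply: le_lt_trans lt; rewrite [leRHS]big_ord_recr/=.
  apply: (@le_trans _ _ (\sum_(k < 4) \int[mu]_x (d k x ^+ 2))).
    apply: ler_sum => k _; have k3 : (k <= 3)%N by have := ltn_ord k; rewrite ltnS.
    by have [_ ->] := sg k k3.
  by rewrite lerDl; apply: Rint_ge0 => x _; exact: sqr_ge0.
Qed.

Lemma sob1_le {I f g d} : ac g d -> sqi setT g -> sqi setT d ->
  {ae mu, forall x, I x -> f x = g x} ->
  (sobolev_norm 1 I f <=
    (Num.sqrt (\int[mu]_x (g x ^+ 2) + \int[mu]_x (d x ^+ 2)))%:E)%E.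
Proof.
move=> acg sg sd fg.
apply: (@le_trans _ _ (sobolev_norm_line 1 g)).
  by apply: ereal_inf_lbound; exists g.
apply: ereal_inf_lbound; exists (fun k => if k is 0%N then g else d).
  split=> // -[|[|k]]; rewrite truncn1// => _.
    split; first by case: sg.
    by move=> phi _; rewrite expr0 mul1r.
  by split; [case: sd|exact: ac_weak].
rewrite truncn1 eqxx adde0 big_ord_recr big_ord1/=.
have fin h : sqi setT h -> L2_sqnorm h = (\int[mu]_x (h x ^+ 2))%:E.
  move=> [mh h2]; rewrite /L2_sqnorm /Rintegral fineK//; exact: integrable_fin_num.
by rewrite !fin.
Qed.

Lemma sob_ge0 (s : R) I f : (0 <= sobolev_norm s I f)%E.
Proof.
apply: le_ereal_inf_tmp => _ [g _ <-]; apply: le_ereal_inf_tmp => _ [d _ <-].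
exact: sqrte_ge0.
Qed.

Lemma ae_opp {P : set R} : {ae mu, forall x, P x} -> {ae mu, forall x, P (- x)}.
Proof.
move=> [N [mN N0 PN]]; exists (-%R @^-1` N); split.
- have c : continuous (fun x : R => - x) by move=> x; apply: cvgN; exact: cvg_id.
  by rewrite -[X in measurable X]setTI; exact: (cont_meas c).
- by rewrite -N0; exact: mu_opp.
- by move=> x; exact: PN.
Qed.

Lemma sqi_opp {f} : sqi setT f -> sqi setT (fun x => f (- x)) /\
  \int[mu]_x (f (- x) ^+ 2) = \int[mu]_x (f x ^+ 2).
Proof.
move=> [mf f2]; have [i e] := Rint_opp measurableT (intg_meas f2) f2; split => //.
split => //; have c : continuous (fun x : R => - x) by move=> x; apply: cvgN; exact: cvg_id.
exact: measurableT_comp mf (cont_meas c).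
Qed.

End SobolevInterface.

(** * The soliton and its derivative with respect to the speed *)

Section Soliton.
Context {R : realType}.
Local Notation mu := (@lebesgue_measure R).
Implicit Types (D : set R) (f g d : R -> R) (x y : R).

(** Monotone convergence along [[- n, n]], for functions whose integrals over segments are bounded
    by means of an explicit primitive. *)
Lemma intg_bounded {f} (C : R) : measurable_fun setT f -> (forall x, 0 <= f x) ->
  (forall n : nat, intg `[- n%:R, n%:R] f /\ \int[mu]_(x in `[- n%:R, n%:R]) f x <= C) ->
  intg setT f.
Proof.
move=> mf f0 H; apply/integrableP; split; first exact/measurable_EFinP.
pose F n x := (\1_`[- n%:R, n%:R] x * f x)%:E.
have e : (fun n => \int[mu]_x F n x)%E @ \oo --> (\int[mu]_x (limn (F ^~ x)))%E.
  apply: cvg_monotone_convergence => //.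
  - by move=> n; apply/measurable_EFinP; apply: meas_indicM => //; exact: measurable_funS mf.
  - by move=> n x _; rewrite lee_fin mulr_ge0.
  - move=> x _ m n mn; rewrite lee_fin ler_wpM2r// !indicE !mem_setE.
    rewrite ler_nat; case: (boolP (x \in `[- m%:R, m%:R])) => // h.
    suff -> : x \in `[- n%:R, n%:R] by [].
    by move: h; rewrite !in_itv/= -!ler_norml => /le_trans; apply; rewrite ler_nat.
have lim x : limn (F ^~ x) = (f x)%:E.
  apply: cvg_lim => //; apply: cvg_near_cst; near=> n; rewrite /F indicE mem_set ?mul1r//=.
  by rewrite in_itv/= -ler_norml; near: n; exact: nbhs_infty_ger.
have lt : (\int[mu]_x (f x)%:E <= C%:E)%E.
  under [leLHS]eq_integral do rewrite -lim.
  rewrite -(cvg_lim _ e)//; apply: lime_le; first by apply/cvg_ex; eexists; exact: e.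
  near=> n; have [i h] := H n.
  have i1 : intg setT (fun x => \1_`[- n%:R, n%:R] x * f x) by exact/intg_indic.
  have -> : (\int[mu]_x F n x = (\int[mu]_x (\1_`[- n%:R, n%:R] x * f x))%:E)%E.
    by rewrite /Rintegral fineK//; exact: (integrable_fin_num measurableT i1).
  by rewrite lee_fin Rint_indic.
apply: le_lt_trans (ltry C); apply: le_trans lt; rewrite le_eqVlt; apply/orP; left.
by apply/eqP; apply: eq_integral => x _ /=; rewrite ger0_norm.
Unshelve. all: by end_near. Qed.

Variable k : R.
Hypothesis k0 : 0 < k.

(** The hyperbolic tangent of [k x], where [k] stands for [sqrt c / 2], so that [c = 4 k^2]. *)
Definition th x : R := (expR (k * x) - expR (- (k * x))) / (expR (k * x) + expR (- (k * x))).

Let den_gt0 x : 0 < expR (k * x) + expR (- (k * x)).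
Proof. by rewrite addr_gt0// expR_gt0. Qed.

Let den_neq0 x : expR (k * x) + expR (- (k * x)) != 0.
Proof. by rewrite gt_eqF. Qed.

Lemma th_sech x : 1 - th x ^+ 2 = (2 / (expR (k * x) + expR (- (k * x)))) ^+ 2.
Proof.
have := expRxMexpNx_1 (k * x); rewrite /th.
set a := expR (k * x); set b := expR _ => ab.
have n0 : a + b != 0 by exact: den_neq0.
have -> : (2 / (a + b)) ^+ 2 = (4 * (a * b)) / (a + b) ^+ 2 by rewrite ab; field.
by field.
Qed.

(** This is [sech^2 (k x)], written through [th] so that identities for the soliton become
    polynomial identities in [th]. *)
Definition sc x : R := 1 - th x ^+ 2.

Lemma sc_gt0 x : 0 < sc x.
Proof. by rewrite /sc th_sech exprn_gt0// divr_gt0. Qed.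

Lemma sc_le1 x : sc x <= 1.
Proof. by rewrite /sc gerBl sqr_ge0. Qed.

Lemma th_lt1 x : `|th x| < 1.
Proof.
have := sc_gt0 x; rewrite /sc -(real_normK (num_real (th x))) => h.
by have := normr_ge0 (th x); nra.
Qed.

Lemma th_itv x : -1 < th x < 1.
Proof. by have := th_lt1 x; rewrite ltr_norml. Qed.

Lemma thN x : th (- x) = - th x.
Proof. by rewrite /th mulrN opprK -[in RHS]mulNr opprB [expR (k * x) + _]addrC. Qed.

Lemma th0 : th 0 = 0.
Proof. by rewrite /th mulr0 oppr0 subrr mul0r. Qed.

Lemma scN x : sc (- x) = sc x.
Proof. by rewrite /sc thN sqrrN. Qed.

Lemma th_d x : is_derive x (1 : R) th (k * sc x).
Proof.
have d1 : is_derive x (1 : R) (fun y => k * y) k.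
  by apply: d_eq (dZ k (did x)) _; rewrite mulr1.
have e1 := dcomp expR _ d1 (is_derive_expR _).
have e2 := dcomp expR _ (dN d1) (is_derive_expR _).
have nm := dB e1 e2; have dn := dD e1 e2.
have iv := @is_deriveV R _ x _ 1 (den_neq0 x) dn.
apply: d_eq (dM nm iv) _; rewrite /GRing.scale /= /sc th_sech.
have := expRxMexpNx_1 (k * x).
have := den_neq0 x; set a := expR (k * x); set b := expR _ => n0 ab.
have -> : k * (2 / (a + b)) ^+ 2 = k * (4 * (a * b)) / (a + b) ^+ 2 by rewrite ab; field.
by field.
Qed.

Lemma sc_d x : is_derive x (1 : R) sc (- 2 * k * th x * sc x).
Proof.
apply: d_eq (dB (dcst 1 x) (dM (th_d x) (th_d x))) _; ring.
Qed.

Lemma th_cont : continuous th.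
Proof. by apply: d_cont => x; eexists; exact: th_d. Qed.

Lemma sc_cont : continuous sc.
Proof. by apply: d_cont => x; eexists; exact: sc_d. Qed.

Lemma th_homo : {homo th : x y / x < y}.
Proof.
move=> x y xy.
have [_ _ _ H] : ac th (fun x => k * sc x).
  apply: ac_C1; first exact: th_d.
  by move=> z; apply: cvgMr; exact: sc_cont.
rewrite -subr_gt0 H ?(ltW xy)//.
have cn : continuous (fun x => k * sc x) by move=> z; apply: cvgMr; exact: sc_cont.
have [m mI Hm] := EVT_min (ltW xy) (continuous_subspaceT cn).
apply: (@lt_le_trans _ _ (k * sc m * (y - x))).
  by rewrite mulr_gt0 ?subr_gt0// mulr_gt0// sc_gt0.
apply: le_Rint_cst_itv; rewrite ?(ltW xy)//.
exact: cont_intg_itv.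
Qed.

Lemma sc_intg : intg setT sc.
Proof.
apply: (intg_bounded (2 / k)).
- by apply: cont_meas; exact: sc_cont.
- by move=> x; exact: ltW (sc_gt0 x).
- move=> n; split; first by apply: cont_intg_itv; exact: sc_cont.
  have [_ _ _ H] : ac th (fun x => k * sc x).
    apply: ac_C1; first exact: th_d.
    by move=> z; apply: cvgMr; exact: sc_cont.
  have nn : - n%:R <= n%:R :> R by rewrite -subr_ge0 opprK addr_ge0.
  have := H _ _ nn; rewrite RintZ//; last by apply: cont_intg_itv; exact: sc_cont.
  move=> e; rewrite ler_pdivlMr// mulrC -e.
  by have := th_itv n%:R; have := th_itv (- n%:R); lra.
Qed.

(** It amounts to [|y| <= exp y + exp (- y)], which comes from [exp y >= 1 + y] at [y] and at [- y].
    This is the decay that makes [Lam] and its derivative square integrable. *)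
Lemma sc_poly_bnd x : (k * x) ^+ 2 * sc x <= 4.
Proof.
rewrite /sc th_sech expr_div_n mulrA ler_pdivrMr ?exprn_gt0//.
set a := expR (k * x); set b := expR _.
suff : (k * x) ^+ 2 <= (a + b) ^+ 2 by lra.
have := expR_ge1Dx (k * x); have := expR_ge1Dx (- (k * x)); rewrite -/a -/b.
have : 0 < a by exact: expR_gt0.
have : 0 < b by exact: expR_gt0.
move=> b0 a0 h1 h2; have h : `|k * x| <= a + b by rewrite ler_norml; lra.
by rewrite -(real_normK (num_real (k * x))) lerXn2r ?nnegrE// addr_ge0// ltW.
Qed.


Definition Q x : R := 6 * k ^+ 2 * sc x.
Definition dQ x : R := - 2 * k * th x * Q x.

Lemma Q_d x : is_derive x (1 : R) Q (dQ x).
Proof. by apply: d_eq (dZ _ (sc_d x)) _; rewrite /dQ /Q; ring. Qed.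

(* [Q'' = c Q - Q^2] with [c = 4 k^2] *)
Lemma dQ_d x : is_derive x (1 : R) dQ (4 * k ^+ 2 * Q x - Q x ^+ 2).
Proof.
apply: d_eq (dM (dZ (- 2 * k) (th_d x)) (Q_d x)) _.
by rewrite /dQ /Q /sc; ring.
Qed.

(** The derivative of the profile with respect to the speed [c = 4 k^2], that is [1 / (8 k)] times
    its derivative in [k]. The equation it satisfies below arises by differentiating
    [Q'' = c Q - Q^2] in [c]. *)
Definition Lam x : R := 3 / 2 * sc x * (1 - k * x * th x).
Definition dLam x : R :=
  3 / 2 * sc x * (k * (- 3 * th x + 2 * (k * x) * th x ^+ 2 - k * x * sc x)).

Lemma Lam_d x : is_derive x (1 : R) Lam (dLam x).
Proof.
apply: d_eq (dM (dZ (3 / 2) (sc_d x)) (dB (dcst 1 x) (dM (dZ k (did x)) (th_d x)))) _.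
by rewrite /dLam /sc; ring.
Qed.

(* [L Lam = - Q] for the linearised operator [L = - d^2/dx^2 + c - 2 Q] *)
Lemma dLam_d x : is_derive x (1 : R) dLam ((4 * k ^+ 2 - 2 * Q x) * Lam x + Q x).
Proof.
have d1 := dZ (- 3) (th_d x).
have d2 := dM (dZ 2 (dZ k (did x))) (dM (th_d x) (th_d x)).
have d3 := dM (dZ k (did x)) (sc_d x).
have := dM (dZ (3 / 2) (sc_d x)) (dZ k (dB (dD d1 d2) d3)).
set f := (fun y => _ ); have -> : f = dLam.
  by apply/funext => y; rewrite /f /dLam; ring.
by move/d_eq; apply; rewrite /Lam /Q /sc; field.
Qed.

Lemma Q_gt0 x : 0 < Q x.
Proof. by rewrite /Q !mulr_gt0 ?exprn_gt0// sc_gt0. Qed.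

Lemma Q_le x : Q x <= 6 * k ^+ 2.
Proof. by rewrite /Q ler_piMr ?sc_le1// mulr_ge0// sqr_ge0. Qed.

Lemma QN x : Q (- x) = Q x. Proof. by rewrite /Q scN. Qed.

Lemma Q_cont : continuous Q. Proof. by apply: d_cont => x; eexists; exact: Q_d. Qed.
Lemma dQ_cont : continuous dQ. Proof. by apply: d_cont => x; eexists; exact: dQ_d. Qed.
Lemma Lam_cont : continuous Lam. Proof. by apply: d_cont => x; eexists; exact: Lam_d. Qed.
Lemma dLam_cont : continuous dLam. Proof. by apply: d_cont => x; eexists; exact: dLam_d. Qed.

Lemma sqi_sc {f} (C : R) : continuous f -> (forall x, f x ^+ 2 <= C * sc x) -> sqi setT f.
Proof.
move=> cf H; split; first exact: cont_meas.
apply: (intg_dom (fun x => C * sc x)) => //.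
- by apply: measurable_funX; exact: cont_meas.
- by apply: intgZ => //; exact: sc_intg.
- by move=> x _; rewrite ger0_norm ?sqr_ge0.
Qed.

Lemma sqi_Q : sqi setT Q.
Proof.
apply: (sqi_sc ((6 * k ^+ 2) ^+ 2)); first exact: Q_cont.
move=> x; rewrite /Q exprMn ler_wpM2l ?sqr_ge0//.
by have := sc_gt0 x; have := sc_le1 x; nra.
Qed.

Lemma dQ_le x : `|dQ x| <= 2 * k * Q x.
Proof.
have -> : dQ x = - (2 * k * (th x * Q x)) by rewrite /dQ; ring.
rewrite normrN normrM [`|2 * k|]gtr0_norm ?mulr_gt0// ler_pM2l ?mulr_gt0//.
rewrite normrM [`|Q x|]gtr0_norm ?Q_gt0//.
by rewrite ler_piMl ?(ltW (Q_gt0 x))// ltW// th_lt1.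
Qed.

Lemma sqi_dQ : sqi setT dQ.
Proof.
apply: (sqi_dom (fun x => 2 * k * Q x)) => //.
- by apply: cont_meas; exact: dQ_cont.
- by apply: sqiZ => //; exact: sqi_Q.
- move=> x _; rewrite (le_trans (dQ_le x))// ger0_norm// mulr_ge0 ?(ltW (Q_gt0 x))//.
  by rewrite mulr_ge0// ltW.
Qed.

Lemma sqi_Lam : sqi setT Lam.
Proof.
(* With [y = k x], the inequalities [(1 - y t)^2 <= 2 + 2 y^2], [s <= 1] and [y^2 s <= 4] give
   [2 + 8 = 10]. *)
apply: (sqi_sc (9 / 4 * 10)); first exact: Lam_cont.
move=> x; have := sc_poly_bnd x; have := sc_le1 x; have := sc_gt0 x.
have := th_itv x; rewrite /Lam.
set s := sc x; set t := th x; set y := k * x => /andP[t1 t2] s0 s1 ys.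
have -> : (3 / 2 * s * (1 - y * t)) ^+ 2 = 9 / 4 * s * (s * (1 - y * t) ^+ 2) by field.
rewrite [leRHS](_ : _ = 9 / 4 * s * 10); last by ring.
rewrite ler_wpM2l//; first by rewrite mulr_ge0// ltW.
have tt : t ^+ 2 <= 1 by nra.
have : (1 - y * t) ^+ 2 <= 2 + 2 * y ^+ 2.
  have := sqr_ge0 (1 + y * t); have : (y * t) ^+ 2 <= y ^+ 2.
    by rewrite exprMn ler_piMr// sqr_ge0.
  nra.
by move=> h; apply: le_trans (ler_wpM2l (ltW s0) h) _; nra.
Qed.

Lemma sqi_dLam : sqi setT dLam.
Proof.
apply: (sqi_sc (9 / 4 * k ^+ 2 * 100)); first exact: dLam_cont.
move=> x; have := sc_poly_bnd x; have := sc_le1 x; have := sc_gt0 x.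
have := th_itv x; rewrite /dLam; have : sc x = 1 - th x ^+ 2 by [].
set s := sc x; set t := th x; set y := k * x => es /andP[t1 t2] s0 s1 ys.
set p := - 3 * t + 2 * y * t ^+ 2 - y * s.
have -> : (3 / 2 * s * (k * p)) ^+ 2 = 9 / 4 * k ^+ 2 * s * (s * p ^+ 2) by field.
rewrite [leRHS](_ : _ = 9 / 4 * k ^+ 2 * s * 100); last by ring.
rewrite ler_wpM2l//.
  by rewrite !mulr_ge0 ?sqr_ge0// ltW.
have -> : p = - 3 * t + y * (2 - 3 * s) by rewrite /p es; ring.
have tt : t ^+ 2 <= 1 by nra.
have : (- 3 * t + y * (2 - 3 * s)) ^+ 2 <= 18 + 8 * y ^+ 2.
  have := sqr_ge0 (- 3 * t - y * (2 - 3 * s)).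
  have : (y * (2 - 3 * s)) ^+ 2 <= 4 * y ^+ 2.
    by rewrite exprMn mulrC ler_wpM2r ?sqr_ge0//; nra.
  nra.
by move=> h; apply: le_trans (ler_wpM2l (ltW s0) h) _; nra.
Qed.
End Soliton.

(** * Positivity of the linearised form under Dirichlet conditions at two points *)

Section Coercivity.
Context {R : realType}.
Local Notation mu := (@lebesgue_measure R).
Implicit Types (D : set R) (f g d : R -> R) (x y t : R).
Variable k : R.
Hypothesis k0 : 0 < k.
Local Notation th := (th k).
Local Notation sc := (sc k).
Local Notation Q := (Q k).
Local Notation dQ := (dQ k).
Local Notation Lam := (Lam k).
Local Notation dLam := (dLam k).

(** The point where [th] equals [1/5]. At this value explicit Riccati functions are available on
    both sides: [pden] is positive for [t >= 1/5], and the cubic of [coercive_mid] works for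
    [|t| <= 1/5]. *)
Definition node : R := ln (3 / 2) / (2 * k).

Lemma node_gt0 : 0 < node.
Proof. by rewrite divr_gt0 ?mulr_gt0// ln_gt0//; lra. Qed.

Lemma th_node : th node = 1 / 5.
Proof.
have e2 : expR (k * node) ^+ 2 = 3 / 2.
  rewrite -expRM_natl /node; have -> : 2%:R * (k * (ln (3 / 2) / (2 * k))) = ln (3 / 2) :> R.
    by field; rewrite gt_eqF.
  by rewrite lnK// posrE; lra.
have a0 : 0 < expR (k * node) by exact: expR_gt0.
have := expRxMexpNx_1 (k * node); rewrite /(th).
set a := expR (k * node) in e2 a0 *; set b := expR _ => ab.
have n0 : a != 0 by rewrite gt_eqF.
have -> : b = a^-1 by apply: (mulfI n0); rewrite ab divff.
have -> : (a - a^-1) / (a + a^-1) = (a ^+ 2 - 1) / (a ^+ 2 + 1).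
  have n1 : a ^+ 2 + 1 != 0 by rewrite gt_eqF// ltr_wpDl ?sqr_ge0.
  by field; rewrite n1 n0.
rewrite e2; have -> : 3 / 2 + 1 = 5 / 2 :> R by lra.
have -> : 3 / 2 - 1 = 1 / 2 :> R by lra.
by field.
Qed.

Lemma node_lt : k * node < 1.
Proof.
have -> : k * node = ln (3 / 2) / 2 by rewrite /node; field; rewrite gt_eqF.
have h : (-1 : R) < 1 / 2 by lra.
have := le_ln1Dx h; have -> : 1 + 1 / 2 = 3 / 2 :> R by field.
by move=> ?; lra.
Qed.

(** In units [k = 1], [exp (- 7/4 x) pden (tanh x)] is the decaying solution whose logarithmic
    derivative is taken below: the coefficient [12] is [l (l + 1)] with [l = 3], for which solutions
    are an exponential times a cubic in [tanh]. The level [15/16] makes the decay rate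
    [sqrt (4 - 15/16) = 7/4] rational; [pnum] is the derivative of [pden]. *)
Definition pden t := 64 * t ^+ 3 + 112 * t ^+ 2 + 40 * t - 7.
Definition pnum t := 192 * t ^+ 2 + 224 * t + 40.
(* [w_out] is the logarithmic derivative (as a function of [t = tanh (k x)], in
   units of [k]) of the solution of [- h'' + (4 - 12 sech^2) h = (15 / 16) h]
   that decays like [exp (- 7/4 k x)] at [+oo]. *)
Definition w_out t := - (7 / 4) + (1 - t ^+ 2) * (pnum t / pden t).

Lemma pden_gt0 t : 1 / 5 <= t -> 5 < pden t.
Proof.
move=> h; rewrite /pden.
have : 0 <= (t - 1 / 5) * t by rewrite mulr_ge0; lra.
have : 0 <= (t - 1 / 5) * t ^+ 2 by rewrite mulr_ge0 ?sqr_ge0; lra.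
by nra.
Qed.

Lemma w_out_d t : 1 / 5 <= t -> is_derive t (1 : R) w_out
  (- 2 * t * (pnum t / pden t) + (1 - t ^+ 2) *
     ((384 * t + 224) / pden t - pnum t ^+ 2 / pden t ^+ 2)).
Proof.
move=> ht; have n0 : pden t != 0 by rewrite gt_eqF// (lt_trans _ (pden_gt0 t ht)).
have dpn : is_derive t (1 : R) pnum (384 * t + 224).
  have := dD (dD (dZ 192 (dM (did t) (did t))) (dZ 224 (did t))) (dcst 40 t).
  set f := (fun y => _); have -> : f = pnum by apply/funext => y; rewrite /f /pnum; ring.
  by move/d_eq; apply; ring.
have dpd : is_derive t (1 : R) pden (pnum t).
  have := dB (dD (dD (dZ 64 (dM (dM (did t) (did t)) (did t))) (dZ 112 (dM (did t) (did t)))) (dZ 40 (did t))) (dcst 7 t).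
  set f := (fun y => _); have -> : f = pden by apply/funext => y; rewrite /f /pden; ring.
  by move/d_eq; apply; rewrite /pnum; ring.
have iv := @is_deriveV R _ t _ 1 n0 dpd.
have := dD (dcst (- (7 / 4)) t) (dM (dB (dcst 1 t) (dM (did t) (did t))) (dM dpn iv)).
set f := (fun y => _); have -> : f = w_out by apply/funext => y; rewrite /f /w_out; ring.
by move/d_eq; apply; rewrite /GRing.scale/=; field.
Qed.

(** Riccati form of [h'' = (12 t^2 - 8 - 15/16) h]; the factor [1 - t^2] is the derivative of
    [t = tanh]. *)
Lemma w_out_riccati t : 1 / 5 <= t ->
  (1 - t ^+ 2) * (- 2 * t * (pnum t / pden t) + (1 - t ^+ 2) *
     ((384 * t + 224) / pden t - pnum t ^+ 2 / pden t ^+ 2)) =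
  12 * t ^+ 2 - 8 - 15 / 16 - w_out t ^+ 2.
Proof.
move=> ht; have n0 : pden t != 0 by rewrite gt_eqF// (lt_trans _ (pden_gt0 t ht)).
by rewrite /w_out; move: n0; rewrite /pnum /pden => n0; field.
Qed.

Lemma w_out_bnd t : 1 / 5 <= t -> t <= 1 -> `|w_out t| <= 100.
Proof.
move=> t5 t1; have d0 := pden_gt0 t t5.
have n1 : 0 <= pnum t / pden t.
  by rewrite divr_ge0 ?(ltW (lt_trans _ d0))// /pnum; nra.
have n2 : pnum t / pden t <= 98.
  by rewrite ler_pdivrMr ?(lt_trans _ d0)// /pnum; nra.
have s0 : 0 <= 1 - t ^+ 2 by nra.
have s1 : 1 - t ^+ 2 <= 1 by rewrite gerBl sqr_ge0.
by rewrite /w_out ler_norml; apply/andP; split; nra.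
Qed.

Definition pot x : R := 4 * k ^+ 2 - 2 * Q x.

Lemma potE x : pot x = k ^+ 2 * (12 * th x ^+ 2 - 8).
Proof. by rewrite /pot /(Q) /(sc); ring. Qed.

Lemma pot_bnd x : `|pot x| <= 8 * k ^+ 2.
Proof.
rewrite potE normrM ger0_norm ?sqr_ge0// mulrC ler_wpM2r ?sqr_ge0//.
have := th_itv k x => /andP[h1 h2]; rewrite ler_norml; apply/andP; split; nra.
Qed.

Lemma pot_cont : continuous pot.
Proof.
move=> x; apply: cvgB; first exact: cvg_cst.
by apply: cvgMr; exact: Q_cont.
Qed.

Lemma pot_intg {f} : sqi setT f -> intg setT (fun x => pot x * f x ^+ 2).
Proof.
move=> [mf f2]; apply: (intg_bM (8 * k ^+ 2)) => //.
- by apply: cont_meas; exact: pot_cont.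
- by move=> x _; exact: pot_bnd.
Qed.

(** Density of the linearised form with [k^2 / 2] taken away from the potential: this margin turns
    nonnegativity into coercivity later on. *)
Definition dens f d x : R := d x ^+ 2 + (pot x * f x ^+ 2 - k ^+ 2 / 2 * f x ^+ 2).

Lemma dens_intg {f d} : sqi setT f -> sqi setT d -> intg setT (dens f d).
Proof.
move=> sf [md d2]; apply: intgD => //; apply: intgB => //; first exact: pot_intg.
by apply: intgZ => //; case: sf.
Qed.

(** If [W' + W^2 <= pot - k^2 / 2], then [dens] dominates [(W f^2)'], because the difference
    contains the square [(f' - W f)^2]. Here the inequality has slack [k^2 (15/16 - 1/2)]. The
    function [W f^2] vanishes at [node], so it may be cut there, and its derivative integrates to
    zero over the half-line. *)
Lemma coercive_right {f d} : ac f d -> sqi setT f -> sqi setT d -> f node = 0 ->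
  0 <= \int[mu]_(x in `]node, +oo[) dens f d x.
Proof.
move=> acf sf sd f0.
pose W x := k * w_out (th x).
pose dW x := k ^+ 2 * (12 * th x ^+ 2 - 8 - 15 / 16 - w_out (th x) ^+ 2).
have tx x : node <= x -> 1 / 5 <= th x.
  by rewrite -th_node le_eqVlt => /orP[/eqP->//|/(th_homo k k0)/ltW].
have W_d x : node <= x -> is_derive x (1 : R) W (dW x).
  move=> /tx h; apply: d_eq (dZ k (dcomp w_out _ (th_d k x) (w_out_d _ h))) _.
  by rewrite /dW -w_out_riccati// /(sc); ring.
have ww x : node <= x -> {for x, continuous (fun y => w_out (th y))}.
  move=> h; apply/differentiable_continuous/derivable1_diffP.
  by have [] := dcomp w_out _ (th_d k x) (w_out_d _ (tx _ h)).
have cdW x : node <= x -> {for x, continuous dW}.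
  move=> h; have cw := ww x h.
  apply: cvgMr; apply: cvgB; last first.
    by rewrite expr2; apply: cvgM; exact: cw.
  apply: cvgB; last exact: cvg_cst.
  apply: cvgB; last exact: cvg_cst.
  by apply: cvgMr; rewrite expr2; apply: cvgM; exact: th_cont.
have acW := ac_C1_clip node W_d cdW.
have acF := acM acW (acM acf acf).
have F0 : W (Num.max node node) * (f node * f node) = 0 by rewrite f0 !mulr0.
have acC := ac_cut node acF F0.
have wb x : `|W (Num.max x node)| <= k * 100.
  rewrite /W normrM gtr0_norm// ler_pM2l//; apply: w_out_bnd.
    by apply: tx; rewrite le_max lexx orbT.
  by have /andP[_ /ltW] := th_itv k (Num.max x node).
have dwb x : `|\1_`]node, +oo[ x * dW x| <= k ^+ 2 * (100 * 100 + 21).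
  rewrite indicE mem_setE in_itv/= andbT; have [xn|xn] := leP x node.
    by rewrite mul0r normr0 mulr_ge0 ?sqr_ge0//; clear; lra.
  rewrite mul1r /dW normrM ger0_norm ?sqr_ge0// ler_wpM2l ?sqr_ge0//.
  have t5 := tx _ (ltW xn); have /andP[t1 t2] := th_itv k x.
  have := w_out_bnd _ t5 (ltW t2); rewrite !ler_norml => /andP[h1 h2].
  by apply/andP; split; nra.
have [cW mdW _ _] := acW; have [mf f2] := sf; have [md d2] := sd.
have ff : intg setT (fun x => f x * f x) by exact: sqiM.
have fd : intg setT (fun x => d x * f x + f x * d x).
  by apply: intgD => //; exact: sqiM.
have iF : intg setT (fun x => W (Num.max x node) * (f x * f x)).
  by apply: (intg_bM (k * 100)) => //; exact: cont_meas.
have iD : intg setT (fun x => \1_`]node, +oo[ x * dW x * (f x * f x) +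
    W (Num.max x node) * (d x * f x + f x * d x)).
  apply: intgD => //; first exact: (intg_bM (k ^+ 2 * (100 * 100 + 21))).
  by apply: (intg_bM (k * 100)) => //; exact: cont_meas.
have := ac_int0 acC; rewrite !Rint_indic// => int0.
have mI : measurable `]node, +oo[%classic by [].
have sub g : intg setT g -> intg `]node, +oo[ g by exact: intgS.
rewrite -(int0 _ _); [|exact/intg_indic/sub..].
apply: le_Rint => //; [exact: sub|by apply: sub; exact: dens_intg|].
move=> x /=; rewrite in_itv/= andbT => xn.
rewrite indicE mem_set/= ?in_itv/= ?xn// mul1r max_l ?(ltW xn)//.
rewrite /dens potE -subr_ge0 /dW /W.
have := sqr_ge0 (d x - k * w_out (th x) * f x).
have := mulr_ge0 (sqr_ge0 k) (sqr_ge0 (f x)).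
nra.
Qed.

(** Same comparison with [(W f^2)'], now for the odd cubic [- 10 t - 33 t^3], which satisfies the
    Riccati inequality as long as [t^2 <= 1/25]. Both boundary terms vanish. *)
Lemma coercive_mid {f d} : ac f d -> sqi setT f -> sqi setT d ->
  f node = 0 -> f (- node) = 0 ->
  0 <= \int[mu]_(x in `[- node, node]) dens f d x.
Proof.
move=> acf sf sd f0 f1.
pose w (t : R) := - 10 * t - 33 * t ^+ 3.
pose W x := k * w (th x).
pose dW x := k * ((- 10 - 99 * th x ^+ 2) * (k * sc x)).
have W_d x : is_derive x (1 : R) W (dW x).
  have t_d := th_d k x.
  have := dZ k (dB (dZ (- 10) t_d) (dZ 33 (dM t_d (dM t_d t_d)))).
  set g := (fun y => _); have -> : g = W by apply/funext => y; rewrite /g /W /w; ring.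
  by move/d_eq; apply; rewrite /dW; ring.
have cdW : continuous dW.
  move=> x; apply: cvgMr; apply: cvgM; last by apply: cvgMr; exact: sc_cont.
  apply: cvgB; first exact: cvg_cst.
  by apply: cvgMr; rewrite expr2; apply: cvgM; exact: th_cont.
have acF := acM (ac_C1 W_d cdW) (acM acf acf).
have [_ _ iD FD] := acF.
have nn : - node <= node by have := node_gt0; lra.
have := FD _ _ nn; rewrite f0 f1 !mulr0 subrr => ->.
apply: le_Rint => //; first by apply: intgS (dens_intg sf sd).
move=> x /=; rewrite in_itv/= => /andP[x1 x2].
have t1 : - (1 / 5) <= th x.
  rewrite -th_node -thN; move: x1; rewrite le_eqVlt => /orP[/eqP->//|/(th_homo k k0)/ltW//].
have t2 : th x <= 1 / 5.
  by rewrite -th_node; move: x2; rewrite le_eqVlt => /orP[/eqP->//|/(th_homo k k0)/ltW//].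
rewrite /dens potE -subr_ge0 /dW /W /w /(sc); set t := th x in t1 t2 *.
set e := d x; set y := f x.
have tt : t ^+ 2 <= 1 / 25 by nra.
have tt0 := sqr_ge0 t.
set u := t ^+ 2 in tt tt0.
(* The slack in the Riccati inequality, with [u = t^2]; in the higher powers each surplus factor [u]
   is replaced by [1/25]. *)
have key : 0 <= 3 / 2 + u - 759 * u ^+ 2 - 1089 * u ^+ 3.
  have u2 : u ^+ 2 <= u * (1 / 25) by rewrite expr2 ler_wpM2l.
  have u3 : u ^+ 3 <= u ^+ 2 * (1 / 25) by rewrite exprSr ler_wpM2l// sqr_ge0.
  by clear -u2 u3 tt tt0; lra.
have -> : e ^+ 2 + (k ^+ 2 * (12 * t ^+ 2 - 8) * y ^+ 2 - k ^+ 2 / 2 * y ^+ 2) -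
   (k * ((-10 - 99 * t ^+ 2) * (k * (1 - t ^+ 2))) * (y * y) +
    k * (-10 * t - 33 * t ^+ 3) * (e * y + y * e)) =
   (e - k * (-10 * t - 33 * t ^+ 3) * y) ^+ 2 +
   k ^+ 2 * y ^+ 2 * (3 / 2 + u - 759 * u ^+ 2 - 1089 * u ^+ 3).
  by rewrite /u; field.
apply: addr_ge0; first exact: sqr_ge0.
apply: mulr_ge0; last exact: key.
by apply: mulr_ge0; exact: sqr_ge0.
Qed.

Lemma dens_opp f d x : dens f d (- x) = dens (fun y => f (- y)) (fun y => - d (- y)) x.
Proof. by rewrite /dens sqrrN /pot QN. Qed.

(** The left half-line is the mirror image of the right one, since [pot] is even. *)
Lemma coercive_dirichlet {f d} : ac f d -> sqi setT f -> sqi setT d ->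
  f node = 0 -> f (- node) = 0 -> 0 <= \int[mu]_x dens f d x.
Proof.
move=> acf sf sd f0 f1; have id := dens_intg sf sd.
have [sf' _] := sqi_opp sf; have [sd' _] := sqi_opp sd.
have h1 := coercive_right acf sf sd f0.
have h2 := coercive_mid acf sf sd f0 f1.
have h3 := coercive_right (ac_opp acf) sf' (sqiN measurableT sd') f1.
have n0 := node_gt0.
have sub (D : set R) : measurable D -> intg D (dens f d) by move=> mD; apply: intgS id.
have e3 : \int[mu]_(x in `]node, +oo[) dens (fun y => f (- y)) (fun y => - d (- y)) x =
    \int[mu]_(x in `]-oo, - node[) dens f d x.
  have [_ <-] := @Rint_opp _ `]-oo, - node[ (dens f d) (measurable_itv _) (intg_meas id) (sub _ (measurable_itv _)).
  have -> : -%R @^-1` `]-oo, - node[ = `]node, +oo[%classic.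
    by apply/seteqP; split => x /=; rewrite !in_itv/= ?andbT ltrN2.
  by apply: eq_Rint => x _; rewrite dens_opp.
rewrite e3 in h3.
have -> : \int[mu]_x dens f d x = \int[mu]_(x in `]-oo, - node[) dens f d x +
   (\int[mu]_(x in `[- node, node]) dens f d x + \int[mu]_(x in `]node, +oo[) dens f d x).
  have i1 := (intg_indic (dens f d) (measurable_itv `]-oo, - node[)).2 (sub _ (measurable_itv _)).
  have i2 := (intg_indic (dens f d) (measurable_itv `[- node, node])).2 (sub _ (measurable_itv _)).
  have i3 := (intg_indic (dens f d) (measurable_itv `]node, +oo[)).2 (sub _ (measurable_itv _)).
  rewrite -(Rint_indic _ (measurable_itv `]-oo, - node[)).
  rewrite -(Rint_indic _ (measurable_itv `[- node, node])).
  rewrite -(Rint_indic _ (measurable_itv `]node, +oo[)).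
  rewrite -(RintD measurableT i2 i3) -(RintD measurableT i1 (intgD measurableT i2 i3)).
  apply: eq_Rint => x _; rewrite !indicE !mem_setE !in_itv/= andbT.
    case: (ltP x (- node)) => xn /=.
      have -> : (node < x) = false by apply/negbTE; rewrite -leNgt; lra.
      by rewrite mul1r !mul0r !addr0.
    by case: (leP x node) => xn2 /=; rewrite !mul0r ?mul1r ?mul0r ?addr0 ?add0r.
by rewrite addr_ge0// addr_ge0.
Qed.

End Coercivity.

(** * Coercivity with the scaling direction restored *)

Section Stability.
Context {R : realType}.
Local Notation mu := (@lebesgue_measure R).
Implicit Types (D : set R) (f g d e : R -> R) (x y t : R).
Variable k : R.
Hypothesis k0 : 0 < k.
Local Notation th := (th k).
Local Notation sc := (sc k).
Local Notation Q := (Q k).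
Local Notation dQ := (dQ k).
Local Notation Lam := (Lam k).
Local Notation dLam := (dLam k).
Local Notation pot := (pot k).
Local Notation node := (node k).

Let mT : measurable [set: R] := measurableT.

Lemma Rint3 {f g h : R -> R} (a b c : R) : intg setT f -> intg setT g -> intg setT h ->
  \int[mu]_x (a * f x + (b * g x + c * h x)) =
  a * \int[mu]_x f x + (b * \int[mu]_x g x + c * \int[mu]_x h x).
Proof.
move=> If Ig Ih; rewrite (RintD mT (intgZ a mT If) (intgD mT (intgZ b mT Ig) (intgZ c mT Ih))).
by rewrite (RintD mT (intgZ b mT Ig) (intgZ c mT Ih)) !RintZ.
Qed.

Lemma Rint_quad {f g : R -> R} (b : R) : sqi setT f -> sqi setT g ->
  \int[mu]_x ((f x + b * g x) ^+ 2) =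
  \int[mu]_x (f x ^+ 2) + 2 * b * \int[mu]_x (f x * g x) + b ^+ 2 * \int[mu]_x (g x ^+ 2).
Proof.
move=> sf sg; have If := sf.2; have Ig := sg.2; have Ifg := sqiM mT sf sg.
transitivity (\int[mu]_x (1 * (f x ^+ 2) + (2 * b * (f x * g x) + b ^+ 2 * (g x ^+ 2)))).
  by apply: eq_Rint => x _; ring.
by rewrite Rint3//; ring.
Qed.

Lemma pot_sqi {f} : sqi setT f -> sqi setT (fun x => pot x * f x).
Proof.
move=> sf; apply: (sqi_bM (8 * k ^+ 2)) => //; first by apply: cont_meas; exact: pot_cont.
by move=> x _; exact: pot_bnd.
Qed.

Lemma Rint_quad_pot {f g : R -> R} (b : R) : sqi setT f -> sqi setT g ->
  \int[mu]_x (pot x * (f x + b * g x) ^+ 2) =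
  \int[mu]_x (pot x * f x ^+ 2) + 2 * b * \int[mu]_x (pot x * f x * g x) +
  b ^+ 2 * \int[mu]_x (pot x * g x ^+ 2).
Proof.
move=> sf sg; have If := pot_intg k sf; have Ig := pot_intg k sg.
have Ifg := sqiM mT (pot_sqi sf) sg.
transitivity (\int[mu]_x (1 * (pot x * f x ^+ 2) +
   (2 * b * (pot x * f x * g x) + b ^+ 2 * (pot x * g x ^+ 2)))).
  by apply: eq_Rint => x _; ring.
by rewrite Rint3//; ring.
Qed.

Lemma ac_Q : ac Q dQ. Proof. exact: ac_C1 (Q_d k) (@dQ_cont _ k). Qed.
Lemma ac_Lam : ac Lam dLam. Proof. exact: ac_C1 (Lam_d k) (@dLam_cont _ k). Qed.

Lemma Q_intg : intg setT Q. Proof. by apply: intgZ => //; exact: sc_intg. Qed.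

Lemma sqQ_gt0 : 0 < \int[mu]_x (Q x ^+ 2).
Proof.
have cn : continuous (fun x => Q x ^+ 2).
  by move=> x; exact: cvgM (@Q_cont _ k x) (@Q_cont _ k x).
have [m mI Hm] := EVT_min (ler01 : 0 <= 1 :> R) (continuous_subspaceT cn).
apply: (@lt_le_trans _ _ (\int[mu]_(x in `[0, 1]) (Q x ^+ 2))); last first.
  by apply: Rint_ge_sub => //; [exact: (sqi_Q k k0).2|move=> x _; exact: sqr_ge0].
apply: (@lt_le_trans _ _ (Q m ^+ 2 * (1 - 0))).
  by rewrite subr0 mulr1 exprn_gt0// Q_gt0.
by apply: le_Rint_cst_itv => //; exact: cont_intg_itv.
Qed.

(** Half the derivative in [c] of the mass, which is proportional to [c^(3/2)]; it is computed from
    the vanishing integral of [(x Q^2)']. Its positivity says that the mass grows with the speed,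
    the sign on which stability rests. *)
Lemma QLam : \int[mu]_x (Q x * Lam x) = 3 / (16 * k ^+ 2) * \int[mu]_x (Q x ^+ 2).
Proof.
have acI : ac (fun x : R => x) (fun=> 1) by apply: (ac_C1 did) => x; exact: cvg_cst.
have acF := acM acI (acM ac_Q ac_Q).
have bx x : `|x * Q x| <= 30 * k.
  rewrite normrM (gtr0_norm (Q_gt0 k k0 x)) /(Q).
  have h1 := sc_poly_bnd k x; have h2 := sc_le1 k x; have h3 := sc_gt0 k x.
  have h4 : k * `|x| <= 1 + (k * x) ^+ 2.
    have -> : (k * x) ^+ 2 = (k * `|x|) ^+ 2 by rewrite !exprMn real_normK ?num_real.
    by have := sqr_ge0 (k * `|x| - 1); nra.
  have h5 : k * `|x| * sc x <= 5 by nra.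
  have -> : `|x| * (6 * k ^+ 2 * sc x) = 6 * k * (k * `|x| * sc x) by ring.
  have -> : 30 * k = 6 * k * 5 by ring.
  by rewrite ler_wpM2l// mulr_ge0// ltW.
have mxQ : measurable_fun setT (fun x => x * Q x).
  apply: cont_meas => x; apply: cvgM; first exact: cvg_id.
  exact: Q_cont.
have i1 : intg setT (fun x => x * (Q x * Q x)).
  apply: (@eq_intg _ _ (fun x => (x * Q x) * Q x)) => //; first by move=> x _; ring.
  by apply: (intg_bM (30 * k)) => //; exact: Q_intg.
have i2 := (sqi_Q k k0).2.
have i3 : intg setT (fun x => k * x * th x * Q x ^+ 2).
  apply: (@eq_intg _ _ (fun x => k * (th x * (x * (Q x * Q x))))) => //.
    by move=> x _; ring.
  apply: intgZ => //; apply: (intg_bM 1) => //.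
    by apply: cont_meas; exact: th_cont.
  by move=> x _; exact: ltW (th_lt1 k x).
have E1 x : 1 * (Q x * Q x) + x * (dQ x * Q x + Q x * dQ x) =
    Q x ^+ 2 - 4 * (k * x * th x * Q x ^+ 2).
  by rewrite /(dQ); ring.
have := ac_int0 acF i1; under eq_Rint do rewrite E1.
move=> /(_ _); have id : intg setT (fun x => Q x ^+ 2 - 4 * (k * x * th x * Q x ^+ 2)).
  by apply: intgB => //; exact: intgZ.
move=> /(_ (eq_intg _ mT (fun x _ => E1 x) id)).
rewrite RintB//; last exact: intgZ.
rewrite RintZ// => e.
transitivity (\int[mu]_x (1 / (4 * k ^+ 2) * (Q x ^+ 2 - k * x * th x * Q x ^+ 2))).
  by apply: eq_Rint => x _; rewrite /(Lam) /(Q); field; rewrite gt_eqF.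
rewrite RintZ//; last exact: intgB.
rewrite RintB//.
have -> : \int[mu]_x (k * x * th x * Q x ^+ 2) = 1 / 4 * \int[mu]_x (Q x ^+ 2) by lra.
by field; rewrite gt_eqF.
Qed.

(* [a3], [a4]: integration by parts against [L Lam = - Q] *)
Lemma Lam_ibp {f d} : ac f d -> sqi setT f -> sqi setT d ->
  \int[mu]_x (d x * dLam x) =
  - (\int[mu]_x (pot x * f x * Lam x)) - (\int[mu]_x (Q x * f x)).
Proof.
move=> acf sf sd; have sL := sqi_Lam k k0; have sdL := sqi_dLam k k0; have sQ := sqi_Q k k0.
have cE : continuous (fun x => (4 * k ^+ 2 - 2 * Q x) * Lam x + Q x).
  move=> x; apply: cvgD; last exact: Q_cont.
  by apply: cvgM; [exact: pot_cont|exact: Lam_cont].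
have acF := acM acf (ac_C1 (dLam_d k) cE).
have i1 := sqiM mT sd sdL; have i2 := sqiM mT (pot_sqi sf) sL; have i3 := sqiM mT sQ sf.
have := ac_int0 acF (sqiM mT sf sdL).
have E x : d x * dLam x + f x * ((4 * k ^+ 2 - 2 * Q x) * Lam x + Q x) =
  1 * (d x * dLam x) + (1 * (pot x * f x * Lam x) + 1 * (Q x * f x)).
  by rewrite /(pot); ring.
under eq_Rint do rewrite E.
move=> /(_ (eq_intg _ mT (fun x _ => E x) (intgD mT (intgZ 1 mT i1) (intgD mT (intgZ 1 mT i2) (intgZ 1 mT i3))))).
by rewrite Rint3// !mul1r; lra.
Qed.

(** As [f] has equal values at [node] and [- node], one multiple of the even function [Lam] cancels
    both, and [coercive_dirichlet] applies to [xi = f + b Lam]. Because [L Lam = - Q], the form at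
    [xi] equals the form at [f] minus [2 b int Q f] minus [b^2 int Q Lam]. The last term has the
    good sign and absorbs the cross term at the price of [K (int Q f)^2]. *)
Lemma coercive : exists delta K : R, [/\ 0 < delta, 0 < K &
  forall f d, ac f d -> sqi setT f -> sqi setT d -> f node = f (- node) ->
  delta * (\int[mu]_x (f x ^+ 2) + \int[mu]_x (d x ^+ 2)) <=
  \int[mu]_x (d x ^+ 2) + \int[mu]_x (pot x * f x ^+ 2) + K * (\int[mu]_x (Q x * f x)) ^+ 2].
Proof.
have sL := sqi_Lam k k0; have sdL := sqi_dLam k k0; have sQ := sqi_Q k k0.
set m := \int[mu]_x (Q x * Lam x).
have m0 : 0 < m by rewrite /m QLam mulr_gt0 ?sqQ_gt0// divr_gt0// mulr_gt0// exprn_gt0.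
set a2 := \int[mu]_x (Lam x ^+ 2); set a4 := \int[mu]_x (dLam x ^+ 2).
have a20 : 0 <= a2 by apply: Rint_ge0 => x _; exact: sqr_ge0.
have a40 : 0 <= a4 by apply: Rint_ge0 => x _; exact: sqr_ge0.
(* The form at [xi] is at least [k^2 / 2] times the mass, and [pot >= - 8 k^2], so the gradient term
   is at most [1 + 16 = 17] times the form. Half of the form is spent on each, whence [k^2 / 4] and
   [1 / 34]. *)
pose d1 := Num.min (k ^+ 2 / 4) (1 / 34).
have k2 : 0 < k ^+ 2 by exact: exprn_gt0.
have d10 : 0 < d1 by rewrite lt_min; apply/andP; split; lra.
have d1a : d1 <= k ^+ 2 / 4 by rewrite ge_min lexx.
have d1b : d1 <= 1 / 34 by rewrite ge_min lexx orbT.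
(* One half of [m b^2] pays for the share of [b Lam] in the norm of [f], the other half for the
   cross term [2 b int Q f]. *)
pose de := Num.min (d1 / 2) (m / (4 * (a2 + a4 + 1))).
have de0 : 0 < de.
  by rewrite lt_min divr_gt0//= divr_gt0// mulr_gt0// ltr_wpDl// addr_ge0.
have dea : 2 * de <= d1.
  have : de <= d1 / 2 by rewrite ge_min lexx.
  lra.
have deb : 2 * de * (a2 + a4) <= m / 2.
  have : de <= m / (4 * (a2 + a4 + 1)) by rewrite ge_min lexx orbT.
  by rewrite ler_pdivlMr ?mulr_gt0 ?ltr_wpDl ?addr_ge0//; clear -de0; lra.
exists de, (2 / m); split => //; first by rewrite divr_gt0.
move=> f d acf sf sd fn.
(* [Lam] does not vanish at [node]: there [th = 1/5] and [k node < 1], so [1 - k x th > 0]. *)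
have L0 : 0 < Lam node.
  rewrite /(Lam) th_node// mulr_gt0//; first by rewrite mulr_gt0 ?sc_gt0//; lra.
  by have := node_lt k k0; lra.
pose b := - f node / Lam node.
pose xi x := f x + b * Lam x; pose dxi x := d x + b * dLam x.
have acx : ac xi dxi by exact: acD acf (acZ b ac_Lam).
have sx : sqi setT xi by exact: sqiD mT sf (sqiZ b mT sL).
have sdx : sqi setT dxi by exact: sqiD mT sd (sqiZ b mT sdL).
have xn : xi node = 0 by rewrite /xi /b; field; rewrite gt_eqF.
have LN : Lam (- node) = Lam node by rewrite /(Lam) scN thN !mulrN mulNr opprK.
have xn' : xi (- node) = 0 by rewrite /xi LN -fn.
have := coercive_dirichlet k k0 acx sx sdx xn xn'.
have -> : \int[mu]_x dens k xi dxi x = \int[mu]_x (dxi x ^+ 2) +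
    \int[mu]_x (pot x * xi x ^+ 2) - k ^+ 2 / 2 * \int[mu]_x (xi x ^+ 2).
  have i1 := sdx.2; have i2 := pot_intg k sx; have i3 := sx.2.
  rewrite /dens RintD//; last by apply: intgB => //; exact: intgZ.
  by rewrite RintB ?RintZ//; [ring|exact: intgZ].
have pot8 : - (8 * k ^+ 2) * \int[mu]_x (xi x ^+ 2) <= \int[mu]_x (pot x * xi x ^+ 2).
  have i3 := sx.2; rewrite -RintZ//; apply: le_Rint => //; [exact: intgZ|exact: pot_intg|].
  move=> x _; rewrite ler_wpM2r ?sqr_ge0//.
  by have := pot_bnd k x; rewrite ler_norml => /andP[].
have : 0 <= \int[mu]_x (xi x ^+ 2) by apply: Rint_ge0 => x _; exact: sqr_ge0.
have : 0 <= \int[mu]_x (dxi x ^+ 2) by apply: Rint_ge0 => x _; exact: sqr_ge0.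
have hA : \int[mu]_x (f x ^+ 2) <= 2 * \int[mu]_x (xi x ^+ 2) + 2 * b ^+ 2 * a2.
  have i1 := sx.2; have i2 := sL.2.
  rewrite -(RintZ 2 mT i1) -(RintZ (2 * b ^+ 2) mT i2) -RintD//; [|exact: intgZ|exact: intgZ].
  apply: le_Rint => //; [exact: sf.2|by apply: intgD => //; exact: intgZ|].
  by move=> x _; rewrite /xi; have := sqr_ge0 (f x + 2 * (b * Lam x)); nra.
have hB : \int[mu]_x (d x ^+ 2) <= 2 * \int[mu]_x (dxi x ^+ 2) + 2 * b ^+ 2 * a4.
  have i1 := sdx.2; have i2 := sdL.2.
  rewrite -(RintZ 2 mT i1) -(RintZ (2 * b ^+ 2) mT i2) -RintD//; [|exact: intgZ|exact: intgZ].
  apply: le_Rint => //; [exact: sd.2|by apply: intgD => //; exact: intgZ|].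
  by move=> x _; rewrite /dxi; have := sqr_ge0 (d x + 2 * (b * dLam x)); nra.
have e1 := Rint_quad b sd sdL; have e2 := Rint_quad_pot b sf sL.
have e3 := Lam_ibp acf sf sd; have e4 := Lam_ibp ac_Lam sL sdL.
have e5 : \int[mu]_x (dLam x * dLam x) = a4 by apply: eq_Rint => x _; rewrite expr2.
have e6 : \int[mu]_x (pot x * Lam x * Lam x) = \int[mu]_x (pot x * Lam x ^+ 2).
  by apply: eq_Rint => x _; rewrite expr2 mulrA.
rewrite e5 e6 -/m in e4.
move: e1 e2 pot8 hA hB; rewrite -/(dxi _) -/(xi _) -/a4.
rewrite -/(\int[mu]_x (dxi x ^+ 2)) -/(\int[mu]_x (xi x ^+ 2)).
set X1 := \int[mu]_x (dxi x ^+ 2); set X0 := \int[mu]_x (xi x ^+ 2).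
set PX := \int[mu]_x (pot x * xi x ^+ 2).
set A := \int[mu]_x (f x ^+ 2); set Ad := \int[mu]_x (d x ^+ 2).
set P := \int[mu]_x (pot x * f x ^+ 2).
set PL := \int[mu]_x (pot x * Lam x ^+ 2) in e4 *.
set a5 := \int[mu]_x (pot x * f x * Lam x) in e3 *.
set a3 := \int[mu]_x (d x * dLam x) in e3 *.
set s := \int[mu]_x (Q x * f x) in e3 *.
move=> e1 e2 p8 hA hB X10 X00 D.
have q1 : X1 + PX = Ad + P - 2 * b * s - b ^+ 2 * m by rewrite e1 e2 e3 e4; ring.
have q2 : d1 * (X0 + X1) <= X1 + PX.
  have h1 := ler_wpM2r X00 d1a; have h2 := ler_wpM2r X10 d1b; clear -h1 h2 p8 D; lra.
have q3 : - (2 * b * s) <= m / 2 * b ^+ 2 + 2 / m * s ^+ 2.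
  have -> : m / 2 * b ^+ 2 + 2 / m * s ^+ 2 = 1 / (2 * m) * ((m * b + 2 * s) ^+ 2 - 4 * m * b * s).
    by field; rewrite gt_eqF.
  have -> : - (2 * b * s) = 1 / (2 * m) * (- (4 * m * b * s)) by field; rewrite gt_eqF.
  rewrite ler_pM2l; last by rewrite divr_gt0// mulr_gt0.
  by have := sqr_ge0 (m * b + 2 * s); clear; lra.
have q4 : de * (A + Ad) <= d1 * (X0 + X1) + m / 2 * b ^+ 2.
  have h1 : A + Ad <= 2 * (X0 + X1) + 2 * b ^+ 2 * (a2 + a4) by clear -hA hB; lra.
  have h2 : 2 * de * (X0 + X1) <= d1 * (X0 + X1) by rewrite ler_wpM2r// addr_ge0.
  have h3 : 2 * de * (a2 + a4) * b ^+ 2 <= m / 2 * b ^+ 2 by rewrite ler_wpM2r// sqr_ge0.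
  have h4 : de * (A + Ad) <= de * (2 * (X0 + X1) + 2 * b ^+ 2 * (a2 + a4)) by rewrite ler_wpM2l// ltW.
  clear -h1 h2 h3 h4; lra.
clear -q1 q2 q3 q4 D; lra.
Qed.

End Stability.

(** * Mass, energy and stability of the soliton at a fixed time *)

Section Static.
Context {R : realType}.
Local Notation mu := (@lebesgue_measure R).
Implicit Types (D : set R) (f g d e : R -> R) (x y t a b s : R).

Definition mass (f : R -> R) : R := \int[mu]_x (f x ^+ 2).
Definition energy (f d : R -> R) : R :=
  1 / 2 * \int[mu]_x (d x ^+ 2) - 1 / 3 * \int[mu]_x (f x ^+ 3).
Definition h1sq (f d : R -> R) : R := mass f + mass d.
Definition H1 (f d : R -> R) : Prop := [/\ ac f d, sqi setT f & sqi setT d].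

Let mT : measurable [set: R] := measurableT.

Lemma mass_ge0 f : 0 <= mass f.
Proof. by apply: Rint_ge0 => x _; exact: sqr_ge0. Qed.

Lemma h1sq_ge0 f d : 0 <= h1sq f d.
Proof. by rewrite addr_ge0// mass_ge0. Qed.

Lemma H1B {f d g e} : H1 f d -> H1 g e -> H1 (fun x => f x - g x) (fun x => d x - e x).
Proof. by move=> [a1 a2 a3] [b1 b2 b3]; split; [exact: acB|exact: sqiB|exact: sqiB]. Qed.

Lemma H1_shift s {f d} : H1 f d -> H1 (fun x => f (x + s)) (fun x => d (x + s)).
Proof.
move=> [a1 a2 a3]; split; first exact: ac_shift.
  by have [] := sqi_shift s a2.
by have [] := sqi_shift s a3.
Qed.

Lemma h1sq_shift s {f d} : H1 f d ->
  h1sq (fun x => f (x + s)) (fun x => d (x + s)) = h1sq f d.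
Proof.
move=> [_ sf sd]; rewrite /h1sq /mass.
by have [_ ->] := sqi_shift s sf; have [_ ->] := sqi_shift s sd.
Qed.

Lemma massD_le {f g} : sqi setT f -> sqi setT g ->
  mass (fun x => f x + g x) <= 2 * mass f + 2 * mass g.
Proof.
move=> sf sg; have i1 := sf.2; have i2 := sg.2.
rewrite /mass -(RintZ 2 mT i1) -(RintZ 2 mT i2) -RintD//; [|exact: intgZ|exact: intgZ].
apply: le_Rint => //; [exact: (sqiD mT sf sg).2|by apply: intgD => //; exact: intgZ|].
by move=> x _; have := sqr_ge0 (f x - g x); nra.
Qed.

Lemma h1sqD_le {f d g e} : H1 f d -> H1 g e ->
  h1sq (fun x => f x + g x) (fun x => d x + e x) <= 2 * h1sq f d + 2 * h1sq g e.
Proof.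
move=> [_ a2 a3] [_ b2 b3]; have := massD_le a2 b2; have := massD_le a3 b3.
by rewrite /h1sq; lra.
Qed.

Lemma eq_h1sq {f d g e} : f =1 g -> d =1 e -> h1sq f d = h1sq g e.
Proof. by move=> /funext-> /funext->. Qed.

Lemma h1sqN f d : h1sq (fun x => - f x) (fun x => - d x) = h1sq f d.
Proof. by rewrite /h1sq /mass; under eq_Rint do rewrite sqrrN; under [X in _ + X]eq_Rint do rewrite sqrrN. Qed.

Lemma H1_sup {f d} : H1 f d -> forall x, f x ^+ 2 <= 2 * h1sq f d.
Proof. by move=> [a1 a2 a3]; exact: ac_sup. Qed.

Lemma sqr_le_norm x y : 0 <= y -> x ^+ 2 <= y ^+ 2 -> `|x| <= y.
Proof. by move=> y0; rewrite -(real_normK (num_real x)) ler_pXn2r ?nnegrE. Qed.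

Lemma cube_intg {f} s : (forall x, `|f x| <= s) -> sqi setT f ->
  intg setT (fun x => f x ^+ 3) /\ `|\int[mu]_x (f x ^+ 3)| <= s * mass f.
Proof.
move=> fs [mf f2]; have H x : `|f x ^+ 3| <= s * f x ^+ 2.
  by rewrite exprS normrM (ger0_norm (sqr_ge0 _)) ler_wpM2r ?sqr_ge0.
have i2 : intg setT (fun x => s * f x ^+ 2) by exact: intgZ.
have mf3 : measurable_fun setT (fun x => f x ^+ 3) by exact: measurable_funX.
split; first by apply: intg_dom i2 _ => // x _; exact: H.
by rewrite /mass -RintZ//; apply: normr_Rint_le => // x _; exact: H.
Qed.

Lemma H1_cube {f d} : H1 f d -> intg setT (fun x => f x ^+ 3).
Proof.
move=> H; have [_ sf _] := H.
have [] // := @cube_intg f (2 * h1sq f d + 1) _ sf => x.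
apply: sqr_le_norm; first by rewrite addr_ge0// mulr_ge0// h1sq_ge0.
by apply: le_trans (H1_sup H x) _; have := h1sq_ge0 f d; nra.
Qed.

Lemma Rint_cst_itv c a b : a <= b -> \int[mu]_(x in `[a, b]) c = c * (b - a).
Proof.
move=> ab; have [_ _ _ H] : ac (fun x => c * x) (fun=> c).
  apply: ac_C1 => x; last exact: cvg_cst.
  by apply: d_eq (dZ c (did x)) _; rewrite mulr1.
by rewrite -H// mulrBr.
Qed.

Lemma ac_lip {f d} (L : R) : ac f d -> (forall x, `|d x| <= L) ->
  forall x y, `|f y - f x| <= L * `|y - x|.
Proof.
move=> [_ md id fd] dL.
suff H x y : x <= y -> `|f y - f x| <= L * `|y - x|.
  by move=> x y; have [/H//|/ltW/H] := leP x y; rewrite distrC (distrC x).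
move=> xy; rewrite fd// [`|y - x|]ger0_norm ?subr_ge0// -Rint_cst_itv//.
apply: normr_Rint_le => //; first exact: measurable_funS md.
by apply: cont_intg_itv => z; exact: cvg_cst.
Qed.

Variable k : R.
Hypothesis k0 : 0 < k.
Local Notation th := (th k).
Local Notation sc := (sc k).
Local Notation Q := (Q k).
Local Notation dQ := (dQ k).
Local Notation pot := (pot k).
Local Notation node := (node k).

Lemma H1_Q : H1 Q dQ.
Proof. by split; [exact: ac_Q|exact: sqi_Q|exact: sqi_dQ]. Qed.

Lemma expand_mass {f} : sqi setT f ->
  mass (fun x => Q x + f x) = mass Q + 2 * \int[mu]_x (Q x * f x) + mass f.
Proof.
move=> sf; have := Rint_quad 1 (sqi_Q k k0) sf; rewrite /mass expr1n !mul1r mulr1 => <-.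
by apply: eq_Rint => x _; rewrite mul1r.
Qed.

(** One integration by parts with [Q'' = 4 k^2 Q - Q^2]: the terms in [int Q^2 f] cancel and the
    linear part reduces to [- 4 k^2 int Q f]. *)
Lemma expand_energy {f d} : H1 f d ->
  energy (fun x => Q x + f x) (fun x => dQ x + d x) =
  energy Q dQ - 4 * k ^+ 2 * \int[mu]_x (Q x * f x) + 1 / 2 * mass d
  - \int[mu]_x (Q x * f x ^+ 2) - 1 / 3 * \int[mu]_x (f x ^+ 3).
Proof.
move=> Hf; have [acf sf sd] := Hf; have sQ := sqi_Q k k0; have sdQ := sqi_dQ k k0.
have bQ g : intg setT g -> intg setT (fun x => Q x * g x).
  apply: (intg_bM (6 * k ^+ 2)) => //; first by apply: cont_meas; exact: Q_cont.
  by move=> x _; rewrite ger0_norm ?Q_le// ltW// Q_gt0.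
have i1 := sqiM mT sQ sf; have i2 := bQ _ i1; have i3 := bQ _ sf.2.
have i4 := H1_cube Hf; have i5 := H1_cube H1_Q.
have e1 : \int[mu]_x (dQ x * d x) =
    - (4 * k ^+ 2) * \int[mu]_x (Q x * f x) + \int[mu]_x (Q x * (Q x * f x)).
  have cE : continuous (fun x => 4 * k ^+ 2 * Q x - Q x ^+ 2).
    move=> x; apply: cvgB; last exact: cvgM (@Q_cont _ k x) (@Q_cont _ k x).
    by apply: cvgMr; exact: Q_cont.
  have acF := acM (ac_C1 (dQ_d k) cE) acf.
  have E x : (4 * k ^+ 2 * Q x - Q x ^+ 2) * f x + dQ x * d x =
      4 * k ^+ 2 * (Q x * f x) + (-1 * (Q x * (Q x * f x)) + 1 * (dQ x * d x)) by ring.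
  have := ac_int0 acF (sqiM mT sdQ sf); under eq_Rint do rewrite E.
  have id := sqiM mT sdQ sd.
  move=> /(_ (eq_intg _ mT (fun x _ => E x) (intgD mT (intgZ _ mT i1) (intgD mT (intgZ _ mT i2) (intgZ 1 mT id))))).
  by rewrite Rint3//; lra.
have e2 := Rint_quad 1 sdQ sd.
have e3 : \int[mu]_x ((Q x + f x) ^+ 3) = \int[mu]_x (Q x ^+ 3) +
    (3 * \int[mu]_x (Q x * (Q x * f x)) + 3 * \int[mu]_x (Q x * f x ^+ 2)) + \int[mu]_x (f x ^+ 3).
  transitivity (\int[mu]_x ((1 * Q x ^+ 3 + (3 * (Q x * (Q x * f x)) + 3 * (Q x * f x ^+ 2))) + f x ^+ 3)).
    by apply: eq_Rint => x _; ring.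
  rewrite RintD//; first by rewrite Rint3// mul1r.
  by apply: intgD => //; [exact: intgZ|apply: intgD => //; exact: intgZ].
have e4 : \int[mu]_x ((dQ x + d x) ^+ 2) = \int[mu]_x ((dQ x + 1 * d x) ^+ 2).
  by apply: eq_Rint => x _; rewrite mul1r.
rewrite /energy e3 e4 e2 e1 /mass; lra.
Qed.

(** Mass is not conserved, so [int Q f] is not prescribed: the mass bound controls it from above,
    and the energy bound, whose linear term is [- 4 k^2 int Q f], from below. In
    [energy + 2 k^2 mass] the linear terms cancel, and [coercive] bounds the remaining quadratic
    form from below up to [K (int Q f)^2], which is [O(a^2 + X^2)] with [X = h1sq f d]; the
    smallness [nu] absorbs the [X^2]. *)
Lemma static_core : exists nu C : R, [/\ 0 < nu, 0 < C &
  forall f d a, H1 f d -> f node = f (- node) -> h1sq f d <= nu -> 0 <= a ->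
  mass (fun x => Q x + f x) <= mass Q + a ->
  energy (fun x => Q x + f x) (fun x => dQ x + d x) <= energy Q dQ + a ->
  energy (fun x => Q x + f x) (fun x => dQ x + d x) + 2 * k ^+ 2 * mass (fun x => Q x + f x)
    <= energy Q dQ + 2 * k ^+ 2 * mass Q + a ^+ 2 ->
  h1sq f d <= C * a ^+ 2].
Proof.
have [de [K [de0 K0 co]]] := coercive k k0.
have k2 : 0 < k ^+ 2 by exact: exprn_gt0.
(* Large enough that the two one-sided bounds both read [|int Q f| <= C2 (a + X)]. *)
pose C2 := 1 + (6 * k ^+ 2 + 2) / (4 * k ^+ 2) + 1 / (4 * k ^+ 2).
have k4 : 0 < 4 * k ^+ 2 by lra.
have u1 : 0 < (6 * k ^+ 2 + 2) / (4 * k ^+ 2) by rewrite divr_gt0//; lra.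
have u2 : 0 < 1 / (4 * k ^+ 2) by rewrite divr_gt0.
have C20 : 0 < C2 by rewrite /C2; lra.
have C2a : 1 <= C2 by rewrite /C2; lra.
have C2b : 6 * k ^+ 2 + 2 <= 4 * k ^+ 2 * C2.
  have -> : 4 * k ^+ 2 * C2 = 4 * k ^+ 2 + (6 * k ^+ 2 + 2) + 1 by rewrite /C2; field; rewrite gt_eqF.
  lra.
have C2c : 1 <= 4 * k ^+ 2 * C2 by lra.
(* A sup bound for [f], secured by [nu <= sg ^+ 2 / 2]; it keeps the cubic term below [de / 4] times
   the squared norm. *)
pose sg := Num.min 1 (de / 4).
have sg0 : 0 < sg by rewrite lt_min ltr01 divr_gt0.
have sg1 : sg <= 1 by rewrite ge_min lexx.
have sg2 : sg <= de / 4 by rewrite ge_min lexx orbT.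
pose nu := Num.min (sg ^+ 2 / 2) (de / (8 * K * C2 ^+ 2)).
have KC : 0 < 8 * K * C2 ^+ 2 by rewrite mulr_gt0 ?exprn_gt0// mulr_gt0.
have nu0 : 0 < nu by rewrite lt_min !divr_gt0// exprn_gt0.
have nu1 : nu <= sg ^+ 2 / 2 by rewrite ge_min lexx.
have nu2 : nu * (8 * K * C2 ^+ 2) <= de.
  by rewrite -ler_pdivlMr// ge_min lexx orbT.
exists nu, ((4 + 4 * K * C2 ^+ 2) / de); split => //.
  by rewrite divr_gt0// addr_gt0// mulr_gt0 ?exprn_gt0// mulr_gt0.
move=> f d a Hf fn Xn a0.
have [acf sf sd] := Hf.
rewrite expand_mass// expand_energy//.
have := co _ _ acf sf sd fn; rewrite -/(mass f) -/(mass d) -/(h1sq f d).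
have bf x : `|f x| <= sg.
  apply: sqr_le_norm; first exact: ltW.
  by have := H1_sup Hf x; lra.
have [_ J] := cube_intg sg bf sf.
have iQ : intg setT (fun x => Q x * f x ^+ 2).
  apply: (intg_bM (6 * k ^+ 2)) => //; [by apply: cont_meas; exact: Q_cont| |exact: sf.2].
  by move=> x _; rewrite ger0_norm ?Q_le// ltW// Q_gt0.
have P1 : \int[mu]_x (Q x * f x ^+ 2) <= 6 * k ^+ 2 * mass f.
  rewrite -RintZ//; last exact: sf.2.
  apply: le_Rint => //; first by apply: intgZ => //; exact: sf.2.
  by move=> x _; rewrite ler_wpM2r ?sqr_ge0// Q_le.
have -> : \int[mu]_x (pot x * f x ^+ 2) = 4 * k ^+ 2 * mass f - 2 * \int[mu]_x (Q x * f x ^+ 2).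
  have i2 := sf.2.
  rewrite -(RintZ _ mT i2) -(RintZ 2 mT iQ) -RintB//; [|exact: intgZ|exact: intgZ].
  by apply: eq_Rint => x _; rewrite /(pot); ring.
have A0 := mass_ge0 f; have B0 := mass_ge0 d.
have XE : h1sq f d = mass f + mass d by [].
move: J P1 A0 B0 XE Xn; rewrite ler_norml.
set S := \int[mu]_x (Q x * f x); set P := \int[mu]_x (Q x * f x ^+ 2).
set J := \int[mu]_x (f x ^+ 3); set X := h1sq f d; set A := mass f; set B := mass d.
set MQ := mass Q; set EQ := energy Q dQ.
move=> /andP[J1 J2] P1 A0 B0 XE Xn co' hM hE hF.
have X0 : 0 <= X by rewrite XE addr_ge0.
have JA : sg * A <= A by rewrite ler_piMl.
have JX : sg * A <= sg * X by rewrite ler_pM2l// XE lerDl.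
have S1 : S <= C2 * (a + X).
  have h : 1 * (a + X) <= C2 * (a + X) by rewrite ler_wpM2r// addr_ge0.
  clear -h hM A0 a0 X0; lra.
have S2 : - (C2 * (a + X)) <= S.
  rewrite -(ler_pM2l k4) mulrN mulrA.
  have h1 : (6 * k ^+ 2 + 2) * X <= 4 * k ^+ 2 * C2 * X by rewrite ler_wpM2r.
  have h2 : 1 * a <= 4 * k ^+ 2 * C2 * a by rewrite ler_wpM2r.
  have h3 : k ^+ 2 * A <= k ^+ 2 * X by rewrite ler_pM2l// XE lerDl.
  clear -h1 h2 h3 hM hE P1 A0 B0 XE J1 J2 JA JX hF a0 X0 k2; lra.
have SS : S ^+ 2 <= C2 ^+ 2 * (2 * a ^+ 2 + 2 * X ^+ 2).
  have : `|S| <= C2 * (a + X) by rewrite ler_norml S2.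
  move=> h; have : S ^+ 2 <= (C2 * (a + X)) ^+ 2.
    by rewrite -(real_normK (num_real S)) lerXn2r ?nnegrE// mulr_ge0 ?addr_ge0// ltW.
  move=> /le_trans; apply; rewrite exprMn ler_wpM2l ?sqr_ge0//.
  by have := sqr_ge0 (a - X); clear; lra.
have KS : K * S ^+ 2 <= K * (C2 ^+ 2 * (2 * a ^+ 2 + 2 * X ^+ 2)) by rewrite ler_pM2l.
have XX : X * X <= nu * X by rewrite ler_wpM2r.
have h1 : K * C2 ^+ 2 * (X * X) <= K * C2 ^+ 2 * (nu * X).
  by rewrite ler_pM2l// mulr_gt0// exprn_gt0.
have h2 : nu * (8 * K * C2 ^+ 2) * X <= de * X by rewrite ler_wpM2r.
have h3 : sg * X <= de / 4 * X by rewrite ler_wpM2r.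
rewrite mulrAC ler_pdivlMr//.
by clear -co' hM hE hF KS h1 h2 h3 J1 J2 JX A0 B0 XE X0 P1; lra.
Qed.

Lemma dQ_bnd x : `|dQ x| <= 12 * k ^+ 3.
Proof.
apply: le_trans (dQ_le k k0 x) _; have -> : 12 * k ^+ 3 = 2 * k * (6 * k ^+ 2) by ring.
by rewrite ler_pM2l ?mulr_gt0// Q_le.
Qed.

Lemma Q_lip x y : `|Q y - Q x| <= 12 * k ^+ 3 * `|y - x|.
Proof. by apply: (ac_lip (12 * k ^+ 3) (ac_Q k)); exact: dQ_bnd. Qed.

Lemma dQ_lip x y : `|dQ y - dQ x| <= 60 * k ^+ 4 * `|y - x|.
Proof.
have cE : continuous (fun x => 4 * k ^+ 2 * Q x - Q x ^+ 2).
  move=> z; apply: cvgB; last exact: cvgM (@Q_cont _ k z) (@Q_cont _ k z).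
  by apply: cvgMr; exact: Q_cont.
apply: (ac_lip (60 * k ^+ 4) (ac_C1 (dQ_d k) cE)) => z.
have q0 := Q_gt0 k k0 z; have q1 := Q_le k z.
have k2 : 0 < k ^+ 2 by exact: exprn_gt0.
have -> : 60 * k ^+ 4 = 4 * k ^+ 2 * (6 * k ^+ 2) + (6 * k ^+ 2) ^+ 2 by ring.
have h1 : 4 * k ^+ 2 * Q z <= 4 * k ^+ 2 * (6 * k ^+ 2) by rewrite ler_pM2l// mulr_gt0.
have h2 : Q z ^+ 2 <= (6 * k ^+ 2) ^+ 2 by rewrite lerXn2r ?nnegrE ?(ltW q0)// mulr_ge0// ltW.
have h3 : 0 < 4 * k ^+ 2 * Q z by rewrite mulr_gt0// mulr_gt0.
by have h4 := sqr_ge0 (Q z); rewrite ler_norml; lra.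
Qed.

(** Of the two factors in the square, one is bounded by a Lipschitz constant times [|s|], the other
    by [Q (x + s) + Q x], which is integrable. This linear rate suffices for choosing a small
    shift. *)
Lemma Q_shift_h1sq : exists2 C : R, 0 < C & forall s,
  h1sq (fun x => Q (x + s) - Q x) (fun x => dQ (x + s) - dQ x) <= C * `|s|.
Proof.
have iQ := Q_intg k k0; set I := \int[mu]_x Q x.
have I0 : 0 <= I by apply: Rint_ge0 => x _; exact: ltW (Q_gt0 k k0 x).
exists (24 * k ^+ 3 * I + 240 * k ^+ 5 * I + 1).
  have h3 : 0 <= k ^+ 3 * I by rewrite mulr_ge0// exprn_ge0// ltW.
  have h5 : 0 <= k ^+ 5 * I by rewrite mulr_ge0// exprn_ge0// ltW.
  by lra.
move=> s; have [iQs _] := Rint_shift s iQ.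
have [_ sQs sdQs] := H1B (H1_shift s H1_Q) H1_Q.
have key f (L M : R) : 0 <= L -> (forall x y, `|f y - f x| <= L * `|y - x|) -> (forall x, `|f x| <= M * Q x) ->
   sqi setT (fun x => f (x + s) - f x) -> mass (fun x => f (x + s) - f x) <= L * `|s| * (2 * M * I).
  move=> L0 fL fM [_ i2].
  have i3 : intg setT (fun x => M * Q (x + s) + M * Q x) by apply: intgD => //; exact: intgZ.
  have -> : L * `|s| * (2 * M * I) = \int[mu]_x (L * `|s| * (M * Q (x + s) + M * Q x)).
    rewrite (RintZ _ mT i3) (RintD mT (intgZ M mT iQs) (intgZ M mT iQ)).
    by rewrite (RintZ M mT iQs) (RintZ M mT iQ) (Rint_shift s iQ).2 -/I; ring.
  apply: le_Rint => //; first exact: intgZ.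
  move=> x _; rewrite -(real_normK (num_real (_ - _))) expr2 ler_pM//.
    by have := fL x (x + s); rewrite addrAC subrr add0r.
  by rewrite (le_trans (ler_normB _ _))// lerD.
have h1 := key Q (12 * k ^+ 3) 1 _ Q_lip _ sQs.
have h2 := key dQ (60 * k ^+ 4) (2 * k) _ dQ_lip (dQ_le k k0) sdQs.
have g1 : mass (fun x => Q (x + s) - Q x) <= 12 * k ^+ 3 * `|s| * (2 * 1 * I).
  apply: h1; first by have := exprn_ge0 3 (ltW k0); lra.
  by move=> x; rewrite mul1r ger0_norm// ltW// Q_gt0.
have g2 : mass (fun x => dQ (x + s) - dQ x) <= 60 * k ^+ 4 * `|s| * (2 * (2 * k) * I).
  by apply: h2; have := exprn_ge0 4 (ltW k0); lra.
have s0 := normr_ge0 s; rewrite /h1sq; lra.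
Qed.

Lemma Q_dec x y : 0 <= x -> x < y -> Q y < Q x.
Proof.
move=> x0 xy; have k2 : 0 < 6 * k ^+ 2 by rewrite mulr_gt0// exprn_gt0.
rewrite /(Q) ltr_pM2l// /(sc) ltrD2l ltrN2.
have h := th_homo k k0 x y xy.
have h0 : 0 <= th x.
  by rewrite -(th0 k); move: x0; rewrite le_eqVlt => /orP[/eqP<-//|/(th_homo k k0)/ltW].
by rewrite ltrXn2r.
Qed.

Lemma Q_gap r : 0 < r -> Q (r + node) < Q (r - node).
Proof.
move=> r0; have n0 := node_gt0 k k0; have [h|h] := leP node r.
  by apply: Q_dec; lra.
by rewrite -(QN k (r - node)) opprB; apply: Q_dec; lra.
Qed.

(** For the soliton, [s |-> Q (node + s) - Q (- node + s)] is negative at [r] and positive at [- r].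
    A function uniformly close to [Q] inherits the signs, and the intermediate value theorem gives a
    shift in [[- r, r]], small enough to cost little in the norm. *)
Lemma orbit_shift nu : 0 < nu -> exists2 de : R, 0 < de & forall v dv, H1 v dv ->
  h1sq (fun x => v x - Q x) (fun x => dv x - dQ x) <= de ->
  exists s, v (node + s) = v (- node + s) /\
    h1sq (fun x => v (x + s) - Q x) (fun x => dv (x + s) - dQ x) <= nu.
Proof.
move=> nu0; have [C C0 HC] := Q_shift_h1sq.
pose r := nu / (4 * C); have r0 : 0 < r by rewrite divr_gt0// mulr_gt0.
have Cr : C * r = nu / 4 by rewrite /r; field; rewrite gt_eqF.
pose gap := (Q (r - node) - Q (r + node)) / 4.
have gap0 : 0 < gap by rewrite divr_gt0// subr_gt0 Q_gap.
pose de := Num.min (nu / 4) (gap ^+ 2 / 2).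
have de1 : de <= nu / 4 by rewrite ge_min lexx.
have de2 : de <= gap ^+ 2 / 2 by rewrite ge_min lexx orbT.
exists de; first by rewrite lt_min !divr_gt0// exprn_gt0.
move=> v dv Hv hN; have Hd := H1B Hv H1_Q.
have close x : `|v x - Q x| <= gap.
  apply: sqr_le_norm; first exact: ltW.
  by have := H1_sup Hd x; lra.
have cv : continuous v by have [[]] := Hv.
pose g s := v (node + s) - v (- node + s).
have cg : continuous g.
  move=> s; apply: cvgB.
    apply: (@continuous_comp _ _ _ (fun s => node + s) v); last exact: cv.
    by apply: cvgD; [exact: cvg_cst|exact: cvg_id].
  apply: (@continuous_comp _ _ _ (fun s => - node + s) v); last exact: cv.
  by apply: cvgD; [exact: cvg_cst|exact: cvg_id].
have gr : g r <= 0.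
  rewrite /g; have := close (node + r); have := close (- node + r).
  rewrite !ler_norml => /andP[h1 h2] /andP[h3 h4].
  by move: h1 h2 h3 h4; rewrite ![_ + r]addrC /gap; lra.
have gr' : 0 <= g (- r).
  rewrite /g; have := close (node + - r); have := close (- node + - r).
  have -> : Q (node + - r) = Q (r - node) by rewrite -QN; congr (Q _); ring.
  have -> : Q (- node + - r) = Q (r + node) by rewrite -QN; congr (Q _); ring.
  rewrite !ler_norml => /andP[h1 h2] /andP[h3 h4].
  by move: h1 h2 h3 h4; rewrite /gap; lra.
have rr : - r <= r by lra.
have [|s sI gs] := @IVT _ g (- r) r 0 rr (continuous_subspaceT cg).
  by rewrite ge_min le_max gr gr' orbT.
exists s; split; first by apply/eqP; rewrite -subr_eq0; apply/eqP.
have sr : `|s| <= r by rewrite ler_norml; move: sI; rewrite in_itv.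
have -> : h1sq (fun x => v (x + s) - Q x) (fun x => dv (x + s) - dQ x) =
    h1sq (fun x => (v (x + s) - Q (x + s)) + (Q (x + s) - Q x))
         (fun x => (dv (x + s) - dQ (x + s)) + (dQ (x + s) - dQ x)).
  by apply: eq_h1sq => x; ring.
have := h1sqD_le (H1_shift s Hd) (H1B (H1_shift s H1_Q) H1_Q).
rewrite (h1sq_shift s Hd); have := HC s.
have : C * `|s| <= C * r by rewrite ler_pM2l.
lra.
Qed.

End Static.

(** * Propagation of the stability estimate in time *)

Section Bootstrap.
Context {R : realType}.
Local Notation mu := (@lebesgue_measure R).
Implicit Types (D : set R) (f g d e v dv : R -> R) (x y t a b s T : R).

Definition clamp T t : R := Num.max 0 (Num.min t T).

Lemma clamp_itv {T} t : 0 <= T -> 0 <= clamp T t <= T.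
Proof. by move=> T0; rewrite /clamp le_max lexx/= ge_max T0 ge_min lexx orbT. Qed.

Lemma clamp_id {T} t : 0 <= t <= T -> clamp T t = t.
Proof. by move=> /andP[t0 tT]; rewrite /clamp min_l// max_r. Qed.

Lemma clamp_lip T t s : `|clamp T t - clamp T s| <= `|t - s|.
Proof.
suff H a b : a <= b -> `|clamp T b - clamp T a| <= `|b - a|.
  by have [/H|/ltW/H] := leP s t; rewrite // distrC (distrC t).
rewrite /clamp => ab; rewrite (ger0_norm (_ : 0 <= b - a)) ?subr_ge0//.
by rewrite ler_norml !maxEle !minEle; apply/andP; split; do !case: ifPn; rewrite -?ltNge => *; lra.
Qed.

(** Connectedness of [[0, T]]: composed with [clamp T], the indicator of [P] would be continuous on
    the line and take the values 1 and 0 without taking [1 / 2]. *)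
Lemma locally_constant_itv (P : R -> Prop) T : 0 <= T ->
  (forall t, 0 <= t <= T -> exists2 de : R, 0 < de &
    forall s, 0 <= s <= T -> `|s - t| < de -> (P s <-> P t)) ->
  P 0 -> forall t, 0 <= t <= T -> P t.
Proof.
move=> T0 H P0 t tT; apply: contrapT => nPt.
pose f s : R := if `[< P (clamp T s) >] then 1 else 0.
have cf : continuous f.
  move=> s; have [de de0 Hd] := H _ (clamp_itv s T0).
  apply: cvg_near_cst; near=> r; rewrite /f.
  have [|h1 h2] := Hd (clamp T r) (clamp_itv r T0) _.
    apply: le_lt_trans (clamp_lip _ _ _) _; rewrite ltr_norml.
    have : r < s + de by near: r; apply: lt_nbhsl; rewrite ltrDl.
    have : s - de < r by near: r; apply: lt_nbhsr; rewrite ltrBlDr ltrDl.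
    by move=> ? ?; apply/andP; split; lra.
  by congr (if _ then _ else _); apply/asboolP/asboolP.
have f0 : f 0 = 1 by rewrite /f clamp_id ?lexx//; case: asboolP.
have ft : f t = 0 by rewrite /f clamp_id//; case: asboolP.
have [t0 _] := andP tT.
have [|c _] := @IVT _ f 0 t (1 / 2) t0 (continuous_subspaceT cf).
  by rewrite f0 ft ge_min le_max; lra.
by rewrite /f; case: ifP => _; lra.
Unshelve. all: by end_near. Qed.

Variable k : R.
Hypothesis k0 : 0 < k.
Local Notation Q := (Q k).
Local Notation dQ := (dQ k).
Local Notation node := (node k).

(** A squared [H^1] distance to the translate centred at [y]; hence the bounds by squares and the
    factors 2 in [dist_triangle]. *)
Definition dist v dv y : R := h1sq (fun x => v x - Q (x - y)) (fun x => dv x - dQ (x - y)).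

Lemma H1_Qs y : H1 (fun x => Q (x - y)) (fun x => dQ (x - y)).
Proof. have h := H1_shift (- y) (H1_Q k k0). exact: h. Qed.

Lemma dist_shift v dv y : H1 v dv ->
  dist v dv y = h1sq (fun x => v (x + y) - Q x) (fun x => dv (x + y) - dQ x).
Proof.
move=> Hv; rewrite /dist -(h1sq_shift y (H1B Hv (H1_Qs y))).
by apply: eq_h1sq => x; rewrite addrK.
Qed.

Lemma h1sq_sym f d g e : h1sq (fun x => f x - g x) (fun x => d x - e x) =
  h1sq (fun x => g x - f x) (fun x => e x - d x).
Proof. by rewrite -h1sqN; apply: eq_h1sq => x; rewrite opprB. Qed.

Lemma dist_triangle {v dv g e} y : H1 v dv -> H1 g e ->
  dist v dv y <= 2 * h1sq (fun x => v x - g x) (fun x => dv x - e x) + 2 * dist g e y.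
Proof.
move=> Hv Hg; apply: le_trans (h1sqD_le (H1B Hv Hg) (H1B Hg (H1_Qs y))).
by rewrite le_eqVlt; apply/orP/or_introl/eqP/eq_h1sq => x; rewrite addrA subrK.
Qed.

Lemma mass_shift s {f} : sqi setT f -> mass (fun x => f (x + s)) = mass f.
Proof. by move=> sf; have [_] := sqi_shift s sf. Qed.

Lemma energy_shift s {f d} : H1 f d ->
  energy (fun x => f (x + s)) (fun x => d (x + s)) = energy f d.
Proof.
move=> Hf; have [_ sf sd] := Hf; rewrite /energy.
by have [_ ->] := sqi_shift s sd; have [_ ->] := Rint_shift s (H1_cube Hf).
Qed.

Lemma static : exists de C : R, [/\ 0 < de, 0 < C & forall v dv y a,
  H1 v dv -> dist v dv y <= de -> 0 <= a -> mass v <= mass Q + a ->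
  energy v dv <= energy Q dQ + a ->
  energy v dv + 2 * k ^+ 2 * mass v <= energy Q dQ + 2 * k ^+ 2 * mass Q + a ^+ 2 ->
  exists z, dist v dv z <= C * a ^+ 2].
Proof.
have [nu [C [nu0 C0 core]]] := static_core k k0.
have [de de0 orb] := orbit_shift k k0 nu nu0.
exists de, C; split => // v dv y a Hv; rewrite dist_shift// => hd a0 hM hE hF.
have [s [vs hs]] := orb _ _ (H1_shift y Hv) hd.
have Hs := H1_shift s (H1_shift y Hv).
have [_ sv _] := Hv; have [_ svy _] := H1_shift y Hv.
exists (y + s); rewrite dist_shift//.
pose f x := v (x + s + y) - Q x; pose d x := dv (x + s + y) - dQ x.
have -> : h1sq (fun x => v (x + (y + s)) - Q x) (fun x => dv (x + (y + s)) - dQ x) = h1sq f d.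
  by apply: eq_h1sq => x; rewrite /f /d addrA addrAC.
have e1 : (fun x => Q x + f x) = (fun x => v (x + s + y)).
  by apply/funext => x; rewrite /f; ring.
have e2 : (fun x => dQ x + d x) = (fun x => dv (x + s + y)).
  by apply/funext => x; rewrite /d; ring.
apply: core => //.
- exact: H1B Hs (H1_Q k k0).
- by rewrite /f QN vs.
- by rewrite e1 (mass_shift s svy) (mass_shift y sv).
- by rewrite e1 e2 (energy_shift s (H1_shift y Hv)) (energy_shift y Hv).
- by rewrite e1 e2 (mass_shift s svy) (mass_shift y sv) (energy_shift s (H1_shift y Hv)) (energy_shift y Hv).
Qed.

(** The soliton is a critical point of [energy + 2 k^2 mass]: a perturbation of size [a] moves this
    combination by [O(a^2)], although it moves mass and energy by [O(a)]. *)
Lemma initial : exists2 C : R, 0 < C & forall v dv y a,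
  H1 v dv -> dist v dv y <= a ^+ 2 -> 0 <= a <= 1 ->
  [/\ mass v <= mass Q + C * a, energy v dv <= energy Q dQ + C * a &
  energy v dv + 2 * k ^+ 2 * mass v <= energy Q dQ + 2 * k ^+ 2 * mass Q + (C * a) ^+ 2].
Proof.
have MQ0 := mass_ge0 Q; have k2 := sqr_ge0 k.
pose C := (1 + 4 * k ^+ 2) * (1 + mass Q) * 2 + 4 + 4 * k ^+ 2.
have C1 : 1 <= C.
  have : 0 <= (1 + 4 * k ^+ 2) * (1 + mass Q) by rewrite mulr_ge0// addr_ge0// mulr_ge0.
  by rewrite /C; lra.
exists C; first by lra.
move=> v dv y a Hv; rewrite dist_shift// => hd /andP[a0 a1].
pose f x := v (x + y) - Q x; pose d x := dv (x + y) - dQ x.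
have Hf : H1 f d := H1B (H1_shift y Hv) (H1_Q k k0).
have [_ sv _] := Hv; have [_ sf sd] := Hf.
rewrite -(mass_shift y sv) -(energy_shift y Hv).
have -> : (fun x => v (x + y)) = (fun x => Q x + f x) by apply/funext => x; rewrite /f; ring.
have -> : (fun x => dv (x + y)) = (fun x => dQ x + d x) by apply/funext => x; rewrite /d; ring.
rewrite (expand_mass k k0 sf) (expand_energy k k0 Hf).
have XE : mass f + mass d <= a ^+ 2 by exact: hd.
have A0 := mass_ge0 f; have B0 := mass_ge0 d.
have aa : a ^+ 2 <= a by rewrite expr2 ler_piMl.
have bf x : `|f x| <= 2.
  apply: sqr_le_norm => //.
  by have := H1_sup Hf x; rewrite /h1sq; lra.
have [_ ] := cube_intg 2 bf sf.
have P0 : 0 <= \int[mu]_x (Q x * f x ^+ 2).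
  by apply: Rint_ge0 => x _; rewrite mulr_ge0 ?sqr_ge0// ltW// Q_gt0.
have := Rint_CS measurableT (sqi_Q k k0) sf; rewrite -/(mass Q) -/(mass f).
move: P0; set S := \int[mu]_x (Q x * f x); set P := \int[mu]_x (Q x * f x ^+ 2).
set J := \int[mu]_x (f x ^+ 3).
move=> P0 CS; rewrite ler_norml => /andP[J1 J2].
have SS : `|S| <= (1 + mass Q) * a.
  apply: sqr_le_norm; first by rewrite mulr_ge0// addr_ge0.
  apply: (le_trans CS); rewrite exprMn.
  have h1 : mass Q * mass f <= mass Q * a ^+ 2 by rewrite ler_wpM2l//; lra.
  have h2 : mass Q * a ^+ 2 <= (1 + mass Q) ^+ 2 * a ^+ 2.
    by rewrite ler_wpM2r ?sqr_ge0//; have := sqr_ge0 (mass Q); lra.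
  lra.
move: SS; rewrite ler_norml => /andP[S1 S2].
have kS : - (k ^+ 2 * S) <= k ^+ 2 * ((1 + mass Q) * a).
  by rewrite -mulrN ler_wpM2l//; lra.
have kA : k ^+ 2 * mass f <= k ^+ 2 * a ^+ 2 by rewrite ler_wpM2l//; lra.
have kP : k ^+ 2 * a ^+ 2 <= k ^+ 2 * a by rewrite ler_wpM2l.
have m1 : 0 <= mass Q * a by rewrite mulr_ge0.
have m2 : 0 <= k ^+ 2 * a by rewrite mulr_ge0.
have m3 : 0 <= k ^+ 2 * (mass Q * a) by rewrite mulr_ge0.
have m4 : 0 <= k ^+ 2 * a ^+ 2 by rewrite mulr_ge0// sqr_ge0.
split.
- by rewrite /C; lra.
- by rewrite /C; lra.
- have h : C * a ^+ 2 <= (C * a) ^+ 2.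
    by rewrite exprMn ler_wpM2r ?sqr_ge0// expr2 ler_peMl//; lra.
  have : (4 + 4 * k ^+ 2) * a ^+ 2 <= C * a ^+ 2.
    rewrite ler_wpM2r ?sqr_ge0// /C; have : 0 <= (1 + 4 * k ^+ 2) * (1 + mass Q) by rewrite mulr_ge0// addr_ge0// mulr_ge0.
    lra.
  lra.
Qed.

(** Being within [C1 a^2] of some translate is an open and closed condition in time: if it holds at
    one of two nearby times, the other time is within the threshold [de] of [static], which brings
    the distance back below [C1 a^2]. *)
Lemma bootstrap : exists a0 C : R, [/\ 0 < a0, 0 < C & forall T (v dv : R -> R -> R) y a,
  0 <= T -> (forall t, 0 <= t <= T -> H1 (v t) (dv t)) ->
  (forall t, 0 <= t <= T -> forall eps : R, 0 < eps -> exists2 de : R, 0 < de &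
    forall s, 0 <= s <= T -> `|s - t| < de ->
    h1sq (fun x => v s x - v t x) (fun x => dv s x - dv t x) <= eps) ->
  (forall t, 0 <= t <= T -> mass (v t) <= mass (v 0) /\
    energy (v t) (dv t) <= energy (v 0) (dv 0)) ->
  0 <= a <= a0 -> dist (v 0) (dv 0) y <= a ^+ 2 ->
  forall t, 0 <= t <= T -> exists z, dist (v t) (dv t) z <= C * a ^+ 2].
Proof.
have [de [C [de0 C0 st]]] := static; have [C' C'0 ini] := initial.
pose C1 := C * C' ^+ 2 + 1.
have CC : 0 < C * C' ^+ 2 by rewrite mulr_gt0// exprn_gt0.
have C10 : 0 < C1 by rewrite /C1; lra.
pose a0 := Num.min 1 (de / (4 * C1)).
have a00 : 0 < a0 by rewrite lt_min ltr01 divr_gt0// mulr_gt0.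
have a01 : a0 <= 1 by rewrite ge_min lexx.
have a02 : 4 * C1 * a0 <= de.
  by rewrite mulrC -ler_pdivlMr ?mulr_gt0// ge_min lexx orbT.
exists a0, C1; split => // T v dv y a T0 Hv cv mono /andP[ap aa] h0.
have a1 : a <= 1 by lra.
have a2 : a ^+ 2 <= a by rewrite expr2 ler_piMl.
have Ca : 2 * (C1 * a ^+ 2) <= de / 2.
  have : C1 * a ^+ 2 <= C1 * a0 by rewrite ler_pM2l//; lra.
  lra.
have T00 : (0 : R) <= 0 <= T by rewrite lexx T0.
have [i1 i2 i3] := ini _ _ _ _ (Hv _ T00) h0 (introT andP (conj ap a1)).
have step t s z : 0 <= s <= T -> 0 <= t <= T ->
    h1sq (fun x => v s x - v t x) (fun x => dv s x - dv t x) <= de / 4 ->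
    dist (v t) (dv t) z <= C1 * a ^+ 2 -> exists z', dist (v s) (dv s) z' <= C1 * a ^+ 2.
  move=> sT tT close hz.
  have hd : dist (v s) (dv s) z <= de.
    have h := dist_triangle z (Hv s sT) (Hv t tT).
    by clear -h close hz Ca; lra.
  have [m1 m2] := mono s sT.
  have k2 := mulr_ge0 (ler0n R 2) (sqr_ge0 k).
  have m3 := ler_wpM2l k2 m1.
  have b0 : 0 <= C' * a by rewrite mulr_ge0// ltW.
  have h3 : energy (v s) (dv s) + 2 * k ^+ 2 * mass (v s) <=
      energy Q dQ + 2 * k ^+ 2 * mass Q + (C' * a) ^+ 2.
    by apply: le_trans i3; exact: lerD.
  have [z' hz'] := st _ _ _ (C' * a) (Hv s sT) hd b0 (le_trans m1 i1) (le_trans m2 i2) h3.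
  exists z'; apply: (le_trans hz'); rewrite exprMn mulrA ler_wpM2r ?sqr_ge0//.
  by rewrite /C1 lerDl.
apply: locally_constant_itv => //; last first.
  by exists y; apply: (le_trans h0); rewrite ler_peMl ?sqr_ge0// /C1; lra.
move=> t tT; have [r r0 Hr] := cv t tT (de / 4) (divr_gt0 de0 (ltr0Sn _ _)).
exists r => // s sT /(Hr s sT) close; split => -[z hz]; last exact: (step _ _ _ sT tT close hz).
by apply: (step _ _ _ tT sT _ hz); rewrite h1sq_sym.
Qed.

End Bootstrap.

(** * Test functions, the equation tested in space, and duality in [L^2] of the half-line *)

Section TestFunctions.
Context {R : realType}.
Local Notation mu := (@lebesgue_measure R).
Local Notation P := (@pos_half_line R).
Import HBNNSimple.
Implicit Types (D : set R) (f g chi : R -> R) (phi w : R -> R -> R) (x y t a b c s r e p h eta T K M eps de : R).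

(* No measurability is needed: a simple function below f, set to 0 on the null
   set, lies below g and has the same integral. *)
Lemma eq_ae_Rint {D f} g : {ae mu, forall x, D x -> f x = g x} ->
  \int[mu]_(x in D) f x = \int[mu]_(x in D) g x.
Proof.
suff H (p q : R -> \bar R) : (forall x, 0 <= p x)%E -> (forall x, 0 <= q x)%E ->
    {ae mu, forall x, p x = q x} -> (\int[mu]_x p x <= \int[mu]_x q x)%E.
  have H' (p q : R -> \bar R) : (forall x, 0 <= p x)%E -> (forall x, 0 <= q x)%E ->
      {ae mu, forall x, p x = q x} -> (\int[mu]_x p x = \int[mu]_x q x)%E.
    by move=> p0 q0 pq; apply/le_anti; rewrite !H//; apply: aeS pq => x ->.
  move=> fg; rewrite /Rintegral integralE [in RHS]integralE; congr (fine (_ - _)).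
    rewrite integral_mkcond [RHS]integral_mkcond; apply: H' => [x|x|].
    - by rewrite patchE; case: ifP.
    - by rewrite patchE; case: ifP.
    - by apply: aeS fg => x h; rewrite !patchE; case: ifPn => // /set_mem/h e; rewrite !funeposE e.
  rewrite integral_mkcond [RHS]integral_mkcond; apply: H' => [x|x|].
  - by rewrite patchE; case: ifP.
  - by rewrite patchE; case: ifP.
  - by apply: aeS fg => x h; rewrite !patchE; case: ifPn => // /set_mem/h e; rewrite !funenegE e.
move=> p0 q0 [N [mN N0 sN]]; rewrite !ge0_integralTE//; apply: ge_ereal_sup => _ [h hp <-].
pose h' := mul_nnsfun h (indic_nnsfun R (measurableC mN)).
have E x : h' x = h x * \1_(~` N) x by [].
have -> : sintegral mu h = sintegral mu h'.
  rewrite -!integralT_nnsfun; apply: ge0_ae_eq_integral => //.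
  - by apply/measurable_EFinP.
  - by apply/measurable_EFinP; exact: (@measurable_funPT _ _ _ _ h').
  - by move=> x _; rewrite lee_fin.
  - by move=> x _; rewrite lee_fin.
  - exists N; split => // x h1; apply: contrapT => h2; apply: h1 => _; rewrite -[LHS]/(h x)%:E -[RHS]/(h' x)%:E.
    by rewrite E indicE mem_set// mulr1.
apply: ereal_sup_ubound; exists h' => // x; rewrite E indicE.
have [/set_mem h1|_] := boolP (x \in ~` N); last by rewrite mulr0.
have -> : q x = p x by apply: contrapT => h2; apply: h1; apply: sN => /= h3; exact: h2.
by rewrite mulr1; exact: hp.
Qed.

Lemma test_smooth {U : set R} {f} : test_function U f -> smooth f. Proof. by case. Qed.

Lemma test_cont {U : set R} {f} : test_function U f -> continuous f.
Proof. by move=> /test_smooth/smooth_cont. Qed.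

Lemma test_out {U : set R} {f} : test_function U f -> forall x, ~ U x -> f x = 0.
Proof. by move=> [_ [K [_ KU fK]]] x Ux; apply: fK => /KU. Qed.

Lemma derive1_out f (K : set R) x : closed K -> (forall x, ~ K x -> f x = 0) -> ~ K x ->
  derive1 f x = 0.
Proof.
move=> cK fK Kx; have [_ <-] : is_derive x (1 : R) f (0 : R).
  have := @dcst R 0 x; apply: (@near_eq_is_derive R R^o R^o) => //.
  have : nbhs x (~` K) by apply: open_nbhs_nbhs; split => //; exact: closed_openC.
  by apply: filterS => y /fK.
by rewrite derive1E.
Qed.

Lemma test_derive {U : set R} {f} : test_function U f -> test_function U (derive1 f).
Proof.
move=> [sf [K [cK KU fK]]]; split; first exact: smooth_derive1.
exists K; split => // x; apply: derive1_out => //.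
by apply: compact_closed => //; exact: Rhausdorff.
Qed.

Lemma test_iter {U : set R} {f} i : test_function U f -> test_function U (derive1n i f).
Proof. by move=> h; elim: i => // i; exact: test_derive. Qed.

Lemma dt_tensor f g : smooth f -> dt (fun t x => f t * g x) = (fun t x => derive1 f t * g x).
Proof.
move=> sf; apply/funext => t; apply/funext => x.
have h (s : R) : is_derive s (1 : R) (fun t => f t * g x) (derive1 f s * g x).
  by apply: d_eq (dM (smooth_d sf s) (dcst (g x) s)) _; rewrite mulr0 addr0.
by rewrite /dt; have /(congr1 (fun k : R -> R => k t)) := d_derive1 h.
Qed.

Lemma dx_tensor f g : smooth g -> dx (fun t x => f t * g x) = (fun t x => f t * derive1 g x).
Proof.
move=> sg; apply/funext => t; apply/funext => x.
have h s := dZ (f t) (smooth_d sg s).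
by rewrite /dx; have /(congr1 (fun k : R -> R => k x)) := d_derive1 h.
Qed.

Lemma smooth_derive1n i {f} : smooth f -> smooth (derive1n i f).
Proof. by move=> sf; elim: i => [|i IH]; [exact: sf|exact: (smooth_derive1 IH)]. Qed.

Lemma iter_dt_tensor j f g : smooth f ->
  iter j dt (fun t x => f t * g x) = (fun t x => derive1n j f t * g x).
Proof.
move=> sf; elim: j => [|j IH]; first by [].
by rewrite iterS IH dt_tensor; last exact: smooth_derive1n.
Qed.

Lemma iter_dx_tensor i f g : smooth g ->
  iter i dx (fun t x => f t * g x) = (fun t x => f t * derive1n i g x).
Proof.
move=> sg; elim: i => [|i IH]; first by [].
by rewrite iterS IH dx_tensor; last exact: smooth_derive1n.
Qed.

(** Separated test functions reduce the equation on the strip to a scalar identity in time for each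
    spatial test function. *)
Lemma test_tensor {T f g} : test_function `]0, T[ f -> test_function P g ->
  test_function2 (strip T) (fun t x => f t * g x).
Proof.
move=> [sf [K [cK KT fK]]] [sg [L [cL LP gL]]]; split.
  move=> i j /=; rewrite iter_dt_tensor// iter_dx_tensor//.
  have s1 := smooth_derive1n j sf; have s2 := smooth_derive1n i sg; split.
  - move=> p; apply: cvgM.
      by apply: (continuous_comp cvg_fst); apply: smooth_cont; exact: s1.
    by apply: (continuous_comp cvg_snd); apply: smooth_cont; exact: s2.
  - by move=> t x; have [h _] := dM (smooth_d s1 t) (dcst (derive1n i g x) t).
  - by move=> t x; have [h _] := dZ (derive1n j f t) (smooth_d s2 x).
exists (K `*` L); split; first exact: compact_setX.
  by move=> [t x] [/KT ? /LP ?].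
move=> t x KL; have [Kt|Kt] := pselect (K t); last by rewrite fK// mul0r.
by rewrite gL ?mulr0// => Lx; exact: KL.
Qed.

Lemma posP x : P x <-> 0 < x. Proof. by rewrite /pos_half_line /= in_itv/= andbT. Qed.

Let mP : measurable P. Proof. exact: measurable_itv. Qed.

Lemma test_sqi {U D : set R} {f} : measurable D -> test_function U f -> sqi D f.
Proof.
move=> mD tf; have cf := test_cont tf; have [A _ fA] := test_bnd tf.
apply: (@sqiS _ D setT f) => //; split; first exact: cont_meas.
apply: (cont_supp_intg A) => [x|x /fA ->]; last by rewrite expr0n.
by apply: cvgM; exact: cf.
Qed.

Lemma test_sup {U : set R} {f} : test_function U f -> exists2 M : R, 0 < M & forall x, `|f x| <= M.
Proof.
move=> tf; have [A _ fA] := test_bnd tf; have [M M0 fM] := cont_bnd_itv (- A) A (test_cont tf).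
exists M => // x; have [h|h] := pselect (`[- A, A]%classic x); last by rewrite fA// normr0 ltW.
by apply: fM; move: h; rewrite /= in_itv.
Qed.

Lemma Rint_CS_le {D f g a b} : measurable D -> sqi D f -> sqi D g -> 0 <= a -> 0 <= b ->
  \int[mu]_(x in D) (f x ^+ 2) <= a ^+ 2 -> \int[mu]_(x in D) (g x ^+ 2) <= b ^+ 2 ->
  `|\int[mu]_(x in D) (f x * g x)| <= a * b.
Proof.
move=> mD sf sg a0 b0 fa gb; apply: sqr_le_norm; first exact: mulr_ge0.
apply: (le_trans (Rint_CS mD sf sg)); rewrite exprMn.
by apply: ler_pM => //; apply: Rint_ge0 => x _; exact: sqr_ge0.
Qed.

Lemma intg_sqr_test {U : set R} {f chi} : test_function U chi -> sqi P f ->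
  intg P (fun x => f x ^+ 2 * chi x).
Proof.
move=> tc [_ sf]; have [M M0 cM] := test_sup tc.
apply: (@eq_intg _ _ (fun x => chi x * f x ^+ 2)) => //; first by move=> x _; rewrite mulrC.
apply: (intg_bM M) => //; apply: (measurable_funS (E := setT)) => //.
exact: cont_meas (test_cont tc).
Qed.

(** The value that the equation prescribes for the time derivative of [int w chi], with all
    derivatives moved onto [chi]. *)
Definition rate (chi f : R -> R) : R :=
  \int[mu]_(x in P) (f x * derive1n 3 chi x + f x ^+ 2 * derive1 chi x).

Lemma rateE {chi f} : test_function P chi -> sqi P f -> rate chi f =
  \int[mu]_(x in P) (f x * derive1n 3 chi x) + \int[mu]_(x in P) (f x ^+ 2 * derive1 chi x).
Proof.
move=> tc sf; rewrite /rate RintD//.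
  by apply: sqiM => //; apply: test_sqi => //; exact: (test_iter 3 tc).
exact: intg_sqr_test (test_derive tc) sf.
Qed.

Lemma bound3 {x y t} : 0 <= x -> 0 <= y -> 0 <= t -> exists B, [/\ 1 <= B, x <= B, y <= B & t <= B].
Proof. by move=> *; exists (1 + x + y + t); split; lra. Qed.

(** The quadratic part uses [f^2 - g^2 = (f - g)^2 + 2 g (f - g)]: the first term is bounded through
    the supremum of [chi'], the second by Cauchy-Schwarz. *)
Lemma rate_close {chi g} eps : test_function P chi -> sqi P g -> 0 < eps ->
  exists2 de : R, 0 < de & forall f, sqi P f -> \int[mu]_(x in P) ((f x - g x) ^+ 2) <= de ->
  `|\int[mu]_(x in P) (f x * chi x) - \int[mu]_(x in P) (g x * chi x)| <= eps /\
  `|rate chi f - rate chi g| <= eps.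
Proof.
move=> tc sg e0; have t1 := test_derive tc; have t3 := test_iter 3 tc.
have s0 := test_sqi mP tc; have s3 := test_sqi mP t3.
have [M M0 cM] := test_sup t1.
have m1 : measurable_fun P (derive1 chi).
  by apply: (measurable_funS (E := setT)) => //; apply: cont_meas; exact: test_cont t1.
have sg1 : sqi P (fun x => derive1 chi x * g x) by exact: (sqi_bM M).
have ge0 (p : R -> R) : 0 <= \int[mu]_(x in P) (p x ^+ 2) by apply: Rint_ge0 => x _; exact: sqr_ge0.
have [B [BB B1 B2 B3]] := bound3 (ge0 chi) (ge0 (derive1n 3 chi)) (ge0 (fun x => derive1 chi x * g x)).
have Bq : B <= B ^+ 2 by rewrite expr2 ler_peMl//; lra.
pose r := Num.min 1 (eps / (3 * B + M)).
have den : 0 < 3 * B + M by lra.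
have r0 : 0 < r by rewrite lt_min ltr01 divr_gt0.
have r1 : r <= 1 by rewrite ge_min lexx.
have r2 : r * (3 * B + M) <= eps by rewrite -ler_pdivlMr// ge_min lexx orbT.
have rr : r ^+ 2 <= r by rewrite expr2 ler_piMl// ltW.
exists (r ^+ 2); first by rewrite exprn_gt0.
move=> f sf fg; have sd := sqiB mP sf sg; have B0 : 0 <= B by lra.
have r0' := ltW r0.
have H (p : R -> R) : sqi P p -> \int[mu]_(x in P) (p x ^+ 2) <= B ->
    `|\int[mu]_(x in P) ((f x - g x) * p x)| <= r * B.
  by move=> sp pB; apply: Rint_CS_le => //; exact: le_trans Bq.
have rM : 0 <= r * M by rewrite mulr_ge0// ltW.
have rB : 0 <= r * B by rewrite mulr_ge0.
have fin (X Y Z : R) : X <= r * B -> Y <= r * M -> Z <= r * B -> X + (Y + 2 * Z) <= eps.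
  by clear -r2; move=> *; lra.
have D (p : R -> R) : sqi P p -> \int[mu]_(x in P) (f x * p x) - \int[mu]_(x in P) (g x * p x)
    = \int[mu]_(x in P) ((f x - g x) * p x).
  move=> sp; rewrite -RintB//; [|exact: sqiM|exact: sqiM].
  by apply: eq_Rint => x _; rewrite mulrBl.
split; first by rewrite D//; apply: le_trans (H _ s0 B1) _; lra.
rewrite (rateE tc sf) (rateE tc sg).
have i1 (q : R -> R) : sqi P q -> intg P (fun x => q x ^+ 2 * derive1 chi x) by exact: (intg_sqr_test t1).
have -> : \int[mu]_(x in P) (f x * derive1n 3 chi x) + \int[mu]_(x in P) (f x ^+ 2 * derive1 chi x)
   - (\int[mu]_(x in P) (g x * derive1n 3 chi x) + \int[mu]_(x in P) (g x ^+ 2 * derive1 chi x))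
  = \int[mu]_(x in P) ((f x - g x) * derive1n 3 chi x)
    + (\int[mu]_(x in P) ((f x - g x) ^+ 2 * derive1 chi x)
    + 2 * \int[mu]_(x in P) ((f x - g x) * (derive1 chi x * g x))).
  rewrite -D// opprD addrACA; congr (_ + _).
  rewrite -RintB//; [|exact: i1|exact: i1].
  rewrite -RintZ//; last exact: sqiM.
  rewrite -RintD//; [|exact: i1|by apply: intgZ => //; exact: sqiM].
  by apply: eq_Rint => x _; ring.
have h1 := H _ s3 B2; have h2 := H _ sg1 B3.
have h3 : `|\int[mu]_(x in P) ((f x - g x) ^+ 2 * derive1 chi x)| <= r * M.
  have i2 : intg P (fun x => M * (f x - g x) ^+ 2) by apply: intgZ => //; case: sd.
  have mm := intg_meas (i1 _ sd).
  apply: (@le_trans _ _ (\int[mu]_(x in P) (M * (f x - g x) ^+ 2))).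
    apply: normr_Rint_le => // x _; rewrite normrM mulrC (ger0_norm (sqr_ge0 _)).
    by rewrite ler_wpM2r ?sqr_ge0.
  rewrite RintZ//; last by case: sd.
  have : M * \int[mu]_(x in P) ((f x - g x) ^+ 2) <= M * r ^+ 2 by rewrite ler_wpM2l// ltW.
  have : M * r ^+ 2 <= M * r by rewrite ler_wpM2l// ltW.
  by lra.
apply: le_trans (ler_normD _ _) _; apply: le_trans (lerD (lexx _) (ler_normD _ _)) _.
by rewrite (normrM 2) (ger0_norm (ler0n R 2)); exact: fin.
Qed.

Definition L2cont T (v : R -> R -> R) : Prop := forall t, 0 <= t <= T -> forall eps, 0 < eps ->
  exists2 de : R, 0 < de & forall s, 0 <= s <= T -> `|s - t| < de ->
  \int[mu]_(x in P) ((v s x - v t x) ^+ 2) <= eps.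

Lemma eps_cont {f} : (forall t eps, 0 < eps -> exists2 de : R, 0 < de & forall s, `|s - t| < de ->
  `|f s - f t| <= eps) -> continuous f.
Proof.
move=> H t; apply/cvgrPdist_le => eps e0; have [de de0 h] := H t eps e0.
near=> s; rewrite distrC; apply: h; rewrite ltr_norml.
have : s < t + de by near: s; apply: lt_nbhsl; rewrite ltrDl.
have : t - de < s by near: s; apply: lt_nbhsr; rewrite ltrBlDr ltrDl.
by move=> ? ?; apply/andP; split; lra.
Unshelve. all: by end_near. Qed.

Lemma ge0_right_limit {f b} : continuous f -> 0 < b -> (forall x, 0 < x <= b -> 0 <= f x) -> 0 <= f 0.
Proof.
move=> cf b0 H; rewrite leNgt; apply/negP => f0.
have /nbhs_ballP[r /= r0 hr] : nbhs (0 : R) [set x | f x < 0] by exact: (cvgr_lt _ (cf 0)).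
have m0 : 0 < Num.min (r / 2) b by rewrite lt_min b0 divr_gt0.
have := hr (Num.min (r / 2) b); rewrite /ball/= sub0r normrN gtr0_norm// => h.
have : f (Num.min (r / 2) b) < 0.
  by apply: h; rewrite gt_min; apply/orP; left; lra.
by apply/negP; rewrite -leNgt; apply: H; rewrite m0 ge_min lexx orbT.
Qed.

(** The functions [A t = int v chi] and [N t = rate chi (v t)] are continuous, and the equation says
    that [A' = N] weakly on []0, T[]. [du_bois_reymond] turns this into an integral identity, whose
    mean value form is the claim for [a > 0]; the case [a = 0] follows by continuity. *)
Lemma weak_time {T w v chi} : kdv_zero_boundary T w ->
  (forall t, 0 <= t <= T -> sqi P (v t) /\ {ae mu, forall x, P x -> w t x = v t x}) ->
  L2cont T v -> test_function P chi ->
  forall a b c eps, 0 <= a -> a <= b -> b < T ->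
  (forall t, a <= t <= b -> `|rate chi (v t) - c| <= eps) ->
  `|\int[mu]_(x in P) (v b x * chi x) - \int[mu]_(x in P) (v a x * chi x) - c * (b - a)|
    <= eps * (b - a).
Proof.
move=> [weq _] Hv cv tc a b c eps a0 ab bT Hn.
have T0 : 0 <= T by lra.
(* [clamp] extends the functions of time continuously from [[0, T]] to the whole line, where
   [du_bois_reymond] is stated. *)
pose A t := \int[mu]_(x in P) (v (clamp T t) x * chi x).
pose N t := rate chi (v (clamp T t)).
have close t e : 0 < e -> exists2 de : R, 0 < de & forall s, `|s - t| < de ->
    `|A s - A t| <= e /\ `|N s - N t| <= e.
  move=> e0; have tT := clamp_itv t T0; have [sv _] := Hv _ tT.
  have [d d0 hd] := rate_close e tc sv e0; have [r r0 hr] := cv _ tT d d0.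
  exists r => // s sr; have sT := clamp_itv s T0; apply: hd; first by have [] := Hv _ sT.
  by apply: hr => //; apply: le_lt_trans sr; exact: clamp_lip.
have cA : continuous A.
  by apply: eps_cont => t e e0; have [r r0 h] := close t e e0; exists r => // s /h[].
have cN : continuous N.
  by apply: eps_cont => t e e0; have [r r0 h] := close t e e0; exists r => // s /h[].
have weak theta : test_function `]0, T[ theta ->
    \int[mu]_x (A x * derive1 theta x) = - \int[mu]_x (N x * theta x).
  move=> tt; have := weq _ (test_tensor tt tc).
  rewrite (_ : \int[mu]_(t in `]0, T[) _ = \int[mu]_(t in `]0, T[) (A t * derive1 theta t + N t * theta t)).
    have mI : measurable (`]0, T[ : set R) by exact: measurable_itv.
    have th0 := test_cont tt; have th1 := test_cont (test_derive tt).
    have i1 : intg `]0, T[ (fun t => A t * derive1 theta t).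
      apply: (@intgS _ `]0, T[ `[0, T]) => //; first exact: subset_itv_oo_cc.
      by apply: cont_intg_itv => x; apply: cvgM; [exact: cA|exact: th1].
    have i2 : intg `]0, T[ (fun t => N t * theta t).
      apply: (@intgS _ `]0, T[ `[0, T]) => //; first exact: subset_itv_oo_cc.
      by apply: cont_intg_itv => x; apply: cvgM; [exact: cN|exact: th0].
    rewrite RintD// => /eqP; rewrite addr_eq0 => /eqP.
    rewrite (@Rint_supp _ `]0, T[ (fun t => A t * _))//; last first.
      by move=> x /(test_out (test_derive tt)) ->; rewrite mulr0.
    rewrite (@Rint_supp _ `]0, T[ (fun t => N t * _))//.
    by move=> x /(test_out tt) ->; rewrite mulr0.
  apply: eq_Rint => t tT; have tT' : 0 <= t <= T by move: tT; rewrite /= in_itv/= => /andP[/ltW-> /ltW].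
  have [sv av] := Hv _ tT'.
  rewrite dt_tensor; last exact: test_smooth tt.
  rewrite iter_dx_tensor; last exact: test_smooth tc.
  rewrite dx_tensor; last exact: test_smooth tc.
  rewrite (eq_ae_Rint (fun x => derive1 theta t * (v t x * chi x) +
      theta t * (v t x * derive1n 3 chi x + v t x ^+ 2 * derive1 chi x))); last first.
    by apply: aeS av => x h /h ->; ring.
  have j0 : intg P (fun x => v t x * chi x) by apply: sqiM => //; exact: test_sqi tc.
  have j3 : intg P (fun x => v t x * derive1n 3 chi x).
    by apply: sqiM => //; apply: test_sqi => //; exact: (test_iter 3 tc).
  have j1 := intg_sqr_test (test_derive tc) sv.
  have j := intgD mP j3 j1.
  rewrite RintD//; [|exact: intgZ|exact: intgZ].
  rewrite RintZ// RintZ// /A /N /rate clamp_id//.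
  by rewrite mulrC; congr (_ + _); rewrite mulrC.
have inner p q : 0 < p -> p <= q -> q < T -> A q - A p = \int[mu]_(x in `[p, q]) N x.
  move=> p0 pq qT; have e0 : 0 < (T - q) / 2 by lra.
  apply: (@du_bois_reymond _ _ _ `]0, T[ _ _ ((T - q) / 2)) => //.
  - exact: cont_meas.
  - exact: cont_meas.
  - by move=> *; exact: cont_intg_itv.
  - by move=> *; exact: cont_intg_itv.
  - by move=> x; rewrite /= !in_itv/= => /andP[h1 h2]; apply/andP; split; lra.
  - exact: cont_lebesgue_pt.
  - exact: cont_lebesgue_pt.
have mv p : 0 < p -> a <= p -> p <= b -> `|A b - A p - c * (b - p)| <= eps * (b - p).
  move=> p0 ap pb; rewrite inner// -Rint_cst_itv// -(Rint_cst_itv eps)//.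
  have iN := cont_intg_itv p b cN.
  have ic (k : R) : intg `[p, b] (fun=> k) by apply: cont_intg_itv => x; exact: cvg_cst.
  have mI : measurable (`[p, b] : set R) by exact: measurable_itv.
  rewrite -RintB//; apply: normr_Rint_le => //; first exact: intg_meas (intgB mI iN (ic c)).
  move=> t; rewrite /= in_itv/= => /andP[h1 h2]; rewrite /N clamp_id; last by apply/andP; split; lra.
  by apply: Hn; rewrite h2 andbT; lra.
have -> : \int[mu]_(x in P) (v b x * chi x) = A b by rewrite /A clamp_id//; apply/andP; split; lra.
have -> : \int[mu]_(x in P) (v a x * chi x) = A a by rewrite /A clamp_id//; apply/andP; split; lra.
have [a1|a1] := ltP 0 a; first exact: mv.
have -> : a = 0 by lra.
have [b1|b1] := ltP 0 b; last first.
  by have -> : b = 0 by [lra]; rewrite !subrr !mulr0 subrr normr0.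
rewrite -subr_ge0.
apply: (@ge0_right_limit (fun p => eps * (b - p) - `|A b - A p - c * (b - p)|) b) => // [x|x /andP[x0 xb]].
  apply: cvgB; first by apply: cvgMr; apply: cvgB; [exact: cvg_cst|exact: cvg_id].
  apply: cvg_norm; apply: cvgB; first by apply: cvgB; [exact: cvg_cst|exact: cA].
  by apply: cvgMr; apply: cvgB; [exact: cvg_cst|exact: cvg_id].
by rewrite subr_ge0; apply: mv => //; lra.
Qed.

Lemma smooth_sum m (F : nat -> R -> R) : (forall i, smooth (F i)) ->
  smooth (fun x => \sum_(i < m) F i x).
Proof.
move=> sF; elim: m => [|m IH].
  rewrite (_ : (fun x => _) = fun=> 0); first exact: smooth_cst.
  by apply/funext => x; rewrite big_ord0.
rewrite (_ : (fun x => _) = fun x => (\sum_(i < m) F i x) + F m x); first exact: (smoothD IH (sF m)).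
by apply/funext => x; rewrite big_ord_recr.
Qed.

(* Interpolation of f at the nodes p + i h by the partition of unity made of the
   differences of consecutive smoothed steps of width h. *)
Lemma interpolate {f} p h eta m b : 0 < h -> 0 <= eta -> p + m.+1%:R * h <= b ->
  (forall x y, p <= x <= b -> `|x - y| < 3 * h -> `|f x - f y| < eta) ->
  exists chi : R -> R, [/\ smooth chi, forall x, ~ `[p, b]%classic x -> chi x = 0 &
    forall x, exists t : R, [/\ 0 <= t <= 1, p + h <= x <= p + m%:R * h -> t = 1,
      ~ `[p, b]%classic x -> t = 0 & `|chi x - t * f x| <= eta * t]].
Proof.
move=> h0 eta0 mb fh; pose q (i : nat) := p + i%:R * h.
have s0 : 0 < h^-1 by rewrite invr_gt0.
pose F (i : nat) x := f (q i) * (ramp h^-1 (q i) x - ramp h^-1 (q i.+1) x).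
have qS i : q i.+1 = q i + h by rewrite /q -natr1 mulrDl mul1r addrA.
have anti i x : ramp h^-1 (q i.+1) x <= ramp h^-1 (q i) x.
  apply: step_homo; rewrite lerD2l lerN2 ler_pM2l// qS.
  by rewrite lerDl ltW.
have lo i x : x <= q i -> ramp h^-1 (q i) x = 0 by exact: ramp_le.
have hi i x : q i + h <= x -> ramp h^-1 (q i) x = 1.
  by move=> ?; apply: ramp_ge => //; rewrite invrK.
have qm i j : (i <= j)%N -> q i <= q j.
  by move=> ij; rewrite lerD2l ler_pM2r// ler_nat.
pose chi x := \sum_(i < m) F i x.
have q0 : q 0%N = p by rewrite /q mul0r addr0.
have qb : q m.+1 <= b by [].
have tele x : \sum_(i < m) (ramp h^-1 (q i) x - ramp h^-1 (q i.+1) x) =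
    ramp h^-1 (q 0%N) x - ramp h^-1 (q m) x.
  by elim: (m) => [|j IH]; rewrite ?big_ord0 ?subrr// big_ord_recr/= IH addrA subrK.
have key x : `|chi x - (ramp h^-1 (q 0%N) x - ramp h^-1 (q m) x) * f x| <=
    eta * (ramp h^-1 (q 0%N) x - ramp h^-1 (q m) x).
  rewrite -tele mulr_suml mulr_sumr /chi -sumrB.
  apply: le_trans (ler_norm_sum _ _ _) _; apply: ler_sum => i _.
  rewrite /F mulrC -mulrBr normrM mulrC.
  have ge0 : 0 <= ramp h^-1 (q i) x - ramp h^-1 (q i.+1) x by rewrite subr_ge0.
  rewrite (ger0_norm ge0); have [l1|l1] := leP x (q i).
    by rewrite lo// lo ?subrr ?mulr0//; apply: le_trans l1 _; exact: qm.
  have [l2|l2] := leP (q i.+1 + h) x.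
    have l3 : q i + h <= x by apply: le_trans l2; rewrite qS; lra.
    by rewrite !hi// subrr !mulr0.
  apply: ler_wpM2r => //; apply: ltW; rewrite distrC; apply: fh.
    have : p <= q i by rewrite -q0; exact: qm.
    have : q i.+2 <= b by apply: le_trans qb; apply: qm; rewrite ltnS.
    by move: l2; rewrite -qS => *; apply/andP; split; lra.
  by rewrite gtr0_norm ?subr_gt0//; move: l2; rewrite qS; lra.
have out x : ~ `[p, b]%classic x -> ramp h^-1 (q 0%N) x - ramp h^-1 (q m) x = 0.
  rewrite /= in_itv/= => /negP; rewrite negb_and -!ltNge => /orP[h1|h1].
    have h2 : x <= q 0%N by rewrite q0 ltW.
    by rewrite !lo ?subrr//; apply: le_trans h2 _; exact: qm.
  have h2 : q m + h <= x by rewrite -qS; lra.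
  by rewrite !hi ?subrr//; apply: le_trans h2; rewrite lerD2r; exact: qm.
exists chi; split.
- apply: (smooth_sum m F) => i; rewrite /F.
  apply: smoothM; first exact: smooth_cst.
  apply: smoothD; first exact: ramp_smooth.
  rewrite (_ : (fun x => _) = fun x => (-1) * ramp h^-1 (q i.+1) x); last by apply/funext => x; rewrite mulN1r.
  by apply: smoothM; [exact: smooth_cst|exact: ramp_smooth].
- by move=> x /out e; have := key x; rewrite e mul0r mulr0 subr0 normr_le0 => /eqP.
- move=> x; exists (ramp h^-1 (q 0%N) x - ramp h^-1 (q m) x); split => //.
  + apply/andP; split; first by rewrite subr_ge0; apply: step_homo; rewrite lerD2l lerN2 ler_pM2l// qm.
    have := step_le1 (h^-1 * x + - (h^-1 * q 0%N)); have := step_ge0 (h^-1 * x + - (h^-1 * q m)).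
    by rewrite /ramp; lra.
  + by move=> /andP[h1 h2]; rewrite hi ?q0// lo ?subr0.
  + exact: out.
Qed.

(** [f] is truncated to [[1/(n+1), n+1]] at a cost of [eps / 4] and then interpolated. Outside that
    interval [chi] is still close to [t f] for some [t] in [[0, 1]], so the part [f - t f] costs no
    more than the truncation. *)
Lemma test_dense {f eps} : continuous f -> sqi P f -> 0 < eps ->
  exists2 chi, test_function P chi & \int[mu]_(x in P) ((f x - chi x) ^+ 2) <= eps.
Proof.
move=> cf sf e0; have [mf f2] := sf.
have if2 : intg setT (fun x => \1_P x * f x ^+ 2) by apply/intg_indic.
pose D (n : nat) : set R := [set` `[n.+1%:R^-1, n.+1%:R]].
have mD n : measurable (D n) by exact: measurable_itv.
have DP n x : D n x -> P x.
  rewrite /D /pos_half_line /= !in_itv/= andbT => /andP[h _]; apply: lt_le_trans h.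
  by rewrite invr_gt0.
have lim : (fun n => \int[mu]_(x in D n) (\1_P x * f x ^+ 2)) @ \oo -->
    \int[mu]_(x in P) (\1_P x * f x ^+ 2).
  apply: Rint_set_lim => // x; have [x0|x0] := ltP 0 x; last first.
    by near=> n; split => [/DP//|/posP]; rewrite ltNge x0.
  near=> n; split => [/DP//|_]; rewrite /D /= in_itv/=; apply/andP; split.
    rewrite -[leRHS]invrK lef_pV2 ?posrE ?invr_gt0//.
    by apply: (@le_trans _ _ n%:R); [near: n; exact: nbhs_infty_ger|rewrite ler_nat].
  by apply: (@le_trans _ _ n%:R); [near: n; exact: nbhs_infty_ger|rewrite ler_nat].
have [n hn] : exists n, \int[mu]_(x in P) (f x ^+ 2) - \int[mu]_(x in D n) (f x ^+ 2) <= eps / 4.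
  have e1 (E : set R) : (forall x, E x -> P x) ->
      \int[mu]_(x in E) (\1_P x * f x ^+ 2) = \int[mu]_(x in E) (f x ^+ 2).
    by move=> EP; apply: eq_Rint => x /EP Px; rewrite indicE mem_set// mul1r.
  move: lim => /cvgrPdist_le/(_ (eps / 4)) []; first by lra.
  move=> n _ /(_ n (leqnn n)); rewrite (e1 P)// (e1 (D n)); last exact: DP.
  by move=> h; exists n; apply: le_trans h; rewrite ler_norm.
pose a : R := n.+1%:R^-1; pose b : R := n.+1%:R.
have Dn x : D n x -> a <= x <= b by rewrite /D /= in_itv.
have a0 : 0 < a by rewrite invr_gt0.
have b1 : 1 <= b by rewrite ler1n.
have a1 : a <= 1 by rewrite invf_le1.
(* Interpolation contributes at most [2 eta (b + 3) <= eps / 2]; the truncation, counted twice,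
   contributes the other [eps / 2]. *)
pose eta := Num.min 1 (eps / (4 * (b + 3))).
have dn : 0 < 4 * (b + 3) by lra.
have et0 : 0 < eta by rewrite lt_min ltr01 divr_gt0.
have et1 : eta <= 1 by rewrite ge_min lexx.
have et2 : eta * (4 * (b + 3)) <= eps by rewrite -ler_pdivlMr// ge_min lexx orbT.
have et3 : eta ^+ 2 <= eta by rewrite expr2 ler_piMl// ltW.
have [de de0 hde] := heine cf (a / 2) (b + 3) eta et0.
pose h := Num.min (a / 2) (de / 3).
have h0 : 0 < h by rewrite lt_min !divr_gt0.
have h1 : h <= a / 2 by rewrite ge_min lexx.
have h2 : 3 * h <= de by rewrite mulrC -ler_pdivlMr// ge_min lexx orbT.
pose m := (Num.truncn (b / h)).+1.
have bh : 0 <= b / h by rewrite divr_ge0//; lra.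
have m1 : b <= m%:R * h by rewrite -ler_pdivrMr//; apply: ltW; exact: truncnS_gt.
have m2 : m.+1%:R * h <= b + 2 * h.
  rewrite /m -natr1 -(natr1 (Num.truncn _)) !mulrDl mul1r -addrA.
  have : (Num.truncn (b / h))%:R * h <= b by rewrite -ler_pdivlMr// truncn_le.
  lra.
have [|||chi [schi chi0 H]] := @interpolate f (a / 2) h eta m (b + 3) h0.
- exact: ltW.
- lra.
- by move=> x y xI xy; apply: hde => //; lra.
have tchi : test_function P chi.
  split => //; exists `[a / 2, b + 3]%classic; split; [exact: segment_compact| |exact: chi0].
  by move=> x; rewrite /= in_itv/= => /andP[h3 _]; apply/posP; lra.
exists chi => //; pose J : set R := [set` `[a / 2, b + 3]].
have mJ : measurable J by exact: measurable_itv.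
have iD : intg P (fun x => \1_(D n) x * f x ^+ 2).
  apply: (intgS setT) => //; apply/intg_indic => //; apply: (intgS P) => //; exact: DP.
have iJT : intg setT (fun x => \1_J x * eta ^+ 2).
  by apply/intg_indic => //; apply: cont_intg_itv => x; exact: cvg_cst.
have iJ : intg P (fun x => \1_J x * eta ^+ 2) by apply: (intgS setT).
have iA := intgB mP f2 iD.
have [_ iF] := sqiB mP sf (test_sqi mP tchi).
apply: (@le_trans _ _ (\int[mu]_(x in P) (2 * (f x ^+ 2 - \1_(D n) x * f x ^+ 2) + 2 * (\1_J x * eta ^+ 2)))).
  apply: le_Rint => //; first by apply: intgD => //; exact: intgZ.
  move=> x Px; have [t [/andP[t0 t1] tD tJ key]] := H x.
  have -> : f x - chi x = f x * (1 - t) - (chi x - t * f x) by ring.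
  have k1 : (chi x - t * f x) ^+ 2 <= \1_J x * eta ^+ 2.
    have [Jx|Jx] := pselect (J x); last first.
      by move: key; rewrite (tJ Jx) mulr0 normr_le0 => /eqP ->; rewrite expr0n mulr_ge0// sqr_ge0.
    rewrite indicE mem_set// mul1r -[leLHS]real_normK ?num_real//.
    rewrite ler_pXn2r ?nnegrE//; last exact: ltW.
    by apply: (le_trans key); rewrite ler_piMr// ltW.
  have k2 : (f x * (1 - t)) ^+ 2 <= f x ^+ 2 - \1_(D n) x * f x ^+ 2.
    have [Dx|Dx] := pselect (D n x).
      rewrite indicE mem_set// mul1r subrr tD ?subrr ?mulr0 ?expr0n//.
      by have := Dn _ Dx; clear -h1 m1 a0 => /andP[? ?]; apply/andP; split; lra.
    rewrite indicE memNset// mul0r subr0 exprMn ler_piMr ?sqr_ge0//.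
    by rewrite expr_le1//; clear -t0 t1; lra.
  by have := sqr_ge0 (f x * (1 - t) + (chi x - t * f x)); clear -k1 k2; nra.
rewrite RintD//; [|exact: intgZ|exact: intgZ]; rewrite RintZ// RintZ// RintB//.
have -> : \int[mu]_(x in P) (\1_(D n) x * f x ^+ 2) = \int[mu]_(x in D n) (f x ^+ 2).
  rewrite -Rint_indic// -[RHS]Rint_indic//; apply: eq_Rint => x _.
  have [Dx|Dx] := pselect (D n x); last first.
    have -> : \1_(D n) x = 0 :> R by rewrite indicE memNset.
    by rewrite mul0r mulr0.
  have -> : \1_P x = 1 :> R by rewrite indicE mem_set//; exact: DP Dx.
  by rewrite mul1r.
have h3 : \int[mu]_(x in P) (\1_J x * eta ^+ 2) <= eta ^+ 2 * (b + 3 - a / 2).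
  rewrite -Rint_cst_itv; last by lra.
  by rewrite -[leRHS]Rint_indic//; apply: Rint_ge_sub => // x _; rewrite mulr_ge0 ?sqr_ge0.
have h4 : eta ^+ 2 * (b + 3 - a / 2) <= eta * (b + 3).
  by apply: ler_pM => //; [exact: sqr_ge0|clear -a1 b1; lra|clear -a0; lra].
move: hn h3; set I1 := Rintegral _ _ _; set I2 := Rintegral _ _ _; set I3 := Rintegral _ _ _.
by clear -et2 h4 => *; lra.
Unshelve. all: by end_near. Qed.

(** Were the norm [n] of [f] larger than [K], a test function within [e] of [f] would have norm at
    most [n + e] but pairing at least [n^2 - n e] with [f], which exceeds [K (n + e)] for the chosen
    [e]. *)
Lemma dual_L2 {f} K : continuous f -> sqi P f -> 0 <= K ->
  (forall chi b, test_function P chi -> 0 <= b -> \int[mu]_(x in P) (chi x ^+ 2) <= b ^+ 2 ->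
    `|\int[mu]_(x in P) (f x * chi x)| <= K * b) ->
  \int[mu]_(x in P) (f x ^+ 2) <= K ^+ 2.
Proof.
move=> cf sf K0 H; have [_ f2] := sf.
have N0 : 0 <= \int[mu]_(x in P) (f x ^+ 2) by apply: Rint_ge0 => x _; exact: sqr_ge0.
have [n n0 En] : exists2 n : R, 0 <= n & \int[mu]_(x in P) (f x ^+ 2) = n ^+ 2.
  by exists (Num.sqrt (\int[mu]_(x in P) (f x ^+ 2))); rewrite ?sqr_sqrtr.
rewrite En ler_pXn2r ?nnegrE// leNgt; apply/negP => Kn.
pose e := (n ^+ 2 - K * n) / (2 * (n + K)).
have g0 : 0 < n ^+ 2 - K * n by rewrite expr2 -mulrBl mulr_gt0//; lra.
have e0 : 0 < e by rewrite divr_gt0//; lra.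
have e1 : e * (2 * (n + K)) = n ^+ 2 - K * n by rewrite divfK//; lra.
have [chi tchi hc] := test_dense cf sf (exprn_gt0 2 e0).
have sc := test_sqi mP tchi; have sd := sqiB mP sf sc.
have Enl : \int[mu]_(x in P) (f x ^+ 2) <= n ^+ 2 by rewrite En.
have fe := Rint_CS_le mP sf sd n0 (ltW e0) Enl hc.
have id := sqiM mP sf sd; have ic := sqiM mP sf sc.
have fc : `|\int[mu]_(x in P) (f x * chi x)| <= K * (n + e).
  apply: H => //; first by lra.
  have -> : \int[mu]_(x in P) (chi x ^+ 2) = n ^+ 2 - 2 * \int[mu]_(x in P) (f x * (f x - chi x))
      + \int[mu]_(x in P) ((f x - chi x) ^+ 2).
    have [_ d2] := sd.
    rewrite -En -RintZ// -RintB//; last exact: intgZ.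
    rewrite -RintD//; last by apply: intgB => //; exact: intgZ.
    by apply: eq_Rint => x _; ring.
  by move: fe; rewrite ler_norml => /andP[? _]; rewrite sqrrD; lra.
have : n ^+ 2 = \int[mu]_(x in P) (f x * (f x - chi x)) + \int[mu]_(x in P) (f x * chi x).
  by rewrite -En -RintD//; apply: eq_Rint => x _; ring.
move: fe fc; rewrite !ler_norml => /andP[_ h1] /andP[_ h2].
move: h1 h2; set I1 := Rintegral _ _ _; set I2 := Rintegral _ _ _.
by clear -e1 g0 => *; lra.
Qed.

End TestFunctions.

(** * Functions on the half-line and their extension by zero *)

Section HalfLine.
Context {R : realType}.
Local Notation mu := (@lebesgue_measure R).
Local Notation P := (@pos_half_line R).
Implicit Types (D : set R) (f g d v dv : R -> R) (x y t a b c s r e eps de : R).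

Let mT : measurable [set: R]. Proof. exact: measurableT. Qed.
Let mP : measurable P. Proof. exact: measurable_itv. Qed.

Lemma cont_pos_eq {f g} : continuous f -> continuous g -> (forall x, 0 < x -> f x = g x) ->
  forall x, 0 <= x -> f x = g x.
Proof.
move=> cf cg fg x; rewrite le_eqVlt => /orP[/eqP<-|/fg//].
have H (p q : R -> R) : continuous p -> continuous q -> (forall x, 0 < x -> p x = q x) ->
    0 <= p 0 - q 0.
  move=> cp cq pq; apply: (@ge0_right_limit _ (fun x => p x - q x) 1) => // [z|z /andP[z0 _]].
    by apply: cvgB; [exact: cp|exact: cq].
  by rewrite pq// subrr.
by apply/le_anti/andP; split; rewrite -subr_ge0; apply: H => // z z0; rewrite fg.
Qed.

(** A continuous difference that is nonzero at some [y > 0] stays nonzero on an interval of positive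
    measure; the endpoint 0 follows by one-sided continuity. *)
Lemma cont_ae_pos {f g} : continuous f -> continuous g ->
  {ae mu, forall x, P x -> f x = g x} -> forall x, 0 <= x -> f x = g x.
Proof.
move=> cf cg [N [mN N0 sN]]; apply: cont_pos_eq => // y y0; apply: contrapT => fgy.
have cd : continuous (fun x => f x - g x) by move=> x; apply: cvgB; [exact: cf|exact: cg].
have d0 : 0 < `|f y - g y| by rewrite normr_gt0 subr_eq0; apply/eqP.
have [de de0 H] := heine cd y y _ d0.
pose r := Num.min de y; have r0 : 0 < r by rewrite lt_min de0.
have r1 : r <= de by rewrite ge_min lexx.
have r2 : r <= y by rewrite ge_min lexx orbT.
have sub : [set` `]y, y + r[] `<=` N.
  move=> x /=; rewrite in_itv/= => /andP[h1 h2]; apply: sN => /= h.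
  have := H y x; rewrite lexx => /(_ isT).
  have -> : f x - g x = 0 by apply/eqP; rewrite subr_eq0; apply/eqP/h/posP; lra.
  by rewrite subr0 ltxx => H'; have /H' : `|y - x| < de by rewrite ltr0_norm; lra.
have : (mu [set` `]y, y + r[%R] <= 0)%E by rewrite -N0; apply: le_measure => //; rewrite inE.
rewrite lebesgue_measure_itv/= lte_fin ltrDl r0 -EFinB lee_fin addrAC subrr add0r.
by rewrite leNgt r0.
Qed.

Lemma deriv_pos {f g d e : R -> R} : (forall x, is_derive x (1 : R) f (d x)) ->
  (forall x, is_derive x (1 : R) g (e x)) -> continuous d -> continuous e ->
  (forall x, 0 <= x -> f x = g x) -> forall x, 0 <= x -> d x = e x.
Proof.
move=> df dg cd ce fg; apply: cont_pos_eq => // x x0.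
have h : is_derive x (1 : R) f (e x).
  apply: (@near_eq_is_derive R R^o R^o g _ _ _ _ _ (dg x)) => //.
  near=> y; rewrite fg//; apply: ltW; near: y; exact: lt_nbhsr.
have [_ <-] := df x; by have [_ ->] := h.
Unshelve. all: by end_near. Qed.

(** Subtracting [F 0] times a smooth cut-off [psi] with [psi 0 = 1] makes the function vanish at 0,
    so it can be cut there and [ac_int0] applies. The kernel [- psi'] has unit mass and gives back
    [F 0]. *)
Lemma half_int {F D : R -> R} : (forall x, is_derive x (1 : R) F (D x)) -> continuous D ->
  intg P F -> intg P D -> \int[mu]_(x in P) D x = - F 0.
Proof.
move=> dF cD iF iD; pose psi x : R := 1 - ramp 1 0 x.
have dpsi x : is_derive x (1 : R) psi (0 - kern 1 0 x) by exact: (dB (dcst 1 x) (ramp_d 1 0 x)).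
have ck : continuous (@kern R 1 0) by apply: smooth_cont; exact: kern_smooth.
have ac1 : ac (fun x => F x - F 0 * psi x) (fun x => D x - F 0 * (0 - kern 1 0 x)).
  apply: acB; first exact: ac_C1.
  apply: acZ; apply: ac_C1 => // x; apply: cvgB; [exact: cvg_cst|exact: ck].
have p0 : psi 0 = 1 by rewrite /psi ramp_le ?subr0.
have := ac_cut 0 ac1; rewrite p0 mulr1 subrr => /(_ erefl) ac2.
have sup (f : R -> R) : continuous f -> (forall x, 1 <= x -> f x = 0) -> intg P f.
  move=> cf f1; have : intg setT (fun x => \1_[set` `[0, 1]] x * f x).
    by apply/intg_indic => //; exact: cont_intg_itv.
  move=> /(intgS setT (D := P)) h; apply: eq_intg (h mT mP _) => //.
  move=> x /posP x0; have [x1|x1] := ltP x 1; last by rewrite f1// mulr0.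
  by rewrite indicE mem_set ?mul1r//= in_itv/= ltW// ltW.
have ipsi : intg P psi.
  apply: sup => [x|x x1]; last by rewrite /psi ramp_ge ?subrr// invr1 add0r.
  by have [h _] := dpsi x; apply: differentiable_continuous; exact/derivable1_diffP.
have ikern : intg P (kern 1 0).
  apply: sup => // x x1; apply: kern_out => //; rewrite invr1 add0r negb_and -!leNgt x1 orbT //.
have i1 : intg P (fun x => F x - F 0 * psi x) by apply: intgB => //; exact: intgZ.
have i2 : intg P (fun x => F 0 * kern 1 0 x) by exact: intgZ.
have i3 : intg P (fun x => D x - F 0 * (0 - kern 1 0 x)).
  apply: (@eq_intg _ _ (fun x => D x + F 0 * kern 1 0 x)) => //; last exact: intgD.
  by move=> x _; ring.
have := ac_int0 ac2; rewrite Rint_indic// => h.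
have : \int[mu]_(x in P) (D x - F 0 * (0 - kern 1 0 x)) = 0.
  by apply: h; apply/intg_indic.
rewrite (eq_Rint _ (fun x => D x + F 0 * kern 1 0 x)); last by move=> x _; ring.
have k1 : \int[mu]_(x in P) kern 1 0 x = 1.
  have km : \int[mu]_(x in `[0, 1]) kern 1 0 x = 1.
    by have := @kern_mass R 1 0 ltr01; rewrite invr1 add0r.
  transitivity (\int[mu]_(x in `[0, 1]) kern 1 0 x); last exact: km.
  have o0 : [set` `]0, 1]] `<=` P by move=> x /=; rewrite in_itv/= => /andP[? _]; exact/posP.
  have mI : measurable [set` `](0 : R), 1]] by exact: measurable_itv.
  rewrite -Rint_obnd_cbnd; last exact: cont_intg_itv.
  rewrite -(Rint_indic _ mP) -(Rint_indic _ mI); apply: eq_Rint => x _.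
  have [/andP[x1 x2]|x1] := boolP (0 < x < 1); last first.
    by rewrite kern_out ?mulr0// invr1 add0r.
  rewrite !indicE !mem_set//=; first by rewrite in_itv/= x1 ltW.
  exact/posP.
by rewrite RintD// RintZ// k1 mulr1 => /eqP; rewrite addr_eq0 => /eqP.
Qed.

(* v is the continuous representative of f on the half-line, extended by 0. *)
Definition rep f v dv : Prop :=
  [/\ H1 v dv, forall x, x <= 0 -> v x = 0, forall x, x <= 0 -> dv x = 0 &
      {ae mu, forall x, P x -> f x = v x}].

(** The zero trace is what makes the extension by zero absolutely continuous. *)
Lemma rep_exists {f} : in_sobolev 1 P f -> has_trace P f 0 0 -> exists v dv, rep f v dv.
Proof.
move=> fin [g [cg fg g0]].
have [a fa] : exists a, (sobolev_norm 1 P f < a%:E)%E.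
  have := sob_ge0 1 P f; move: fin; rewrite /in_sobolev; case: (sobolev_norm 1 P f) => // r _ _.
  by exists (r + 1); rewrite lte_fin ltrDl.
have [h [d [ah sh sd fh _]]] := sob1_lt fa.
have ch : continuous h by case: ah.
have h0 : h 0 = 0.
  have hg : {ae mu, forall x, P x -> h x = g x}.
    by apply: aeS (aeI fg fh) => x [h1 h2] Px; rewrite -h1// h2.
  by rewrite (cont_ae_pos ch cg hg 0).
exists (fun x => \1_P x * h x), (fun x => \1_P x * d x); split.
- split; [exact: ac_cut|by apply: sqi_indic => //; apply: (sqiS setT)|].
  by apply: sqi_indic => //; apply: (sqiS setT).
- by move=> x x0; rewrite indicE memNset ?mul0r// => /posP; rewrite ltNge x0.
- by move=> x x0; rewrite indicE memNset ?mul0r// => /posP; rewrite ltNge x0.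
- by apply: aeS fh => x h1 Px; rewrite indicE mem_set// mul1r h1.
Qed.

Lemma mass_pos {f} : (forall x, x <= 0 -> f x = 0) -> mass f = \int[mu]_(x in P) (f x ^+ 2).
Proof.
move=> f0; rewrite /mass (Rint_supp mP)// => x; rewrite posP => /negP; rewrite -leNgt => /f0 ->.
by rewrite expr0n.
Qed.

Lemma rep_close {f g v dv u du : R -> R} {eps} : rep f v dv -> rep g u du ->
  (sobolev_norm 1 P (fun x => f x - g x)%R < eps%:E)%E ->
  h1sq (fun x => v x - u x) (fun x => dv x - du x) <= eps ^+ 2.
Proof.
move=> [Hv v0 dv0 fv] [Hu u0 du0 gu] /sob1_lt [h [d [ah sh sd fgh lt]]].
have [ad [md _] _] := H1B Hv Hu; have cd : continuous (fun x => v x - u x) by case: ad.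
have ch : continuous h by case: ah.
have e0 : forall x, 0 <= x -> v x - u x = h x.
  apply: (cont_ae_pos cd ch); apply: aeS (aeI fgh (aeI fv gu)) => x [h1 [h2 h3]] Px.
  by rewrite -h1// h2// h3.
have e1 := ac_unique_pos ad ah (fun x hx => e0 x (ltW hx)).
apply/ltW/(le_lt_trans _ lt); rewrite /h1sq mass_pos; last by move=> x x0; rewrite v0// u0// subrr.
rewrite mass_pos; last by move=> x x0; rewrite dv0// du0// subrr.
rewrite (eq_Rint _ (fun x => h x ^+ 2)); last by move=> x /posP/ltW/e0 ->.
rewrite (eq_ae_Rint (fun x => d x ^+ 2) (f := fun x => (dv x - du x) ^+ 2)); last first.
  by apply: aeS e1 => x h1 /posP/h1 ->.
by apply: lerD; apply: Rint_ge_sub => //; [case: sh|move=> x _; exact: sqr_ge0|case: sd|move=> x _; exact: sqr_ge0].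
Qed.

End HalfLine.

(** * Boundary identities for smooth profiles *)

Section Chain.
Context {R : realType}.
Local Notation mu := (@lebesgue_measure R).
Local Notation P := (@pos_half_line R).
Implicit Types (D : set R) (g h : nat -> R -> R) (chi f : R -> R) (x y t tau K eps de : R).

Let mT : measurable [set: R]. Proof. exact: measurableT. Qed.
Let mP : measurable P. Proof. exact: measurable_itv. Qed.

(** A function with its first three classical derivatives, the regularity that the flux requires. *)
Definition chain g : Prop :=
  (forall k, (k <= 3)%N -> continuous (g k) /\ sqi setT (g k)) /\
  (forall k, (k < 3)%N -> forall x, is_derive x (1 : R) (g k) (g k.+1 x)).

Definition csq g : R := \sum_(k < 4) \int[mu]_x (g k x ^+ 2).

Lemma csq_ge g {k} : (k <= 3)%N -> \int[mu]_x (g k x ^+ 2) <= csq g.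
Proof.
move=> k3; have -> : k = (Ordinal (k3 : (k < 4)%N)) :> nat by [].
rewrite /csq (bigD1 (Ordinal (k3 : (k < 4)%N)))//= lerDl; apply: sumr_ge0 => i _.
by apply: Rint_ge0 => x _; exact: sqr_ge0.
Qed.

(** The value [- (w_xx + w^2)_x] that the equation prescribes for [w_t]. *)
Definition flux g x : R := - (g 3 x + 2 * (g 0 x * g 1 x)).

(** Minus the gradient of the energy; [flux] is minus its derivative in [x]. *)
Definition potential g x : R := g 2 x + g 0 x * g 0 x.

(** The integral runs over the half-line because a chain is an arbitrary extension to [x < 0]. *)
Definition emass g := \int[mu]_(x in P) (g 0 x ^+ 2).
Definition eenergy g := 1 / 2 * \int[mu]_(x in P) (g 1 x ^+ 2) - 1 / 3 * \int[mu]_(x in P) (g 0 x ^+ 3).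

Section OneChain.
Context {g : nat -> R -> R}.
Hypothesis cg : chain g.

Lemma chain_cont {k} : (k <= 3)%N -> continuous (g k). Proof. by move=> /(cg.1)[]. Qed.

Lemma chain_sqi {k} : (k <= 3)%N -> sqi P (g k).
Proof. by move=> /(cg.1)[_ h]; apply: (sqiS setT). Qed.

Lemma chain_d {k} : (k < 3)%N -> forall x, is_derive x (1 : R) (g k) (g k.+1 x).
Proof. exact: cg.2. Qed.

Lemma chain_meas {k} : (k <= 3)%N -> measurable_fun P (g k).
Proof. by move=> /chain_sqi []. Qed.

Lemma chain_le {k} : (k <= 3)%N -> \int[mu]_(x in P) (g k x ^+ 2) <= csq g.
Proof.
move=> k3; have [_ [_ ik]] := cg.1 k k3.
apply: le_trans (csq_ge g k3); apply: Rint_ge_sub => //.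
by move=> x _; exact: sqr_ge0.
Qed.

Lemma chain_sup {k} : (k < 3)%N -> forall x, g k x ^+ 2 <= 4 * csq g.
Proof.
move=> k3 x; have [ck sk] := cg.1 k (ltnW k3); have [c1 s1] := cg.1 k.+1 k3.
have := ac_sup (ac_C1 (chain_d k3) c1) sk s1 x.
by have := csq_ge g (ltnW k3); have := csq_ge g k3; lra.
Qed.

Lemma chain_bnd : exists2 K : R, 1 <= K & forall k, (k < 3)%N -> forall x, `|g k x| <= K.
Proof.
have c0 : 0 <= csq g.
  by apply: le_trans (csq_ge g (leq0n 3 : (0 <= 3)%N)); apply: Rint_ge0 => x _; exact: sqr_ge0.
exists (1 + 4 * csq g); first by lra.
move=> k k3 x; apply: sqr_le_norm; first by lra.
by apply: le_trans (chain_sup k3 x) _; have := sqr_ge0 (csq g); lra.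
Qed.

Lemma sqi_01 k : (k < 3)%N -> sqi P (fun x => g 0 x * g k x).
Proof.
move=> k3; have [K _ gK] := chain_bnd; apply: (sqi_bM K) => //.
- exact: chain_meas.
- by move=> x _; exact: gK.
- exact: chain_sqi (ltnW k3).
Qed.

Lemma sqi_flux : sqi P (flux g).
Proof.
apply: sqiN => //; apply: sqiD => //; first exact: chain_sqi.
by apply: sqiZ => //; exact: sqi_01.
Qed.

Lemma sqi_potential : sqi P (potential g).
Proof. by apply: sqiD => //; [exact: chain_sqi|exact: sqi_01]. Qed.

Lemma flux_cont : continuous (flux g).
Proof.
move=> x; apply: cvgN; apply: cvgD; first exact: chain_cont.
by apply: cvgMr; apply: cvgM; exact: chain_cont.
Qed.

(** The integrations by parts are packed into one primitive [F]; it vanishes at 0 because [chi] and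
    its derivatives do. *)
Lemma flux_test {chi} : test_function P chi ->
  \int[mu]_(x in P) (flux g x * chi x) = rate chi (g 0).
Proof.
move=> tc; have t1 := test_derive tc; have t2 := test_derive t1; have t3 := test_derive t2.
have d0 := smooth_d (test_smooth tc); have d1 := smooth_d (test_smooth t1).
have d2 := smooth_d (test_smooth t2).
pose F x := g 0 x * derive1 (derive1 chi) x - g 1 x * derive1 chi x + g 2 x * chi x
  + g 0 x * g 0 x * chi x.
pose D x := (g 0 x * derive1 (derive1 (derive1 chi)) x + g 0 x ^+ 2 * derive1 chi x) - flux g x * chi x.
have dF x : is_derive x (1 : R) F (D x).
  have a0 := chain_d (isT : (0 < 3)%N) x; have a1 := chain_d (isT : (1 < 3)%N) x.
  have a2 := chain_d (isT : (2 < 3)%N) x.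
  have h1 := dD (dD (dB (dM a0 (d2 x)) (dM a1 (d1 x))) (dM a2 (d0 x))) (dM (dM a0 a0) (d0 x)).
  apply: d_eq h1 _; rewrite /D /flux; move: (derive1 _ x) (derive1 (derive1 chi) x) (derive1 chi x) (chi x).
  by move: (g 0 x) (g 1 x) (g 2 x) (g 3 x) => *; ring.
have c0 := chain_cont (isT : (0 <= 3)%N).
have cD : continuous D.
  move=> x; apply: cvgB; last by apply: cvgM; [exact: flux_cont|exact: test_cont tc x].
  apply: cvgD; first by apply: cvgM; [exact: c0|exact: test_cont t3 x].
  by apply: cvgM; [exact: (cvgM (c0 x) (c0 x))|exact: test_cont t1 x].
have iR : intg P (fun x => g 0 x * derive1 (derive1 (derive1 chi)) x + g 0 x ^+ 2 * derive1 chi x).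
  apply: intgD => //; first by apply: sqiM => //; [exact: chain_sqi|exact: test_sqi t3].
  by apply: (intg_sqr_test t1); exact: chain_sqi.
have iN : intg P (fun x => flux g x * chi x) by apply: sqiM => //; [exact: sqi_flux|exact: test_sqi tc].
have iF : intg P F.
  apply: intgD => //; last by apply: sqiM => //; [exact: sqi_01|exact: test_sqi tc].
  apply: intgD => //; last by apply: sqiM => //; [exact: chain_sqi|exact: test_sqi tc].
  apply: intgB => //; first by apply: sqiM => //; [exact: chain_sqi|exact: test_sqi t2].
  by apply: sqiM => //; [exact: chain_sqi|exact: test_sqi t1].
have n0 : ~ P 0 by rewrite posP ltxx.
have := half_int dF cD iF (intgB mP iR iN); rewrite RintB// /F.
rewrite (test_out tc 0 n0) (test_out t1 0 n0) (test_out t2 0 n0) !mulr0 !addr0 subr0 oppr0.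
by move=> /eqP; rewrite subr_eq0 => /eqP <-.
Qed.

Lemma intg_cube : intg P (fun x => g 0 x ^+ 3).
Proof.
apply: (@eq_intg _ _ (fun x => g 0 x * (g 0 x * g 0 x))) => //.
by apply: sqiM => //; [exact: chain_sqi|exact: sqi_01].
Qed.

(** The integrand is the derivative of [1/2 w_x^2 - w w_xx - 2/3 w^3], of which only [1/2 w_x(0)^2]
    survives at the boundary. *)
Lemma flux_mass : g 0 0 = 0 -> \int[mu]_(x in P) (flux g x * g 0 x) = - (1 / 2 * g 1 0 ^+ 2).
Proof.
move=> g0; pose F x := 1 / 2 * (g 1 x * g 1 x) - g 0 x * g 2 x - 2 / 3 * (g 0 x * g 0 x * g 0 x).
have dF x : is_derive x (1 : R) F (flux g x * g 0 x).
  have a0 := chain_d (isT : (0 < 3)%N) x; have a1 := chain_d (isT : (1 < 3)%N) x.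
  have a2 := chain_d (isT : (2 < 3)%N) x.
  have h1 := dB (dB (dZ (1 / 2) (dM a1 a1)) (dM a0 a2)) (dZ (2 / 3) (dM (dM a0 a0) a0)).
  by apply: d_eq h1 _; rewrite /flux; field.
rewrite (half_int dF).
- by rewrite /F g0; congr (- _); ring.
- by move=> x; apply: cvgM; [exact: flux_cont|exact: chain_cont].
- apply: intgB => //; first apply: intgB => //.
  + by apply: intgZ => //; apply: sqiM => //; exact: chain_sqi.
  + by apply: sqiM => //; exact: chain_sqi.
  + by apply: intgZ => //; apply: sqiM => //; [exact: sqi_01|exact: chain_sqi].
- by apply: sqiM => //; [exact: sqi_flux|exact: chain_sqi].
Qed.

(** The integrand is the derivative of [- 1/2 potential^2], whatever the boundary value of [g 0]. *)
Lemma flux_energy : \int[mu]_(x in P) (flux g x * potential g x) = 1 / 2 * potential g 0 ^+ 2.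
Proof.
pose F x := - (1 / 2) * (potential g x * potential g x).
have dp x : is_derive x (1 : R) (potential g) (- flux g x).
  have a0 := chain_d (isT : (0 < 3)%N) x; have a2 := chain_d (isT : (2 < 3)%N) x.
  by apply: d_eq (dD a2 (dM a0 a0)) _; rewrite /flux; ring.
have dF x : is_derive x (1 : R) F (flux g x * potential g x).
  by apply: d_eq (dZ (- (1 / 2)) (dM (dp x) (dp x))) _; field.
have sp := sqi_potential; have cp : continuous (potential g).
  move=> x; apply: cvgD; first exact: chain_cont.
  by apply: cvgM; exact: chain_cont.
rewrite (half_int dF).
- by rewrite /F; ring.
- by move=> x; apply: cvgM; [exact: flux_cont|exact: cp].
- by apply: intgZ => //; exact: sqiM.
- by apply: sqiM => //; exact: sqi_flux.
Qed.

End OneChain.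

Lemma chain_ibp {g h} j : chain g -> chain h -> h 0 0 = 0 -> (j < 3)%N ->
  \int[mu]_(x in P) (g j x * h 1 x) = - \int[mu]_(x in P) (g j.+1 x * h 0 x).
Proof.
move=> cg ch h0 j3; have sg := chain_sqi cg (ltnW j3); have sg1 := chain_sqi cg j3.
have s0 := chain_sqi ch (isT : (0 <= 3)%N); have s1 := chain_sqi ch (isT : (1 <= 3)%N).
have dF x : is_derive x (1 : R) (fun x => g j x * h 0 x) (g j.+1 x * h 0 x + g j x * h 1 x).
  exact: dM (chain_d cg j3 x) (chain_d ch (isT : (0 < 3)%N) x).
have i0 := sqiM mP sg1 s0; have i1 := sqiM mP sg s1.
have := half_int dF; rewrite h0 mulr0 oppr0 RintD// => H.
apply/eqP; rewrite -addr_eq0 addrC; apply/eqP/H; [|exact: sqiM|exact: intgD].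
move=> x; apply: cvgD; apply: cvgM.
- exact: (chain_cont cg j3).
- exact: (chain_cont ch (isT : (0 <= 3)%N)).
- exact: (chain_cont cg (ltnW j3)).
- exact: (chain_cont ch (isT : (1 <= 3)%N)).
Qed.

Lemma chainD {g h} : chain g -> chain h -> chain (fun k x => g k x + h k x).
Proof.
move=> [g1 g2] [h1 h2]; split=> k k3.
  split; last by have [_ p] := g1 k k3; have [_ q] := h1 k k3; exact: sqiD.
  by move=> x; apply: cvgD; [have [p _] := g1 k k3; exact: p|have [p _] := h1 k k3; exact: p].
by move=> x; exact: dD (g2 k k3 x) (h2 k k3 x).
Qed.

Lemma flux_close {g} eps : chain g -> 0 < eps -> exists2 de : R, 0 < de &
  forall h, chain h -> csq h <= de ^+ 2 ->
  \int[mu]_(x in P) ((flux (fun k x => g k x + h k x) x - flux g x) ^+ 2) <= eps ^+ 2.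
Proof.
move=> cg e0; have [K K1 gK] := chain_bnd cg.
pose de := Num.min 1 (eps / (13 * K)).
have de0 : 0 < de by rewrite lt_min ltr01 divr_gt0//; lra.
have de1 : de <= 1 by rewrite ge_min lexx.
have de2 : de * (13 * K) <= eps by rewrite -ler_pdivlMr ?ge_min ?lexx ?orbT//; lra.
have ge2 : (de * (13 * K)) ^+ 2 <= eps ^+ 2.
  by rewrite ler_pXn2r ?nnegrE//; [apply: mulr_ge0; lra|exact: ltW].
exists de => // h ch hd.
have [s0 s1 s3] := And3 (chain_sqi ch (isT : (0 <= 3)%N)) (chain_sqi ch (isT : (1 <= 3)%N))
  (chain_sqi ch (isT : (3 <= 3)%N)).
have [l0 l1 l3] := And3 (chain_le ch (isT : (0 <= 3)%N)) (chain_le ch (isT : (1 <= 3)%N))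
  (chain_le ch (isT : (3 <= 3)%N)).
have [_ i0] := s0; have [_ i1] := s1; have [_ i3] := s3.
have [_ iF] := sqiB mP (sqi_flux (chainD cg ch)) (sqi_flux cg).
have KK : 1 <= K ^+ 2 by rewrite exprn_ege1.
(* Pointwise, [(a + 2 (u + v + w))^2 <= 2 a^2 + 24 (u^2 + v^2 + w^2)]. The purely quadratic product
   is tamed by [(h 0)^2 <= 4], whence [120 = 24 + 4 . 24]; in total [2 + 24 + 120 <= 13^2]. *)
apply: (@le_trans _ _ (\int[mu]_(x in P) (2 * h 3 x ^+ 2 + (24 * K ^+ 2 * h 0 x ^+ 2 + 120 * K ^+ 2 * h 1 x ^+ 2)))).
  apply: le_Rint => //; first by do 2?[apply: intgD => //]; exact: intgZ.
  move=> x _; have h0x := chain_sup ch (isT : (0 < 3)%N) x.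
  have g0 : g 0 x ^+ 2 <= K ^+ 2.
    by rewrite -(real_normK (num_real (g 0 x))) ler_pXn2r ?nnegrE//; [exact: gK|lra].
  have g1 : g 1 x ^+ 2 <= K ^+ 2.
    by rewrite -(real_normK (num_real (g 1 x))) ler_pXn2r ?nnegrE//; [exact: gK|lra].
  have -> : flux (fun k x => g k x + h k x) x - flux g x =
    - (h 3 x + 2 * (h 0 x * g 1 x + g 0 x * h 1 x + h 0 x * h 1 x)) by rewrite /flux; ring.
  rewrite sqrrN; move: (h 3 x) (h 0 x) (h 1 x) (g 0 x) (g 1 x) h0x g0 g1 => a3 a0 a1 b0 b1 h0x g0 g1.
  have t1 : (a0 * b1) ^+ 2 <= K ^+ 2 * a0 ^+ 2 by rewrite exprMn mulrC ler_wpM2r ?sqr_ge0.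
  have t2 : (b0 * a1) ^+ 2 <= K ^+ 2 * a1 ^+ 2 by rewrite exprMn ler_wpM2r ?sqr_ge0.
  have t3 : (a0 * a1) ^+ 2 <= 4 * (K ^+ 2 * a1 ^+ 2).
    rewrite exprMn mulrA ler_wpM2r ?sqr_ge0//; apply: (le_trans h0x).
    have : de ^+ 2 <= 1 by rewrite expr_le1// ltW.
    by lra.
  have t4 := sqr_ge0 (a3 - 2 * (a0 * b1 + b0 * a1 + a0 * a1)).
  have t5 := sqr_ge0 (a0 * b1 - b0 * a1); have t6 := sqr_ge0 (a0 * b1 - a0 * a1).
  have t7 := sqr_ge0 (b0 * a1 - a0 * a1).
  move: t1 t2 t3 t4 t5 t6 t7; rewrite -(mulrA 24) -(mulrA 120).
  move: (a0 * b1) (b0 * a1) (a0 * a1) (K ^+ 2 * a0 ^+ 2) (K ^+ 2 * a1 ^+ 2) => u v w p q.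
  by clear => *; lra.
have j0 : intg P (fun x => 24 * K ^+ 2 * h 0 x ^+ 2) by exact: intgZ.
have j1 : intg P (fun x => 120 * K ^+ 2 * h 1 x ^+ 2) by exact: intgZ.
rewrite RintD//; [|exact: intgZ|exact: intgD]; rewrite RintD// !RintZ//.
apply: le_trans ge2; move: l0 l1 l3; set I0 := Rintegral _ _ _; set I1 := Rintegral _ _ _; set I3 := Rintegral _ _ _.
move=> l0 l1 l3; have k0 : 0 <= K ^+ 2 by exact: sqr_ge0.
have m0 : K ^+ 2 * I0 <= K ^+ 2 * de ^+ 2 by rewrite ler_wpM2l//; lra.
have m1 : K ^+ 2 * I1 <= K ^+ 2 * de ^+ 2 by rewrite ler_wpM2l//; lra.
have m3 : I3 <= K ^+ 2 * de ^+ 2.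
  apply: (@le_trans _ _ (de ^+ 2)); first by lra.
  by rewrite ler_peMl// sqr_ge0.
have m4 : 0 <= K ^+ 2 * de ^+ 2 by rewrite mulr_ge0// sqr_ge0.
have -> : (de * (13 * K)) ^+ 2 = 169 * (K ^+ 2 * de ^+ 2) by ring.
move: m0 m1 m3 m4; rewrite -(mulrA 24) -(mulrA 120); move: (K ^+ 2 * I0) (K ^+ 2 * I1) (K ^+ 2 * de ^+ 2) => *; lra.
Qed.

End Chain.

(** * First variation of mass and energy over a short time *)

Section Increment.
Context {R : realType}.
Local Notation mu := (@lebesgue_measure R).
Local Notation P := (@pos_half_line R).
Implicit Types (D : set R) (g h : nat -> R -> R) (chi f : R -> R) (x y t s tau K T eps de : R).

Let mT : measurable [set: R]. Proof. exact: measurableT. Qed.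
Let mP : measurable P. Proof. exact: measurable_itv. Qed.

(** Here [h] models the increment over a time [tau]: small with three derivatives, and equal to
    [tau flux] up to a small multiple of [tau] in [L^2] only. Hence [h] itself is [O(tau)] in [L^2],
    and every term quadratic in [h] gains a further small factor. *)
Lemma increment_bounds {g} eps : chain g -> 0 < eps -> exists de K : R,
  [/\ 0 < de <= 1, 9 * K ^+ 3 * de <= eps, 1 <= K, forall x, `|g 0 x| <= K &
  forall h tau, chain h -> csq h <= de ^+ 2 -> `|tau| <= de ->
  \int[mu]_(x in P) ((h 0 x - tau * flux g x) ^+ 2) <= (de * `|tau|) ^+ 2 ->
  [/\ \int[mu]_(x in P) (h 0 x ^+ 2) <= 4 * K ^+ 2 * de * `|tau|,
     `|\int[mu]_(x in P) (h 0 x * h 2 x)| <= 2 * K * de * `|tau|,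
     `|\int[mu]_(x in P) (g 0 x * h 0 x) - tau * \int[mu]_(x in P) (flux g x * g 0 x)|
       <= K * de * `|tau| &
     `|\int[mu]_(x in P) (potential g x * h 0 x) - tau * \int[mu]_(x in P) (flux g x * potential g x)|
       <= K * de * `|tau|]].
Proof.
move=> cg e0; have [B B1 gB] := chain_bnd cg.
have ge0 (p : R -> R) : 0 <= \int[mu]_(x in P) (p x ^+ 2) by apply: Rint_ge0 => x _; exact: sqr_ge0.
have [A [A1 A2 A3 A4]] := bound3 (ge0 (flux g)) (ge0 (g 0)) (ge0 (potential g)).
pose K := A + B; have K1 : 1 <= K by rewrite /K; lra.
have KA : A <= K ^+ 2.
  by apply: (@le_trans _ _ K); [rewrite /K; lra|rewrite expr2 ler_peMl//; lra].
have K3 : 0 < 9 * K ^+ 3 by rewrite mulr_gt0// exprn_gt0//; lra.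
(* In [increment] the errors of the energy sum to at most [(2 K + 4 K^3 + 8/3 K^2) de |tau|], and
   those of the mass to less than that budget allows; [9 K^3] covers both. *)
pose de := Num.min 1 (eps / (9 * K ^+ 3)).
have de0 : 0 < de by rewrite lt_min ltr01 divr_gt0.
have de1 : de <= 1 by rewrite ge_min lexx.
have de2 : de * (9 * K ^+ 3) <= eps by rewrite -ler_pdivlMr// ge_min lexx orbT.
exists de, K; split => //.
- by rewrite de0.
- by rewrite mulrC.
- by move=> x; apply: le_trans (gB 0%N isT x) _; rewrite /K; lra.
move=> h tau ch hd td hr; have s0 := chain_sqi ch (isT : (0 <= 3)%N).
have s2 := chain_sqi ch (isT : (2 <= 3)%N); have sN := sqi_flux cg.
have sg := chain_sqi cg (isT : (0 <= 3)%N); have sp := sqi_potential cg.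
have stN := sqiZ tau mP sN; have sr := sqiB mP s0 stN.
have K0 : 0 <= K by lra.
have t0 := normr_ge0 tau.
have KK : 1 <= K ^+ 2 by rewrite exprn_ege1.
have dd : de ^+ 2 <= 1 by rewrite expr_le1// ltW.
have h0le : \int[mu]_(x in P) (h 0 x ^+ 2) <= 4 * K ^+ 2 * `|tau| ^+ 2.
  have [_ ir] := sr; have [_ iN] := sN; have [_ i0] := s0.
  apply: (@le_trans _ _ (\int[mu]_(x in P) (2 * (h 0 x - tau * flux g x) ^+ 2 + 2 * tau ^+ 2 * flux g x ^+ 2))).
    apply: le_Rint => //; first by apply: intgD => //; exact: intgZ.
    move=> x _; have := sqr_ge0 (h 0 x - 2 * (tau * flux g x)).
    by move: (h 0 x) (flux g x) => a b; clear; nra.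
  rewrite RintD//; [|exact: intgZ|exact: intgZ]; rewrite !RintZ//.
  rewrite -(real_normK (num_real tau)); have tt := sqr_ge0 `|tau|.
  have : `|tau| ^+ 2 * \int[mu]_(x in P) (flux g x ^+ 2) <= `|tau| ^+ 2 * K ^+ 2.
    by rewrite ler_wpM2l//; exact: le_trans KA.
  have : de ^+ 2 * `|tau| ^+ 2 <= K ^+ 2 * `|tau| ^+ 2 by rewrite ler_wpM2r//; lra.
  move: hr; rewrite exprMn -(mulrA 2) -(mulrA 4); move: (Rintegral _ _ _) (`|tau| ^+ 2 * _) => a b.
  by rewrite (mulrC _ (K ^+ 2)); move: (_ * `|tau| ^+ 2) (K ^+ 2 * _) => c d; clear; lra.
have tde : `|tau| ^+ 2 <= de * `|tau| by rewrite expr2 ler_wpM2r.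
have pair (p : R -> R) : sqi P p -> \int[mu]_(x in P) (p x ^+ 2) <= A ->
    `|\int[mu]_(x in P) (p x * h 0 x) - tau * \int[mu]_(x in P) (flux g x * p x)| <= K * de * `|tau|.
  move=> sq qA; have i1 := sqiM mP sq s0; have i2 := sqiM mP sN sq.
  rewrite -RintZ// -RintB//; last exact: intgZ.
  rewrite (eq_Rint _ (fun x => p x * (h 0 x - tau * flux g x))); last by move=> x _; ring.
  rewrite -mulrA; apply: Rint_CS_le => //; first by rewrite mulr_ge0// ltW.
  exact: le_trans KA.
split; [| |exact: pair|exact: pair].
- by apply: le_trans h0le _; rewrite -(mulrA (4 * _)) ler_wpM2l// mulr_ge0 ?sqr_ge0.
- have -> : 2 * K * de * `|tau| = (2 * K * `|tau|) * de by ring.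
  apply: Rint_CS_le => //; first by rewrite !mulr_ge0.
  + exact: ltW.
  + by apply: le_trans h0le _; rewrite le_eqVlt; apply/orP/or_introl/eqP; ring.
  + exact: le_trans (chain_le ch (isT : (2 <= 3)%N)) hd.
Qed.

(** The delicate term of the energy is [1/2 int h_x^2], for which no bound linear in [tau] is at
    hand. Since [h] vanishes at 0 it equals [- 1/2 int h h_xx], the product of an [O(tau)] factor
    and a small one. The linear terms are the pairings evaluated in [flux_mass] and
    [flux_energy]. *)
Lemma increment {g} eps : chain g -> g 0 0 = 0 -> 0 < eps -> exists2 de : R, 0 < de &
  forall h tau, chain h -> h 0 0 = 0 -> csq h <= de ^+ 2 -> `|tau| <= de ->
  \int[mu]_(x in P) ((h 0 x - tau * flux g x) ^+ 2) <= (de * `|tau|) ^+ 2 ->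
  `|emass (fun k x => g k x + h k x) - emass g - tau * (- g 1 0 ^+ 2)| <= eps * `|tau| /\
  `|eenergy (fun k x => g k x + h k x) - eenergy g - tau * (- (1 / 2 * potential g 0 ^+ 2))|
    <= eps * `|tau|.
Proof.
move=> cg g00 e0; have [de [K [/andP[de0 de1] Kde K1 gK H]]] := increment_bounds eps cg e0.
exists de => // h tau ch h00 hd td hr; have [b1 b2 b3 b4] := H h tau ch hd td hr.
have [g0 g1 g2] := And3 (chain_sqi cg (isT : (0 <= 3)%N)) (chain_sqi cg (isT : (1 <= 3)%N))
  (chain_sqi cg (isT : (2 <= 3)%N)).
have [h0 h1 h2] := And3 (chain_sqi ch (isT : (0 <= 3)%N)) (chain_sqi ch (isT : (1 <= 3)%N))
  (chain_sqi ch (isT : (2 <= 3)%N)).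
have t0 := normr_ge0 tau; have dt0 : 0 <= de * `|tau| by rewrite mulr_ge0// ltW.
have K0 : 0 <= K by exact: le_trans K1.
have KK : 1 <= K ^+ 2 by rewrite exprn_ege1.
have p1 : K <= K ^+ 3 by rewrite exprS ler_peMr.
have p2 : K ^+ 2 <= K ^+ 3 by rewrite exprS ler_peMl// sqr_ge0.
have q1 : K * (de * `|tau|) <= K ^+ 3 * (de * `|tau|) by rewrite ler_wpM2r.
have q2 : K ^+ 2 * (de * `|tau|) <= K ^+ 3 * (de * `|tau|) by rewrite ler_wpM2r.
have q3 : 9 * (K ^+ 3 * (de * `|tau|)) <= eps * `|tau|.
  by rewrite mulrA (mulrA (9 * _) de) ler_wpM2r.
have [[_ i00] [_ i11]] := (h0, h1); have [[_ j0] [_ j1]] := (g0, g1).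
have igh := sqiM mP g0 h0.
move: b3 b4; rewrite (flux_mass cg g00) (flux_energy cg) => b3 b4.
have Y0 : 0 <= \int[mu]_(x in P) (h 0 x ^+ 2) by apply: Rint_ge0 => x _; exact: sqr_ge0.
split.
  have -> : emass (fun k x => g k x + h k x) =
      emass g + 2 * \int[mu]_(x in P) (g 0 x * h 0 x) + \int[mu]_(x in P) (h 0 x ^+ 2).
    rewrite /emass -RintZ// -RintD//; last exact: intgZ.
    rewrite -RintD//; last by apply: intgD => //; exact: intgZ.
    by apply: eq_Rint => x _; ring.
  move: b1 b3 q1 q2 q3 Y0; rewrite -!(mulrA _ de) -(mulrA 4) !ler_norml.
  move: (Rintegral _ _ _) (\int[mu]_(x in P) (h 0 x ^+ 2)) (emass g) => X Y m.
  move: (K * _) (K ^+ 2 * _) (K ^+ 3 * _) (eps * _) => w1 w2 w3 e.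
  by clear => ? /andP[? ?] *; apply/andP; split; lra.
have sup x : `|h 0 x| <= 2.
  apply: sqr_le_norm => //; apply: le_trans (chain_sup ch (isT : (0 < 3)%N) x) _.
  have : de ^+ 2 <= 1 by rewrite expr_le1// ltW.
  by move: hd; clear; lra.
have small (p : R -> R) (B : R) : measurable_fun P p -> (forall x, `|p x| <= B) ->
    intg P (fun x => p x * h 0 x ^+ 2) /\
    `|\int[mu]_(x in P) (p x * h 0 x ^+ 2)| <= B * \int[mu]_(x in P) (h 0 x ^+ 2).
  move=> mp pB; have ip : intg P (fun x => p x * h 0 x ^+ 2) by apply: (intg_bM B).
  split => //; rewrite -RintZ//; apply: normr_Rint_le => //; [exact: intg_meas ip|exact: intgZ|].
  by move=> x _; rewrite normrM (ger0_norm (sqr_ge0 _)) ler_wpM2r ?sqr_ge0.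
have [iA bA] := small _ _ g0.1 gK; have [iB bB] := small _ _ h0.1 sup.
have i11' := sqiM mP g1 h1; have ih := sqiM mP g2 h0; have ig2 := sqiM mP (sqi_01 cg 0 isT) h0.
have E : eenergy (fun k x => g k x + h k x) = eenergy g
    - \int[mu]_(x in P) (potential g x * h 0 x) - 1 / 2 * \int[mu]_(x in P) (h 0 x * h 2 x)
    - \int[mu]_(x in P) (g 0 x * h 0 x ^+ 2) - 1 / 3 * \int[mu]_(x in P) (h 0 x * h 0 x ^+ 2).
  have e1 : \int[mu]_(x in P) ((g 1 x + h 1 x) ^+ 2) = \int[mu]_(x in P) (g 1 x ^+ 2)
      + 2 * \int[mu]_(x in P) (g 1 x * h 1 x) + \int[mu]_(x in P) (h 1 x ^+ 2).
    rewrite -RintZ// -RintD//; last exact: intgZ.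
    rewrite -RintD//; last by apply: intgD => //; exact: intgZ.
    by apply: eq_Rint => x _; ring.
  have e2 : \int[mu]_(x in P) ((g 0 x + h 0 x) ^+ 3) = \int[mu]_(x in P) (g 0 x ^+ 3)
      + 3 * \int[mu]_(x in P) (g 0 x * g 0 x * h 0 x) + 3 * \int[mu]_(x in P) (g 0 x * h 0 x ^+ 2)
      + \int[mu]_(x in P) (h 0 x * h 0 x ^+ 2).
    have ic := intg_cube cg.
    rewrite -RintZ// -RintZ// -RintD//; last exact: intgZ.
    rewrite -RintD//; [|by apply: intgD => //; exact: intgZ|exact: intgZ].
    rewrite -RintD//; last by do 2?[apply: intgD => //]; exact: intgZ.
    by apply: eq_Rint => x _; ring.
  have e3 : \int[mu]_(x in P) (h 1 x ^+ 2) = - \int[mu]_(x in P) (h 0 x * h 2 x).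
    rewrite (eq_Rint _ (fun x => h 1 x * h 1 x)); last by move=> x _; rewrite expr2.
    by rewrite (chain_ibp 1 ch ch h00 isT); congr (- _); apply: eq_Rint => x _; rewrite mulrC.
  have e4 : \int[mu]_(x in P) (potential g x * h 0 x) =
      \int[mu]_(x in P) (g 2 x * h 0 x) + \int[mu]_(x in P) (g 0 x * g 0 x * h 0 x).
    by rewrite -RintD//; apply: eq_Rint => x _; rewrite /potential; ring.
  by rewrite /eenergy e1 e2 e3 e4 (chain_ibp 1 cg ch h00 isT); field.
rewrite E; move: b1 b2 b4 bA bB q1 q2 q3 Y0; rewrite -!(mulrA _ de) -(mulrA 4) -(mulrA 2) !ler_norml.
have KY : 4 * (K ^+ 3 * (de * `|tau|)) = K * (4 * (K ^+ 2 * (de * `|tau|))) by ring.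
move=> b1; have := ler_wpM2l K0 b1; rewrite -{}KY; move: b1.
move: (\int[mu]_(x in P) (h 0 x * h 2 x)) (\int[mu]_(x in P) (potential g x * h 0 x)) => I1 I2.
move: (\int[mu]_(x in P) (g 0 x * h 0 x ^+ 2)) (\int[mu]_(x in P) (h 0 x * h 0 x ^+ 2)) => I3 I4.
move: (\int[mu]_(x in P) (h 0 x ^+ 2)) (eenergy g) => Y m.
move: (K * Y) (K * (de * _)) (K ^+ 2 * _) (K ^+ 3 * _) (eps * _) => KY w1 w2 w3 e.
by clear => ? ? /andP[? ?] /andP[? ?] /andP[? ?] /andP[? ?] *; apply/andP; split; lra.
Qed.

End Increment.

(** * Monotonicity of mass and energy for the smoother solutions *)

Section SmoothMonotone.
Context {R : realType}.
Local Notation mu := (@lebesgue_measure R).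
Local Notation P := (@pos_half_line R).
Implicit Types (D : set R) (g h : nat -> R -> R) (chi f : R -> R) (x y t s a b d tau K T eps de : R).

Let mT : measurable [set: R]. Proof. exact: measurableT. Qed.
Let mP : measurable P. Proof. exact: measurable_itv. Qed.

Lemma eps_derive {f s d} : (forall eps, 0 < eps -> exists2 de : R, 0 < de &
  forall t, `|t - s| < de -> `|f t - f s - (t - s) * d| <= eps * `|t - s|) ->
  is_derive s (1 : R) f d.
Proof.
move=> H; have h1 : (fun h : R => h^-1 *: (f (h *: 1 + s) - f s)) @ 0^' --> d.
  apply/cvgrPdist_le => eps e0; have [de de0 Hd] := H eps e0.
  near=> h.
  have hn : h != 0 by near: h; exact: nbhs_dnbhs_neq.
  have hde : `|h| < de by near: h; apply: dnbhs0_lt.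
  rewrite distrC; have := Hd (h + s); rewrite addrK => /(_ hde) le1.
  have -> : h^-1 *: (f (h *: 1 + s) - f s) - d = h^-1 * (f (h + s) - f s - h * d).
    by rewrite [_ *: 1]mulr1 mulrBr mulKf.
  by rewrite normrM normfV mulrC ler_pdivrMr ?normr_gt0.
apply: DeriveDef; first by apply/cvg_ex; exists d.
exact: cvg_lim h1.
Unshelve. all: by end_near. Qed.

Lemma noninc_of_eps {f T} : (forall s, 0 < s < T -> exists2 d : R, d <= 0 & forall eps, 0 < eps ->
  exists2 de : R, 0 < de & forall t, 0 < t < T -> `|t - s| <= de ->
  `|f t - f s - (t - s) * d| <= eps * `|t - s|) ->
  forall a b, 0 < a -> a <= b -> b < T -> f b <= f a.
Proof.
move=> H a b a0 ab bT.
have D s : 0 < s < T -> exists2 d : R, d <= 0 & is_derive s (1 : R) f d.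
  move=> /[dup] sT /andP[s0 s1]; have [d d0 Hd] := H s sT; exists d => //.
  apply: eps_derive => eps e0; have [de de0 He] := Hd eps e0.
  exists (Num.min de (Num.min s (T - s))); first by rewrite !lt_min de0 s0 subr_gt0.
  move=> t; rewrite !lt_min => /and3P[h1 h2 h3]; apply: He; last exact: ltW.
  by move: h2 h3; rewrite !ltr_norml => /andP[? ?] /andP[? ?]; apply/andP; split; lra.
apply: (@ler0_derive1_le_oo R f 0 T) => //.
- by move=> x; rewrite in_itv => /D [d _ []].
- by move=> x; rewrite in_itv => /D [d d0 [_ e]]; rewrite derive1E e.
- move=> x; rewrite inE/= in_itv => /D [d _ [dx _]].
  by apply: differentiable_continuous; exact/derivable1_diffP.
- by rewrite in_itv/= bT (lt_le_trans a0).
- by rewrite in_itv/= a0 (le_lt_trans ab).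
Qed.

Lemma chain_of_sob4 {f : R -> R} {eps} : (sobolev_norm 4 P f < eps%:E)%E -> exists g,
  [/\ chain g, {ae mu, forall x, P x -> f x = g 0 x} & csq g < eps ^+ 2].
Proof. by move=> /sob4_lt [g [g1 g2 g3 g4]]; exists g; split. Qed.

Lemma chain_eq {g h} : chain g -> chain h -> (forall x, 0 <= x -> g 0 x = h 0 x) ->
  forall k, (k <= 3)%N -> forall x, 0 <= x -> g k x = h k x.
Proof.
move=> cg ch gh; elim=> [//|k IH] k3.
apply: (deriv_pos (chain_d cg k3) (chain_d ch k3)) => //.
- exact: chain_cont cg _ k3.
- exact: chain_cont ch _ k3.
- exact: IH (ltnW k3).
Qed.

Lemma emass_eq {g h} : chain g -> chain h -> (forall x, 0 <= x -> g 0 x = h 0 x) ->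
  emass g = emass h /\ eenergy g = eenergy h.
Proof.
move=> cg ch gh; have E k (k3 : (k <= 3)%N) : forall x, P x -> g k x = h k x.
  by move=> x /posP/ltW; exact: (chain_eq cg ch gh k k3).
rewrite /emass /eenergy; split; first by apply: eq_Rint => x Px; rewrite (E 0%N).
by congr (_ * _ - _ * _); apply: eq_Rint => x Px; [rewrite (E 1%N)|rewrite (E 0%N)].
Qed.

Lemma rep_chain {f v dv : R -> R} {g} : rep f v dv -> chain g ->
  {ae mu, forall x, P x -> f x = g 0 x} -> mass v = emass g /\ energy v dv = eenergy g.
Proof.
move=> [[av sv sd] v0 dv0 fv] cg fg.
have cv : continuous v by case: av.
have c0 := chain_cont cg (isT : (0 <= 3)%N); have c1 := chain_cont cg (isT : (1 <= 3)%N).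
have e0 : forall x, 0 <= x -> v x = g 0 x.
  by apply: (cont_ae_pos cv c0); apply: aeS (aeI fv fg) => x [h1 h2] Px; rewrite -h1// h2.
have ag := ac_C1 (chain_d cg (isT : (0 < 3)%N)) c1.
have e1 := ac_unique_pos av ag (fun x hx => e0 x (ltW hx)).
have m0 : mass v = emass g.
  by rewrite mass_pos// /emass; apply: eq_Rint => x /posP/ltW/e0 ->.
split => //; rewrite /energy /eenergy; congr (_ * _ - _ * _).
  rewrite -/(mass dv) mass_pos//; apply: eq_ae_Rint; apply: aeS e1 => x h /posP/h -> //.
rewrite (Rint_supp mP) => [|x]; first by apply: eq_Rint => x /posP/ltW/e0 ->.
by rewrite posP => /negP; rewrite -leNgt => /v0 ->; rewrite expr0n.
Qed.

Lemma in_sobolev_lt {r : R} {I : set R} {f} : in_sobolev r I f -> exists a, (sobolev_norm r I f < a%:E)%E.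
Proof.
have := sob_ge0 r I f; rewrite /in_sobolev; case: (sobolev_norm r I f) => // a _ _.
by exists (a + 1); rewrite lte_fin ltrDl.
Qed.

Lemma sobolev_continuous_eps {J I : set R} {r : R} {w : R -> R -> R} {s} eps :
  sobolev_continuous J r I w -> J s -> 0 < eps -> exists2 de : R, 0 < de & forall t, J t ->
  `|t - s| < de -> (sobolev_norm r I (fun x => w t x - w s x)%R < eps%:E)%E.
Proof.
move=> cw Js e0; have [_ cs] := cw s Js.
have /cs : nbhs (0%R%:E : \bar R) [set y | (y < eps%:E)%E] by exact: (@nbhs_open_ereal_lt _ 0 (fun=> eps)).
move=> /nbhs_ballP[de /= de0 H]; exists de => // t Jt ts.
by apply: H Jt; rewrite /ball/= distrC.
Qed.

(** Chains chosen at different times are unrelated for [x < 0], so continuity in time is expressed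
    by a separate small chain [h] that accounts for the difference on [x >= 0]. *)
Lemma smooth_reps {T} {w : R -> R -> R} : sobolev_continuous `[0, T] 4 P w ->
  kdv_zero_boundary T w -> exists G : R -> nat -> R -> R,
  [/\ forall t, 0 <= t <= T -> chain (G t) /\ {ae mu, forall x, P x -> w t x = G t 0 x},
      forall t, 0 < t < T -> G t 0 0 = 0 &
      forall s eps, 0 <= s <= T -> 0 < eps -> exists2 de : R, 0 < de & forall t, 0 <= t <= T ->
        `|t - s| < de -> exists h,
        [/\ chain h, csq h <= eps ^+ 2 & forall x, 0 <= x -> G t 0 x = G s 0 x + h 0 x]].
Proof.
move=> cw [_ tr].
have itvE t : 0 <= t <= T -> `[0, T]%classic t by rewrite /= in_itv.
have exG t : exists g, 0 <= t <= T -> chain g /\ {ae mu, forall x, P x -> w t x = g 0 x}.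
  have [tT|tT] := boolP (0 <= t <= T); last by exists (fun _ _ => 0).
  have [fin _] := cw t (itvE t tT); have [a fa] := in_sobolev_lt fin.
  by have [g [cg fg _]] := chain_of_sob4 fa; exists g.
have [G HG] := choice exG.
have cG0 t : 0 <= t <= T -> continuous (G t 0).
  by move=> /HG[cg _]; exact: (chain_cont cg (isT : (0 <= 3)%N)).
exists G; split => //.
- move=> t /[dup] tT /andP[/ltW t0 /ltW tT']; have [g [cg wg g0]] := tr t tT.
  have tT2 : 0 <= t <= T by rewrite t0.
  have [_ wG] := HG t tT2; rewrite -[RHS]g0; apply: (cont_ae_pos (cG0 t tT2) cg) => //.
  by apply: aeS (aeI wg wG) => x [h1 h2] Px; rewrite -h1// h2.
- move=> s eps sT e0; have [de de0 H] := sobolev_continuous_eps eps cw (itvE s sT) e0.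
  exists de => // t tT ts; have [h [ch wh hlt]] := chain_of_sob4 (H t (itvE t tT) ts).
  exists h; split => //; first exact: ltW.
  have c0 := chain_cont ch (isT : (0 <= 3)%N).
  have [_ wt] := HG t tT; have [_ ws] := HG s sT; have cs := cG0 s sT.
  apply: (cont_ae_pos (cG0 t tT)).
    by move=> x; apply: cvgD; [exact: cs|exact: c0].
  by apply: aeS (aeI wh (aeI wt ws)) => x [h1 [h2 h3]] Px; rewrite -h1// h2// h3// addrC subrK.
Qed.

(** The time derivative is obtained in [L^2] by duality. For each test function, [weak_time]
    compares [int h chi] with [(t - s) int flux chi], with an error governed by the oscillation of
    the flux in [L^2], which is small by [flux_close]. The error is linear in the norm of [chi], so
    [dual_L2] gives the bound on the remainder. *)
Lemma chain_flow {T} {w : R -> R -> R} {G : R -> nat -> R -> R} : kdv_zero_boundary T w ->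
  (forall t, 0 <= t <= T -> chain (G t) /\ {ae mu, forall x, P x -> w t x = G t 0 x}) ->
  (forall t, 0 < t < T -> G t 0 0 = 0) ->
  (forall s eps, 0 <= s <= T -> 0 < eps -> exists2 de : R, 0 < de & forall t, 0 <= t <= T ->
    `|t - s| < de -> exists h,
    [/\ chain h, csq h <= eps ^+ 2 & forall x, 0 <= x -> G t 0 x = G s 0 x + h 0 x]) ->
  forall s eps, 0 < s < T -> 0 < eps -> exists2 de : R, 0 < de & forall t, 0 < t < T ->
  `|t - s| <= de -> exists h, [/\ chain h, h 0 0 = 0, csq h <= eps ^+ 2,
    forall x, 0 <= x -> G t 0 x = G s 0 x + h 0 x &
    \int[mu]_(x in P) ((h 0 x - (t - s) * flux (G s) x) ^+ 2) <= (eps * `|t - s|) ^+ 2].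
Proof.
move=> kw HG G0 close s eps sT e0.
have wid t : 0 < t < T -> 0 <= t <= T by move=> /andP[/ltW -> /ltW].
have cG t : 0 <= t <= T -> chain (G t) by move=> /HG[].
have cv : L2cont T (fun t => G t 0).
  move=> r rT e e1; have m0 : 0 < Num.min 1 e by rewrite lt_min ltr01.
  have m1 : Num.min 1 e <= 1 by rewrite ge_min lexx.
  have m2 : Num.min 1 e <= e by rewrite ge_min lexx orbT.
  have [de de0 H] := close r _ rT m0; exists de => // t tT /(H t tT) [h [ch hle Gh]].
  apply: le_trans m2; apply: (@le_trans _ _ (Num.min 1 e ^+ 2)); last by rewrite expr2 ler_piMl// ltW.
  apply: le_trans hle; apply: le_trans (chain_le ch (isT : (0 <= 3)%N)).
  rewrite le_eqVlt; apply/orP/or_introl/eqP; apply: eq_Rint => x /posP/ltW/Gh ->.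
  by rewrite addrAC subrr add0r.
have reps t : 0 <= t <= T -> sqi P (G t 0) /\ {ae mu, forall x, P x -> w t x = G t 0 x}.
  by move=> /HG[cg wg]; split => //; exact: (chain_sqi cg (isT : (0 <= 3)%N)).
have [d1 d10 Hf] := flux_close eps (cG s (wid s sT)) e0.
have m0 : 0 < Num.min eps d1 by rewrite lt_min e0.
have m1 : Num.min eps d1 <= eps by rewrite ge_min lexx.
have m2 : Num.min eps d1 <= d1 by rewrite ge_min lexx orbT.
have [d2 d20 Hc] := close s _ (wid s sT) m0.
exists (d2 / 2); first by rewrite divr_gt0.
move=> t tT ts; have ts2 : `|t - s| < d2 by lra.
have [h [ch hle Gh]] := Hc t (wid t tT) ts2.
have sq (x y : R) : 0 < x -> x <= y -> x ^+ 2 <= y ^+ 2.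
  by move=> x0 xy; rewrite ler_pXn2r ?nnegrE//; lra.
exists h; split => //.
- by have := Gh 0 (lexx 0); rewrite !G0// add0r.
- exact: le_trans (sq _ _ m0 m1).
have cs := cG s (wid s sT); have sF := sqi_flux cs; have h0 := chain_sqi ch (isT : (0 <= 3)%N).
have c0 := chain_cont ch (isT : (0 <= 3)%N).
apply: dual_L2.
- by move=> x; apply: cvgB; [exact: c0|apply: cvgMr; exact: flux_cont].
- by apply: sqiB => //; exact: sqiZ.
- by rewrite mulr_ge0// ltW.
move=> chi b tc b0 chib.
have sc : sqi P chi by exact: test_sqi tc.
have slow r : 0 <= r <= T -> `|r - s| < d2 -> `|rate chi (G r 0) - \int[mu]_(x in P) (flux (G s) x * chi x)| <= eps * b.
  move=> rT rs; have [k [ck kle Gk]] := Hc r rT rs; have cr := cG r rT.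
  have csk := chainD cs ck.
  have := Hf k ck (le_trans kle (sq _ _ m0 m2)).
  rewrite -(flux_test cr tc).
  have E x : P x -> flux (G r) x = flux (fun k0 x => G s k0 x + k k0 x) x.
    move=> /posP/ltW x0; have F j (j3 : (j <= 3)%N) := chain_eq cr csk Gk j j3 x x0.
    by rewrite /flux (F 0%N isT) (F 1%N isT) (F 3%N isT).
  rewrite (eq_Rint (fun x => flux (G r) x * chi x) (fun x => flux (fun k0 x => G s k0 x + k k0 x) x * chi x)); last first.
    by move=> x /E ->.
  have sk := sqi_flux csk; move=> fle.
  rewrite -RintB//; [|exact: sqiM|exact: sqiM].
  rewrite (eq_Rint _ (fun x => (flux (fun k0 x => G s k0 x + k k0 x) x - flux (G s) x) * chi x)).
    by apply: Rint_CS_le => //; [exact: sqiB|exact: ltW].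
  by move=> x _; rewrite mulrBl.
have -> : \int[mu]_(x in P) ((h 0 x - (t - s) * flux (G s) x) * chi x) =
    \int[mu]_(x in P) (G t 0 x * chi x) - \int[mu]_(x in P) (G s 0 x * chi x)
    - \int[mu]_(x in P) (flux (G s) x * chi x) * (t - s).
  have [[st _] [ss _]] := (reps t (wid t tT), reps s (wid s sT)).
  have i1 := sqiM mP st sc; have i2 := sqiM mP ss sc; have i3 := sqiM mP sF sc.
  rewrite mulrC -RintZ// -RintB// -RintB//; [|exact: intgB|exact: intgZ].
  by apply: eq_Rint => x /posP/ltW/Gh ->; ring.
have [[s0 s1] [t0 t1]] := (andP sT, andP tT).
have [st|st] := leP s t.
  rewrite [`|t - s|]ger0_norm ?subr_ge0// mulrAC.
  apply: (weak_time kw reps cv tc) => //; first exact: ltW.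
  move=> r /andP[r1 r2]; apply: slow; first by rewrite (le_trans (ltW s0) r1) (le_trans r2 (ltW t1)).
  by move: ts2; rewrite !ger0_norm ?subr_ge0//; clear -r2; lra.
(* For [t < s] the forward estimate is used from [t] to [s], and the sign is reversed. *)
rewrite [in leRHS]distrC [`|s - t|]gtr0_norm ?subr_gt0// mulrAC.
have := weak_time kw reps cv tc t s (\int[mu]_(x in P) (flux (G s) x * chi x)) (eps * b) (ltW t0) (ltW st) s1.
move=> H; have : `|\int[mu]_(x in P) (G s 0 x * chi x) - \int[mu]_(x in P) (G t 0 x * chi x)
    - \int[mu]_(x in P) (flux (G s) x * chi x) * (s - t)| <= eps * b * (s - t).
  apply: H => r /andP[r1 r2]; apply: slow; first by rewrite (le_trans (ltW t0) r1) (le_trans r2 (ltW s1)).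
  by move: ts2; rewrite !(distrC _ s) !ger0_norm ?subr_ge0 ?(ltW st)//; clear -r1; lra.
move=> le; apply: (le_trans _ le); rewrite -[leRHS]normrN le_eqVlt; apply/orP/or_introl/eqP.
by congr (`|_|); ring.
Qed.

(** [chain_flow] provides the increments required by [increment], so mass and energy are
    differentiable in time with derivatives [- w_x(0)^2] and [- 1/2 w_xx(0)^2]. *)
Lemma smooth_monotone {T} {w : R -> R -> R} : sobolev_continuous `[0, T] 4 P w ->
  kdv_zero_boundary T w ->
  forall s t v dv u du, 0 < s -> s <= t -> t < T -> rep (w s) v dv -> rep (w t) u du ->
  mass u <= mass v /\ energy u du <= energy v dv.
Proof.
move=> cw kw s t v dv u du s0 st tT Hv Hu.
have [G [HG G0 close]] := smooth_reps cw kw.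
have flow := chain_flow kw HG G0 close.
have wid r : 0 < r < T -> 0 <= r <= T by move=> /andP[/ltW -> /ltW].
have sT : 0 < s < T by rewrite s0 (le_lt_trans st).
have tT' : 0 < t < T by rewrite tT (lt_le_trans s0).
have [cs ws] := HG s (wid s sT); have [ct wt] := HG t (wid t tT').
have [-> ->] := rep_chain Hv cs ws; have [-> ->] := rep_chain Hu ct wt.
have key r : 0 < r < T -> forall eps, 0 < eps -> exists2 de : R, 0 < de & forall q, 0 < q < T ->
    `|q - r| <= de ->
    `|emass (G q) - emass (G r) - (q - r) * (- G r 1 0 ^+ 2)| <= eps * `|q - r| /\
    `|eenergy (G q) - eenergy (G r) - (q - r) * (- (1 / 2 * potential (G r) 0 ^+ 2))| <= eps * `|q - r|.
  move=> rT eps e0; have [cr _] := HG r (wid r rT).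
  have [d1 d10 Hi] := increment eps cr (G0 r rT) e0.
  have [d2 d20 Hd] := flow r d1 rT d10.
  exists (Num.min d1 d2); first by rewrite lt_min d10.
  move=> q qT; rewrite le_min => /andP[q1 q2].
  have [h [ch h0 hle Gh hL]] := Hd q qT q2.
  have [cq _] := HG q (wid q qT); have [-> ->] := emass_eq cq (chainD cr ch) Gh.
  exact: Hi.
split.
  apply: (@noninc_of_eps (fun t => emass (G t)) T) => // r rT.
  exists (- G r 1 0 ^+ 2); first by rewrite oppr_le0 sqr_ge0.
  by move=> eps /(key r rT eps) [de de0 H]; exists de => // q qT /(H q qT) [].
apply: (@noninc_of_eps (fun t => eenergy (G t)) T) => // r rT.
exists (- (1 / 2 * potential (G r) 0 ^+ 2)); first by rewrite oppr_le0 mulr_ge0// sqr_ge0.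
by move=> eps /(key r rT eps) [de de0 H]; exists de => // q qT /(H q qT) [].
Qed.

End SmoothMonotone.

(** * What is retained of the given solution *)

Section Solution.
Context {R : realType}.
Local Notation mu := (@lebesgue_measure R).
Local Notation P := (@pos_half_line R).
Implicit Types (f g h d e : R -> R) (w v dv : R -> R -> R) (x y t s a b c r K T eps de : R).

Let mT : measurable [set: R]. Proof. exact: measurableT. Qed.
Let mP : measurable P. Proof. exact: measurable_itv. Qed.

(** Allows monotonicity to pass to limits in [H^1]. Linear terms are bounded by Cauchy-Schwarz,
    higher ones by a sup bound times the squared norm. *)
Lemma mass_energy_cont {f d} eps : H1 f d -> 0 < eps -> exists2 de : R, 0 < de &
  forall g e, H1 g e -> h1sq (fun x => g x - f x) (fun x => e x - d x) <= de ->
  `|mass g - mass f| <= eps /\ `|energy g e - energy f d| <= eps.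
Proof.
move=> Hf e0; have [af sf sd] := Hf.
have sup := H1_sup Hf; pose B := 2 * h1sq f d + 1.
have B1 : 1 <= B by have := h1sq_ge0 f d; rewrite /B; lra.
have fB x : `|f x| <= B.
  apply: sqr_le_norm; first by lra.
  apply: (le_trans (sup x)); apply: (@le_trans _ _ B); first by rewrite /B; lra.
  by rewrite expr2 ler_peMl//; lra.
have mf : measurable_fun setT f by case: sf.
have sff : sqi setT (fun x => f x * f x) by exact: (sqi_bM B).
have [A [A1 A2 A3 A4]] := bound3 (mass_ge0 f) (mass_ge0 d) (mass_ge0 (fun x => f x * f x)).
pose K := A + B; have K1 : 1 <= K by rewrite /K; lra.
have KA : A <= K ^+ 2.
  by apply: (@le_trans _ _ K); [rewrite /K; lra|rewrite expr2 ler_peMl//; lra].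
pose r := Num.min 1 (eps / (5 * K)); have K5 : 0 < 5 * K by lra.
have r0 : 0 < r by rewrite lt_min ltr01 divr_gt0.
have r1 : r <= 1 by rewrite ge_min lexx.
have r2 : r * (5 * K) <= eps by rewrite -ler_pdivlMr// ge_min lexx orbT.
exists (r ^+ 2); first by rewrite exprn_gt0.
move=> g e Hg; pose h x := g x - f x; pose k x := e x - d x => hr.
have Hh : H1 h k := H1B Hg Hf; have [ah sh sk] := Hh.
have h0 := mass_ge0 h; have k0 := mass_ge0 k.
have hr' : mass h + mass k <= r ^+ 2 by [].
have rr : r ^+ 2 <= r by rewrite expr2 ler_piMl// ltW.
have hh : mass h <= r ^+ 2 by lra.
have kk : mass k <= r ^+ 2 by lra.
have K0 : 0 <= K by lra.
have CS (p q : R -> R) : sqi setT p -> sqi setT q -> mass p <= A -> mass q <= r ^+ 2 ->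
    `|\int[mu]_x (p x * q x)| <= K * r.
  move=> sp sq pA qr; apply: Rint_CS_le => //; first exact: ltW.
  exact: le_trans KA.
have b1 := CS _ _ sf sh A2 hh; have b2 := CS _ _ sd sk A3 kk; have b3 := CS _ _ sff sh A4 hh.
have hB x : `|h x| <= 2.
  apply: sqr_le_norm => //; apply: (le_trans (H1_sup Hh x)); rewrite /h1sq.
  have : r ^+ 2 <= 1 by exact: le_trans r1.
  by move: hr'; clear; lra.
have [i3 b4] := cube_intg 2 hB sh.
have [_ ih] := sh; have [_ ik] := sk; have [_ if2] := sf; have [_ id2] := sd.
have if3 := H1_cube Hf.
have ifh := sqiM mT sf sh; have idk := sqiM mT sd sk; have iffh := sqiM mT sff sh.
have ifhh : intg setT (fun x => f x * h x ^+ 2) by exact: (intg_bM B).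
have b5 : `|\int[mu]_x (f x * h x ^+ 2)| <= B * mass h.
  rewrite /mass -RintZ//; apply: normr_Rint_le => //; [exact: intg_meas ifhh|exact: intgZ|].
  by move=> x _; rewrite normrM (ger0_norm (sqr_ge0 _)) ler_wpM2r ?sqr_ge0.
have b6 : B * mass h <= K * r.
  by apply: ler_pM => //; [clear -B1; lra|rewrite /K; clear -A1; lra|exact: le_trans rr].
have eg : g = (fun x => f x + h x) by apply/funext => x; rewrite /h; ring.
have ee : e = (fun x => d x + k x) by apply/funext => x; rewrite /k; ring.
have sqE (p q : R -> R) : sqi setT p -> sqi setT q ->
    mass (fun x => p x + q x) = mass p + 2 * \int[mu]_x (p x * q x) + mass q.
  move=> sp sq; have [[_ ip] [_ iq]] := (sp, sq); have ipq := sqiM mT sp sq.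
  rewrite /mass -RintZ// -RintD//; last exact: intgZ.
  by rewrite -RintD//; [apply: eq_Rint => x _; ring|apply: intgD => //; exact: intgZ].
have cubE : \int[mu]_x (g x ^+ 3) = \int[mu]_x (f x ^+ 3) + 3 * \int[mu]_x (f x * f x * h x)
    + 3 * \int[mu]_x (f x * h x ^+ 2) + \int[mu]_x (h x ^+ 3).
  rewrite -RintZ// -RintZ// -RintD//; last exact: intgZ.
  rewrite -RintD//; [|by apply: intgD => //; exact: intgZ|exact: intgZ].
  rewrite -RintD//; last by do 2?[apply: intgD => //]; exact: intgZ.
  by apply: eq_Rint => x _; rewrite eg; ring.
have mg : mass g = mass f + 2 * \int[mu]_x (f x * h x) + mass h by rewrite eg sqE.
have me : mass e = mass d + 2 * \int[mu]_x (d x * k x) + mass k by rewrite ee sqE.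
rewrite /energy cubE -/(mass e) -/(mass d) mg me.
have r3 : 5 * (K * r) <= eps by rewrite mulrA mulrC.
have rK : r <= K * r by rewrite ler_peMl// ltW.
move: b1 b2 b3 b4 b5; rewrite !ler_norml.
move: (\int[mu]_x (f x * h x)) (\int[mu]_x (d x * k x)) (\int[mu]_x (f x * f x * h x)) => I1 I2 I3.
move: (\int[mu]_x (h x ^+ 3)) (\int[mu]_x (f x * h x ^+ 2)) (\int[mu]_x (f x ^+ 3)) => I4 I5 I6.
move: b6 rK r3 h0 k0 hh kk rr.
move: (B * mass h) (K * r) (mass h) (mass k) (mass f) (mass d) (r ^+ 2) => c1 c2 c3 c4 c5 c6 c7.
by clear => ? ? ? ? ? ? ? ? /andP[? ?] /andP[? ?] /andP[? ?] /andP[? ?] /andP[? ?]; split; apply/andP; split; lra.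
Qed.

Lemma Z1_norm_ge {T} {w} {vn : nat -> R -> R -> R} {t} : 0 <= t <= T ->
  (sobolev_norm 1 P (w t) <= Z1_norm T w vn)%E.
Proof.
move=> tT; apply: (@le_trans _ _ (ereal_sup [set sobolev_norm 1 P (w t) | t in [set` `[0, T]]])).
  by apply: ereal_sup_ubound; exists t => //=; rewrite in_itv.
apply: leeDl; apply: sume_ge0 => i _.
apply: (@le_trans _ _ (sobolev_norm ((2 - i%:R) / 3) [set` `]0, T[] (vn i 1))); first exact: sob_ge0.
by apply: ereal_sup_ubound; exists 1 => //; apply/posP.
Qed.

(** All that is used of the solution from here on, in terms of the extensions by zero. Monotonicity
    is recorded against time 0, and the equation survives as [flow_rate], its mean value form for
    one test function. *)
Record flow (w0 : R -> R) v dv : Prop := Flow {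
  flow_H1 : forall t, 0 <= t -> H1 (v t) (dv t);
  flow_neg : forall t x, 0 <= t -> x <= 0 -> v t x = 0;
  flow_init : {ae mu, forall x, P x -> w0 x = v 0 x};
  flow_cont : forall t eps, 0 <= t -> 0 < eps -> exists2 de : R, 0 < de & forall s, 0 <= s ->
    `|s - t| < de -> h1sq (fun x => v s x - v t x) (fun x => dv s x - dv t x) <= eps;
  flow_mono : forall t, 0 <= t -> mass (v t) <= mass (v 0) /\ energy (v t) (dv t) <= energy (v 0) (dv 0);
  flow_rate : forall chi a b c eps, test_function P chi -> 0 <= a -> a <= b ->
    (forall t, a <= t <= b -> `|rate chi (v t) - c| <= eps) ->
    `|\int[mu]_(x in P) (v b x * chi x) - \int[mu]_(x in P) (v a x * chi x) - c * (b - a)|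
      <= eps * (b - a) }.

(** For the approximations, zero trace and monotonicity are available at positive times. The [Z1]
    norm bounds the [H^1] distance at every time, so monotonicity passes to the limit between
    positive times, and time 0 is reached through continuity in [H^1]. *)
Lemma solution_flow {w0 : R -> R} {w} : has_trace P w0 0 0 ->
  right_half_line_solution w0 w -> exists v dv, flow w0 v dv /\
  forall t, 0 <= t -> {ae mu, forall x, P x -> w t x = v t x}.
Proof.
move=> [g0 [cg0 wg0 g00]] [ww0 sol].
have exR t : exists p : (R -> R) * (R -> R), 0 <= t -> rep (w t) p.1 p.2.
  have [t0|t0] := leP 0 t; last by exists (w0, w0).
  (* The final time [t + 1] puts a positive [t] strictly inside the time interval, where the trace
     condition holds; at [t = 0] the trace comes from the datum. *)
  have tT : 0 < t + 1 by lra.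
  have [vl [[cw _] [_ tr] _]] := sol _ tT.
  have tI : `[0, t + 1]%classic t by rewrite /= in_itv/= t0/=; lra.
  have [fin _] := cw t tI.
  have [|v [dv H]] := rep_exists fin; last by exists (v, dv).
  have [tp|tn] := ltP 0 t; first by apply: tr; apply/andP; split; lra.
  have -> : t = 0 by lra.
  by exists g0; split => //; apply: aeS (aeI ww0 wg0) => x [h1 h2] Px; rewrite h1// h2.
have [p Hp] := choice exR.
pose v t := (p t).1; pose dv t := (p t).2; exists v, dv.
have Hv t : 0 <= t -> rep (w t) (v t) (dv t) by exact: Hp.
have cont t eps : 0 <= t -> 0 < eps -> exists2 de : R, 0 < de & forall s, 0 <= s ->
    `|s - t| < de -> h1sq (fun x => v s x - v t x) (fun x => dv s x - dv t x) <= eps.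
  move=> t0 e0; have tT : 0 < t + 1 by lra.
  have [vl [[cw _] _ _]] := sol _ tT.
  have tI : `[0, t + 1]%classic t by rewrite /= in_itv/= t0/=; lra.
  pose r := Num.min 1 eps; have r0 : 0 < r by rewrite lt_min ltr01.
  have r1 : r <= 1 by rewrite ge_min lexx.
  have r2 : r <= eps by rewrite ge_min lexx orbT.
  have [de de0 H] := sobolev_continuous_eps r cw tI r0.
  exists (Num.min de 1); first by rewrite lt_min de0 ltr01.
  move=> s s0; rewrite lt_min => /andP[sd s1].
  have sI : `[0, t + 1]%classic s.
    by rewrite /= in_itv/= s0/=; move: s1; rewrite ltr_norml => /andP[_ ?]; lra.
  apply: le_trans (rep_close (Hv s s0) (Hv t t0) (H s sI sd)) _; apply: le_trans r2.
  by rewrite expr2 ler_piMl// ltW.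
have mono s t : 0 < s -> s <= t -> mass (v t) <= mass (v s) /\ energy (v t) (dv t) <= energy (v s) (dv s).
  move=> s0 st; have t0 : 0 < t by exact: lt_le_trans st.
  have tT : 0 < t + 1 by lra.
  have [vl [_ _ [wn [vn [Hn lim]]]]] := sol _ tT.
  have rI r : 0 <= r <= t + 1 -> `[0, t + 1]%classic r by rewrite /= in_itv.
  have [Hs _ _ _] := Hv s (ltW s0); have [Ht _ _ _] := Hv t (ltW t0).
  have approx eps : 0 < eps -> mass (v t) <= mass (v s) + eps /\
      energy (v t) (dv t) <= energy (v s) (dv s) + eps.
    move=> e0; have e2 : 0 < eps / 2 by lra.
    have [d1 d10 Hd1] := mass_energy_cont _ Hs e2.
    have [d2 d20 Hd2] := mass_energy_cont _ Ht e2.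
    pose r := Num.min 1 (Num.min d1 d2); have r0 : 0 < r by rewrite !lt_min ltr01 d10.
    have r1 : r <= 1 by rewrite ge_min lexx.
    have rd1 : r <= d1 by rewrite !ge_min lexx orbT.
    have rd2 : r <= d2 by rewrite !ge_min lexx !orbT.
    have rr : r ^+ 2 <= r by rewrite expr2 ler_piMl// ltW.
    have : nbhs (0%R%:E : \bar R) [set y | (y < r%:E)%E] by exact: (@nbhs_open_ereal_lt _ 0 (fun=> r)).
    move=> /lim [n _ /(_ n (leqnn n))] /= lt.
    have [[cwn _] kn c4] := Hn n.
    have nrep q : 0 < q < t + 1 -> exists u du, rep (wn n q) u du.
      move=> qT; have /andP[q0 q1] := qT; have qI : `[0, t + 1]%classic q.
        by apply: rI; rewrite !ltW.
      have [fin _] := cwn q qI.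
      have [_ tr] := kn; exact: rep_exists fin (tr q qT).
    have sT : 0 < s < t + 1 by rewrite s0/=; lra.
    have tT' : 0 < t < t + 1 by rewrite t0/=; lra.
    have [us [dus Hus]] := nrep s sT; have [ut [dut Hut]] := nrep t tT'.
    have tT1 : t < t + 1 by rewrite ltrDl.
    have [m1 m2] := smooth_monotone c4 kn s t us dus ut dut s0 st tT1 Hus Hut.
    have cl q u du : 0 <= q <= t + 1 -> rep (wn n q) u du -> rep (w q) (v q) (dv q) ->
        h1sq (fun x => u x - v q x) (fun x => du x - dv q x) <= r.
      move=> qT Hu Hw; rewrite h1sq_sym; apply: le_trans rr; apply: (rep_close Hw Hu).
      by apply: le_lt_trans lt; exact: (Z1_norm_ge (w := fun t => w t \- wn n t) qT).
    have [H1us _ _ _] := Hus; have [H1ut _ _ _] := Hut.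
    have wid q : 0 < q < t + 1 -> 0 <= q <= t + 1 by move=> /andP[/ltW -> /ltW].
    have [] := Hd1 us dus H1us (le_trans (cl s us dus (wid s sT) Hus (Hv s (ltW s0))) rd1).
    have [] := Hd2 ut dut H1ut (le_trans (cl t ut dut (wid t tT') Hut (Hv t (ltW t0))) rd2).
    by rewrite !ler_norml; clear -m1 m2 => /andP[? ?] /andP[? ?] /andP[? ?] /andP[? ?]; split; lra.
  by split; apply/ler_addgt0Pr => eps /approx [].
split; last by move=> t /Hv [].
have Hv0 := Hv 0 (lexx 0); split.
- by move=> t /Hv [].
- by move=> t x /Hv [_ h _ _]; exact: h.
- by have [_ _ _ h] := Hv0; apply: aeS (aeI ww0 h) => x [h1 h2] Px; rewrite -h1// h2.
- exact: cont.
- move=> t; rewrite le_eqVlt => /orP[/eqP<-//|t0].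
  have [H0 _ _ _] := Hv0.
  have approx eps : 0 < eps -> mass (v t) <= mass (v 0) + eps /\
      energy (v t) (dv t) <= energy (v 0) (dv 0) + eps.
    move=> e0; have [d1 d10 Hd1] := mass_energy_cont _ H0 e0.
    have [d2 d20 Hd2] := cont 0 d1 (lexx 0) d10.
    pose s := Num.min t (d2 / 2); have s0 : 0 < s by rewrite lt_min t0 divr_gt0.
    have st : s <= t by rewrite ge_min lexx.
    have sd : s <= d2 / 2 by rewrite ge_min lexx orbT.
    have sn : `|s - 0| < d2 by rewrite subr0 gtr0_norm//; lra.
    have [Hs _ _ _] := Hv s (ltW s0).
    have [] := Hd1 _ _ Hs (Hd2 s (ltW s0) sn); have [] := mono s t s0 st.
    by rewrite !ler_norml; clear => ? ? /andP[? ?] /andP[? ?]; split; lra.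
  by split; apply/ler_addgt0Pr => eps /approx [].
- move=> chi a b c eps tc a0 ab Hr; have tT : 0 < b + 1 by lra.
  have [vl [_ kw _]] := sol _ tT.
  have reps t : 0 <= t <= b + 1 -> sqi P (v t) /\ {ae mu, forall x, P x -> w t x = v t x}.
    move=> /andP[t0 _]; have [[_ sv _] _ _ h] := Hv t t0; split => //.
    exact: (sqiS setT).
  apply: (weak_time kw reps _ tc) => //; last by rewrite ltrDl.
  move=> t /andP[t0 _] e e0; have [de de0 H] := cont t e t0 e0.
  exists de => // s /andP[s0 _] /(H s s0); apply: le_trans.
  have [[_ ss _] _ _ _] := Hv s s0; have [[_ st _] _ _ _] := Hv t t0.
  have [_ i2] := sqiB mT ss st.
  rewrite /h1sq; apply: (@le_trans _ _ (mass (fun x => v s x - v t x))).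
    by apply: Rint_ge_sub => // x _; exact: sqr_ge0.
  by rewrite lerDl mass_ge0.
Qed.

End Solution.

(** * Pairings with translates of a compactly supported window *)

Section Windows.
Context {R : realType}.
Local Notation mu := (@lebesgue_measure R).
Local Notation P := (@pos_half_line R).
Implicit Types (f g psi : R -> R) (x y z t s a b h m n M eps de : R).

Let mT : measurable [set: R]. Proof. exact: measurableT. Qed.

Lemma mvt {f g} a b : (forall x, is_derive x (1 : R) f (g x)) ->
  exists2 c : R, `|c - a| <= `|b - a| & f b - f a = g c * (b - a).
Proof.
move=> df; have cf : continuous f by apply: d_cont => x; exists (g x).
have [ab|/ltW ba] := leP a b.
  have [c cI e] := MVT_segment ab (fun x _ => df x) (continuous_subspaceT cf).
  exists c => //; move: cI; rewrite in_itv/= => /andP[h1 h2].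
  by rewrite !ger0_norm ?subr_ge0// lerD2r.
have [c cI e] := MVT_segment ba (fun x _ => df x) (continuous_subspaceT cf).
exists c; last by rewrite -opprB e; ring.
move: cI; rewrite in_itv/= => /andP[h1 h2].
by rewrite distrC (distrC b) !ger0_norm ?subr_ge0// lerD2l lerN2.
Qed.

Definition nrm f : R := Num.sqrt (mass f).

Lemma nrm_ge0 f : 0 <= nrm f. Proof. exact: sqrtr_ge0. Qed.

Lemma nrm_sqr f : nrm f ^+ 2 = mass f. Proof. by rewrite sqr_sqrtr// mass_ge0. Qed.

Lemma nrm_le {f n} : 0 <= n -> mass f <= n ^+ 2 -> nrm f <= n.
Proof. by move=> n0 fn; rewrite -(ler_pXn2r (n := 2)) ?nnegrE ?nrm_ge0// nrm_sqr. Qed.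

Lemma nrm_CS {f g} : sqi setT f -> sqi setT g -> `|\int[mu]_x (f x * g x)| <= nrm f * nrm g.
Proof.
by move=> sf sg; apply: Rint_CS_le; rewrite ?nrm_ge0// nrm_sqr.
Qed.

Lemma nrm_shift s {f} : sqi setT f -> nrm (fun x => f (x + s)) = nrm f.
Proof. by move=> sf; rewrite /nrm (mass_shift s sf). Qed.

Definition win psi : Prop := smooth psi /\ forall x, 1 < `|x| -> psi x = 0.

Lemma win_derive {psi} : win psi -> win (derive1 psi).
Proof.
move=> [sp p0]; split; first exact: smooth_derive1.
move=> x x1; apply: (@derive1_out _ _ [set` `[-1, 1]]).
- exact: interval_closed.
- by move=> y /= /negP; rewrite in_itv/= -ler_norml -ltNge => /p0.
- by apply/negP; rewrite /= in_itv/= -ler_norml -ltNge.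
Qed.

Lemma win_test {psi} y : win psi -> test_function `[y - 1, y + 1] (fun x => psi (x - y)).
Proof.
move=> [sp p0]; split.
  have := smooth_affine 1 (- y) sp; rewrite (_ : (fun x => psi (1 * x + - y)) = fun x => psi (x - y))//.
  by apply/funext => x; rewrite mul1r.
exists [set` `[y - 1, y + 1]]; split => //; first exact: segment_compact.
move=> x; rewrite /= in_itv/= => /negP xy; apply: p0; rewrite ltNge; apply: contraNN xy.
by rewrite ler_norml => /andP[? ?]; apply/andP; split; lra.
Qed.

Lemma win_derive1 {psi} y : win psi ->
  derive1 (fun x => psi (x - y)) = (fun x => derive1 psi (x - y)).
Proof.
move=> [sp _]; apply: d_derive1 => x.
have ds : is_derive x (1 : R) (fun x => x - y) 1.
  by apply: d_eq (dB (did x) (dcst y x)) _; rewrite subr0.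
by apply: d_eq (dcomp psi _ ds (smooth_d sp (x - y))) _; rewrite mulr1.
Qed.

Lemma win_derive3 {psi} y : win psi ->
  derive1n 3 (fun x => psi (x - y)) = (fun x => derive1 (derive1 (derive1 psi)) (x - y)).
Proof.
move=> w0; have w1 := win_derive w0; have w2 := win_derive w1.
rewrite -(win_derive1 y w2); apply: (congr1 (fun f : R -> R => derive1 f)).
rewrite -(win_derive1 y w1); apply: (congr1 (fun f : R -> R => derive1 f)).
exact: win_derive1.
Qed.

Lemma win_cont {psi} : win psi -> continuous psi.
Proof. by move=> [sp _]; exact: smooth_cont. Qed.

Lemma win_sqi {psi} y : win psi -> sqi setT (fun x => psi (x - y)).
Proof. by move=> wp; apply: test_sqi => //; exact: win_test wp. Qed.

Lemma win_bnd {psi} : win psi -> exists2 M : R, 0 < M & forall x, `|psi x| <= M.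
Proof.
move=> wp; have [M M0 H] := test_sup (win_test 0 wp); exists M => // x.
by have := H x; rewrite subr0.
Qed.

(** Viewed as a function of the position [y] of the window; for the window [phi] its zeros define
    the modulated centre. *)
Definition pair psi f y : R := \int[mu]_x (f x * psi (x - y)).

Lemma pairB {psi f g} y : win psi -> sqi setT f -> sqi setT g ->
  pair psi (fun x => f x - g x) y = pair psi f y - pair psi g y.
Proof.
move=> wp sf sg; have sp := win_sqi y wp.
rewrite /pair -RintB//; [|exact: sqiM|exact: sqiM].
by apply: eq_Rint => x _; rewrite mulrBl.
Qed.

Lemma pair_shift {psi f} s y : win psi -> sqi setT f ->
  pair psi (fun x => f (x - s)) (y + s) = pair psi f y.
Proof.
move=> wp sf; have sp := win_sqi y wp; have i := sqiM mT sf sp.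
have [_] := Rint_shift (- s) i; rewrite -/(pair psi f y) => <-.
by apply: eq_Rint => x _; rewrite opprD addrA addrAC.
Qed.

(** The support has length 4, so the squared norm is at most [4 m^2]. Radius 2 accommodates
    differences of windows of radius 1 whose centres are at distance at most 1. *)
Lemma supp_mass {p : R -> R} {y m} : continuous p -> 0 <= m -> (forall x, `|p x| <= m) ->
  (forall x, 2 < `|x - y| -> p x = 0) -> sqi setT p /\ nrm p <= 2 * m.
Proof.
move=> cp m0 pm p0; have mI : measurable [set` `[y - 2, y + 2]] by exact: measurable_itv.
have cpp : continuous (fun x => p x ^+ 2) by move=> x; exact: cvgM (cp x) (cp x).
have out x : ~ [set` `[y - 2, y + 2]] x -> p x = 0.
  rewrite /= in_itv/= => /negP xy; apply: p0; rewrite ltNge; apply: contraNN xy.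
  by rewrite ler_norml => /andP[? ?]; apply/andP; split; lra.
have ip := cont_intg_itv (y - 2) (y + 2) cpp.
split.
  split; first exact: cont_meas.
  apply: (@eq_intg _ _ (fun x => \1_[set` `[y - 2, y + 2]] x * p x ^+ 2)) => //; last exact/intg_indic.
  move=> x _; have [h|h] := pselect ([set` `[y - 2, y + 2]] x); last by rewrite out// expr0n mulr0.
  by rewrite indicE mem_set// mul1r.
apply: nrm_le; first by rewrite mulr_ge0.
rewrite /mass (Rint_supp mI); last by move=> x /out ->; rewrite expr0n.
have -> : (2 * m) ^+ 2 = m ^+ 2 * (y + 2 - (y - 2)) by ring.
rewrite -Rint_cst_itv; last by lra.
apply: le_Rint => //; first by apply: cont_intg_itv => x; exact: cvg_cst.
by move=> x _; rewrite -(real_normK (num_real (p x))) ler_pXn2r ?nnegrE.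
Qed.

Lemma pair_bnd {psi} : win psi -> exists2 B : R, 0 < B & forall f y, sqi setT f ->
  `|pair psi f y| <= B * nrm f.
Proof.
move=> wp; have sp := win_sqi 0 wp; exists (nrm (fun x => psi (x - 0)) + 1).
  by have := nrm_ge0 (fun x => psi (x - 0)); lra.
move=> f y sf; apply: (le_trans (nrm_CS sf (win_sqi y wp))).
rewrite mulrC ler_wpM2r ?nrm_ge0//.
have := nrm_shift (- y) sp; rewrite (_ : (fun x => psi (x + - y - 0)) = (fun x => psi (x - y))).
  by move=> ->; rewrite lerDl.
by apply/funext => x; rewrite subr0.
Qed.

Lemma pair_lip {psi} : win psi -> exists2 B : R, 0 < B & forall f y z, sqi setT f ->
  `|z - y| <= 1 -> `|pair psi f z - pair psi f y| <= B * nrm f * `|z - y|.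
Proof.
move=> wp; have [M M0 pM] := win_bnd (win_derive wp); have [sp p0] := wp.
exists (2 * M); first by rewrite mulr_gt0.
move=> f y z sf zy; pose p x := psi (x - z) - psi (x - y).
have cp : continuous p.
  have H s : continuous (fun x => psi (x - s)) by exact: test_cont (win_test s wp).
  by move=> x; apply: cvgB; exact: H.
have pb x : `|p x| <= M * `|z - y|.
  have [c _ e] := mvt (x - y) (x - z) (smooth_d sp); rewrite /p e normrM.
  have -> : x - z - (x - y) = - (z - y) by ring.
  by rewrite normrN ler_wpM2r.
have [||sqp np] := supp_mass (y := y) cp _ pb.
- by rewrite mulr_ge0// ltW.
- move=> x xy; rewrite /p !p0 ?subrr//; first by lra.
  have := ler_normD (x - z) (z - y); have -> : x - z + (z - y) = x - y by ring.
  by lra.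
have i1 := sqiM mT sf (win_sqi z wp); have i2 := sqiM mT sf (win_sqi y wp).
have -> : pair psi f z - pair psi f y = \int[mu]_x (f x * p x).
  by rewrite /pair -RintB//; apply: eq_Rint => x _; rewrite -mulrBr.
apply: (le_trans (nrm_CS sf sqp)); rewrite mulrC mulrAC ler_wpM2r ?nrm_ge0//.
by rewrite -mulrA.
Qed.

(** Two applications of the mean value theorem bound the remainder of [psi (x - z)] uniformly in
    [x]; by Cauchy-Schwarz [f] enters through its [L^2] norm alone. *)
Lemma pair_taylor {psi} : win psi -> exists2 B : R, 0 < B & forall f y z, sqi setT f ->
  `|z - y| <= 1 ->
  `|pair psi f z - pair psi f y - (z - y) * - pair (derive1 psi) f y| <= B * nrm f * `|z - y| ^+ 2.
Proof.
move=> wp; have w1 := win_derive wp; have w2 := win_derive w1.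
have [M M0 pM] := win_bnd w2; have [sp p0] := wp; have [s1 p1] := w1.
exists (2 * M); first by rewrite mulr_gt0.
move=> f y z sf zy; pose p x := psi (x - z) - psi (x - y) + (z - y) * derive1 psi (x - y).
have cp : continuous p.
  have H s : continuous (fun x => psi (x - s)) by exact: test_cont (win_test s wp).
  have H' : continuous (fun x => derive1 psi (x - y)) by exact: test_cont (win_test y w1).
  by move=> x; apply: cvgD; [apply: cvgB; exact: H|apply: cvgMr; exact: H'].
have pb x : `|p x| <= M * `|z - y| ^+ 2.
  have [c cy e] := mvt (x - y) (x - z) (smooth_d sp).
  have [c' _ e'] := mvt (x - y) c (smooth_d s1).
  have -> : p x = - (z - y) * (derive1 psi c - derive1 psi (x - y)) by rewrite /p e; ring.
  rewrite e' !normrM normrN mulrC expr2 mulrA ler_wpM2r//.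
  apply: ler_pM => //; apply: le_trans cy _.
  by rewrite (_ : x - z - (x - y) = - (z - y)) ?normrN//; ring.
have [||sqp np] := supp_mass (y := y) cp _ pb.
- by rewrite mulr_ge0 ?sqr_ge0// ltW.
- move=> x xy; have a1 : 1 < `|x - y| by lra.
  have a2 : 1 < `|x - z|.
    have := ler_normD (x - z) (z - y); have -> : x - z + (z - y) = x - y by ring.
    by lra.
  by rewrite /p !p0// p1// subrr mulr0 addr0.
have i1 := sqiM mT sf (win_sqi z wp); have i2 := sqiM mT sf (win_sqi y wp).
have i3 := sqiM mT sf (win_sqi y w1).
have -> : pair psi f z - pair psi f y - (z - y) * - pair (derive1 psi) f y = \int[mu]_x (f x * p x).
  rewrite mulrN opprK /pair -RintZ// -RintB//.
  rewrite -RintD//; [|exact: intgB|exact: intgZ].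
  by apply: eq_Rint => x _; rewrite /p; ring.
apply: (le_trans (nrm_CS sf sqp)); rewrite mulrC mulrAC ler_wpM2r ?nrm_ge0//.
by rewrite -mulrA.
Qed.

Lemma nrm_bM {f g M} : 0 <= M -> measurable_fun setT g -> (forall x, `|g x| <= M) -> sqi setT f ->
  sqi setT (fun x => g x * f x) /\ nrm (fun x => g x * f x) <= M * nrm f.
Proof.
move=> M0 mg gM sf; have sgf : sqi setT (fun x => g x * f x) by exact: (sqi_bM M).
split => //; apply: nrm_le; first by rewrite mulr_ge0 ?nrm_ge0.
have [_ if2] := sf; rewrite exprMn nrm_sqr /mass -RintZ//.
apply: le_Rint => //; [by case: sgf|exact: intgZ|].
move=> x _; rewrite exprMn ler_wpM2r ?sqr_ge0//.
by rewrite -(real_normK (num_real (g x))) ler_pXn2r ?nnegrE.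
Qed.

Lemma pair_close {psi f} eps : win psi -> sqi setT f -> 0 < eps -> exists2 de : R, 0 < de &
  forall g y z, sqi setT g -> nrm (fun x => g x - f x) <= de -> `|z - y| <= de ->
  `|pair psi g z - pair psi f y| <= eps.
Proof.
move=> wp sf e0; have [A A0 hA] := pair_bnd wp; have [B B0 hB] := pair_lip wp.
have n0 := nrm_ge0 f; pose K := A + B * nrm f + 1.
have Bn : 0 <= B * nrm f by rewrite mulr_ge0// ltW.
have K1 : 0 < K by rewrite /K; lra.
pose de := Num.min 1 (eps / K).
have de0 : 0 < de by rewrite lt_min ltr01 divr_gt0.
have de1 : de <= 1 by rewrite ge_min lexx.
have de2 : de * K <= eps by rewrite -ler_pdivlMr// ge_min lexx orbT.
exists de => // g y z sg gf zy.
have -> : pair psi g z - pair psi f y = pair psi (fun x => g x - f x) z + (pair psi f z - pair psi f y).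
  by rewrite pairB//; ring.
apply: le_trans (ler_normD _ _) _.
have h1 := hA _ z (sqiB mT sg sf); have h2 := hB f y z sf (le_trans zy de1).
have h3 : A * nrm (fun x => g x - f x) <= A * de by rewrite ler_wpM2l// ltW.
have h4 : B * nrm f * `|z - y| <= B * nrm f * de by rewrite ler_wpM2l.
by move: de2; rewrite /K; move: h1 h2 h3 h4 de0 => *; lra.
Qed.

End Windows.

(** * The modulated centre at a fixed time *)

Section Modulation.
Context {R : realType}.
Local Notation mu := (@lebesgue_measure R).
Local Notation P := (@pos_half_line R).
Implicit Types (f g psi v dv : R -> R) (x y z t s a b h m n M eps de : R).

Let mT : measurable [set: R]. Proof. exact: measurableT. Qed.

(** Odd, so that it is orthogonal to the even [Q], and of the same sign as [Q'], so that
    [kappa > 0]. *)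
Definition phi x : R := bump (-1 * x + 0) - bump x.

Lemma phi_win : win phi.
Proof.
split; last first.
  move=> x x1; rewrite /phi !bump_out ?subrr//; apply/negP => /andP[h1 h2]; move: x1; rewrite ltNge => /negP; apply.
    by rewrite ler_norml; apply/andP; split; lra.
  by rewrite ler_norml; apply/andP; split; lra.
have e : (fun x => bump (-1 * x + 0) + -1 * bump x) = phi.
  by apply/funext => x; rewrite /phi !mulN1r.
by rewrite -e; exact: smoothD (smooth_affine (-1) 0 bump_smooth) (smoothM (smooth_cst (-1)) (@bump_smooth R)).
Qed.

Lemma phiN x : phi (- x) = - phi x.
Proof. by rewrite /phi opprB; congr (bump _ - bump _); ring. Qed.

Lemma phi_le0 x : 0 <= x -> phi x <= 0.
Proof.
move=> x0; rewrite /phi bump_out; last by apply/negP => /andP[h _]; lra.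
by rewrite sub0r oppr_le0 bump_ge0.
Qed.

Lemma phi_lt0 x : 0 < x < 1 -> phi x < 0.
Proof.
move=> /[dup] x01 /andP[x0 _]; rewrite /phi bump_out; last by apply/negP => /andP[h _]; lra.
by rewrite sub0r oppr_lt0 bump_gt0.
Qed.

Lemma pair_d {psi f} y : win psi -> sqi setT f ->
  is_derive y (1 : R) (pair psi f) (- pair (derive1 psi) f y).
Proof.
move=> wp sf; have [B B0 H] := pair_taylor wp; apply: eps_derive => eps e0.
have n0 := nrm_ge0 f; have Bn : 0 <= B * nrm f by rewrite mulr_ge0// ltW.
pose K := B * nrm f + 1; have K0 : 0 < K by rewrite /K; lra.
exists (Num.min 1 (eps / K)); first by rewrite lt_min ltr01 divr_gt0.
move=> z; rewrite lt_min => /andP[/ltW z1 /ltW z2].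
apply: (le_trans (H f y z sf z1)); rewrite expr2 mulrA ler_wpM2r//.
apply: (@le_trans _ _ (K * `|z - y|)); first by rewrite ler_wpM2r// /K lerDl.
by rewrite mulrC -ler_pdivlMr.
Qed.

Lemma pair_cont {psi f} : win psi -> sqi setT f -> continuous (pair psi f).
Proof. by move=> wp sf; apply: d_cont => y; eexists; exact: pair_d. Qed.

Lemma win_int0 {F D : R -> R} : (forall x, is_derive x (1 : R) F (D x)) -> continuous D ->
  (forall x, 1 < `|x| -> F x = 0) -> (forall x, 1 < `|x| -> D x = 0) -> \int[mu]_x D x = 0.
Proof.
move=> dF cD F0 D0; have cF : continuous F by apply: d_cont => x; exists (D x).
have out x : ~ `[- 1, 1]%classic x -> 1 < `|x|.
  by rewrite /= in_itv/= -ler_norml => /negP; rewrite -ltNge.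
apply: (ac_int0 (ac_C1 dF cD)).
- by apply: (cont_supp_intg 1) => // x /out/F0.
- by apply: (cont_supp_intg 1) => // x /out/D0.
Qed.

Variable k : R.
Hypothesis k0 : 0 < k.
Local Notation Q := (Q k).
Local Notation dQ := (dQ k).
Local Notation dist := (dist k).

(** From [|Q'| <= 2 k Q], the product [Q exp (2 k x)] is nondecreasing and [Q exp (- 2 k x)] is
    nonincreasing. *)
Lemma Q_near x y : `|y - x| <= 1 -> Q y <= expR (2 * k) * Q x.
Proof.
have ed (r z : R) : is_derive z (1 : R) (fun z => expR (r * z)) (expR (r * z) * r).
  by apply: d_eq (dcomp expR _ (dZ r (did z)) (is_derive_expR _)) _; rewrite mulr1.
have mono (f d : R -> R) a b : (forall z, is_derive z (1 : R) f (d z)) -> (forall z, 0 <= d z) -> a <= b -> f a <= f b.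
  move=> df d0 ab; have [c _ e] := mvt a b df; rewrite -subr_ge0 e mulr_ge0// subr_ge0 //.
have dQle z : - (2 * k * Q z) <= dQ z <= 2 * k * Q z by rewrite -ler_norml; exact: dQ_le.
have inc a b : a <= b -> Q a * expR (2 * k * a) <= Q b * expR (2 * k * b).
  apply: (mono _ _ a b (fun z => dM (Q_d k z) (ed (2 * k) z))) => z.
  have -> : dQ z * expR (2 * k * z) + Q z * (expR (2 * k * z) * (2 * k)) = (dQ z + 2 * k * Q z) * expR (2 * k * z) by ring.
  by rewrite mulr_ge0 ?expR_ge0//; have /andP[? _] := dQle z; lra.
have dec a b : a <= b -> - (Q a * expR (- (2 * k) * a)) <= - (Q b * expR (- (2 * k) * b)).
  apply: (mono _ _ a b (fun z => dN (dM (Q_d k z) (ed (- (2 * k)) z)))) => z.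
  have -> : - (dQ z * expR (- (2 * k) * z) + Q z * (expR (- (2 * k) * z) * - (2 * k))) =
    (2 * k * Q z - dQ z) * expR (- (2 * k) * z) by ring.
  by rewrite mulr_ge0 ?expR_ge0//; have /andP[_ ?] := dQle z; lra.
move=> xy; have q0 := Q_gt0 k k0 x.
suff H : Q y <= Q x * expR (2 * k * `|y - x|).
  apply: (le_trans H); rewrite mulrC ler_pM2r// ler_expR ger_pMr// mulr_gt0 //.
have [h|/ltW h] := leP x y.
  rewrite ger0_norm ?subr_ge0//; have := dec x y h; rewrite lerN2 !mulNr !expRN -ler_pdivlMr ?invr_gt0 ?expR_gt0//.
  suff -> : Q x / expR (2 * k * x) / (expR (2 * k * y))^-1 = Q x * expR (2 * k * (y - x)) by [].
  by rewrite invrK mulrBr expRD expRN; ring.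
rewrite distrC ger0_norm ?subr_ge0//; have := inc y x h; rewrite -ler_pdivlMr ?expR_gt0//.
suff -> : Q x * expR (2 * k * x) / expR (2 * k * y) = Q x * expR (2 * k * (x - y)) by [].
by rewrite mulrBr expRD expRN; ring.
Qed.

(** Quadratic in [s], unlike [Q_shift_h1sq]: moving the centre by [O(b)] must cost only [O(b)] in
    the norm. The mean value theorem is used pointwise, and [Q_near] brings the intermediate point
    back to [x]. *)
Lemma Q_shift_sq : exists2 C : R, 0 < C & forall s, `|s| <= 1 ->
  h1sq (fun x => Q (x + s) - Q x) (fun x => dQ (x + s) - dQ x) <= C * s ^+ 2.
Proof.
pose E := expR (2 * k); have E0 : 0 < E := expR_gt0 _.
have q2 : 0 <= 10 * k ^+ 2 by rewrite mulr_ge0// sqr_ge0.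
pose C := (2 * k * E) ^+ 2 * mass Q + (10 * k ^+ 2 * E) ^+ 2 * mass Q + 1.
have M0 := mass_ge0 Q; exists C.
  by rewrite /C ltr_wpDl// addr_ge0// mulr_ge0// sqr_ge0.
move=> s s1; have HQ := H1_Q k k0; have [_ sQ _] := HQ; have [_ iQ] := sQ.
have [_ [_ i1] [_ i2]] := H1B (H1_shift s HQ) HQ.
have near x c : `|c - x| <= `|x + s - x| -> Q c <= E * Q x.
  by move=> h; apply: Q_near; apply: le_trans h _; rewrite addrAC subrr add0r.
have bnd (f d : R -> R) (K : R) : 0 <= K -> (forall x, is_derive x (1 : R) f (d x)) ->
    (forall x, `|d x| <= K * Q x) -> intg setT (fun x => (f (x + s) - f x) ^+ 2) ->
    mass (fun x => f (x + s) - f x) <= (K * E) ^+ 2 * mass Q * s ^+ 2.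
  move=> K0 df dK ifs; rewrite mulrAC -RintZ//; apply: le_Rint => //; first exact: intgZ.
  move=> x _; have [c hc e] := mvt x (x + s) df.
  have dc : `|d c| <= K * (E * Q x) by apply: le_trans (dK c) _; rewrite ler_wpM2l// near.
  rewrite e (_ : x + s - x = s); last by ring.
  have -> : (K * E) ^+ 2 * s ^+ 2 * Q x ^+ 2 = (K * (E * Q x)) ^+ 2 * s ^+ 2 by ring.
  rewrite exprMn ler_wpM2r ?sqr_ge0//.
  rewrite -(real_normK (num_real (d c))) ler_pXn2r ?nnegrE//.
  by apply: mulr_ge0 => //; apply: mulr_ge0; [exact: ltW|exact: ltW (Q_gt0 k k0 x)].
have b1 := bnd _ _ (2 * k) (mulr_ge0 (ler0n _ 2) (ltW k0)) (Q_d k) (dQ_le k k0) i1.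
have b2 : mass (fun x => dQ (x + s) - dQ x) <= (10 * k ^+ 2 * E) ^+ 2 * mass Q * s ^+ 2.
  apply: (bnd _ _ _ q2 (dQ_d k)) => // x; have q0 := Q_gt0 k k0 x; have q1 := Q_le k x.
  have k2 := sqr_ge0 k; rewrite ler_norml; apply/andP; split; nra.
have s2 := sqr_ge0 s; rewrite /h1sq /C; lra.
Qed.

(** The slope at 0 of [y |-> pair phi Q y]. *)
Definition kappa : R := \int[mu]_x (dQ x * phi x).

Lemma dQ_phi_ge0 x : 0 <= dQ x * phi x.
Proof.
have H y : 0 <= y -> 0 <= dQ y * phi y.
  move=> y0; rewrite mulr_le0 ?phi_le0// /(dQ).
  have t0 : 0 <= th k y.
    by rewrite -(th0 k); move: y0; rewrite le_eqVlt => /orP[/eqP<-//|/(th_homo k k0)/ltW].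
  have q0 := Q_gt0 k k0 y; have -> : - 2 * k * th k y * Q y = - (2 * k * th k y * Q y) by ring.
  rewrite oppr_le0; apply: mulr_ge0; last exact: ltW.
  by apply: mulr_ge0 => //; rewrite mulr_ge0// ltW.
have [/H//|x0] := leP 0 x; rewrite -(opprK x) phiN.
have -> : dQ (- - x) = - dQ (- x) by rewrite /(dQ) thN QN; ring.
by rewrite mulrNN; apply: H; lra.
Qed.

Lemma kappa_gt0 : 0 < kappa.
Proof.
have cf : continuous (fun x => dQ x * phi x).
  by move=> x; apply: cvgM; [exact: dQ_cont|exact: win_cont phi_win x].
have ab : 1 / 4 <= 3 / 4 :> R by lra.
have [m mI H] := EVT_min ab (continuous_subspaceT cf).
have m0 : 0 < dQ m * phi m.
  move: mI; rewrite in_itv/= => /andP[m1 m2]; rewrite nmulr_rgt0; first by apply: phi_lt0; lra.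
  have t0 : 0 < th k m by rewrite -(th0 k); apply: (th_homo k k0); lra.
  have q0 := Q_gt0 k k0 m.
  have -> : dQ m = - (2 * k * th k m * Q m) by rewrite /(dQ); ring.
  by rewrite oppr_lt0; apply: mulr_gt0 => //; apply: mulr_gt0 => //; rewrite mulr_gt0.
have ii : intg setT (fun x => dQ x * phi x).
  have := win_sqi 0 phi_win; under eq_fun do rewrite subr0.
  by move=> sp; apply: sqiM => //; exact: sqi_dQ.
apply: (@lt_le_trans _ _ (\int[mu]_(x in `[1 / 4, 3 / 4]) (dQ x * phi x))); last first.
  by apply: Rint_ge_sub => // x _; exact: dQ_phi_ge0.
apply: (@lt_le_trans _ _ (dQ m * phi m * (3 / 4 - 1 / 4))).
  by rewrite mulr_gt0//; lra.
apply: le_Rint_cst_itv => //; exact: cont_intg_itv.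
Qed.

Lemma pair_phi_Q : pair phi Q 0 = 0.
Proof.
have sp := win_sqi 0 phi_win; have i := sqiM mT (sqi_Q k k0) sp.
have [_] := Rint_opp mT (intg_meas i) i; rewrite -/(pair phi Q 0) preimage_setT.
rewrite (eq_Rint _ (fun x => - (Q x * phi (x - 0)))) => [|x _]; last first.
  by rewrite QN !subr0 phiN mulrN.
by rewrite RintN// -/(pair phi Q 0); lra.
Qed.

Lemma pair_dphi_Q : pair (derive1 phi) Q 0 = - kappa.
Proof.
have w1 := win_derive phi_win; have [sp p0] := phi_win; have [s1 p1] := w1.
have c0 := win_cont phi_win; have c1 := win_cont w1.
pose D x := dQ x * phi x + Q x * derive1 phi x.
have e : \int[mu]_x D x = 0.
  apply: (@win_int0 (fun x => Q x * phi x) D).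
  - by move=> x; exact: dM (Q_d k x) (smooth_d sp x).
  - by move=> x; apply: cvgD; apply: cvgM; [exact: dQ_cont|exact: c0|exact: Q_cont|exact: c1].
  - by move=> x /p0 ->; rewrite mulr0.
  - by move=> x h; rewrite /D p0// p1// !mulr0 addr0.
have f0 : sqi setT phi by have := win_sqi 0 phi_win; under eq_fun do rewrite subr0.
have f1 : sqi setT (derive1 phi) by have := win_sqi 0 w1; under eq_fun do rewrite subr0.
move: e; rewrite /D RintD//; [|by apply: sqiM => //; exact: sqi_dQ|by apply: sqiM => //; exact: sqi_Q].
have -> : pair (derive1 phi) Q 0 = \int[mu]_x (Q x * derive1 phi x).
  by apply: eq_Rint => x _; rewrite subr0.
by rewrite -/kappa => /eqP; rewrite addrC addr_eq0 => /eqP.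
Qed.

(** The soliton travels at speed [4 k^2], so its pairing with a fixed window changes at the rate
    [- 4 k^2 kappa]. The proof integrates an explicit derivative built on [Q'' = 4 k^2 Q - Q^2]. *)
Lemma rate_Q : pair (derive1 (derive1 (derive1 phi))) Q 0
  + pair (derive1 phi) (fun x => Q x * Q x) 0 = - (4 * k ^+ 2 * kappa).
Proof.
have w0 := phi_win; have w1 := win_derive w0; have w2 := win_derive w1; have w3 := win_derive w2.
have [s0 p0] := w0; have [s1 p1] := w1; have [s2 p2] := w2; have [s3 p3] := w3.
have cQ := @Q_cont _ k; have cdQ := @dQ_cont _ k.
pose D x := (Q x * derive1 (derive1 (derive1 phi)) x + Q x * Q x * derive1 phi x)
    + 4 * k ^+ 2 * (dQ x * phi x).
have e : \int[mu]_x D x = 0.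
  apply: (@win_int0 (fun x => Q x * derive1 (derive1 phi) x - dQ x * derive1 phi x
      + 4 * k ^+ 2 * (Q x * phi x)) D).
  - move=> x; have h := dD (dB (dM (Q_d k x) (smooth_d s2 x)) (dM (dQ_d k x) (smooth_d s1 x)))
      (dZ (4 * k ^+ 2) (dM (Q_d k x) (smooth_d s0 x))).
    apply: d_eq h _; rewrite /D; move: (derive1 (derive1 (derive1 phi)) x) (derive1 (derive1 phi) x) (derive1 phi x) (phi x).
    by move: (Q x) (dQ x) => *; ring.
  - move=> x; apply: cvgD; last by apply: cvgMr; apply: cvgM; [exact: cdQ|exact: win_cont w0 x].
    apply: cvgD; first by apply: cvgM; [exact: cQ|exact: win_cont w3 x].
    by apply: cvgM; [exact: (cvgM (cQ x) (cQ x))|exact: win_cont w1 x].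
  - by move=> x h; rewrite p0// p1// p2// !mulr0 subr0 addr0.
  - by move=> x h; rewrite /D p0// p1// p3// !mulr0 !addr0.
have f (p : R -> R) : win p -> sqi setT p by move=> /(win_sqi 0); under eq_fun do rewrite subr0.
have sQ := sqi_Q k k0; have sdQ := sqi_dQ k k0.
have sQQ : sqi setT (fun x => Q x * Q x).
  apply: (sqi_bM (6 * k ^+ 2)) => //; first exact: cont_meas cQ.
  by move=> x _; rewrite gtr0_norm ?Q_gt0// Q_le.
have i1 := sqiM mT sQ (f _ w3); have i2 := sqiM mT sQQ (f _ w1); have i3 := sqiM mT sdQ (f _ w0).
move: e; rewrite /D RintD//; [|exact: intgD|exact: intgZ]; rewrite RintD// RintZ// -/kappa.
have pe (p h : R -> R) : pair p h 0 = \int[mu]_x (h x * p x).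
  by apply: eq_Rint => x _; rewrite subr0.
by rewrite !pe => /eqP; rewrite addr_eq0 => /eqP.
Qed.

(** Near [z] the function [pair phi v] has slope at least [kappa / 2], and its value at [z] is
    [O(b)], so it vanishes at a distance [O(b)]. The zero is kept within [r0 / 4] so that the slope
    bound still covers the zeros at neighbouring times. *)
Lemma modulation_static : exists r0 b0 C : R, [/\ 0 < r0 <= 1, 0 < b0, 0 < C &
  forall v dv z b, H1 v dv -> 0 < b <= b0 -> dist v dv z <= b ^+ 2 ->
  (forall y, `|y - z| <= r0 -> kappa / 2 <= - pair (derive1 phi) v y) /\
  exists y, [/\ `|y - z| <= r0 / 4, pair phi v y = 0 & dist v dv y <= (C * b) ^+ 2]].
Proof.
have K0 := kappa_gt0; have w0 := phi_win; have w1 := win_derive w0.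
have [A A0 hA] := pair_bnd w0; have [A' A'0 hA'] := pair_bnd w1; have [B B0 hB] := pair_lip w1.
have [CQ CQ0 hQ] := Q_shift_sq; have nQ := nrm_ge0 Q; have Bn : 0 <= B * nrm Q by rewrite mulr_ge0// ltW.
have sQ := sqi_Q k k0; have HQ := H1_Q k k0.
pose D := 4 * (B * nrm Q + 1); have D0 : 0 < D by rewrite /D; lra.
pose r0 := Num.min 1 (kappa / D).
have r00 : 0 < r0 by rewrite lt_min ltr01 divr_gt0.
have r01 : r0 <= 1 by rewrite ge_min lexx.
have r02 : r0 * D <= kappa by rewrite -ler_pdivlMr// ge_min lexx orbT.
(* Over the distance [2 A b / kappa], a slope of [kappa / 2] makes up for the value at [z], which is
   at most [A b] in size. *)
pose C1 := 2 * A / kappa; have C10 : 0 < C1 by rewrite divr_gt0// mulr_gt0.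
have C1k : C1 * kappa = 2 * A by rewrite divfK// gt_eqF.
pose b0 := Num.min (kappa / (4 * A')) (r0 / (4 * C1)).
have b00 : 0 < b0 by rewrite lt_min !divr_gt0// mulr_gt0.
pose C := 2 + 2 * CQ * C1 ^+ 2; have C11 := sqr_ge0 C1.
have CC : 0 <= 2 * CQ * C1 ^+ 2 by rewrite mulr_ge0// mulr_ge0// ltW.
exists r0, b0, C; split; rewrite ?r00//; first by rewrite /C; lra.
move=> v dv z b Hv /andP[bp bb] hd.
have b1 : b * (4 * A') <= kappa.
  have A4 : 0 < 4 * A' by rewrite mulr_gt0.
  by rewrite -ler_pdivlMr//; apply: (le_trans bb); rewrite ge_min lexx.
have b2 : b * (4 * C1) <= r0.
  have C2 : 0 < 4 * C1 by rewrite mulr_gt0.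
  by rewrite -ler_pdivlMr//; apply: (le_trans bb); rewrite ge_min lexx orbT.
have [_ sv _] := Hv; have [_ sQz _] := H1_Qs k k0 z.
pose f x := v x - Q (x - z); have sf : sqi setT f := sqiB mT sv sQz.
have nf : nrm f <= b.
  apply: nrm_le; first exact: ltW.
  by apply: le_trans hd; rewrite /(dist) /h1sq lerDl mass_ge0.
have vE : v = (fun x => Q (x - z) + f x) by apply/funext => x; rewrite /f; ring.
have split psi y : win psi -> pair psi v y = pair psi f y + pair psi (fun x => Q (x - z)) y.
  by move=> wp; rewrite /f pairB// subrK.
have base psi : win psi -> pair psi (fun x => Q (x - z)) z = pair psi Q 0.
  by move=> wp; rewrite -(pair_shift z 0 wp sQ) add0r.
have slope y : `|y - z| <= r0 -> kappa / 2 <= - pair (derive1 phi) v y.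
  move=> yz; rewrite (split _ y w1).
  have := hB _ z y sQz (le_trans yz r01); rewrite (base _ w1) pair_dphi_Q.
  have := hA' f y sf; rewrite (nrm_shift (- z) sQ) !ler_norml => /andP[_ h1] /andP[_ h2].
  have h3 : A' * nrm f <= A' * b by rewrite ler_wpM2l// ltW.
  have h4 : B * nrm Q * `|y - z| <= B * nrm Q * r0 by rewrite ler_wpM2l.
  by move: r02; rewrite /D; move: h1 h2 h3 h4 b1 r00; clear => *; lra.
split => //.
have [s [s0 s1 sk sE]] : exists s : R, [/\ 0 < s, s <= r0 / 4, s * kappa = 2 * (A * b) & s = C1 * b].
  exists (C1 * b); split => //; first by rewrite mulr_gt0.
    by rewrite mulrC; clear -b2; lra.
  by rewrite mulrAC C1k; ring.
have dG y := pair_d y w0 sv; have cG := pair_cont w0 sv.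
have Gz : `|pair phi v z| <= A * b.
  rewrite (split _ z w0) (base _ w0) pair_phi_Q addr0; apply: (le_trans (hA f z sf)).
  by rewrite ler_wpM2l// ltW.
have s2 : s <= r0 by clear -s1 r00; lra.
have slope' c : `|c - z| <= s -> s * (kappa / 2) <= - pair (derive1 phi) v c * s.
  by move=> hc; rewrite mulrC ler_wpM2r ?(ltW s0)//; apply: slope; exact: le_trans s2.
move: Gz; rewrite ler_norml => /andP[g1 g2].
have up : 0 <= pair phi v (z + s).
  have [c hc e] := mvt z (z + s) dG; have e1 : z + s - z = s by ring.
  move: e hc; rewrite {}e1 (gtr0_norm s0) => e /slope' hs.
  move: e hs g1 sk; move: (pair phi v (z + s)) (pair phi v z) (pair (derive1 phi) v c) kappa (A * b).
  by clear => *; lra.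
have dn : pair phi v (z - s) <= 0.
  have [c hc e] := mvt z (z - s) dG; have e1 : z - s - z = - s by ring.
  move: e hc; rewrite {}e1 normrN (gtr0_norm s0) => e /slope' hs.
  move: e hs g2 sk; move: (pair phi v (z - s)) (pair phi v z) (pair (derive1 phi) v c) kappa (A * b).
  by clear => *; lra.
have zs : z - s <= z + s by clear -s0; lra.
have [|y yI y0] := IVT zs (continuous_subspaceT cG) (v := 0).
  apply/andP; split; first by rewrite ge_min; apply/orP; left; exact: dn.
  by rewrite le_max; apply/orP; right; exact: up.
have yz : `|y - z| <= s by move: yI; rewrite in_itv/= ler_norml; clear => /andP[? ?]; apply/andP; split; lra.
exists y; split => //; first exact: le_trans s1.
have H1z := H1_Qs k k0 z; have H1y := H1_Qs k k0 y.
have := h1sqD_le (H1B Hv H1z) (H1B H1z H1y).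
have -> : h1sq (fun x => v x - Q (x - z) + (Q (x - z) - Q (x - y)))
   (fun x => dv x - dQ (x - z) + (dQ (x - z) - dQ (x - y))) = dist v dv y.
  by apply: eq_h1sq => x; ring.
rewrite -/(dist v dv z).
have -> : h1sq (fun x => Q (x - z) - Q (x - y)) (fun x => dQ (x - z) - dQ (x - y)) =
    h1sq (fun x => Q (x + (y - z)) - Q x) (fun x => dQ (x + (y - z)) - dQ x).
  rewrite -(h1sq_shift y (H1B H1z H1y)); apply: eq_h1sq => x.
    by congr (Q _ - Q _); ring.
  by congr (dQ _ - dQ _); ring.
have yz1 : `|y - z| <= 1 by apply: (le_trans yz); clear -s2 r01; lra.
have := hQ (y - z) yz1; have : (y - z) ^+ 2 <= (C1 * b) ^+ 2.
  rewrite -sE.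
  by rewrite -(real_normK (num_real (y - z))) ler_pXn2r ?nnegrE//; exact: ltW.
move=> q1 q2 q3; apply: (le_trans q3).
have q4 : CQ * (y - z) ^+ 2 <= CQ * (C1 * b) ^+ 2 by rewrite ler_wpM2l// ltW.
apply: (@le_trans _ _ (C * b ^+ 2)).
  move: q2 q4 hd; rewrite /C exprMn; move: (h1sq _ _) (dist v dv z) (CQ * (y - z) ^+ 2) (C1 ^+ 2) (b ^+ 2).
  by clear => *; lra.
by rewrite exprMn ler_wpM2r ?sqr_ge0// expr2 ler_peMl// /C; clear -CC; lra.
Qed.

End Modulation.

(** * Rate of the pairing and location of the centres *)

Section Dynamics.
Context {R : realType}.
Local Notation mu := (@lebesgue_measure R).
Local Notation P := (@pos_half_line R).
Implicit Types (f g psi u du : R -> R) (v dv : R -> R -> R) (x y z t s a b m n M K eps de : R).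

Let mT : measurable [set: R]. Proof. exact: measurableT. Qed.
Let mP : measurable P. Proof. exact: measurable_itv. Qed.

Local Notation phi1 := (derive1 (@phi R)).
Local Notation phi3 := (derive1 (derive1 (derive1 (@phi R)))).

Let w0 : win (@phi R). Proof. exact: phi_win. Qed.
Let w1 : win phi1. Proof. exact: win_derive w0. Qed.
Let w3 : win phi3. Proof. exact: win_derive (win_derive w1). Qed.

(** For [u] vanishing on [x <= 0], this is [rate] for the window moved to [y]: the time derivative
    of the pairing at a fixed position. *)
Definition speed u y : R := pair phi3 u y + pair phi1 (fun x => u x * u x) y.

Lemma phi_test {y} : 1 < y -> test_function P (fun x => phi (x - y)).
Proof.
move=> y1; have [sp [K [cK KU K0]]] := win_test y w0; split => //; exists K; split => //.
by move=> x /KU; rewrite /= in_itv/= => /andP[h _]; apply/posP; lra.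
Qed.

Lemma Rint_pos_supp {g} : (forall x, x <= 0 -> g x = 0) -> \int[mu]_(x in P) g x = \int[mu]_x g x.
Proof.
move=> g0; rewrite (Rint_supp mP)// => x; rewrite posP => /negP; rewrite -leNgt; exact: g0.
Qed.

Lemma rate_speed {u y} : (forall x, x <= 0 -> u x = 0) -> sqi setT u -> sqi setT (fun x => u x * u x) ->
  rate (fun x => phi (x - y)) u = speed u y.
Proof.
move=> u0 su suu.
have e1 := win_derive1 y w0; have e3 := win_derive3 y w0.
rewrite /rate Rint_pos_supp; last by move=> x /u0 ->; rewrite expr0n !mul0r addr0.
have i3 := sqiM mT su (win_sqi y w3); have i1 := sqiM mT suu (win_sqi y w1).
have -> : speed u y = \int[mu]_x (u x * phi3 (x - y) + u x * u x * phi1 (x - y)) by rewrite RintD.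
rewrite e3 e1; apply: eq_Rint => x _; rewrite expr2; exact: erefl.
Qed.

Lemma H1_bnd {u du} : H1 u du -> exists2 B : R, 1 <= B & forall x, `|u x| <= B.
Proof.
move=> Hu; have h0 := h1sq_ge0 u du; exists (2 * h1sq u du + 1); first by lra.
move=> x; apply: sqr_le_norm; first by lra.
apply: (le_trans (H1_sup Hu x)); apply: (@le_trans _ _ (2 * h1sq u du + 1)); first by lra.
by rewrite expr2 ler_peMl//; lra.
Qed.

Lemma H1_sqr {u du} : H1 u du -> sqi setT (fun x => u x * u x).
Proof.
move=> Hu; have [B B1 uB] := H1_bnd Hu; have [_ su _] := Hu.
by apply: (sqi_bM B) => //; case: su.
Qed.

Lemma nrm_sqrB {u du f df : R -> R} {B} : H1 u du -> H1 f df -> 0 <= B -> (forall x, `|f x| <= B) ->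
  (forall x, `|u x - f x| <= 2) ->
  nrm (fun x => u x * u x - f x * f x) <= (2 + 2 * B) * nrm (fun x => u x - f x).
Proof.
move=> Hu Hf B0 fB uf; have [_ su _] := Hu; have [_ sf _] := Hf.
have [||||_ h] := @nrm_bM _ (fun x => u x - f x) (fun x => u x + f x) (2 + 2 * B).
- by lra.
- by apply: measurable_funD; [case: su|case: sf].
- move=> x; have -> : u x + f x = (u x - f x) + 2 * f x by ring.
  by rewrite (le_trans (ler_normD _ _))// lerD// normrM ger0_norm// ler_pM2l.
- exact: sqiB.
apply: le_trans h; rewrite le_eqVlt; apply/orP/or_introl/eqP.
by congr nrm; apply/funext => x; ring.
Qed.

Lemma speed_close {u du} eps : H1 u du -> 0 < eps -> exists2 de : R, 0 < de &
  forall f df y z, H1 f df -> h1sq (fun x => f x - u x) (fun x => df x - du x) <= de ->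
  `|z - y| <= de -> `|speed f z - speed u y| <= eps.
Proof.
move=> Hu e0; have e2 : 0 < eps / 2 by lra.
have [_ su _] := Hu; have suu := H1_sqr Hu; have [B B1 uB] := H1_bnd Hu.
have [d3 d30 h3] := pair_close _ w3 su e2; have [d1 d10 h1] := pair_close _ w1 suu e2.
pose K := 2 + 2 * B; have K1 : 1 <= K by rewrite /K; lra.
pose r := Num.min 1 (Num.min d3 (d1 / K)).
have r0 : 0 < r by rewrite !lt_min ltr01 d30 divr_gt0//; lra.
have r1 : r <= 1 by rewrite ge_min lexx.
have r3 : r <= d3 by rewrite !ge_min lexx orbT.
have rK : r <= d1 / K by rewrite !ge_min lexx !orbT.
have rK' : K * r <= d1 by rewrite mulrC -ler_pdivlMr//; lra.
have rd1 : r <= d1 by apply: le_trans rK'; rewrite ler_peMl// ltW.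
have rr : r ^+ 2 <= r by rewrite expr2 ler_piMl// ltW.
exists (r ^+ 2); first by rewrite exprn_gt0.
move=> f df y z Hf hf zy; have [_ sf _] := Hf; have sff := H1_sqr Hf.
have nf : nrm (fun x => f x - u x) <= r.
  apply: nrm_le; first exact: ltW.
  by apply: le_trans hf; rewrite /h1sq lerDl mass_ge0.
have sup x : `|f x - u x| <= 2.
  apply: sqr_le_norm => //; apply: (le_trans (H1_sup (H1B Hf Hu) x)).
  by apply: (@le_trans _ _ (2 * r ^+ 2)); [rewrite ler_pM2l|clear -rr r1; lra].
have nff : nrm (fun x => f x * f x - u x * u x) <= K * r.
  apply: (le_trans (nrm_sqrB Hf Hu _ uB sup)); first by lra.
  by rewrite ler_wpM2l//; lra.
have zr : `|z - y| <= r by exact: le_trans rr.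
have := h3 f y z sf (le_trans nf r3) (le_trans zr r3).
have := h1 _ y z sff (le_trans nff rK') (le_trans zr rd1).
rewrite /speed => p1 p3; rewrite opprD addrACA; apply: (le_trans (ler_normD _ _)).
by have := lerD p3 p1; rewrite -splitr.
Qed.

Variable k : R.
Hypothesis k0 : 0 < k.
Local Notation Q := (Q k).
Local Notation dQ := (dQ k).
Local Notation dist := (dist k).
Local Notation kappa := (kappa k).

(** At the soliton the two quantities are [- 4 k^2 kappa] and [kappa], by [rate_Q] and
    [pair_dphi_Q]; near it they depend on [u] in a Lipschitz way. *)
Lemma speed_near : exists2 C : R, 0 < C & forall u du y n, H1 u du -> 0 <= n <= 1 ->
  dist u du y <= n ^+ 2 ->
  `|speed u y + 4 * k ^+ 2 * kappa| <= C * n /\ `|- pair phi1 u y - kappa| <= C * n.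
Proof.
have [A3 A30 h3] := pair_bnd w3; have [A1 A10 h1] := pair_bnd w1.
have k2 := sqr_ge0 k; pose K := 2 + 2 * (6 * k ^+ 2).
have K0 : 0 <= K by rewrite /K; lra.
have AK : 0 <= A1 * K by rewrite mulr_ge0// ltW.
exists (A3 + A1 * K + A1); first by clear -A30 A10 AK; lra.
move=> u du y n Hu /andP[n0 n1] hd; have [_ su _] := Hu.
have HQ := H1_Qs k k0 y; have [_ sQ _] := HQ; have sQ0 := sqi_Q k k0.
have nu : nrm (fun x => u x - Q (x - y)) <= n.
  by apply: nrm_le => //; apply: le_trans hd; rewrite /(dist) /h1sq lerDl mass_ge0.
have sup x : `|u x - Q (x - y)| <= 2.
  apply: sqr_le_norm => //; apply: (le_trans (H1_sup (H1B Hu HQ) x)).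
  apply: (@le_trans _ _ (2 * n ^+ 2)); first by rewrite ler_pM2l.
  have n2 : n ^+ 2 <= 1 by rewrite expr_le1.
  by rewrite -[leRHS]/(2 * 2) ler_pM2l// (le_trans n2)// ler1n.
have QB x : `|Q (x - y)| <= 6 * k ^+ 2 by rewrite gtr0_norm ?Q_gt0// Q_le.
have nuu : nrm (fun x => u x * u x - Q (x - y) * Q (x - y)) <= K * n.
  apply: (le_trans (nrm_sqrB Hu HQ _ QB sup)); first by rewrite mulr_ge0.
  by rewrite ler_wpM2l.
have base (psi : R -> R) (g : R -> R) : win psi -> sqi setT g -> pair psi (fun x => g (x - y)) y = pair psi g 0.
  by move=> wp sg; rewrite -(pair_shift y 0 wp sg) add0r.
have b3 := base _ _ w3 sQ0; have b1 := base _ _ w1 sQ0.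
have b2 := base _ (fun x => Q x * Q x) w1 (H1_sqr (H1_Q k k0)).
have q3 := h3 _ y (sqiB mT su sQ); have q1 := h1 _ y (sqiB mT su sQ).
have q2 := h1 _ y (sqiB mT (H1_sqr Hu) (H1_sqr HQ)).
have E3 := pairB y w3 su sQ; rewrite b3 in E3.
have E1 := pairB y w1 su sQ; rewrite b1 (pair_dphi_Q k k0) in E1.
have E2 := pairB y w1 (H1_sqr Hu) (H1_sqr HQ); rewrite b2 in E2.
rewrite E3 in q3; rewrite E1 in q1; rewrite E2 in q2.
have e := rate_Q k k0.
have m3 := ler_wpM2l (ltW A30) nu; have m1 := ler_wpM2l (ltW A10) nu; have m2 := ler_wpM2l (ltW A10) nuu.
have p3 := mulr_ge0 (ltW A30) n0; have p1 := mulr_ge0 (ltW A10) n0; have p2 := mulr_ge0 AK n0.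
rewrite mulrA in m2.
move: q1 q2 q3 e m1 m2 m3 p1 p2 p3; rewrite /speed.
move: (pair phi3 u y) (pair phi1 (fun x => u x * u x) y) (pair phi1 u y) (nrm _) (nrm _) kappa.
move: (pair phi3 Q 0) (pair phi1 (fun x => Q x * Q x) 0).
move=> a1 a2 c1 c2 c3 n1' n2' kp; rewrite !ler_norml.
clear => /andP[? ?] /andP[? ?] /andP[? ?] e *.
by split; apply/andP; split; lra.
Qed.

(** If [z <= 2], some point [x <= 0] has [Q (x - z) >= Q 2] although [u x = 0], which the sup bound
    forbids for small [b]. A window of radius 1 at a slightly moved centre therefore avoids the
    boundary. *)
Lemma center_gt {u du z b} : H1 u du -> (forall x, x <= 0 -> u x = 0) -> dist u du z <= b ^+ 2 ->
  0 < b -> 2 * b <= Q 2 -> 2 < z.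
Proof.
move=> Hu u0 hd b0 bQ; rewrite ltNge; apply/negP => z2.
have q2 := Q_gt0 k k0 2.
have key x : x <= 0 -> Q 2 <= Q (x - z) -> False.
  move=> x0 hQ; have := H1_sup (H1B Hu (H1_Qs k k0 z)) x; rewrite u0// sub0r sqrrN -/(dist u du z) => h.
  have h2 : Q 2 ^+ 2 <= Q (x - z) ^+ 2 by rewrite ler_pXn2r ?nnegrE// ltW// Q_gt0.
  have b2 : 0 <= 2 * b by rewrite mulr_ge0// ltW.
  have h3 : (2 * b) ^+ 2 <= Q 2 ^+ 2 by rewrite ler_pXn2r ?nnegrE//; exact: ltW.
  have h4 : 0 < b ^+ 2 by rewrite exprn_gt0.
  have e4 : (2 * b) ^+ 2 = 4 * b ^+ 2 by ring.
  rewrite e4 in h3; move: h h2 h3 h4 hd; move: (dist u du z) (Q 2 ^+ 2) (Q (x - z) ^+ 2) (b ^+ 2).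
  by clear => *; lra.
have [z0|z0] := leP z 0.
  by apply: (key z z0); rewrite subrr; apply/ltW/Q_dec.
apply: (key 0 (lexx 0)); rewrite sub0r QN; move: z2; rewrite le_eqVlt => /orP[/eqP->//|z2].
by apply/ltW/Q_dec => //; exact: ltW.
Qed.

(** Two triangle inequalities put the two translates of [Q] at squared distance at most [10 b^2], so
    the sup bound gives [20 b^2] at the peak of one of them. If the centres were more than [r]
    apart, the squared difference there would be at least [25 b^2]. *)
Lemma centers_close {u du f df : R -> R} {z z' b r} : H1 u du -> H1 f df -> 0 < r -> 0 < b ->
  5 * b <= Q 0 - Q r -> dist u du z <= b ^+ 2 -> dist f df z' <= b ^+ 2 ->
  h1sq (fun x => f x - u x) (fun x => df x - du x) <= b ^+ 2 -> `|z' - z| <= r.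
Proof.
move=> Hu Hf r0 b0 gap hz hz' hfu; rewrite leNgt; apply/negP => zr.
have Hz := H1_Qs k k0 z; have Hz' := H1_Qs k k0 z'.
have h1 := dist_triangle k k0 z Hf Hu.
have h2 := h1sqD_le (H1B Hz' Hf) (H1B Hf Hz).
have e2 : h1sq (fun x => Q (x - z') - f x + (f x - Q (x - z))) (fun x => dQ (x - z') - df x + (df x - dQ (x - z)))
   = h1sq (fun x => Q (x - z') - Q (x - z)) (fun x => dQ (x - z') - dQ (x - z)).
  by apply: eq_h1sq => x; ring.
have e3 : h1sq (fun x => Q (x - z') - f x) (fun x => dQ (x - z') - df x) = dist f df z' by exact: h1sq_sym.
have h3 := H1_sup (H1B Hz' Hz) z'.
have qz : Q (z' - z) <= Q r.
  have [p|p] := leP 0 (z' - z).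
    by apply/ltW/Q_dec; [exact: k0|exact: ltW|rewrite -(ger0_norm p)].
  rewrite -QN; apply/ltW/Q_dec; [exact: k0|exact: ltW|by rewrite -(ltr0_norm p)].
have b5 : 0 <= 5 * b by rewrite mulr_ge0// ltW.
have g5 : 5 * b <= Q (z' - z') - Q (z' - z) by rewrite subrr; clear -gap qz; lra.
have g0 : 0 <= Q (z' - z') - Q (z' - z) by exact: le_trans g5.
have h4 : (5 * b) ^+ 2 <= (Q (z' - z') - Q (z' - z)) ^+ 2 by rewrite ler_pXn2r ?nnegrE.
have h5 : 0 < b ^+ 2 by rewrite exprn_gt0.
have e5 : (5 * b) ^+ 2 = 25 * b ^+ 2 by ring.
rewrite e5 in h4; move: h1 h2 h3 h4 h5 hz hz' hfu; rewrite e2 e3 -/(dist f df z).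
move: (dist u du z) (dist f df z) (dist f df z') (h1sq _ _) (h1sq _ _) (_ ^+ 2 : R) (b ^+ 2).
by clear => *; lra.
Qed.

End Dynamics.

(** * The centre as a [C^1] function of time *)

Section Trajectory.
Context {R : realType}.
Local Notation mu := (@lebesgue_measure R).
Local Notation P := (@pos_half_line R).
Implicit Types (w : R -> R) (v dv : R -> R -> R) (x y z r s t a b c m n h N E X K eps de tau kp : R).

Lemma div_bound kp {h X m} : 0 < kp -> kp / 2 <= h -> `|h * X| <= m -> `|X| <= 2 / kp * m.
Proof.
move=> k0 kh; rewrite normrM (gtr0_norm (lt_le_trans (divr_gt0 k0 (ltr0Sn _ 1)) kh)) => hX.
have : kp / 2 * `|X| <= m by apply: le_trans hX; rewrite ler_wpM2r.
by rewrite -ler_pdivlMl ?divr_gt0// invf_div.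
Qed.

(** Quantitative implicit differentiation: [X] is the increment of the centre, [E] the increment in
    time of the pairing at a fixed window, [N] its rate, and [h], [h'] are slopes with respect to
    the centre. *)
Lemma quotient_derivative kp {h h' N E X tau e : R} : 0 < kp -> kp / 2 <= h -> kp / 2 <= h' ->
  `|h' - h| <= e -> `|E - N * tau| <= e * `|tau| -> - E = h' * X -> e <= 1 ->
  `|X - tau * (- N / h)| <= 2 / kp * (1 + 2 / kp * (`|N| + 1)) * e * `|tau|.
Proof.
move=> k0 kh kh' hh' HE EX e1; have h0 : 0 < h by apply: lt_le_trans kh; rewrite divr_gt0.
have k2 : 0 < 2 / kp by rewrite divr_gt0.
have t0 := normr_ge0 tau; have e0 : 0 <= e by exact: le_trans hh'.
have E1 : `|E| <= (`|N| + 1) * `|tau|.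
  have -> : E = E - N * tau + N * tau by rewrite subrK.
  rewrite (le_trans (ler_normD _ _))// normrM mulrDl mul1r addrC lerD2l (le_trans HE)//.
  by rewrite ler_piMl.
have X1 : `|X| <= 2 / kp * ((`|N| + 1) * `|tau|).
  by apply: (div_bound _ k0 kh'); rewrite -EX normrN.
have -> : 2 / kp * (1 + 2 / kp * (`|N| + 1)) * e * `|tau| =
    2 / kp * (e * `|tau| + e * (2 / kp * ((`|N| + 1) * `|tau|))) by ring.
apply: (div_bound _ k0 kh).
have -> : h * (X - tau * (- N / h)) = - (E - N * tau) + - ((h' - h) * X).
  have e3 : h * (tau * (- N / h)) = - (tau * N) by have e4 : h * (- N / h) = - N by [rewrite mulrC divfK// gt_eqF]; rewrite mulrCA e4 mulrN.
  by rewrite mulrBr e3 mulrBl -EX; ring.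
rewrite (le_trans (ler_normD _ _))// !normrN lerD// normrM.
by apply: ler_pM.
Qed.

Lemma quotient_close kp {h h' N N' e : R} : 0 < kp -> kp / 2 <= h -> kp / 2 <= h' ->
  `|h' - h| <= e -> `|N' - N| <= e -> `|- N' / h' - - N / h| <= 2 / kp * (1 + `|N / h|) * e.
Proof.
move=> k0 kh kh' hh NN; have p0 : 0 < h' by apply: lt_le_trans kh'; rewrite divr_gt0.
rewrite -mulrA; apply: (div_bound _ k0 kh').
have -> : h' * (- N' / h' - - N / h) = - (N' - N) + (N / h * (h' - h)).
  have p1 : 0 < h by apply: lt_le_trans kh; rewrite divr_gt0.
  have e1 : h' * (- N' / h') = - N' by rewrite mulrC divfK// gt_eqF.
  have e2 : N / h * h = N by rewrite divfK// gt_eqF.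
  by rewrite mulrBr e1 [in RHS]mulrBr e2; ring.
rewrite (le_trans (ler_normD _ _))// normrN normrM mulrDl mul1r lerD//.
by rewrite ler_wpM2l.
Qed.

Lemma quotient_near kp {h N m : R} c : 0 < kp -> kp / 2 <= h -> 0 <= c ->
  `|N + c * kp| <= m -> `|h - kp| <= m -> `|- N / h - c| <= 2 / kp * (1 + c) * m.
Proof.
move=> k0 kh c0 HN Hh; have p0 : 0 < h by apply: lt_le_trans kh; rewrite divr_gt0.
rewrite -mulrA; apply: (div_bound _ k0 kh).
have -> : h * (- N / h - c) = - (N + c * kp) + - (c * (h - kp)).
  have e1 : h * (- N / h) = - N by rewrite mulrC divfK// gt_eqF.
  by rewrite mulrBr e1; ring.
rewrite (le_trans (ler_normD _ _))// !normrN normrM (ger0_norm c0) mulrDl mul1r lerD//.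
by rewrite ler_wpM2l.
Qed.

(** [flow_rate] for the window at [y] and for either order of the two times, with integrals taken
    over the whole line. *)
Lemma flow_rate_sym {w0 v dv} : flow w0 v dv -> forall y s t c eps, 1 < y -> 0 <= s -> 0 <= t ->
  (forall r, 0 <= r -> `|r - t| <= `|s - t| -> `|speed (v r) y - c| <= eps) ->
  `|pair phi (v s) y - pair phi (v t) y - c * (s - t)| <= eps * `|s - t|.
Proof.
move=> F y s t c eps y1 s0 t0 H; have tc := phi_test y1.
have E r : 0 <= r -> \int[mu]_(x in P) (v r x * phi (x - y)) = pair phi (v r) y.
  by move=> r0; rewrite Rint_pos_supp// => x x0; rewrite (flow_neg _ _ _ F)// mul0r.
have rt r : 0 <= r -> rate (fun x => phi (x - y)) (v r) = speed (v r) y.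
  move=> r0; have Hr := flow_H1 _ _ _ F _ r0; have [_ sr _] := Hr.
  by apply: rate_speed => //; [move=> x; exact: (flow_neg _ _ _ F)|exact: H1_sqr Hr].
have [ts|st] := leP t s.
  rewrite -(E s s0) -(E t t0) [`|s - t|]ger0_norm ?subr_ge0//; apply: (flow_rate _ _ _ F) => // r /andP[h1 h2].
  have r0 : 0 <= r by exact: le_trans h1.
  rewrite rt//; apply: H => //; rewrite !ger0_norm ?subr_ge0//.
  by rewrite lerD2r.
have := flow_rate _ _ _ F _ s t c eps tc s0 (ltW st); rewrite !E// => H'.
rewrite [`|s - t|]distrC [`|t - s|]gtr0_norm ?subr_gt0// -[leLHS]normrN.
have -> : - (pair phi (v s) y - pair phi (v t) y - c * (s - t)) =
  pair phi (v t) y - pair phi (v s) y - c * (t - s) by ring.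
apply: H' => r /andP[h1 h2]; have r0 : 0 <= r by exact: le_trans h1.
rewrite rt//; apply: H => //; rewrite !(distrC _ t) !ger0_norm ?subr_ge0//; [|exact: ltW].
by rewrite lerD2l lerN2.
Qed.

Variable k : R.
Hypothesis k0 : 0 < k.
Local Notation Q := (Q k).
Local Notation dist := (dist k).
Local Notation kappa := (kappa k).

(** The condition [pair phi (v t) (y t) = 0] is differentiated implicitly and gives [y' = - N / h],
    with [N] the rate and [h] the slope. The approximate centres [z t] come from a mere choice and
    may jump; [centers_close] confines them at nearby times, and the slope bound then makes [y]
    continuous. *)
Lemma modulation : exists b0 C : R, [/\ 0 < b0, 0 < C & forall w0 v dv b, flow w0 v dv -> 0 < b <= b0 ->
  (forall t, 0 <= t -> exists z, dist (v t) (dv t) z <= b ^+ 2) ->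
  exists y dy : R -> R, [/\
    forall t, 0 <= t -> dist (v t) (dv t) (y t) <= (C * b) ^+ 2,
    forall t, 0 <= t -> `|dy t - 4 * k ^+ 2| <= C * b &
    forall t eps, 0 <= t -> 0 < eps -> exists2 de : R, 0 < de & forall s, 0 <= s -> `|s - t| < de ->
      `|y s - y t - (s - t) * dy t| <= eps * `|s - t| /\ `|dy s - dy t| <= eps]].
Proof.
have [r0 [bm [C [/andP[r00 r01] bm0 C0 st]]]] := modulation_static k k0.
have [D D0 near] := speed_near k k0.
have [kp kpE] : exists kp : R, kp = kappa by exists kappa.
have kp0 : 0 < kp by rewrite kpE; exact: kappa_gt0.
have kp2 : 0 < 2 / kp by rewrite divr_gt0.
have k2 : 0 <= 4 * k ^+ 2 by rewrite mulr_ge0// sqr_ge0.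
have w0 := @phi_win R; have w1 := win_derive w0.
have [A A0 hA] := pair_bnd w0.
pose Cf := C + 2 / kp * (1 + 4 * k ^+ 2) * (D * C).
have Cf0 : 0 <= 2 / kp * (1 + 4 * k ^+ 2) * (D * C).
  rewrite mulr_ge0//; last by rewrite mulr_ge0// ltW.
  by rewrite mulr_ge0//; [exact: ltW|rewrite addr_ge0].
have [g0 g00 gE] : exists2 g0 : R, 0 < g0 & g0 = Q 0 - Q (r0 / 4).
  by exists (Q 0 - Q (r0 / 4)) => //; rewrite subr_gt0; apply: Q_dec => //; rewrite divr_gt0.
have [q2 q20 qE] : exists2 q2 : R, 0 < q2 & q2 = Q 2 by exists (Q 2) => //; exact: Q_gt0.
pose b0 := Num.min (Num.min bm (1 / C)) (Num.min (g0 / 5) (q2 / 2)).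
exists b0, Cf; split.
- by rewrite !lt_min bm0 !divr_gt0.
- by rewrite /Cf ltr_pwDl.
move=> u0 v dv b F /andP[bp]; rewrite !le_min => /andP[/andP[bb1 bb2] /andP[bb3 bb4]] Hz.
have bg : 5 * b <= Q 0 - Q (r0 / 4) by rewrite -gE mulrC -ler_pdivlMr.
have bq : 2 * b <= Q 2 by rewrite -qE mulrC -ler_pdivlMr.
have bC : 0 <= C * b <= 1.
  by rewrite mulr_ge0 ?(ltW C0) ?(ltW bp)//= mulrC -ler_pdivlMr.
have bbm : 0 < b <= bm by rewrite bp.
have HH t := flow_H1 _ _ _ F t.
have sv t : 0 <= t -> sqi setT (v t) by move=> /HH [].
have exz t : exists z, 0 <= t -> dist (v t) (dv t) z <= b ^+ 2.
  by have [/Hz [z hz]|_] := leP 0 t; [exists z|exists 0].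
have [z hz] := choice exz.
have exy t : exists y, 0 <= t -> [/\ `|y - z t| <= r0 / 4, pair phi (v t) y = 0 & dist (v t) (dv t) y <= (C * b) ^+ 2].
  have [t0|_] := leP 0 t; last by exists 0.
  by have [_ [y hy]] := st _ _ _ _ (HH t t0) bbm (hz t t0); exists y.
have [y hy] := choice exy.
have slope t x : 0 <= t -> `|x - z t| <= r0 -> kp / 2 <= - pair (derive1 phi) (v t) x.
  by move=> t0; rewrite kpE; have [h _] := st _ _ _ _ (HH t t0) bbm (hz t t0); exact: h.
have yz t : 0 <= t -> `|y t - z t| <= r0 / 4 by move=> /hy [].
have y0 t : 0 <= t -> pair phi (v t) (y t) = 0 by move=> /hy [].
have y1 t : 0 <= t -> 1 < y t.
  move=> t0; have := center_gt k k0 (HH t t0) (flow_neg _ _ _ F t ^~ t0) (hz t t0) bp bq.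
  have := yz t t0; rewrite ler_norml => /andP[h _].
  by clear -h r01; lra.
have vc t eps : 0 <= t -> 0 < eps -> exists2 de : R, 0 < de & forall s, 0 <= s -> `|s - t| < de ->
    nrm (fun x => v s x - v t x) <= eps.
  move=> t0 e0; have [de de0 H] := flow_cont _ _ _ F t _ t0 (exprn_gt0 2 e0).
  exists de => // s s0 st'; apply: nrm_le; first exact: ltW.
  by apply: le_trans (H s s0 st'); rewrite /h1sq lerDl mass_ge0.
have g4 : 0 < r0 / 4 by rewrite divr_gt0.
(* A point between [y t] and [y s] is within [4 (r0 / 4)] of [z t], going through [z s]; so the
   slope bound holds there, and the mean value theorem controls [|y s - y t|] by the change of
   [v]. *)
have lip t : 0 <= t -> exists2 de : R, 0 < de & forall s, 0 <= s -> `|s - t| < de ->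
    (forall c, `|c - y t| <= `|y s - y t| -> kp / 2 <= - pair (derive1 phi) (v t) c) /\
    kp / 2 * `|y s - y t| <= A * nrm (fun x => v s x - v t x).
  move=> t0; have [de de0 H] := flow_cont _ _ _ F t _ t0 (exprn_gt0 2 bp).
  exists de => // s s0 st'.
  have zz := centers_close k k0 (HH t t0) (HH s s0) g4 bp bg (hz t t0) (hz s s0) (H s s0 st').
  have rng c : `|c - y t| <= `|y s - y t| -> kp / 2 <= - pair (derive1 phi) (v t) c.
    move=> hc; apply: slope => //; move: hc zz (yz t t0) (yz s s0).
    have := ler_distD (y t) c (z t); have := ler_distD (z s) (y s) (y t); have := ler_distD (z t) (z s) (y t).
    rewrite (distrC (z t) (y t)).
    by move: (`|_|) (`|_|) (`|_|) (`|_|) (`|_|) (`|_|) (`|_|); clear => *; lra.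
  split => //; have [c hc e] := mvt (y t) (y s) (fun x => pair_d x w0 (sv t t0)).
  have := hA _ (y s) (sqiB (@measurableT _ R) (sv s s0) (sv t t0)).
  rewrite pairB// ?y0//; [|exact: sv|exact: sv].
  rewrite sub0r normrN; rewrite y0// subr0 in e; rewrite e normrM => h.
  apply: le_trans h; rewrite ler_wpM2r//; apply: le_trans (ler_norm _); exact: rng.
have yc t eps : 0 <= t -> 0 < eps -> exists2 de : R, 0 < de & forall s, 0 <= s -> `|s - t| < de ->
    `|y s - y t| <= eps.
  move=> t0 e0; have [de de0 H] := lip t t0.
  have [d1 d10 H1'] := vc t (kp / 2 * eps / A) t0 (divr_gt0 (mulr_gt0 (divr_gt0 kp0 (ltr0Sn _ 1)) e0) A0).
  exists (Num.min de d1); first by rewrite lt_min de0.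
  move=> s s0; rewrite lt_min => /andP[h1 h2]; have [_ h3] := H s s0 h1.
  have h4 := ler_wpM2l (ltW A0) (H1' s s0 h2).
  have h5 : A * (kp / 2 * eps / A) = kp / 2 * eps by rewrite mulrC divfK// gt_eqF.
  rewrite h5 in h4; have := le_trans h3 h4; rewrite ler_pM2l//; exact: divr_gt0.
pose h t := - pair (derive1 phi) (v t) (y t).
pose N t := speed (v t) (y t).
have kh t : 0 <= t -> kp / 2 <= h t.
  by move=> t0; apply: slope => //; apply: le_trans (yz t t0) _; clear -r00; lra.
exists y, (fun t => - N t / h t); split.
- move=> t t0; have [_ _ hd] := hy t t0; apply: (le_trans hd); rewrite ler_pXn2r ?nnegrE//.
  + by rewrite ler_pM2r// /Cf lerDl.
  + by case/andP: bC.
  + by apply: mulr_ge0; [apply: addr_ge0 => //; exact: ltW|exact: ltW].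
- move=> t t0; have [_ _ hd] := hy t t0; have [n1 n2] := near _ _ _ _ (HH t t0) bC hd.
  rewrite -kpE in n1 n2; have := quotient_near kp _ kp0 (kh t t0) k2 n1 n2 => q.
  apply: (le_trans q); rewrite [D * _]mulrA [leLHS]mulrA ler_pM2r//.
  by rewrite /Cf lerDr ltW.
move=> t eps t0 e0; have p1 := kh t t0.
pose M := 2 / kp * (1 + 2 / kp * (`|N t| + 1)) + 2 / kp * (1 + `|N t / h t|).
have Mb : 0 <= 2 / kp * (1 + 2 / kp * (`|N t| + 1)).
  have nn := normr_ge0 (N t); apply: mulr_ge0; first exact: ltW.
  by apply: addr_ge0 => //; apply: mulr_ge0; [exact: ltW|exact: addr_ge0].
have Ma : 0 < 2 / kp * (1 + `|N t / h t|) by rewrite mulr_gt0// ltr_pwDl.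
have M0 : 0 < M by rewrite /M ltr_wpDl.
pose e := Num.min 1 (eps / M); have ep : 0 < e by rewrite lt_min ltr01 divr_gt0.
have e1 : e <= 1 by rewrite ge_min lexx.
have eM : M * e <= eps by rewrite mulrC -ler_pdivlMr// ge_min lexx orbT.
have [d1 d10 sc] := speed_close e (HH t t0) ep.
have [d2 d20 pc] := pair_close e w1 (sv t t0) ep.
have [d3 d30 lp] := lip t t0.
have m12 : 0 < Num.min d1 d2 by rewrite lt_min d10.
have [d4 d40 yC] := yc t _ t0 m12.
have [d5 d50 vC] := flow_cont _ _ _ F t _ t0 d10.
have [d6 d60 nC] := vc t _ t0 d20.
exists (Num.min (Num.min d3 d4) (Num.min d5 d6)).
  by rewrite !lt_min d30 d40 d50.
move=> s s0; rewrite !lt_min => /andP[/andP[s3 s4] /andP[s5 s6]].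
have := yC s s0 s4; rewrite le_min => /andP[ys1 ys2].
have [rng _] := lp s s0 s3.
have [c hc ce] := mvt (y t) (y s) (fun x => pair_d x w0 (sv t t0)).
have tT : nrm (fun x => v t x - v t x) <= d2.
  by apply: nC => //; rewrite subrr normr0.
have hh : `|- pair (derive1 phi) (v t) c - h t| <= e.
  rewrite /h -opprD normrN; apply: pc => //; [exact: sv|exact: le_trans ys2].
have rt := flow_rate_sym F (y s) s t (N t) e (y1 s s0) s0 t0.
have HE : `|pair phi (v s) (y s) - pair phi (v t) (y s) - N t * (s - t)| <= e * `|s - t|.
  apply: rt => r r0' hr; apply: sc (HH r r0') _ ys1.
  by apply: vC => //; exact: le_lt_trans s5.
(* Both [pair phi (v s) (y s)] and [pair phi (v t) (y t)] vanish, so the increment in time at the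
   fixed window [y s] is minus the increment in position at time [t]. *)
have EX : - (pair phi (v s) (y s) - pair phi (v t) (y s)) = - pair (derive1 phi) (v t) c * (y s - y t).
  rewrite -ce (y0 s s0) (y0 t t0) subr0 sub0r opprK; exact: erefl.
have := quotient_derivative kp kp0 p1 (rng c hc) hh HE EX e1 => dd.
split.
  rewrite [(s - t) * _]mulrC [_ * (s - t)]mulrC; apply: (le_trans dd); rewrite ler_wpM2r//.
  by apply: le_trans eM; rewrite ler_pM2r// /M lerDl ltW.
have hs : `|h s - h t| <= e by rewrite /h -opprD normrN; apply: pc => //; [exact: sv|exact: nC].
have Ns : `|N s - N t| <= e by apply: sc (HH s s0) _ ys1; exact: vC.
apply: (le_trans (quotient_close kp kp0 p1 (kh s s0) hs Ns)).
by apply: le_trans eM; rewrite ler_pM2r// /M lerDr.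
Qed.

End Trajectory.

(** * Distance to the soliton at the initial time *)

Section Initial.
Context {R : realType}.
Local Notation mu := (@lebesgue_measure R).
Local Notation P := (@pos_half_line R).
Implicit Types (f g v dv d : R -> R) (x y z s a b c : R).

Let mT : measurable [set: R]. Proof. exact: measurableT. Qed.
Let mP : measurable P. Proof. exact: measurable_itv. Qed.

Lemma le_ae_Rint {f g} : intg setT f -> intg setT g -> {ae mu, forall x, f x <= g x} ->
  \int[mu]_x f x <= \int[mu]_x g x.
Proof.
move=> intf ig fg; rewrite -subr_ge0 -RintB// (eq_ae_Rint (fun x => `|g x - f x|)).
  by apply: Rint_ge0 => x _; exact: normr_ge0.
by apply: aeS fg => x fgx _; rewrite ger0_norm// subr_ge0.
Qed.

Variable k : R.
Hypothesis k0 : 0 < k.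
Local Notation Q := (Q k).
Local Notation dQ := (dQ k).
Local Notation dist := (dist k).

Lemma th_ge_half x : 1 / k <= x -> 1 / 2 <= th k x.
Proof.
rewrite ler_pdivrMr// mulrC => kx; rewrite /th.
have a2 := expR_ge1Dx (k * x); have ab := expRxMexpNx_1 (k * x); have b0 := expR_gt0 (- (k * x)).
move: a2 ab b0; move: (expR (k * x)) (expR (- (k * x))) => a b a2 ab b0.
have a0 : 2 <= a by clear -a2 kx; lra.
have ab0 : 0 < a + b by clear -a0 b0; lra.
by rewrite ler_pdivlMr//; nra.
Qed.

(** Beyond [1 / k] one has [th >= 1/2], hence [- (Q^2)' >= 2 k Q^2], and integration from [L] gives
    the bound. This is the origin of the threshold [L0 = 1 / k]. *)
Lemma Q_tail L : 1 / k <= L -> \int[mu]_(x in P) (Q (x + L) ^+ 2) <= Q L ^+ 2 / (2 * k).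
Proof.
move=> kL; have [sQ _] := sqi_shift L (sqi_Q k k0); have [sdQ _] := sqi_shift L (sqi_dQ k k0).
have sub : P `<=` setT by [].
have i1 : intg P (fun x => Q (x + L) ^+ 2) by apply: (intgS setT) => //; case: sQ.
have i2 : intg P (fun x => Q (x + L) * dQ (x + L)) by apply: (intgS setT) => //; exact: sqiM.
pose D x := 2 * (Q (x + L) * dQ (x + L)).
have dsh x : is_derive x (1 : R) (fun x => Q (x + L)) (dQ (x + L)).
  by apply: d_eq (dcomp Q _ (dD (did x) (dcst L x)) (Q_d k (x + L))) _; rewrite addr0 mulr1.
have dF x : is_derive x (1 : R) (fun x => Q (x + L) ^+ 2) (D x).
  by apply: d_eq (dM (dsh x) (dsh x)) _; rewrite /D; ring.
have cD : continuous D.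
  move=> x; apply: cvgM; first exact: cvg_cst.
  by apply: cvgM; [exact: (continuous_comp (@shift_cont R L x) (@Q_cont R k _))
                  |exact: (continuous_comp (@shift_cont R L x) (@dQ_cont R k _))].
have := half_int dF cD i1 (intgZ 2 mP i2); rewrite add0r => e.
rewrite ler_pdivlMr ?mulr_gt0// mulrC -RintZ// -[leRHS]opprK -e -RintN//; last exact: intgZ.
apply: le_Rint => //; [exact: intgZ|by apply: intgN => //; exact: intgZ|].
move=> x /posP x0; rewrite /D.
have h : 1 / k <= x + L by clear -x0 kL; lra.
have q := sqr_ge0 (Q (x + L)).
have -> : - (2 * (Q (x + L) * dQ (x + L))) = 4 * k * th k (x + L) * Q (x + L) ^+ 2.
  by rewrite /(dQ); ring.
have := th_ge_half _ h; move: (th k (x + L)) => t t2; rewrite ler_wpM2r//.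
have kt : k * (1 / 2) <= k * t by rewrite ler_pM2l.
by rewrite -[leRHS]mulrA; lra.
Qed.

(** The tail is reflected and carried by a function on the whole line, so that it can be added under
    integrals over the line. *)
Lemma tail_extension L : 1 / k <= L -> exists p : R -> R, [/\ forall x, 0 <= p x,
  forall x, x < 0 -> p x = Q (x - L) ^+ 2, intg setT p & \int[mu]_x p x <= Q L ^+ 2 / (2 * k)].
Proof.
move=> kL; pose p x := \1_P x * Q (x + L) ^+ 2.
have [[_ iQ] _] := sqi_shift L (sqi_Q k k0).
have ip : intg setT p by apply/intg_indic => //; exact: (intgS setT).
have [ir er] := Rint_opp mT (intg_meas ip) ip.
rewrite preimage_setT in ir er.
exists (fun x => p (- x)); split; [| |exact: ir|].
- by move=> x; rewrite /p mulr_ge0 ?sqr_ge0// indicE.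
- move=> x x0; rewrite /p indicE mem_set ?mul1r; last by apply/posP; rewrite oppr_gt0.
  by rewrite -(QN k (x - L)) opprB addrC.
- by rewrite er (Rint_indic _ mP); exact: Q_tail.
Qed.

Lemma initial_dist {v dv g d} L : 1 / k <= L -> H1 v dv -> (forall x, x <= 0 -> v x = 0) ->
  H1 g d -> (forall x, 0 <= x -> v x - Q (x - L) = g x) ->
  dist v dv L <= (1 + (1 + 4 * k ^+ 2) / k) * h1sq g d.
Proof.
move=> kL Hv v0 Hg vg; have HQ := H1_Qs k k0 L; have Hd := H1B Hv HQ.
have [acv _ _] := Hv; have [acd [_ if2] [_ idf2]] := Hd; have [acg [_ ig] [_ idg]] := Hg.
have [p [p0 pneg ip hp]] := tail_extension L kL.
have tail : \int[mu]_x p x <= h1sq g d / k.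
  apply: (le_trans hp).
  (* Since [v 0 = 0], the value of [g] at 0 is [- Q L], and the sup bound on [g] yields
     [Q L ^+ 2 <= 2 h1sq g d]. *)
  have := H1_sup Hg 0; rewrite -(vg 0 (lexx 0)) (v0 0 (lexx 0)) !sub0r QN sqrrN => h.
  have -> : h1sq g d / k = 2 * h1sq g d / (2 * k) by field; rewrite gt_eqF.
  apply: (ler_wpM2r _ h); rewrite invr_ge0; apply: mulr_ge0 => //; exact: ltW.
have b1 : mass (fun x => v x - Q (x - L)) <= mass g + \int[mu]_x p x.
  rewrite /mass -(RintD mT ig ip); apply: (le_Rint mT if2 (intgD mT ig ip)).
  move=> x _; have [x0|x0] := ltP x 0; last by rewrite (vg x x0) lerDl p0.
  by rewrite (pneg x x0) (v0 x (ltW x0)) sub0r sqrrN lerDr sqr_ge0.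
have b2 : mass (fun x => dv x - dQ (x - L)) <= mass d + 4 * k ^+ 2 * \int[mu]_x p x.
  have i4 : intg setT (fun x => 4 * k ^+ 2 * p x) by exact: intgZ.
  rewrite /mass -(RintZ _ mT ip) -(RintD mT idg i4); apply: (le_ae_Rint idf2 (intgD mT idg i4)).
  have a1 := ac_unique_pos acd acg (fun x (xp : 0 < x) => vg x (ltW xp)).
  (* The density of a function that vanishes on [x <= 0] is zero almost everywhere there: uniqueness
     of densities on [x > 0], applied after reflection. The point 0 is discarded as a null set. *)
  have a2 : {ae mu, forall x, 0 < x -> - dv (- x) = 0}.
    apply: (ac_unique_pos (ac_opp acv) (ac_cst 0)) => x x0.
    by rewrite v0// oppr_le0 ltW.
  have a3 : {ae mu, forall x, x != 0}.
    exists [set 0]; split; [exact: measurable_set1|exact: lebesgue_measure_set1|].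
    by move=> x /= /negP; rewrite negbK => /eqP.
  apply: aeS (aeI (aeI a1 (ae_opp a2)) a3) => x [[h1 h2] xn0].
  have [x0|x0] := ltP 0 x.
    by rewrite (h1 x0) lerDl mulr_ge0 ?p0// mulr_ge0// sqr_ge0.
  have xlt : x < 0 by rewrite lt_neqAle xn0.
  have -> : dv x = 0 by have := h2; rewrite oppr_gt0 opprK => /(_ xlt)/eqP; rewrite oppr_eq0 => /eqP.
  rewrite (pneg x xlt) sub0r sqrrN; apply: ler_wpDl; first exact: sqr_ge0.
  have -> : 4 * k ^+ 2 * Q (x - L) ^+ 2 = (2 * k * Q (x - L)) ^+ 2 by ring.
  rewrite -(real_normK (num_real (dQ _))) ler_pXn2r ?nnegrE//; first exact: dQ_le.
  by apply: mulr_ge0; [apply: mulr_ge0 => //; exact: ltW|apply: ltW; exact: Q_gt0].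
have k2 : 0 <= 1 + 4 * k ^+ 2 by rewrite addr_ge0// mulr_ge0// sqr_ge0.
have e : (1 + (1 + 4 * k ^+ 2) / k) * h1sq g d =
    mass g + mass d + (1 + 4 * k ^+ 2) * (h1sq g d / k) by rewrite -/(h1sq g d); ring.
rewrite e; move: (ler_wpM2l k2 tail) b1 b2; rewrite /(dist) [h1sq (fun x => _ x - _) _]/h1sq.
move: (4 * k ^+ 2) (h1sq g d / k).
move: (mass _) (mass _) (mass _) (mass _) (\int[mu]_x p x) => m1 m2 m3 m4 i q n.
by clear => *; lra.
Qed.

End Initial.

(** * Assembly on the right half-line and reflection to the left one *)

Section Orbit.
Context {R : realType}.
Local Notation mu := (@lebesgue_measure R).
Local Notation P := (@pos_half_line R).
Local Notation N := (@neg_half_line R).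
Implicit Types (v dv : R -> R -> R) (x y z s t r a b c n m K eps de : R).

Lemma neg_lineP x : N x <-> x < 0.
Proof. by rewrite /neg_half_line /= in_itv. Qed.

Variable k : R.
Hypothesis k0 : 0 < k.
Local Notation Q := (Q k).
Local Notation dQ := (dQ k).
Local Notation dist := (dist k).

(** [initial_dist] and then [bootstrap] bound the squared distance by [C1 (K a)^2], whereas
    [modulation] takes a square [b^2]; the choice [b = (C1 + 1) K a] works because
    [C1 <= (C1 + 1)^2]. *)
Lemma flow_orbit : exists b0 C : R, [/\ 0 < b0, 0 < C & forall w0 v dv (g d : R -> R) L a,
  flow w0 v dv -> 1 / k <= L -> H1 g d -> (forall x, 0 <= x -> v 0 x - Q (x - L) = g x) ->
  0 < a <= b0 -> h1sq g d <= a ^+ 2 ->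
  exists y dy : R -> R, [/\
    forall t, 0 <= t -> dist (v t) (dv t) (y t) <= (C * a) ^+ 2,
    forall t, 0 <= t -> `|dy t - 4 * k ^+ 2| <= C * a &
    forall t eps, 0 <= t -> 0 < eps -> exists2 de : R, 0 < de & forall s, 0 <= s -> `|s - t| < de ->
      `|y s - y t - (s - t) * dy t| <= eps * `|s - t| /\ `|dy s - dy t| <= eps]].
Proof.
have [a0 [C1 [a00 C10 boot]]] := bootstrap k k0.
have [bm [C2 [bm0 C20 modu]]] := modulation k k0.
have [K K1 KE] : exists2 K : R, 1 <= K & K = 1 + (1 + 4 * k ^+ 2) / k.
  exists (1 + (1 + 4 * k ^+ 2) / k) => //; rewrite lerDl divr_ge0//; last exact: ltW.
  by rewrite addr_ge0// mulr_ge0// sqr_ge0.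
have K0 : 0 < K by lra.
have M0 : 0 < (C1 + 1) * K by rewrite mulr_gt0//; lra.
exists (Num.min (a0 / K) (bm / ((C1 + 1) * K))), (C2 * ((C1 + 1) * K)); split.
- by rewrite lt_min !divr_gt0.
- by rewrite mulr_gt0.
move=> w0 v dv g d L a F kL Hg vg /andP[ap]; rewrite le_min => /andP[h1 h2] ga.
rewrite ler_pdivlMr// mulrC in h1; rewrite ler_pdivlMr// mulrC in h2.
have Ka : 0 <= K * a by rewrite mulr_ge0 ?ltW.
have HF := flow_H1 _ _ _ F.
have d0 : dist (v 0) (dv 0) L <= (K * a) ^+ 2.
  have := initial_dist k k0 L kL (HF 0 (lexx 0)) (fun x => flow_neg _ _ _ F 0 x (lexx 0)) Hg vg.
  rewrite -KE => h; apply: (le_trans h); apply: (@le_trans _ _ (K * a ^+ 2)).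
    by rewrite ler_pM2l.
  by rewrite exprMn ler_wpM2r ?sqr_ge0// expr2 ler_peMl// ltW.
rewrite -mulrA; apply: (modu w0 v dv ((C1 + 1) * K * a) F).
  by rewrite mulr_gt0.
move=> t t0; have tI : 0 <= t <= t by rewrite t0 lexx.
have [||||z hz] := boot t v dv L (K * a) t0 _ _ _ _ d0 t tI.
- by move=> s /andP[s0 _]; exact: HF.
- move=> s /andP[s0 _] eps e0; have [de de0 H] := flow_cont _ _ _ F s eps s0 e0.
  by exists de => // r /andP[r0 _]; exact: H.
- by move=> s /andP[s0 _]; exact: (flow_mono _ _ _ F).
- by rewrite Ka.
exists z; apply: (le_trans hz); rewrite -[(C1 + 1) * K * a]mulrA [leRHS]exprMn.
apply: ler_wpM2r; first exact: sqr_ge0.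
by move: C10; clear; nra.
Qed.

Lemma C1_on_reflect {y dy : R -> R} (L : R) :
  (forall t eps, 0 <= t -> 0 < eps -> exists2 de : R, 0 < de & forall s, 0 <= s -> `|s - t| < de ->
      `|y s - y t - (s - t) * dy t| <= eps * `|s - t| /\ `|dy s - dy t| <= eps) ->
  C1_on `]-oo, 0] (fun t => L - y (- t)) (fun t => dy (- t)).
Proof.
move=> H; have H' t eps : `]-oo, 0]%classic t -> 0 < eps -> exists2 de : R, 0 < de &
    forall s, `]-oo, 0]%classic s -> `|s - t| < de ->
    `|y (- s) - y (- t) + (s - t) * dy (- t)| <= eps * `|s - t| /\ `|dy (- s) - dy (- t)| <= eps.
  rewrite /= in_itv/= => t0 e0; have nt : 0 <= - t by rewrite oppr_ge0.
  have [de de0 h] := H _ eps nt e0; exists de => // s; rewrite /= in_itv/= => s0.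
  have := h (- s); rewrite oppr_ge0 => /(_ s0).
  have -> : - s - - t = - (s - t) by ring.
  by rewrite normrN mulNr opprK.
split.
  apply/subspace_continuousP => t tI; apply/cvgrPdist_le => eps e0.
  have [de de0 h] := H' t eps tI e0.
  apply/nbhs_ballP; exists de => // s /= st sI.
  by rewrite distrC; have [] := h s sI; rewrite // distrC.
move=> t tI; apply/cvgrPdist_le => eps e0.
have [de de0 h] := H' t eps tI e0.
apply/nbhs_ballP; exists de => // s /= st snt sI.
have st' : `|s - t| < de by rewrite distrC.
have [h1 _] := h s sI st'; have s0 : s - t != 0 by rewrite subr_eq0.
rewrite -(ler_pM2r (_ : 0 < `|s - t|)) ?normr_gt0//; apply: le_trans h1.
rewrite -normrM mulrBl divfK// le_eqVlt; apply/orP; left; apply/eqP.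
by congr (`|_|); ring.
Qed.

Lemma sobolev_reflect {v dv : R -> R} {u : R -> R} {y m} : H1 v dv -> 0 <= m ->
  {ae mu, forall x, N x -> u x = v (- x)} -> dist v dv y <= m ^+ 2 ->
  (sobolev_norm 1 N (fun x => u x - Q (x + y))%R <= m%:E)%E.
Proof.
move=> Hv m0 uv hd; have [ah sh sdh] := H1B Hv (H1_Qs k k0 y).
have [sr er] := sqi_opp sh; have [sdr edr] := sqi_opp sdh.
have e : {ae mu, forall x, N x -> u x - Q (x + y) = v (- x) - Q (- x - y)}.
  by apply: aeS uv => x h /h ->; rewrite -opprD QN.
apply: (le_trans (sob1_le (ac_opp ah) sr (sqiN (@measurableT _ R) sdr) e)).
rewrite lee_fin -(ger0_norm m0) -sqrtr_sqr; apply: ler_wsqrtr.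
apply: le_trans hd; rewrite /(dist) /h1sq /mass -er -edr lerD2l le_eqVlt.
by apply/orP; left; apply/eqP/eq_Rint => x _; rewrite sqrrN.
Qed.

End Orbit.

(** * Translation of the hypotheses and the stability theorem *)

Section Transfer.
Context {R : realType}.
Local Notation mu := (@lebesgue_measure R).
Local Notation P := (@pos_half_line R).
Local Notation N := (@neg_half_line R).

Lemma soliton_Q (c : R) : 0 < c -> soliton c = Q (Num.sqrt c / 2).
Proof.
move=> c0; apply/funext => x; rewrite /soliton /Q /sc th_sech /sech.
have -> : Num.sqrt c * x / 2 = Num.sqrt c / 2 * x by ring.
move: ((2 / (expR _ + _)) ^+ 2) => E.
by rewrite expr_div_n sqr_sqrtr ?(ltW c0)//; field.
Qed.

Lemma trace_reflect (u0 : R -> R) : has_trace N u0 0 0 -> has_trace P (fun x => u0 (- x)) 0 0.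
Proof.
move=> [g [cg ug g0]]; exists (fun x => g (- x)); split; last by rewrite oppr0.
  by move=> x; apply: (continuous_comp (@opp_continuous R x)); exact: cg.
by apply: aeS (ae_opp ug) => x h /posP x0; apply: h; apply/neg_lineP; rewrite oppr_lt0.
Qed.

Lemma datum_reflect (k L a : R) (u0 : R -> R) (v dv : R -> R -> R) : 0 < k ->
  flow (fun x => u0 (- x)) v dv ->
  (sobolev_norm 1 N (fun x => u0 x - Q k (x + L))%R < a%:E)%E ->
  exists g d : R -> R, [/\ H1 g d, forall x, 0 <= x -> v 0 x - Q k (x - L) = g x &
    h1sq g d <= a ^+ 2].
Proof.
move=> k0 F /sob1_lt[g [d [acg sg sd ug gd]]].
have [sr er] := sqi_opp sg; have [sdr edr] := sqi_opp sd.
exists (fun x => g (- x)), (fun x => - d (- x)).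
have Hr : H1 (fun x => g (- x)) (fun x => - d (- x)).
  by split; [exact: ac_opp|exact: sr|exact: sqiN].
split => //.
- have [acv _ _] := H1B (flow_H1 _ _ _ F 0 (lexx 0)) (H1_Qs k k0 L).
  have [cv _ _ _] := acv; have [[cr _ _ _] _ _] := Hr.
  apply: (cont_ae_pos cv cr); apply: aeS (aeI (flow_init _ _ _ F) (ae_opp ug)) => x [h1 h2] Px.
  have /h2 <- : N (- x) by apply/neg_lineP; rewrite oppr_lt0; exact/posP.
  by rewrite (h1 Px) -(QN k (x - L)) opprB [L - x]addrC.
- apply: ltW; apply: le_lt_trans gd; rewrite /h1sq /mass er -edr lerD2l le_eqVlt.
  by apply/orP; left; apply/eqP/eq_Rint => x _; rewrite sqrrN.
Qed.

End Transfer.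

Theorem theorem1p2 (R : realType) (c : R) (hc : 0 < c) :
  exists alpha0 C0 L0 C : R,
    [/\ 0 < alpha0, 0 < C0, 0 < L0 & 0 < C] /\
    forall alpha L : R, 0 < alpha -> alpha < alpha0 -> L0 < L ->
    forall u0 : R -> R,
      in_sobolev 1 neg_half_line u0 ->
      has_trace neg_half_line u0 0 0 ->
      (sobolev_norm 1 neg_half_line (fun x => u0 x - soliton c (x + L))%R
         < alpha%:E)%E ->
    forall u : R -> R -> R, left_half_line_backward_solution u0 u ->
    exists rho drho : R -> R,
      [/\ C1_on `]-oo, 0] rho drho,
          (ereal_sup
             [set sobolev_norm 1 neg_half_line
                    (fun x => u t x - soliton c (x - rho t + L))%R
             | t in `]-oo, 0%R]]
           < (C0 * (alpha + expR (- (Num.sqrt c * L))))%R%:E)%E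
        & (ereal_sup [set (`|drho t - c|%R)%:E | t in `]-oo, 0%R]]
           < (C * C0 * alpha)%R%:E)%E].
Proof.
have k0 : 0 < Num.sqrt c / 2 by rewrite divr_gt0// sqrtr_gt0.
have kc : 4 * (Num.sqrt c / 2) ^+ 2 = c by rewrite expr_div_n sqr_sqrtr ?(ltW hc)//; field.
rewrite (soliton_Q c hc); move: (Num.sqrt c / 2) k0 kc => k k0 kc.
have [b0 [C [b00 C0 orb]]] := flow_orbit k k0.
have C1 : 0 < C + 1 by rewrite addr_gt0.
(* Suprema preserve weak inequalities only; replacing [C] by [C + 1] gives the strict ones. The
   threshold [1 / k] equals [2 / sqrt c]. *)
exists b0, (C + 1), (1 / k), 1; split; first by rewrite divr_gt0.
move=> alpha L a0 ab kL u0 _ tr ini u [w [sol uw]].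
have [v [dv [F wv]]] := solution_flow (trace_reflect u0 tr) sol.
have [g [d [Hg vg gd]]] := datum_reflect k L alpha u0 v dv k0 F ini.
have [||y [dy [hd hdy hC]]] := orb _ _ _ _ _ L alpha F _ Hg vg _ gd.
- exact: ltW.
- by rewrite a0 ltW.
have Ca : C * alpha < (C + 1) * alpha by rewrite ltr_pM2r// ltrDl.
(* In the original variables the profile is centred at [- y (- t)], and the statement writes this
   centre as [rho t - L]; the two reflections of sign cancel in the derivative. *)
exists (fun t => L - y (- t)), (fun t => dy (- t)); split; first exact: C1_on_reflect.
- apply: (@le_lt_trans _ _ (C * alpha)%:E); last first.
    by rewrite lte_fin (lt_le_trans Ca)// ler_pM2l// lerDl expR_ge0.
  apply: ge_ereal_sup => z /= [t]; rewrite in_itv/= => t0 <-.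
  have nt : 0 <= - t by rewrite oppr_ge0.
  have -> : (fun x => u t x - Q k (x - (L - y (- t)) + L)) = (fun x => u t x - Q k (x + y (- t))).
    by apply/funext => x; congr (_ - Q k _); ring.
  apply: (sobolev_reflect k k0 (flow_H1 _ _ _ F _ nt)); last exact: hd.
    by rewrite mulr_ge0 ?ltW.
  apply: aeS (ae_opp (wv _ nt)) => x h /neg_lineP x0; rewrite uw// h//.
  by apply/posP; rewrite oppr_gt0.
- apply: (@le_lt_trans _ _ (C * alpha)%:E); last by rewrite lte_fin mul1r.
  apply: ge_ereal_sup => z /= [t]; rewrite in_itv/= => t0 <-.
  by rewrite lee_fin -kc; apply: hdy; rewrite oppr_ge0.
Qed.
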